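(* Let $r\in\mathbb{C}\setminus\mathbb{Z}_{\ge1}$. Then $\mathcal{B}_r(\mathbb{P}^1(\mathbb{R}))=\mathcal{H}_r(\mathbb{H})\oplus\mathcal{W}^\omega_r(\mathbb{P}^1(\mathbb{R}))$; that is, every $r$-harmonic boundary germ on $\mathbb{P}^1(\mathbb{R})$ is in a unique way the sum of the germ of an $r$-harmonic function on all of $\mathbb{H}$ and an analytic boundary germ.
   Context: $\mathbb{H}$ upper half-plane, $z=x+iy$. For open $V\subset\mathbb{H}$, $\mathcal{H}_r(V)$ is the space of $C^2$ functions $F$ on $V$ with $-4y^2\partial_z\partial_{\bar z}F+2iry\partial_{\bar z}F=0$. $\mathcal{B}_r(\mathbb{P}^1(\mathbb{R}))=\varinjlim_U\mathcal{H}_r(U\cap\mathbb{H})$, $U$ running over open neighbourhoods of $\mathbb{P}^1(\mathbb{R})$ in $\mathbb{P}^1(\mathbb{C})$ (germs of $r$-harmonic functions near the boundary); $\mathcal{H}_r(\mathbb{H})$ is identified with its image. $f_r(z)=\frac{2i}{z-i}\left(\frac{\bar z-i}{\bar z-z}\right)^{r-1}$ on $\mathbb{H}\setminus\{i\}$ (continuous branch on $\mathbb{H}$). $\mathcal{W}^\omega_r(\mathbb{P}^1(\mathbb{R}))\subset\mathcal{B}_r(\mathbb{P}^1(\mathbb{R}))$ consists of the germs represented by $F\in\mathcal{H}_r(U\cap\mathbb{H})$ such that $F/f_r$ has a real-analytic continuation to $U$. *)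

(* Defs.v *)
From Stdlib Require Import Reals.
From Coquelicot Require Import Coquelicot.

Open Scope R_scope.

Definition Cexp (z : C) : C :=
  (exp (Re z) * cos (Im z), exp (Re z) * sin (Im z)).

Definition Carg (w : C) : R :=
  match Rlt_dec 0 (Re w) with
  | left _ => atan (Im w / Re w)
  | right _ =>
    match Rlt_dec (Re w) 0 with
    | left _ => match Rle_dec 0 (Im w) with
                | left _ => atan (Im w / Re w) + PI
                | right _ => atan (Im w / Re w) - PI
                end
    | right _ => match Rlt_dec 0 (Im w) with
                 | left _ => PI / 2
                 | right _ => - (PI / 2)
                 end
    end
  end.

Definition CLog (w : C) : C := (ln (Cmod w), Carg w).

Definition Cpowc (w s : C) : C := Cexp (s * CLog w)%C.

(* f_r(z) = 2i/(z-i) * ((conj z - i)/(conj z - z))^(r-1).  For z in H the base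
   has positive real part, so the principal branch is continuous on H. *)
Definition f_r (r : C) (z : C) : C :=
  ((2 * Ci) / (z - Ci) * Cpowc ((Cconj z - Ci) / (Cconj z - z)) (r - 1))%C.

Definition px (F : C -> C) (z : C) : C :=
  (Derive (fun t => Re (F (t, Im z))) (Re z),
   Derive (fun t => Im (F (t, Im z))) (Re z)).
Definition py (F : C -> C) (z : C) : C :=
  (Derive (fun t => Re (F (Re z, t))) (Im z),
   Derive (fun t => Im (F (Re z, t))) (Im z)).

Definition ex_px (F : C -> C) (z : C) : Prop :=
  ex_derive (fun t => Re (F (t, Im z))) (Re z) /\
  ex_derive (fun t => Im (F (t, Im z))) (Re z).
Definition ex_py (F : C -> C) (z : C) : Prop :=
  ex_derive (fun t => Re (F (Re z, t))) (Im z) /\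
  ex_derive (fun t => Im (F (Re z, t))) (Im z).

Definition C1_on (V : C -> Prop) (F : C -> C) : Prop :=
  forall z, V z ->
    ex_px F z /\ ex_py F z /\
    continuous F z /\ continuous (px F) z /\ continuous (py F) z.

Definition C2_on (V : C -> Prop) (F : C -> C) : Prop :=
  C1_on V F /\ C1_on V (px F) /\ C1_on V (py F).

Definition dz (F : C -> C) (z : C) : C := ((px F z - Ci * py F z) / 2)%C.
Definition dzb (F : C -> C) (z : C) : C := ((px F z + Ci * py F z) / 2)%C.

Definition Hp (z : C) : Prop := 0 < Im z.

Definition rHarm (r : C) (V : C -> Prop) (F : C -> C) : Prop :=
  open V /\ (forall z, V z -> Hp z) /\ C2_on V F /\
  forall z, V z ->
    (- 4 * RtoC (Im z) ^ 2 * dz (dzb F) z + 2 * Ci * r * RtoC (Im z) * dzb F z = 0)%C.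

Definition P1C := option C.   (* Some z = z, None = oo *)

Definition chart_inf (w : C) : P1C :=
  match Req_dec_T (Re w) 0, Req_dec_T (Im w) 0 with
  | left _, left _ => None
  | _, _ => Some (/ w)%C
  end.

Definition openP1 (U : P1C -> Prop) : Prop :=
  open (fun z => U (Some z)) /\ open (fun w => U (chart_inf w)).

Definition P1R (p : P1C) : Prop :=
  match p with None => True | Some z => Im z = 0 end.

Definition nbhdP1R (U : P1C -> Prop) : Prop :=
  openP1 U /\ forall p, P1R p -> U p.

Definition UH (U : P1C -> Prop) (z : C) : Prop := Hp z /\ U (Some z).

Definition dsum (b : nat -> nat -> C) (N : nat) : C :=
  sum_n (fun j => sum_n (fun k => b j k) N) N.
Definition dsumR (b : nat -> nat -> R) (N : nat) : R :=
  sum_n (fun j => sum_n (fun k => b j k) N) N.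

Definition real_analytic_on (W : C -> Prop) (A : C -> C) : Prop :=
  forall z0, W z0 ->
  exists (a : nat -> nat -> C) (rho : R), 0 < rho /\
    (forall z, Cmod (z - z0)%C < rho -> W z) /\
    forall z, Cmod (z - z0)%C < rho ->
      (exists M, forall N,
          dsumR (fun j k => Cmod (a j k) * Rabs (Re z - Re z0) ^ j
                                 * Rabs (Im z - Im z0) ^ k) N <= M) /\
      filterlim
        (dsum (fun j k => (a j k * RtoC ((Re z - Re z0) ^ j * (Im z - Im z0) ^ k))%C))
        eventually (locally (A z)).

Definition real_analytic_P1 (U : P1C -> Prop) (A : P1C -> C) : Prop :=
  real_analytic_on (fun z => U (Some z)) (fun z => A (Some z)) /\
  real_analytic_on (fun w => U (chart_inf w)) (fun w => A (chart_inf w)).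

Definition Brep (r : C) (U : P1C -> Prop) (F : C -> C) : Prop :=
  nbhdP1R U /\ rHarm r (UH U) F.

Definition germ_eq (F G : C -> C) : Prop :=
  exists U, nbhdP1R U /\ forall z, UH U z -> F z = G z.

Definition Wrep (r : C) (F : C -> C) : Prop :=
  exists U, Brep r U F /\
    exists A : P1C -> C, real_analytic_P1 U A /\
      forall z, UH U z -> z <> Ci -> A (Some z) = (F z / f_r r z)%C.

(* Main.v *)
Require Import Defs.
From Stdlib Require Import ZArith Reals Lra Lia ssreflect ClassicalEpsilon.
From Coquelicot Require Import Coquelicot.

(** The Cayley transform [w = (z - i) / (z + i)] and the factor [(1 - w)^(-r)] turn an [r]-harmonic germ
    into a function [Phi] on an annulus [R0 < |w| < 1] with [Phi_wbar = s^(-r) phi], where [s = 1 - |w|^2]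
    and [phi] is antiholomorphic.  Elements of [W^omega] become [s^(1-r)] times a function that is
    real-analytic across [|w| = 1].  In the Fourier mode [n], the radial equation is solved by [|w|^n] and by
    [|w|^n s^(1-r) Q], where [Q] is analytic at [s = 0] because [r] is not a positive integer.  For [n >= 0]
    the first solution is regular at the origin; for [n < 0] the regular one is a combination of both in which
    both coefficients are nonzero.  So every mode splits uniquely into a regular multiple, which goes to the
    global part, and a multiple of [|w|^n s^(1-r) Q].  The coefficients of the regular parts grow
    subexponentially, since [Phi] is defined up to [|w| = 1], and their sum converges on the whole disk; the
    other coefficients are bounded by powers of radii smaller than [1], and their sum converges on both sides
    of the circle.

    For uniqueness, let [Phi] be defined on the whole disk and [s^(r-1) Phi] extend smoothly across the
    circle.  Then [b s^(r-1)] is smooth at [s = 0] for the coefficient [b] of [|w|^n], which forces [b = 0]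
    as [r - 1] is not a natural number; and no nonzero multiple of [|w|^n s^(1-r) Q] is bounded at
    the origin. *)

(** The equation reads $\partial_z(\partial_{\bar z}F)=\frac{ir}{2y}\partial_{\bar z}F$, and
    $y^{-r}$ solves the same equation in $z$; hence $y^r\partial_{\bar z}F$ is antiholomorphic. As
    $y=s/|1-w|^2$, the factor $(1-w)^{-r}$ cancels the holomorphic power of $1-w$ brought in by
    $y^{-r}$, and the antiholomorphic one is absorbed by [phi]. The same factor turns $f_r$ into
    $s^{1-r}/w$.

    The real part of $r$ is arbitrary, so neither boundary values nor integrals up to the circle are
    available. Everything is read off circles inside the annulus, where each mode obeys a
    first-order equation in the radius. The primitives of $s^{-r}t^m$ that solve it are built
    algebraically, with divisors $k+1-r$ that the hypothesis on $r$ keeps nonzero. The delicate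
    modes are the negative ones: their splitting divides by the Beta value $B(m+1,1-r)$, whose
    inverse grows subexponentially, so that no radius of convergence is lost. Beyond the circle the
    terms grow geometrically with a ratio close to $1$, and the decay of the coefficients pays for
    it on a thin enough annulus. *)

Open Scope R_scope.

(** * Wirtinger derivatives *)

Lemma Cconj_R (x : R) : Cconj x = x.
Proof. by rewrite /Cconj /RtoC /= Ropp_0. Qed.

Lemma Cminus_eq (u v : C) : (u - v = 0)%C -> u = v.
Proof. by move=> E; transitivity (v + (u - v))%C; [ring | rewrite E; ring]. Qed.

(** Real differentiability, with the differential split into its complex-linear part [a] and its
    antilinear part [b]. The rules of calculus become algebra in [a] and [b], which they would not
    be for the partials [px] and [py]. *)
Definition is_Wd (f : C -> C) (z a b : C) : Prop :=
  forall eps, 0 < eps -> exists del, 0 < del /\ forall h, Cmod h < del ->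
    Cmod (f (z + h) - f z - a * h - b * Cconj h)%C <= eps * Cmod h.

(** Lets each rule of calculus be proved with its natural error constant instead of a splitting of
    [eps]. *)
Lemma is_Wd_scaled f z a b K :
  (forall eps, 0 < eps -> exists del, 0 < del /\ forall h, Cmod h < del ->
    Cmod (f (z + h) - f z - a * h - b * Cconj h)%C <= K * eps * Cmod h) ->
  is_Wd f z a b.
Proof.
move=> H eps Heps.
have HK : 0 < Rabs K + 1 by move: (Rabs_pos K); lra.
have He : 0 < eps / (Rabs K + 1) by apply: Rdiv_lt_0_compat.
case: (H _ He) => del [Hd Hh]; exists del; split=> // h /Hh Hle.
apply: (Rle_trans _ _ _ Hle); apply: Rmult_le_compat_r; first exact: Cmod_ge_0.
have -> : K * (eps / (Rabs K + 1)) = eps * (K / (Rabs K + 1)) by field; lra.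
rewrite -{2}(Rmult_1_r eps); apply: Rmult_le_compat_l; first lra.
apply/Rle_div_l => //; move: (Rle_abs K); lra.
Qed.

Lemma is_Wd_lipschitz f z a b : is_Wd f z a b ->
  exists del K, 0 < del /\ 0 < K /\
    forall h, Cmod h < del -> Cmod (f (z + h) - f z)%C <= K * Cmod h.
Proof.
move=> H; case: (H 1 Rlt_0_1) => del [Hd Hh].
exists del, (Cmod a + Cmod b + 1); split=> //; split.
  by move: (Cmod_ge_0 a) (Cmod_ge_0 b); lra.
move=> h Hlt.
have -> : (f (z + h) - f z)%C =
   ((f (z + h) - f z - a * h - b * Cconj h) + (a * h + b * Cconj h))%C by ring.
apply: (Rle_trans _ _ _ (Cmod_triangle _ _)).
apply: (Rle_trans _ _ _ (Rplus_le_compat _ _ _ _ (Hh _ Hlt) (Cmod_triangle _ _))).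
rewrite !Cmod_mult Cmod_conj; lra.
Qed.

Lemma is_Wd_eq f z a b a' b' : is_Wd f z a b -> a = a' -> b = b' -> is_Wd f z a' b'.
Proof. by move=> H <- <-. Qed.

Lemma is_Wd_ext_loc f g z a b :
  (exists d, 0 < d /\ forall h, Cmod h < d -> f (z + h)%C = g (z + h)%C) ->
  is_Wd f z a b -> is_Wd g z a b.
Proof.
move=> [d [Hd E]] H eps Heps; case: (H _ Heps) => d' [Hd' K].
exists (Rmin d d'); split; first exact: Rmin_pos.
move=> h Hh.
have E0 : f z = g z.
  by have := E 0%C; rewrite Cplus_0_r; apply; rewrite Cmod_0.
rewrite -E; last by move: (Rmin_l d d'); lra.
by rewrite -E0; apply: K; move: (Rmin_r d d'); lra.
Qed.

Lemma is_Wd_ext f g z a b : (forall x, f x = g x) -> is_Wd f z a b -> is_Wd g z a b.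
Proof. by move=> E; apply: is_Wd_ext_loc; exists 1; split; [lra | move=> h _; exact: E]. Qed.

Lemma is_Wd_const c z : is_Wd (fun _ => c) z 0 0.
Proof.
move=> eps Heps; exists 1; split; first lra; move=> h _.
have -> : (c - c - 0 * h - 0 * Cconj h = 0)%C by ring.
rewrite Cmod_0; move: (Cmod_ge_0 h); nra.
Qed.

Lemma is_Wd_id z : is_Wd (fun x => x) z 1 0.
Proof.
move=> eps Heps; exists 1; split; first lra; move=> h _.
have -> : (z + h - z - 1 * h - 0 * Cconj h = 0)%C by ring.
rewrite Cmod_0; move: (Cmod_ge_0 h); nra.
Qed.

Lemma is_Wd_conj_id z : is_Wd Cconj z 0 1.
Proof.
move=> eps Heps; exists 1; split; first lra; move=> h _.
rewrite Cplus_conj.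
have -> : (Cconj z + Cconj h - Cconj z - 0 * h - 1 * Cconj h = 0)%C by ring.
rewrite Cmod_0; move: (Cmod_ge_0 h); nra.
Qed.

Lemma is_Wd_plus f g z a b a' b' : is_Wd f z a b -> is_Wd g z a' b' ->
  is_Wd (fun x => f x + g x)%C z (a + a') (b + b').
Proof.
move=> H1 H2; apply: (is_Wd_scaled _ _ _ _ 2) => eps Heps.
case: (H1 _ Heps) => d1 [Hd1 K1]; case: (H2 _ Heps) => d2 [Hd2 K2].
exists (Rmin d1 d2); split; first exact: Rmin_pos.
move=> h Hh.
have B1 := K1 h (Rlt_le_trans _ _ _ Hh (Rmin_l _ _)).
have B2 := K2 h (Rlt_le_trans _ _ _ Hh (Rmin_r _ _)).
match type of B1 with Cmod ?e1 <= _ => match type of B2 with Cmod ?e2 <= _ =>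
  apply: (Rle_trans _ (Cmod (e1 + e2)%C)) end end.
  by apply: Req_le; congr Cmod; ring.
apply: (Rle_trans _ _ _ (Cmod_triangle _ _)); lra.
Qed.

Lemma is_Wd_mult f g z a b a' b' : is_Wd f z a b -> is_Wd g z a' b' ->
  is_Wd (fun x => f x * g x)%C z (a * g z + f z * a') (b * g z + f z * b').
Proof.
move=> H1 H2; apply: (is_Wd_scaled _ _ _ _ (Cmod (f z) + Cmod (g z) + 1)) => eps Heps.
case: (H1 _ Heps) => d1 [Hd1 K1]; case: (H2 _ Heps) => d2 [Hd2 K2].
case: (is_Wd_lipschitz _ _ _ _ H1) => d3 [k1 [Hd3 [Hk1 L1]]].
case: (is_Wd_lipschitz _ _ _ _ H2) => d4 [k2 [Hd4 [Hk2 L2]]].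
have Hk : 0 < k1 * k2 by apply: Rmult_lt_0_compat.
have Hd5 : 0 < eps / (k1 * k2) by apply: Rdiv_lt_0_compat.
exists (Rmin (Rmin (Rmin d1 d2) (Rmin d3 d4)) (eps / (k1 * k2))); split.
  by repeat apply: Rmin_pos.
move=> h Hh.
have := Rmin_l (Rmin (Rmin d1 d2) (Rmin d3 d4)) (eps / (k1 * k2)).
have := Rmin_r (Rmin (Rmin d1 d2) (Rmin d3 d4)) (eps / (k1 * k2)).
have := Rmin_l (Rmin d1 d2) (Rmin d3 d4); have := Rmin_r (Rmin d1 d2) (Rmin d3 d4).
have := Rmin_l d1 d2; have := Rmin_r d1 d2; have := Rmin_l d3 d4; have := Rmin_r d3 d4.
move=> m1 m2 m3 m4 m5 m6 m7 m8.
have B1 := K1 h ltac:(lra). have B2 := K2 h ltac:(lra).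
have B3 := L1 h ltac:(lra). have B4 := L2 h ltac:(lra).
have Hlast : Cmod h * (k1 * k2) <= eps.
  apply/Rle_div_r => //; lra.
move: B1 B2 B3 B4; set e1 := (f _ - _ - _ - _)%C; set e2 := (g _ - _ - _ - _)%C.
set u := (f _ - _)%C; set v := (g _ - _)%C => B1 B2 B3 B4.
have -> : (f (z + h) * g (z + h) - f z * g z - (a * g z + f z * a') * h -
   (b * g z + f z * b') * Cconj h = e1 * g z + f z * e2 + u * v)%C.
  by rewrite /e1 /e2 /u /v; ring.
apply: (Rle_trans _ _ _ (Cmod_triangle _ _)).
apply: (Rle_trans _ _ _ (Rplus_le_compat_r _ _ _ (Cmod_triangle _ _))).
rewrite !Cmod_mult.
move: (Cmod_ge_0 h) (Cmod_ge_0 (f z)) (Cmod_ge_0 (g z)) (Cmod_ge_0 u) (Cmod_ge_0 v) => p1 p2 p3 p4 p5.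
have I1 : Cmod e1 * Cmod (g z) <= eps * Cmod h * Cmod (g z) by apply: Rmult_le_compat_r.
have I2 : Cmod (f z) * Cmod e2 <= Cmod (f z) * (eps * Cmod h) by apply: Rmult_le_compat_l.
have I3 : Cmod u * Cmod v <= (k1 * Cmod h) * (k2 * Cmod h) by apply: Rmult_le_compat.
have I4 : Cmod h * (k1 * k2) * Cmod h <= eps * Cmod h by apply: Rmult_le_compat_r.
lra.
Qed.

Lemma is_Wd_comp g f z a b a' b' : is_Wd f z a b -> is_Wd g (f z) a' b' ->
  is_Wd (fun x => g (f x)) z (a' * a + b' * Cconj b) (a' * b + b' * Cconj a).
Proof.
move=> H1 H2.
case: (is_Wd_lipschitz _ _ _ _ H1) => d3 [k1 [Hd3 [Hk1 L1]]].
apply: (is_Wd_scaled _ _ _ _ (Cmod a' + Cmod b' + k1)) => eps Heps.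
case: (H1 _ Heps) => d1 [Hd1 K1]; case: (H2 _ Heps) => d2 [Hd2 K2].
have Hd4 : 0 < d2 / k1 by apply: Rdiv_lt_0_compat.
exists (Rmin (Rmin d1 d3) (d2 / k1)); split; first by repeat apply: Rmin_pos.
move=> h Hh.
have := Rmin_l (Rmin d1 d3) (d2 / k1); have := Rmin_r (Rmin d1 d3) (d2 / k1).
have := Rmin_l d1 d3; have := Rmin_r d1 d3 => m1 m2 m3 m4.
have B1 := K1 h ltac:(lra). have B3 := L1 h ltac:(lra).
have Hk : Cmod h * k1 < d2 by apply/Rlt_div_r => //; lra.
have B2 := K2 (f (z + h) - f z)%C ltac:(lra).
have E : (f z + (f (z + h) - f z) = f (z + h))%C by ring.
rewrite E in B2.
move: B1 B2 B3; set e1 := (f _ - _ - _ - _)%C; set e2 := (g _ - _ - _ - _)%C.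
set u := (f _ - _)%C => B1 B2 B3.
have Eu : u = (a * h + b * Cconj h + e1)%C by rewrite /u /e1; ring.
have -> : (g (f (z + h)) - g (f z) - (a' * a + b' * Cconj b) * h -
   (a' * b + b' * Cconj a) * Cconj h = e2 + (a' * e1 + b' * Cconj e1))%C.
  have E2 : (g (f (z + h)) - g (f z) = a' * u + b' * Cconj u + e2)%C by rewrite /e2 /u; ring.
  rewrite E2 Eu !Cplus_conj !Cmult_conj Cconj_conj; ring.
apply: (Rle_trans _ _ _ (Cmod_triangle _ _)).
apply: (Rle_trans _ _ _ (Rplus_le_compat_l _ _ _ (Cmod_triangle _ _))).
rewrite !Cmod_mult Cmod_conj.
move: (Cmod_ge_0 h) (Cmod_ge_0 a') (Cmod_ge_0 b') => p1 p2 p3.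
have I1 : Cmod a' * Cmod e1 <= Cmod a' * (eps * Cmod h) by apply: Rmult_le_compat_l.
have I2 : Cmod b' * Cmod e1 <= Cmod b' * (eps * Cmod h) by apply: Rmult_le_compat_l.
have I3 : eps * Cmod u <= eps * (k1 * Cmod h) by apply: Rmult_le_compat_l; lra.
lra.
Qed.

Lemma is_Wd_opp f z a b : is_Wd f z a b -> is_Wd (fun x => - f x)%C z (- a) (- b).
Proof.
move=> H; have := is_Wd_mult _ _ _ _ _ _ _ (is_Wd_const (-1)%C z) H => H'.
apply: (is_Wd_ext (fun x => -1 * f x)%C); first by move=> x; ring.
by apply: (is_Wd_eq _ _ _ _ _ _ H'); ring.
Qed.

Lemma is_Wd_minus f g z a b a' b' : is_Wd f z a b -> is_Wd g z a' b' ->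
  is_Wd (fun x => f x - g x)%C z (a - a') (b - b').
Proof. by move=> H1 H2; apply: is_Wd_plus => //; apply: is_Wd_opp. Qed.

Lemma is_Wd_scal c f z a b : is_Wd f z a b -> is_Wd (fun x => c * f x)%C z (c * a) (c * b).
Proof.
move=> H; have := is_Wd_mult _ _ _ _ _ _ _ (is_Wd_const c z) H => H'.
by apply: (is_Wd_eq _ _ _ _ _ _ H'); ring.
Qed.

Lemma is_Wd_conj f z a b : is_Wd f z a b -> is_Wd (fun x => Cconj (f x)) z (Cconj b) (Cconj a).
Proof.
move=> H; have := is_Wd_comp _ _ _ _ _ _ _ H (is_Wd_conj_id (f z)) => H'.
by apply: (is_Wd_eq _ _ _ _ _ _ H'); ring.
Qed.

Lemma is_Wd_inv (z : C) : z <> 0%C -> is_Wd Cinv z (- / (z * z)) 0.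
Proof.
move=> Hz; have Hm : 0 < Cmod z by apply Cmod_gt_0.
apply: (is_Wd_scaled _ _ _ _ (2 / (Cmod z * Cmod z * Cmod z))) => eps Heps.
exists (Rmin (Cmod z / 2) eps); split; first by apply: Rmin_pos; lra.
move=> h Hh; have := Rmin_l (Cmod z / 2) eps; have := Rmin_r (Cmod z / 2) eps => m1 m2.
have Hb : Cmod z / 2 <= Cmod (z + h)%C.
  have := Cmod_triangle (z + h) (- h); rewrite Cmod_opp.
  have -> : (z + h + - h = z)%C by ring.
  lra.
have Hzh : (z + h)%C <> 0%C by apply: (proj2 (Cmod_gt_0 _)); lra.
have -> : (/ (z + h) - / z - - / (z * z) * h - 0 * Cconj h = h * h * / (z * z * (z + h)))%C.
  by field.
rewrite !Cmod_mult Cmod_inv; last by repeat apply: Cmult_neq_0.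
rewrite !Cmod_mult.
have I : / (Cmod z * Cmod z * Cmod (z + h)) <= 2 / (Cmod z * Cmod z * Cmod z).
  have -> : 2 / (Cmod z * Cmod z * Cmod z) = / (Cmod z * Cmod z * (Cmod z / 2)) by field; lra.
  apply: Rinv_le_contravar; first by repeat apply: Rmult_lt_0_compat; lra.
  by apply: Rmult_le_compat_l => //; nra.
have P1 := Cmod_ge_0 h.
have P2 : 0 <= / (Cmod z * Cmod z * Cmod (z + h)).
  by apply: Rlt_le; apply: Rinv_0_lt_compat; repeat apply: Rmult_lt_0_compat; lra.
have I2 : Cmod h * Cmod h * / (Cmod z * Cmod z * Cmod (z + h)) <=
   (eps * Cmod h) * (2 / (Cmod z * Cmod z * Cmod z)).
  apply: Rmult_le_compat => //; first nra.
  by apply: Rmult_le_compat_r; lra.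
lra.
Qed.

Lemma C_ext (u v : C) : Re u = Re v -> Im u = Im v -> u = v.
Proof. by case: u => a b; case: v => c d /= -> ->. Qed.

Lemma im_le_Cmod (c : C) : Rabs (Im c) <= Cmod c.
Proof. by move: (Rmax_Cmod c) (Rmax_r (Rabs (fst c)) (Rabs (snd c))); rewrite /Im; lra. Qed.

Lemma Cmod_le_ReIm (c : C) : Cmod c <= Rabs (Re c) + Rabs (Im c).
Proof.
have -> : c = (RtoC (Re c) + Ci * RtoC (Im c))%C.
  by apply: C_ext; rewrite /=; ring.
apply: (Rle_trans _ _ _ (Cmod_triangle _ _)).
rewrite Cmod_mult Cmod_Ci !Cmod_R /= ?Rmult_1_l.
by apply: Req_le; congr (_ + _); congr Rabs; ring.
Qed.

Lemma locally_Cmod (P : C -> Prop) (z : C) :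
  locally z P <-> exists d, 0 < d /\ forall h, Cmod h < d -> P (z + h)%C.
Proof.
split.
  move=> [eps H]; exists eps; split; first exact: cond_pos.
  move=> h Hh; apply: H; apply: C_NormedModule_mixin_compat1.
  by have -> : minus (z + h)%C z = h :> C by rewrite /minus /plus /opp /=; ring.
move=> [d [Hd H]].
(* The balls behind [locally] on [C] are squares; comparing them with disks costs a factor [sqrt 2],
   which the half radius absorbs. *)
have Hd2 : 0 < d / 2 by lra.
exists (mkposreal _ Hd2) => y Hy.
have := C_NormedModule_mixin_compat2 z y (mkposreal _ Hd2) Hy => /= K.
have E : forall u : C, u = (z + (u - z))%C by move=> u; ring.
rewrite (E y).
apply: H; apply: (Rlt_le_trans _ _ _ K).
have : sqrt 2 <= 2 by rewrite -{2}(sqrt_square 2); [apply: sqrt_le_1; lra | lra].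
move=> S; nra.
Qed.

Lemma open_Cmod (W : C -> Prop) (z : C) : open W -> W z ->
  exists d, 0 < d /\ forall h, Cmod h < d -> W (z + h)%C.
Proof. by move=> H Hz; apply/locally_Cmod; exact: H. Qed.

Lemma continuous_Cmod (F : C -> C) (z : C) :
  continuous F z <-> forall eps, 0 < eps -> exists d, 0 < d /\
    forall h, Cmod h < d -> Cmod (F (z + h) - F z)%C < eps.
Proof.
split.
  move=> H eps Heps.
  have : locally (F z) (fun y => Cmod (y - F z)%C < eps).
    apply/locally_Cmod; exists eps; split=> // h.
    by have -> : (F z + h - F z = h)%C by ring.
  by move=> /H /locally_Cmod.
move=> H P /locally_Cmod [e [He K]]; apply/locally_Cmod.
case: (H _ He) => d [Hd L]; exists d; split=> // h /L Hh.
have -> : F (z + h)%C = (F z + (F (z + h) - F z))%C by ring.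
exact: K.
Qed.

Lemma is_Wd_continuous f z a b : is_Wd f z a b -> continuous f z.
Proof.
move=> /is_Wd_lipschitz [d [K [Hd [HK H]]]]; apply/continuous_Cmod => eps Heps.
exists (Rmin d (eps / (2 * K))); split.
  by apply: Rmin_pos => //; apply: Rdiv_lt_0_compat; lra.
move=> h Hh; have := Rmin_l d (eps / (2 * K)); have := Rmin_r d (eps / (2 * K)) => m1 m2.
apply: (Rle_lt_trans _ _ _ (H h ltac:(lra))).
have : K * Cmod h <= K * (eps / (2 * K)) by apply: Rmult_le_compat_l; lra.
have -> : K * (eps / (2 * K)) = eps / 2 by field; lra.
lra.
Qed.

Lemma is_Wd_pow f z a b n : is_Wd f z a b ->
  is_Wd (fun x => f x ^ n)%C z (INR n * f z ^ pred n * a) (INR n * f z ^ pred n * b).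
Proof.
move=> H; elim: n => [|n IH].
  by apply: (is_Wd_eq _ _ _ _ _ _ (is_Wd_const 1 z)); rewrite /=; ring.
have E : (INR n * f z ^ n = f z * (INR n * f z ^ pred n))%C.
  by case: n {IH} => [|n]; [rewrite /=; ring | simpl pred; rewrite Cpow_S; ring].
apply: (is_Wd_eq _ _ _ _ _ _ (is_Wd_mult _ _ _ _ _ _ _ H IH)); rewrite S_INR RtoC_plus;
  simpl pred.
  by transitivity (a * f z ^ n + f z * (INR n * f z ^ pred n) * a)%C; [ring | rewrite -E; ring].
by transitivity (b * f z ^ n + f z * (INR n * f z ^ pred n) * b)%C; [ring | rewrite -E; ring].
Qed.

Lemma is_Wd_div (f g : C -> C) z a b a' b' : g z <> 0%C -> is_Wd f z a b -> is_Wd g z a' b' ->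
  is_Wd (fun x => f x / g x)%C z ((a * g z - f z * a') / (g z * g z))
    ((b * g z - f z * b') / (g z * g z)).
Proof.
move=> Hg H1 H2.
have H3 := is_Wd_comp _ _ _ _ _ _ _ H2 (is_Wd_inv _ Hg).
by apply: (is_Wd_eq _ _ _ _ _ _ (is_Wd_mult _ _ _ _ _ _ _ H1 H3)); field.
Qed.

(** * Derivatives of complex-valued functions of a real variable *)

Definition is_Dv (f : R -> C) (x : R) (l : C) : Prop :=
  is_derive (fun t => Re (f t)) x (Re l) /\ is_derive (fun t => Im (f t)) x (Im l).

Lemma is_derive_eps (f : R -> R) (x l : R) : is_derive f x l <->
  forall eps, 0 < eps -> exists d, 0 < d /\ forall h, Rabs h < d ->
    Rabs (f (x + h) - f x - l * h) <= eps * Rabs h.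
Proof.
split.
  move=> /is_derive_Reals H eps Heps; case: (H _ Heps) => d K.
  exists d; split; first exact: cond_pos.
  move=> h Hh; case: (Req_dec h 0) => [-> | Hn].
    by rewrite Rplus_0_r Rabs_R0 !Rmult_0_r Rminus_diag Rminus_0_r Rabs_R0; lra.
  have := K h Hn Hh => B.
  have -> : f (x + h) - f x - l * h = ((f (x + h) - f x) / h - l) * h by field.
  by rewrite Rabs_mult; apply: Rmult_le_compat_r; [exact: Rabs_pos | lra].
move=> H; apply/is_derive_Reals => eps Heps.
have He2 : 0 < eps / 2 by lra.
case: (H _ He2) => d [Hd K]; exists (mkposreal _ Hd) => h Hn Hh.
have -> : (f (x + h) - f x) / h - l = (f (x + h) - f x - l * h) / h by field.
have Hp : 0 < Rabs h by apply: Rabs_pos_lt.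
rewrite Rabs_div //; apply/Rlt_div_l => //.
move: (K h Hh); nra.
Qed.

Lemma is_Dv_eps f x l : is_Dv f x l <->
  forall eps, 0 < eps -> exists d, 0 < d /\ forall h : R, Rabs h < d ->
    Cmod (f (x + h)%R - f x - l * h)%C <= eps * Rabs h.
Proof.
have ER : forall h : R, Re (f (x + h)%R - f x - l * h)%C =
   Re (f (x + h)) - Re (f x) - Re l * h by move=> h; rewrite /Re /Im /=; ring.
have EI : forall h : R, Im (f (x + h)%R - f x - l * h)%C =
   Im (f (x + h)) - Im (f x) - Im l * h by move=> h; rewrite /Re /Im /=; ring.
split.
  move=> [/is_derive_eps H1 /is_derive_eps H2] eps Heps.
  have He2 : 0 < eps / 2 by lra.
  case: (H1 _ He2) => d1 [Hd1 K1]; case: (H2 _ He2) => d2 [Hd2 K2].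
  exists (Rmin d1 d2); split; first exact: Rmin_pos.
  move=> h Hh; have := Rmin_l d1 d2; have := Rmin_r d1 d2 => m1 m2.
  apply: (Rle_trans _ _ _ (Cmod_le_ReIm _)); rewrite ER EI.
  have := K1 h ltac:(lra); have := K2 h ltac:(lra); lra.
move=> H; split; apply/is_derive_eps => eps Heps; case: (H _ Heps) => d [Hd K];
  exists d; split=> // h Hh; apply: Rle_trans (K h Hh).
  by rewrite -ER; exact: re_le_Cmod.
by rewrite -EI; exact: im_le_Cmod.
Qed.

(** Since $x=(z+\bar z)/2$, a function of the real part has equal Wirtinger derivatives. The real
    calculus is obtained from the rules for [is_Wd] through this equivalence. *)
Lemma is_Dv_Wd f (z : C) l :
  is_Dv f (Re z) l <-> is_Wd (fun z => f (Re z)) z (l / 2) (l / 2).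
Proof.
have E : forall h : C, (l / 2 * h + l / 2 * Cconj h = l * Re h)%C.
  by move=> h; rewrite re_alt; field.
split.
  move=> /is_Dv_eps H eps Heps; case: (H _ Heps) => d [Hd K].
  exists d; split=> // h Hh.
  have -> : (f (Re (z + h)) - f (Re z) - l / 2 * h - l / 2 * Cconj h =
     f (Re z + Re h)%R - f (Re z) - (l / 2 * h + l / 2 * Cconj h))%C.
    by rewrite re_plus; ring.
  rewrite E; apply: Rle_trans (K _ _) _.
    by move: (re_le_Cmod h); lra.
  by apply: Rmult_le_compat_l; [lra | exact: re_le_Cmod].
move=> H; apply/is_Dv_eps => eps Heps; case: (H _ Heps) => d [Hd K].
exists d; split=> // h Hh.
have := K (RtoC h); rewrite Cmod_R => /(_ Hh).
have -> : (f (Re (z + h)) - f (Re z) - l / 2 * h - l / 2 * Cconj h =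
     f (Re z + h)%R - f (Re z) - (l / 2 * h + l / 2 * Cconj h))%C.
  by rewrite re_plus re_RtoC; ring.
by rewrite E.
Qed.

Lemma is_Dv_comp (f : C -> C) (g : R -> C) x l a b :
  is_Dv g x l -> is_Wd f (g x) a b -> is_Dv (fun t => f (g t)) x (a * l + b * Cconj l).
Proof.
move=> H1 H2; apply/(is_Dv_Wd _ (RtoC x)).
have H1' : is_Wd (fun z => g (Re z)) (RtoC x) (l / 2) (l / 2) by apply/is_Dv_Wd.
have := is_Wd_comp _ _ _ _ _ _ _ H1' H2 => H.
have E2 : Cconj (l / 2) = (Cconj l / 2)%C.
  by rewrite Cdiv_conj ?Cconj_R // => -[]; lra.
by apply: (is_Wd_eq _ _ _ _ _ _ H); rewrite E2; field.
Qed.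

Lemma is_Dv_unique f x l l' : is_Dv f x l -> is_Dv f x l' -> l = l'.
Proof.
move=> [H1 H2] [H3 H4]; apply: C_ext.
  by rewrite -(is_derive_unique _ _ _ H1) -(is_derive_unique _ _ _ H3).
by rewrite -(is_derive_unique _ _ _ H2) -(is_derive_unique _ _ _ H4).
Qed.

Lemma is_Dv_horizontal (x y : R) : is_Dv (fun t => (t, y) : C) x 1.
Proof. by split=> /=; [exact: is_derive_id | exact: is_derive_const]. Qed.

Lemma is_Dv_vertical (x y : R) : is_Dv (fun t => (x, t) : C) y Ci.
Proof. by split=> /=; [exact: is_derive_const | exact: is_derive_id]. Qed.

Lemma C_eta (z : C) : (Re z, Im z) = z.
Proof. by case: z. Qed.

Lemma Cconj_Ci : Cconj Ci = (- Ci)%C.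
Proof. by rewrite /Cconj /Copp /Ci /= Ropp_0. Qed.

Lemma Ci_sqr : (Ci * Ci = -1)%C.
Proof. by rewrite /Ci /Cmult /RtoC /Copp /=; f_equal; ring. Qed.

Lemma is_Wd_partials (F : C -> C) (z : C) a b : is_Wd F z a b ->
  ex_px F z /\ ex_py F z /\ px F z = (a + b)%C /\ py F z = (Ci * (a - b))%C.
Proof.
rewrite -{1}(C_eta z) => H.
have [H1 H2] := is_Dv_comp F _ _ _ _ _ (is_Dv_horizontal (Re z) (Im z)) H.
have [H3 H4] := is_Dv_comp F _ _ _ _ _ (is_Dv_vertical (Re z) (Im z)) H.
split; first by split; eexists; eassumption.
split; first by split; eexists; eassumption.
split.
- rewrite /px (is_derive_unique _ _ _ H1) (is_derive_unique _ _ _ H2) Cconj_R.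
  by rewrite C_eta; ring.
- rewrite /py (is_derive_unique _ _ _ H3) (is_derive_unique _ _ _ H4) Cconj_Ci.
  by rewrite C_eta; ring.
Qed.

Lemma C2_neq_0 : (2 : C) <> RtoC 0.
Proof. by move=> []; lra. Qed.

Lemma is_Wd_dz (F : C -> C) (z : C) a b : is_Wd F z a b -> dz F z = a /\ dzb F z = b.
Proof.
move=> /is_Wd_partials [_ [_ [Ex Ey]]]; rewrite /dz /dzb Ex Ey; split.
  transitivity ((a + b - (Ci * Ci) * (a - b)) / 2)%C; first by field.
  by rewrite Ci_sqr; field.
transitivity ((a + b + (Ci * Ci) * (a - b)) / 2)%C; first by field.
by rewrite Ci_sqr; field.
Qed.

Lemma partials_filterdiff (f : R -> R -> R) (g : R -> R -> R) (x y l : R) :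
  locally (x, y) (fun u : R * R => is_derive (fun t => f t (snd u)) (fst u) (g (fst u) (snd u))) ->
  is_derive (fun t => f x t) y l ->
  continuous (fun u : R * R => g (fst u) (snd u)) (x, y) ->
  forall eps, 0 < eps -> exists d, 0 < d /\ forall h : C, Cmod h < d ->
    Rabs (f (x + Re h) (y + Im h) - f x y - (g x y * Re h + l * Im h)) <= eps * Cmod h.
Proof.
move=> H1 H2 H3 eps Heps.
have K := is_derive_filterdiff f x y g l H1 H2 H3.
have /filterdiff_differentiable_pt_lim K' : filterdiff (fun u : R * R => f (fst u) (snd u))
    (locally (x, y)) (fun u : R * R => fst u * g x y + snd u * l) by exact: K.
case: (K' (mkposreal _ Heps)) => d Hd; exists d; split; first exact: cond_pos.
move=> h Hh.
have Hx : Rabs (x + Re h - x) < d.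
  by rewrite Rplus_minus_l; move: (re_le_Cmod h); lra.
have Hy : Rabs (y + Im h - y) < d.
  by rewrite Rplus_minus_l; move: (im_le_Cmod h); lra.
have := Hd _ _ Hx Hy; rewrite !Rplus_minus_l => /= B.
apply: (Rle_trans _ _ _ B); apply: Rmult_le_compat_l; first lra.
by apply: Rmax_lub; [exact: re_le_Cmod | exact: im_le_Cmod].
Qed.

(** Total differentiability from continuous partials, applied to the real and imaginary parts of [F]
    separately. *)
Lemma C1_on_is_Wd (V : C -> Prop) (F : C -> C) (z : C) : open V -> C1_on V F -> V z -> is_Wd F z (dz F z) (dzb F z).
Proof.
move=> HV H Hz.
have [[ex1 ex2] [[ey1 ey2] [_ [cx _]]]] := H _ Hz.
have cRe : continuous (fun u : C => Re (px F u)) z.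
  by apply: (continuous_comp (px F) (fun u : C => fst u)) => //; exact: continuous_fst.
have cIm : continuous (fun u : C => Im (px F u)) z.
  by apply: (continuous_comp (px F) (fun u : C => snd u)) => //; exact: continuous_snd.
have L : locally z V by exact: HV.
have E1 := partials_filterdiff (fun x y => Re (F (x, y))) (fun x y => Re (px F (x, y)))
  (Re z) (Im z) (Derive (fun t => Re (F (Re z, t))) (Im z)).
have E2 := partials_filterdiff (fun x y => Im (F (x, y))) (fun x y => Im (px F (x, y)))
  (Re z) (Im z) (Derive (fun t => Im (F (Re z, t))) (Im z)).
rewrite C_eta in E1, E2.
move=> eps Heps; have He : 0 < eps / 2 by lra.
have [| | |d1 [Hd1 K1]] := E1 _ _ _ (eps / 2) He.
- apply: filter_imp L => u Hu; rewrite /px /=; apply: Derive_correct.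
  by have [[]] := H _ Hu.
- exact: Derive_correct.
- apply: (continuous_ext _ _ _ _ cRe) => u; by case: u.
have [| | |d2 [Hd2 K2]] := E2 _ _ _ (eps / 2) He.
- apply: filter_imp L => u Hu; rewrite /px /=; apply: Derive_correct.
  by have [[]] := H _ Hu.
- exact: Derive_correct.
- apply: (continuous_ext _ _ _ _ cIm) => u; by case: u.
exists (Rmin d1 d2); split; first exact: Rmin_pos.
move=> h Hh; have := Rmin_l d1 d2; have := Rmin_r d1 d2 => m1 m2.
have B1 := K1 h ltac:(lra); have B2 := K2 h ltac:(lra).
have E : (dz F z * h + dzb F z * Cconj h = px F z * Re h + py F z * Im h)%C.
  have Eh : h = (RtoC (Re h) + Ci * RtoC (Im h))%C by apply: C_ext; rewrite /=; ring.
  rewrite {1 2}Eh Cplus_conj Cmult_conj !Cconj_R Cconj_Ci /dz /dzb.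
  transitivity (px F z * Re h - (Ci * Ci) * (py F z * Im h))%C; first by field.
  by rewrite Ci_sqr; ring.
have -> : (F (z + h) - F z - dz F z * h - dzb F z * Cconj h =
   F (z + h) - F z - (px F z * Re h + py F z * Im h))%C by rewrite -E; ring.
apply: (Rle_trans _ _ _ (Cmod_le_ReIm _)).
have Ezh : (z + h)%C = (Re z + Re h, Im z + Im h) by [].
rewrite -Ezh in B1 B2.
have -> : Re (F (z + h) - F z - (px F z * Re h + py F z * Im h))%C =
  Re (F (z + h)%C) - Re (F z) -
   (Re (px F z) * Re h + Derive (fun t => Re (F (Re z, t))) (Im z) * Im h).
  by rewrite /py /Re /Im /=; ring.
have -> : Im (F (z + h) - F z - (px F z * Re h + py F z * Im h))%C =
  Im (F (z + h)%C) - Im (F z) -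
   (Im (px F z) * Re h + Derive (fun t => Im (F (Re z, t))) (Im z) * Im h).
  by rewrite /py /Re /Im /=; ring.
lra.
Qed.

(** * Functions of class C^k *)

(** Class $C^k$ with Wirtinger derivatives in place of partials, so that each closure property is an
    induction on [k] fed by the corresponding rule for [is_Wd]. *)
Fixpoint Sm (k : nat) (W : C -> Prop) (F : C -> C) : Prop :=
  match k with
  | O => forall z, W z -> continuous F z
  | S k => (forall z, W z -> is_Wd F z (dz F z) (dzb F z)) /\ Sm k W (dz F) /\ Sm k W (dzb F)
  end.

Lemma continuous_ext_Cmod (F G : C -> C) (z : C) :
  (exists d, 0 < d /\ forall h, Cmod h < d -> F (z + h)%C = G (z + h)%C) ->
  continuous F z -> continuous G z.
Proof.
move=> [d [Hd E]] /continuous_Cmod H; apply/continuous_Cmod => eps Heps.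
case: (H _ Heps) => d' [Hd' K]; exists (Rmin d d'); split; first exact: Rmin_pos.
move=> h Hh; have := Rmin_l d d'; have := Rmin_r d d' => m1 m2.
have E0 := E 0%C; rewrite Cplus_0_r Cmod_0 in E0.
by rewrite -E -?E0 //; try apply: K; lra.
Qed.

Lemma Sm_ext k (W : C -> Prop) (F G : C -> C) : open W ->
  (forall z, W z -> F z = G z) -> Sm k W F -> Sm k W G.
Proof.
move=> HW; elim: k F G => [|k IH] F G E /=.
  move=> H z Hz; apply: continuous_ext_Cmod (H z Hz).
  by case: (open_Cmod _ _ HW Hz) => d [Hd K]; exists d; split=> // h /K /E.
move=> [H1 [H2 H3]].
have D : forall z, W z -> is_Wd G z (dz F z) (dzb F z).
  move=> z Hz; apply: is_Wd_ext_loc (H1 _ Hz).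
  by case: (open_Cmod _ _ HW Hz) => d [Hd K]; exists d; split=> // h /K /E.
have E' : forall z, W z -> dz F z = dz G z /\ dzb F z = dzb G z.
  by move=> z Hz; have [-> ->] := is_Wd_dz _ _ _ _ (D _ Hz).
split; first by move=> z Hz; have [<- <-] := E' z Hz; exact: D.
by split; [apply: IH H2 | apply: IH H3] => z Hz; have [] := E' z Hz.
Qed.

(** Derivatives computed by the rules are known on [W] only, where they agree with [dz] and [dzb];
    openness of [W] makes that enough. *)
Lemma Sm_intro k (W : C -> Prop) (F a b : C -> C) : open W ->
  (forall z, W z -> is_Wd F z (a z) (b z)) -> Sm k W a -> Sm k W b -> Sm (S k) W F.
Proof.
move=> HW H Ha Hb.
have E z : W z -> a z = dz F z /\ b z = dzb F z.
  by move=> Hz; have [-> ->] := is_Wd_dz _ _ _ _ (H _ Hz).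
split; first by move=> z Hz; have [<- <-] := E z Hz; exact: H.
by split; [apply: Sm_ext Ha | apply: Sm_ext Hb] => // z Hz; have [] := E z Hz.
Qed.

Lemma Sm_loc k (W : C -> Prop) (F : C -> C) :
  (forall z, W z -> exists W', W' z /\ Sm k W' F) -> Sm k W F.
Proof.
elim: k F => [|k IH] F /= H.
  by move=> z Hz; have [W' [Hz' K]] := H z Hz; exact: K.
split; first by move=> z Hz; have [W' [Hz' [K _]]] := H z Hz; exact: K.
by split; apply: IH => z Hz; have [W' [Hz' [_ [K1 K2]]]] := H z Hz; exists W'.
Qed.

Lemma Sm_is_Wd k (W : C -> Prop) (F : C -> C) (z : C) : Sm (S k) W F -> W z -> is_Wd F z (dz F z) (dzb F z).
Proof. by move=> [H _] /H. Qed.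

Lemma Sm_pred k (W : C -> Prop) (F : C -> C) : Sm (S k) W F -> Sm k W F.
Proof.
elim: k F => [|k IH] F; first by move=> [H _] z /H /is_Wd_continuous.
by move=> [H1 [H2 H3]]; split=> //; split; exact: IH.
Qed.

Lemma Sm_continuous k (W : C -> Prop) (F : C -> C) (z : C) : Sm k W F -> W z -> continuous F z.
Proof. by elim: k F => [|k IH] F H Hz; [exact: H | apply: IH => //; exact: Sm_pred]. Qed.

Lemma Sm_const k (W : C -> Prop) c : open W -> Sm k W (fun _ => c).
Proof.
move=> HW; elim: k c => [|k IH] c; first by move=> z _; exact: continuous_const.
by apply: (Sm_intro _ _ _ (fun _ => RtoC 0) (fun _ => RtoC 0)) => // z _; exact: is_Wd_const.
Qed.

Lemma Sm_id k (W : C -> Prop) : open W -> Sm k W (fun z => z).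
Proof.
move=> HW; case: k => [|k]; first by move=> z _; exact: continuous_id.
apply: (Sm_intro _ _ _ (fun _ => RtoC 1) (fun _ => RtoC 0)) => //; try exact: Sm_const.
by move=> z _; exact: is_Wd_id.
Qed.

Lemma Sm_conj k (W : C -> Prop) (F : C -> C) : open W -> Sm k W F -> Sm k W (fun z => Cconj (F z)).
Proof.
move=> HW; elim: k F => [|k IH] F.
  move=> H z Hz; apply: (continuous_comp F Cconj); first exact: H.
  exact: is_Wd_continuous (is_Wd_conj_id _).
move=> [H1 [H2 H3]]; apply: (Sm_intro _ _ _ (fun z => Cconj (dzb F z)) (fun z => Cconj (dz F z)));
  try exact: IH; try done.
by move=> z Hz; apply: is_Wd_conj; exact: H1.
Qed.

Lemma Sm_plus k (W : C -> Prop) (F : C -> C) (G : C -> C) : open W -> Sm k W F -> Sm k W G -> Sm k W (fun z => F z + G z)%C.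
Proof.
move=> HW; elim: k F G => [|k IH] F G.
  by move=> H1 H2 z Hz; apply: (continuous_plus F G); [exact: H1 | exact: H2].
move=> [H1 [H2 H3]] [H4 [H5 H6]].
apply: (Sm_intro _ _ _ (fun z => dz F z + dz G z)%C (fun z => dzb F z + dzb G z)%C);
  try exact: IH; try done.
by move=> z Hz; apply: is_Wd_plus; [exact: H1 | exact: H4].
Qed.

Lemma continuous_Cmult (F G : C -> C) (z : C) : continuous F z -> continuous G z ->
  continuous (fun z => F z * G z)%C z.
Proof.
move=> /continuous_Cmod H1 /continuous_Cmod H2; apply/continuous_Cmod => eps Heps.
set M := Cmod (F z) + Cmod (G z) + 1.
have HM : 0 < M by rewrite /M; move: (Cmod_ge_0 (F z)) (Cmod_ge_0 (G z)); lra.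
have He : 0 < Rmin 1 (eps / M) by apply: Rmin_pos; [lra | exact: Rdiv_lt_0_compat].
case: (H1 _ He) => d1 [Hd1 K1]; case: (H2 _ He) => d2 [Hd2 K2].
exists (Rmin d1 d2); split; first exact: Rmin_pos.
move=> h Hh; have := Rmin_l d1 d2; have := Rmin_r d1 d2 => m1 m2.
have := K1 h ltac:(lra); have := K2 h ltac:(lra).
set u := (F _ - _)%C; set v := (G _ - _)%C => B2 B1.
have -> : (F (z + h) * G (z + h) - F z * G z = u * G z + F z * v + u * v)%C.
  by rewrite /u /v; ring.
apply: (Rle_lt_trans _ _ _ (Cmod_triangle _ _)).
apply: (Rle_lt_trans _ _ _ (Rplus_le_compat_r _ _ _ (Cmod_triangle _ _))).
rewrite !Cmod_mult.
have := Rmin_l 1 (eps / M); have := Rmin_r 1 (eps / M) => n1 n2.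
move: (Cmod_ge_0 (F z)) (Cmod_ge_0 (G z)) (Cmod_ge_0 u) (Cmod_ge_0 v) => p1 p2 p3 p4.
have Q : eps / M * M = eps by field; lra.
set e := Rmin 1 (eps / M) in He B1 B2 n1 n2.
have I0 : e * M <= eps by rewrite -Q; apply: Rmult_le_compat_r; lra.
have I1 : Cmod u * Cmod (G z) <= e * Cmod (G z) by apply: Rmult_le_compat_r; lra.
have I2 : Cmod (F z) * Cmod v <= Cmod (F z) * e by apply: Rmult_le_compat_l; lra.
have I3 : Cmod u * Cmod v <= Cmod u * 1 by apply: Rmult_le_compat_l; lra.
rewrite /M in I0; lra.
Qed.

Lemma Sm_mult k (W : C -> Prop) (F : C -> C) (G : C -> C) : open W -> Sm k W F -> Sm k W G -> Sm k W (fun z => F z * G z)%C.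
Proof.
move=> HW; elim: k F G => [|k IH] F G.
  by move=> H1 H2 z Hz; apply: continuous_Cmult; [exact: H1 | exact: H2].
move=> K1 K2; move: (Sm_pred _ _ _ K1) (Sm_pred _ _ _ K2) => P1 P2.
move: K1 K2 => [H1 [H2 H3]] [H4 [H5 H6]].
apply: (Sm_intro _ _ _ (fun z => dz F z * G z + F z * dz G z)%C
    (fun z => dzb F z * G z + F z * dzb G z)%C) => //.
- by move=> z Hz; apply: is_Wd_mult; [exact: H1 | exact: H4].
- by apply: Sm_plus => //; exact: IH.
- by apply: Sm_plus => //; exact: IH.
Qed.

Lemma Sm_opp k (W : C -> Prop) (F : C -> C) : open W -> Sm k W F -> Sm k W (fun z => - F z)%C.
Proof.
move=> HW H; apply: (Sm_ext _ _ (fun z => -1 * F z)%C) => //; first by move=> z _; ring.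
by apply: Sm_mult => //; exact: Sm_const.
Qed.

Lemma Sm_minus k (W : C -> Prop) (F : C -> C) (G : C -> C) : open W -> Sm k W F -> Sm k W G -> Sm k W (fun z => F z - G z)%C.
Proof. by move=> HW H1 H2; apply: Sm_plus => //; exact: Sm_opp. Qed.

Lemma Sm_inv k (W : C -> Prop) (F : C -> C) : open W -> (forall z, W z -> F z <> RtoC 0) -> Sm k W F ->
  Sm k W (fun z => / F z)%C.
Proof.
move=> HW Hn; elim: k => [|k IH].
  move=> H z Hz; apply: (continuous_comp F Cinv); first exact: H.
  exact: is_Wd_continuous (is_Wd_inv _ (Hn _ Hz)).
move=> H; have K := IH (Sm_pred _ _ _ H); move: H => [H1 [H2 H3]].
apply: (Sm_intro _ _ _ (fun z => -1 * (dz F z * (/ F z * / F z)))%C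
   (fun z => -1 * (dzb F z * (/ F z * / F z)))%C) => //.
- move=> z Hz; have Hnz := Hn _ Hz.
  by apply: (is_Wd_eq _ _ _ _ _ _ (is_Wd_comp _ _ _ _ _ _ _ (H1 _ Hz) (is_Wd_inv _ Hnz))); field.
- by apply: Sm_mult => //; [exact: Sm_const | apply: Sm_mult => //; exact: Sm_mult].
- by apply: Sm_mult => //; [exact: Sm_const | apply: Sm_mult => //; exact: Sm_mult].
Qed.

Lemma Sm_comp k (W V : C -> Prop) (F g g' : C -> C) : open W -> open V ->
  (forall z, V z -> W (g z)) -> (forall z, V z -> is_Wd g z (g' z) 0) ->
  (forall k, Sm k V g') -> Sm k W F -> Sm k V (fun z => F (g z)).
Proof.
move=> HW HV Hg Dg Hg'; elim: k F => [|k IH] F.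
  move=> H z Hz; apply: (continuous_comp g F); last by apply: H; exact: Hg.
  exact: is_Wd_continuous (Dg _ Hz).
move=> [H1 [H2 H3]].
apply: (Sm_intro _ _ _ (fun z => dz F (g z) * g' z)%C (fun z => dzb F (g z) * Cconj (g' z))%C) => //.
- move=> z Hz.
  apply: (is_Wd_eq _ _ _ _ _ _ (is_Wd_comp _ _ _ _ _ _ _ (Dg _ Hz) (H1 _ (Hg _ Hz)))).
    by rewrite Cconj_R; ring.
  by ring.
- by apply: Sm_mult => //; exact: IH.
- by apply: Sm_mult => //; [exact: IH | exact: Sm_conj].
Qed.

Lemma continuous_px (F : C -> C) (W : C -> Prop) (z : C) : open W -> (forall z, W z -> is_Wd F z (dz F z) (dzb F z)) ->
  W z -> continuous (dz F) z -> continuous (dzb F) z ->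
  continuous (px F) z /\ continuous (py F) z.
Proof.
move=> HW H Hz H1 H2; split.
  apply: (continuous_ext_Cmod (fun z => dz F z + dzb F z)%C); last exact: (continuous_plus (dz F) (dzb F)).
  case: (open_Cmod _ _ HW Hz) => d [Hd K]; exists d; split=> // h /K /H.
  by move=> /is_Wd_partials [_ [_ [-> _]]].
apply: (continuous_ext_Cmod (fun z => Ci * (dz F z - dzb F z))%C).
  case: (open_Cmod _ _ HW Hz) => d [Hd K]; exists d; split=> // h /K /H.
  by move=> /is_Wd_partials [_ [_ [_ ->]]].
apply: (continuous_Cmult (fun _ => Ci) (fun z => dz F z - dzb F z)%C).
  exact: continuous_const.
exact: (continuous_minus (dz F) (dzb F)).
Qed.

Lemma Sm_C1_on (W : C -> Prop) (F : C -> C) : open W -> Sm 1 W F -> C1_on W F.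
Proof.
move=> HW [H1 [H2 H3]] z Hz; have D := H1 _ Hz.
have [P1 [P2 _]] := is_Wd_partials _ _ _ _ D.
have [Q1 Q2] := continuous_px F W z HW H1 Hz (H2 _ Hz) (H3 _ Hz).
by do 2 split=> //; split=> //; exact: is_Wd_continuous D.
Qed.

Lemma Sm_C2_on (W : C -> Prop) (F : C -> C) : open W -> Sm 2 W F -> C2_on W F.
Proof.
move=> HW H; have [H1 [H2 H3]] := H.
split; first by apply: Sm_C1_on => //; exact: Sm_pred.
split; apply: Sm_C1_on => //.
  apply: (Sm_ext _ _ (fun z => dz F z + dzb F z)%C) => //; last exact: Sm_plus.
  by move=> z /H1 /is_Wd_partials [_ [_ [-> _]]].
apply: (Sm_ext _ _ (fun z => Ci * (dz F z - dzb F z))%C) => //.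
  by move=> z /H1 /is_Wd_partials [_ [_ [_ ->]]].
by apply: Sm_mult => //; [exact: Sm_const | exact: Sm_minus].
Qed.

Lemma C1_on_Sm (W : C -> Prop) (F : C -> C) : open W -> C1_on W F -> Sm 1 W F.
Proof.
move=> HW H; split; first by move=> z Hz; exact: (C1_on_is_Wd W).
have L : (2 : C) <> RtoC 0 := C2_neq_0.
have Cx : Sm 0 W (px F) by move=> z /H [_ [_ [_ []]]].
have Cy : Sm 0 W (py F) by move=> z /H [_ [_ [_ []]]].
split.
  apply: (Sm_ext _ _ (fun z => / 2 * (px F z - Ci * py F z))%C) => //.
    by move=> z _; rewrite /dz; field.
  apply: Sm_mult => //; first exact: Sm_const.
  by apply: Sm_minus => //; apply: Sm_mult => //; exact: Sm_const.
apply: (Sm_ext _ _ (fun z => / 2 * (px F z + Ci * py F z))%C) => //.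
  by move=> z _; rewrite /dzb; field.
apply: Sm_mult => //; first exact: Sm_const.
by apply: Sm_plus => //; apply: Sm_mult => //; exact: Sm_const.
Qed.

Lemma C2_on_Sm (W : C -> Prop) (F : C -> C) : open W -> C2_on W F -> Sm 2 W F.
Proof.
move=> HW [H1 [H2 H3]].
have [D _] := C1_on_Sm _ _ HW H1.
have Sx := C1_on_Sm _ _ HW H2; have Sy := C1_on_Sm _ _ HW H3.
split=> //; split.
  apply: (Sm_ext _ _ (fun z => / 2 * (px F z - Ci * py F z))%C) => //.
    by move=> z _; rewrite /dz; field.
  apply: Sm_mult => //; first exact: Sm_const.
  by apply: Sm_minus => //; apply: Sm_mult => //; exact: Sm_const.
apply: (Sm_ext _ _ (fun z => / 2 * (px F z + Ci * py F z))%C) => //.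
  by move=> z _; rewrite /dzb; field.
apply: Sm_mult => //; first exact: Sm_const.
by apply: Sm_plus => //; apply: Sm_mult => //; exact: Sm_const.
Qed.

(** * Complex powers *)

Definition expi (x : R) : C := (cos x, sin x).

Lemma is_Dv_expi x : is_Dv expi x (Ci * expi x).
Proof.
have E1 : Re (Ci * expi x)%C = - sin x by rewrite /Re /=; ring.
have E2 : Im (Ci * expi x)%C = cos x by rewrite /Im /=; ring.
by split; rewrite ?E1 ?E2; [exact: is_derive_cos | exact: is_derive_sin].
Qed.

Lemma expi_plus x y : expi (x + y) = (expi x * expi y)%C.
Proof. by apply: C_ext; rewrite /expi /Re /Im /= ?cos_plus ?sin_plus; ring. Qed.

Lemma Cmod_expi x : Cmod (expi x) = 1.
Proof.
rewrite /Cmod /expi /=.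
have -> : cos x * (cos x * 1) + sin x * (sin x * 1) = 1.
  by have := sin2_cos2 x; rewrite /Rsqr; lra.
exact: sqrt_1.
Qed.

Lemma expi_0 : expi 0 = RtoC 1.
Proof. by rewrite /expi cos_0 sin_0. Qed.

Lemma expi_neq_0 x : expi x <> RtoC 0.
Proof. by move=> E; have := Cmod_expi x; rewrite E Cmod_0; lra. Qed.

Lemma expi_opp x : expi (- x) = (/ expi x)%C.
Proof.
have E : (expi (- x) * expi x = 1)%C by rewrite -expi_plus Rplus_opp_l expi_0.
transitivity (expi (- x) * expi x * / expi x)%C; last by rewrite E; ring.
by field; exact: expi_neq_0.
Qed.

Lemma Cconj_expi x : Cconj (expi x) = expi (- x).
Proof. by rewrite /Cconj /expi cos_neg sin_neg. Qed.

Lemma Cexp_alt z : Cexp z = (RtoC (exp (Re z)) * expi (Im z))%C.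
Proof. by apply: C_ext; rewrite /Cexp /expi /Re /Im /=; ring. Qed.

Lemma Cexp_plus u v : Cexp (u + v) = (Cexp u * Cexp v)%C.
Proof. by rewrite !Cexp_alt re_plus im_plus exp_plus expi_plus RtoC_mult; ring. Qed.

Lemma Cexp_0 : Cexp 0 = RtoC 1.
Proof. by rewrite Cexp_alt /= exp_0 expi_0; ring. Qed.

Lemma Cmod_Cexp z : Cmod (Cexp z) = exp (Re z).
Proof.
rewrite Cexp_alt Cmod_mult Cmod_expi Cmod_R Rabs_pos_eq; first ring.
by move: (exp_pos (Re z)); lra.
Qed.

Lemma Cexp_neq_0 z : Cexp z <> RtoC 0.
Proof. by move=> E; have := Cmod_Cexp z; rewrite E Cmod_0; move: (exp_pos (Re z)); lra. Qed.

Lemma is_Wd_Cexp z : is_Wd Cexp z (Cexp z) 0.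
Proof.
(* [Im z] is written as the real part of $-iz$, so that both factors are functions of a real part
   and [is_Dv_Wd] applies. *)
apply: (is_Wd_ext (fun z => RtoC (exp (Re z)) * expi (Re (- Ci * z)))%C).
  by move=> u; rewrite Cexp_alt; congr (_ * expi _)%C; rewrite /Re /Im /=; ring.
have D1 : is_Wd (fun z => RtoC (exp (Re z))) z (RtoC (exp (Re z)) / 2) (RtoC (exp (Re z)) / 2).
  apply/(is_Dv_Wd (fun t => RtoC (exp t))); split=> /=.
    exact: is_derive_exp.
  exact: is_derive_const.
have D2 := is_Wd_scal (- Ci)%C _ _ _ _ (is_Wd_id z).
have D3 : is_Wd (fun u => expi (Re u)) (- Ci * z)%C (Ci * expi (Re (- Ci * z)) / 2)
   (Ci * expi (Re (- Ci * z)) / 2).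
  by apply/(is_Dv_Wd expi); exact: is_Dv_expi.
have Er : Re (- Ci * z)%C = Im z by rewrite /Re /Im /=; ring.
have := is_Wd_mult _ _ _ _ _ _ _ D1 (is_Wd_comp _ _ _ _ _ _ _ D2 D3) => D.
apply: (is_Wd_eq _ _ _ _ _ _ D); rewrite Er ?Cexp_alt ?Cmult_conj ?Copp_conj ?Cconj_R ?Cconj_Ci.
  transitivity (exp (Re z) * expi (Im z) / 2 - (Ci * Ci) * (exp (Re z) * expi (Im z) / 2))%C.
    by field.
  by rewrite Ci_sqr; field.
transitivity (exp (Re z) * expi (Im z) / 2 + (Ci * Ci) * (exp (Re z) * expi (Im z) / 2))%C.
  by field.
by rewrite Ci_sqr; field.
Qed.

Lemma Re_pos_neq_0 (z : C) : 0 < Re z -> z <> RtoC 0.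
Proof. by move=> H E; rewrite E /= in H; lra. Qed.

Lemma Cmod_sqr (z : C) : RtoC (Re (z * Cconj z)) = (z * Cconj z)%C.
Proof. by apply: C_ext; rewrite /Re /Im /=; ring. Qed.

Lemma is_derive_ln_sqrt (x : R) : 0 < x -> is_derive (fun t => ln (sqrt t)) x (/ (2 * x)).
Proof.
move=> Hx; have Hq := sqrt_lt_R0 _ Hx; auto_derive; first by [].
rewrite -{3}(sqrt_sqrt x); last lra.
by field; lra.
Qed.

(** On the right half-plane the logarithm is $\frac12\ln(z\bar z)+i\arctan\bigl(-i\frac{z-\bar
    z}{z+\bar z}\bigr)$: two real functions composed with rational expressions in $z$ and $\bar
    z$. *)
Lemma is_Wd_CLog (z : C) : 0 < Re z -> is_Wd CLog z (/ z) 0.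
Proof.
move=> Hz; have Hz0 := Re_pos_neq_0 _ Hz.
have Hzc0 : Cconj z <> RtoC 0 by apply: Re_pos_neq_0; rewrite re_conj.
have Hs : (z + Cconj z)%C <> RtoC 0.
  by apply: Re_pos_neq_0; rewrite re_plus re_conj; lra.
have i0 : Ci <> RtoC 0 by move=> []; lra.
have HN : 0 < Re (z * Cconj z)%C by rewrite /Re /= -/(Re z); rewrite -/(Re z) in Hz; nra.
have D0 := is_Wd_mult _ _ _ _ _ _ _ (is_Wd_id z) (is_Wd_conj_id z).
have D1 : is_Wd (fun u => RtoC (ln (sqrt (Re u)))) (z * Cconj z)%C
   (RtoC (/ (2 * Re (z * Cconj z)%C)) / 2) (RtoC (/ (2 * Re (z * Cconj z)%C)) / 2).
  apply/(is_Dv_Wd (fun t => RtoC (ln (sqrt t)))); split=> /=; last exact: is_derive_const.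
  exact: is_derive_ln_sqrt HN.
have D2 := is_Wd_comp _ _ _ _ _ _ _ D0 D1.
have D3 := is_Wd_div (fun u => - Ci * (u - Cconj u))%C (fun u => u + Cconj u)%C _ _ _ _ _ Hs (is_Wd_scal (- Ci)%C _ _ _ _ (is_Wd_minus _ _ _ _ _ _ _ (is_Wd_id z) (is_Wd_conj_id z)))
  (is_Wd_plus _ _ _ _ _ _ _ (is_Wd_id z) (is_Wd_conj_id z)).
have Eq : forall u : C, 0 < Re u -> (- Ci * (u - Cconj u) / (u + Cconj u) = RtoC (Im u / Re u))%C.
  move=> u Hu; have Hu' : RtoC (Re u) <> RtoC 0 by move=> []; lra.
  have -> : (u + Cconj u = 2 * Re u)%C by rewrite re_alt; field.
  rewrite im_alt' RtoC_div; try lra.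
  transitivity (- (Ci * Ci) * (Im u / Re u))%C; first by field.
  by rewrite Ci_sqr; ring.
set q := (Im z / Re z).
have D4 : is_Wd (fun u => RtoC (atan (Re u))) (- Ci * (z - Cconj z) / (z + Cconj z))%C
   (RtoC (/ (1 + q ^ 2)) / 2) (RtoC (/ (1 + q ^ 2)) / 2).
  apply/(is_Dv_Wd (fun t => RtoC (atan t))); rewrite Eq //= -/q; split=> /=; last exact: is_derive_const.
  by apply/is_derive_Reals; exact: derivable_pt_lim_atan.
have D5 := is_Wd_comp _ _ _ _ _ _ _ D3 D4.
have D6 := is_Wd_plus _ _ _ _ _ _ _ D2 (is_Wd_scal Ci _ _ _ _ D5).
have E4 : ((z + Cconj z) * (z + Cconj z) * (1 + q ^ 2)%R = 4 * z * Cconj z)%C.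
  rewrite RtoC_plus RtoC_pow -(Eq _ Hz).
  transitivity ((z + Cconj z) * (z + Cconj z) + (Ci * Ci) * (z - Cconj z) * (z - Cconj z))%C.
    by field.
  by rewrite Ci_sqr; ring.
have Hq1 : 0 < 1 + q ^ 2 by move: (pow2_ge_0 q); lra.
have Hq2 : RtoC (1 + q ^ 2) <> RtoC 0 by move=> []; lra.
have E5 : RtoC (/ (1 + q ^ 2)) = ((z + Cconj z) * (z + Cconj z) / (4 * z * Cconj z))%C.
  rewrite -E4 RtoC_inv; last lra.
  by field.
have E6 : RtoC (/ (2 * Re (z * Cconj z)%C)) = (/ (2 * (z * Cconj z)))%C.
  by rewrite RtoC_inv; [rewrite RtoC_mult Cmod_sqr | lra].
have Hs' : (Cconj z + z)%C <> RtoC 0 by rewrite Cplus_comm.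
apply: (is_Wd_ext_loc (fun x => RtoC (ln (sqrt (Re (x * Cconj x)))) +
   Ci * RtoC (atan (Re (- Ci * (x - Cconj x) / (x + Cconj x)))))%C).
  exists (Re z); split=> // h Hh.
  have Hzh : 0 < Re (z + h)%C.
    by rewrite re_plus; have := re_le_Cmod h => K; have := Rcomplements.Rabs_lt_between (Re h) (Re z) => [[L _]]; move: L => /(_ ltac:(lra)); lra.
  rewrite Eq // /CLog /Carg; case: Rlt_dec => // _.
  have -> : Cmod (z + h)%C = sqrt (Re ((z + h) * Cconj (z + h))%C).
    by rewrite /Cmod; congr sqrt; rewrite /Re /=; ring.
  move: (ln _) (atan _) => A B.
  by apply: C_ext; rewrite /Re /Im /=; ring.
apply: (is_Wd_eq _ _ _ _ _ _ D6); rewrite E5 E6 !Cdiv_conj //; try by apply: Cmult_neq_0.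
all: rewrite !(Cplus_conj, Cmult_conj, Cminus_conj, Copp_conj, Cconj_conj, Cconj_R, Cconj_Ci).
all: have H := Ci_sqr; by field [H].
Qed.

Lemma CLog_scal (w : C) (x : R) : 0 < Re w -> 0 < x -> CLog (w * x)%C = (CLog w + ln x)%C.
Proof.
move=> Hw Hx.
have E1 : Re (w * x)%C = Re w * x by rewrite /Re /=; ring.
have E2 : Im (w * x)%C = Im w * x by rewrite /Im /=; ring.
have Hwx : 0 < Re (w * x)%C by rewrite E1; nra.
rewrite /CLog /Carg; case: Rlt_dec => // _; case: Rlt_dec => // _.
have Hm : 0 < Cmod w by apply Cmod_gt_0; exact: Re_pos_neq_0.
have Hq : Im w * x / (Re w * x) = Im w / Re w by field; lra.
rewrite E1 E2 Hq Cmod_mult Cmod_R Rabs_pos_eq ?ln_mult //; last lra.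
by apply: C_ext; rewrite /Re /Im /=; ring.
Qed.

Lemma CLog_R (x : R) : 0 < x -> CLog x = RtoC (ln x).
Proof.
move=> Hx; rewrite /CLog /Carg /=; case: Rlt_dec => // _.
by rewrite Cmod_R Rabs_pos_eq /Rdiv ?Rmult_0_l ?atan_0 //; lra.
Qed.

Lemma Cexp_CLog (w : C) : 0 < Re w -> Cexp (CLog w) = w.
Proof.
move=> Hw; have Hm : 0 < Cmod w by apply Cmod_gt_0; exact: Re_pos_neq_0.
rewrite Cexp_alt /CLog /Carg /=; case: Rlt_dec => // _.
rewrite exp_ln // /expi cos_atan sin_atan.
have -> : sqrt (1 + (Im w / Re w)²) = Cmod w / Re w.
  rewrite -(sqrt_square (Cmod w / Re w)); last by apply: Rdiv_le_0_compat; lra.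
  congr sqrt; have -> : Cmod w / Re w * (Cmod w / Re w) = Cmod w ^ 2 / (Re w * Re w) by field; lra.
  by rewrite Cmod2_alt /Rsqr; field; lra.
by apply: C_ext; rewrite /Re /Im /= -/(Re w) -/(Im w); field; lra.
Qed.

Lemma Cpowc_plus w s s' : Cpowc w (s + s') = (Cpowc w s * Cpowc w s')%C.
Proof. by rewrite /Cpowc -Cexp_plus; congr Cexp; ring. Qed.

Lemma Cpowc_0 w : Cpowc w 0 = RtoC 1.
Proof. by rewrite /Cpowc Cmult_0_l Cexp_0. Qed.

Lemma Cpowc_1 (w : C) : 0 < Re w -> Cpowc w 1 = w.
Proof. by move=> Hw; rewrite /Cpowc Cmult_1_l Cexp_CLog. Qed.

Lemma Cpowc_neq_0 w s : Cpowc w s <> RtoC 0.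
Proof. exact: Cexp_neq_0. Qed.

Lemma Cpowc_opp w s : Cpowc w (- s) = (/ Cpowc w s)%C.
Proof.
have E : (Cpowc w (- s) * Cpowc w s = 1)%C.
  by rewrite -Cpowc_plus -(Cpowc_0 w); congr Cpowc; ring.
transitivity (Cpowc w (- s) * Cpowc w s * / Cpowc w s)%C; last by rewrite E; ring.
by field; exact: Cpowc_neq_0.
Qed.

Lemma Cpowc_scal (w s : C) (x : R) : 0 < Re w -> 0 < x ->
  Cpowc (w * x) s = (Cpowc w s * Cpowc x s)%C.
Proof. by move=> Hw Hx; rewrite /Cpowc CLog_scal // CLog_R // -Cexp_plus; congr Cexp; ring. Qed.

Lemma Cpowc_inv_R (x : R) (s : C) : 0 < x -> Cpowc (/ x)%R s = Cpowc x (- s).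
Proof.
move=> Hx; have Hi := Rinv_0_lt_compat _ Hx.
by rewrite /Cpowc !CLog_R // ln_Rinv // RtoC_opp; congr Cexp; ring.
Qed.

Lemma Cpowc_1_base s : Cpowc 1 s = RtoC 1.
Proof. by rewrite /Cpowc CLog_R ?ln_1 ?Cmult_0_r ?Cexp_0 //; lra. Qed.

Lemma Cmod_Cpowc_R (x : R) (s : C) : 0 < x -> Cmod (Cpowc x s) = exp (Re s * ln x).
Proof. by move=> Hx; rewrite /Cpowc CLog_R // Cmod_Cexp; congr exp; rewrite /Re /=; ring. Qed.

Lemma is_Wd_Cpowc (w s : C) : 0 < Re w -> is_Wd (fun w => Cpowc w s) w (s * Cpowc w s / w) 0.
Proof.
move=> Hw; have Hw0 := Re_pos_neq_0 _ Hw.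
have D := is_Wd_comp _ _ _ _ _ _ _ (is_Wd_scal s _ _ _ _ (is_Wd_CLog _ Hw)) (is_Wd_Cexp (s * CLog w)).
apply: (is_Wd_eq _ _ _ _ _ _ D); rewrite /Cpowc; last by ring.
by field.
Qed.

(** * Fourier coefficients *)

Definition RIC (f : R -> C) (a b : R) : C :=
  (RInt (fun t => Re (f t)) a b, RInt (fun t => Im (f t)) a b).

Definition ctsR (f : R -> C) : Prop := forall x, continuous f x.

Lemma ctsR_Re f x : ctsR f -> continuous (fun t => Re (f t)) x.
Proof. by move=> H; apply: (continuous_comp f (fun u : C => fst u)); [exact: H | exact: continuous_fst]. Qed.

Lemma ctsR_Im f x : ctsR f -> continuous (fun t => Im (f t)) x.
Proof. by move=> H; apply: (continuous_comp f (fun u : C => snd u)); [exact: H | exact: continuous_snd]. Qed.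

Lemma continuous_RC (f : R -> C) (x : R) : continuous f x <->
  forall eps, 0 < eps -> exists d, 0 < d /\ forall h, Rabs h < d -> Cmod (f (x + h)%R - f x)%C < eps.
Proof.
split.
  move=> H eps Heps.
  have : locally (f x) (fun y => Cmod (y - f x)%C < eps).
    apply/locally_Cmod; exists eps; split=> // h.
    by have -> : (f x + h - f x = h)%C by ring.
  move=> /H [d Hd]; exists d; split; first exact: cond_pos.
  move=> h Hh; apply: (Hd (x + h)).
  by rewrite /ball /= /AbsRing_ball /abs /minus /plus /opp /= Rplus_assoc (Rplus_comm h) -Rplus_assoc Rplus_opp_r Rplus_0_l.
move=> H P /locally_Cmod [e [He K]].
case: (H _ He) => d [Hd L]; exists (mkposreal _ Hd) => y.
rewrite /ball /= /AbsRing_ball /abs /minus /plus /opp /= => Hy.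
have E : forall u : R, x + (u + - x) = u by move=> u; ring.
have := L _ Hy; rewrite E => /K.
by have -> : (f x + (f y - f x) = f y)%C by ring.
Qed.

Lemma ctsR_plus f g : ctsR f -> ctsR g -> ctsR (fun t => f t + g t)%C.
Proof. by move=> H1 H2 x; apply: (continuous_plus f g); [exact: H1 | exact: H2]. Qed.

Lemma ctsR_const c : ctsR (fun _ => c).
Proof. by move=> x; exact: continuous_const. Qed.

Lemma ctsR_comp F (g : R -> R) : ctsR F -> (forall x, continuous g x) -> ctsR (fun t => F (g t)).
Proof. by move=> H1 H2 x; apply: (continuous_comp g F); [exact: H2 | exact: H1]. Qed.

Lemma continuous_RtoC x : continuous RtoC x.
Proof.
apply/continuous_RC => eps Heps; exists eps; split=> // h.
have -> : (RtoC (x + h) - x = h)%C by rewrite RtoC_plus; ring.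
by rewrite Cmod_R.
Qed.

Lemma ctsR_Wd f : ctsR f <-> forall z, continuous (fun z : C => f (Re z)) z.
Proof.
split.
  move=> H z; apply: (continuous_comp (fun z : C => fst z) f); last exact: H.
  exact: continuous_fst.
move=> H x; apply: (continuous_comp (fun t => RtoC t) (fun z : C => f (Re z))); last exact: H.
exact: continuous_RtoC.
Qed.

Lemma ctsR_mult f g : ctsR f -> ctsR g -> ctsR (fun t => f t * g t)%C.
Proof.
move=> /ctsR_Wd H1 /ctsR_Wd H2; apply/ctsR_Wd => z.
exact: (continuous_Cmult (fun z => f (Re z)) (fun z => g (Re z))).
Qed.

Lemma is_Dv_continuous f x l : is_Dv f x l -> continuous f x.
Proof.
move=> /(is_Dv_Wd f (RtoC x)) /is_Wd_continuous H.
apply: (continuous_comp (fun t => RtoC t) (fun z : C => f (Re z))); last exact: H.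
exact: continuous_RtoC.
Qed.

Lemma is_Dv_comp_R (f : R -> C) (g : R -> R) x l m :
  is_derive g x m -> is_Dv f (g x) l -> is_Dv (fun t => f (g t)) x (m * l).
Proof.
move=> H [H1 H2].
have E1 : Re (m * l)%C = scal m (Re l) by rewrite /scal /= /mult /Re /=; ring.
have E2 : Im (m * l)%C = scal m (Im l) by rewrite /scal /= /mult /Im /=; ring.
split; rewrite ?E1 ?E2.
  exact: (is_derive_comp (fun t => Re (f t)) g).
exact: (is_derive_comp (fun t => Im (f t)) g).
Qed.

Lemma ctsR_expi n : ctsR (fun t => expi (n * t)).
Proof.
move=> x; apply: is_Dv_continuous.
apply: (is_Dv_comp_R expi (fun t => n * t) x (Ci * expi (n * x)) n); last exact: is_Dv_expi.
by auto_derive => //; ring.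
Qed.

Lemma ex_RInt_ctsR f a b : ctsR f ->
  ex_RInt (fun t => Re (f t)) a b /\ ex_RInt (fun t => Im (f t)) a b.
Proof.
by move=> H; split; apply: (ex_RInt_continuous (V := R_CompleteNormedModule)) => z _;
  [exact: ctsR_Re | exact: ctsR_Im].
Qed.

Lemma RIC_ext f g a b : (forall t, f t = g t) -> RIC f a b = RIC g a b.
Proof. by move=> E; rewrite /RIC; f_equal; apply: RInt_ext => t _; rewrite E. Qed.

Lemma RIC_plus f g a b : ctsR f -> ctsR g ->
  RIC (fun t => f t + g t)%C a b = (RIC f a b + RIC g a b)%C.
Proof.
move=> Hf Hg; have [F1 F2] := ex_RInt_ctsR f a b Hf; have [G1 G2] := ex_RInt_ctsR g a b Hg.
apply: C_ext; rewrite /RIC /Re /Im /=.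
  exact: (RInt_plus (fun t => Re (f t)) (fun t => Re (g t))).
exact: (RInt_plus (fun t => Im (f t)) (fun t => Im (g t))).
Qed.

Lemma RInt_lin (f g : R -> R) a b c d : ex_RInt f a b -> ex_RInt g a b ->
  RInt (fun t => c * f t + d * g t) a b = c * RInt f a b + d * RInt g a b.
Proof.
move=> Hf Hg.
have E1 := RInt_scal f a b c Hf; have E2 := RInt_scal g a b d Hg.
have K := RInt_plus (fun t => scal c (f t)) (fun t => scal d (g t)) a b
  (ex_RInt_scal _ _ _ _ Hf) (ex_RInt_scal _ _ _ _ Hg).
by rewrite E1 E2 in K.
Qed.

Lemma RIC_scal c f a b : ctsR f -> RIC (fun t => c * f t)%C a b = (c * RIC f a b)%C.
Proof.
move=> Hf; have [F1 F2] := ex_RInt_ctsR f a b Hf.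
have P1 t : Re (c * f t)%C = Re c * Re (f t) + - Im c * Im (f t) by rewrite /Re /Im /=; ring.
have P2 t : Im (c * f t)%C = Re c * Im (f t) + Im c * Re (f t) by rewrite /Re /Im /=; ring.
apply: C_ext; rewrite {1}/RIC /=.
  transitivity (Re c * RInt (fun t => Re (f t)) a b + - Im c * RInt (fun t => Im (f t)) a b).
    by rewrite -RInt_lin //; apply: RInt_ext => t _; exact: P1.
  by rewrite /Re /Im /=; ring.
transitivity (Re c * RInt (fun t => Im (f t)) a b + Im c * RInt (fun t => Re (f t)) a b).
  by rewrite -RInt_lin //; apply: RInt_ext => t _; exact: P2.
by rewrite /Re /Im /=; ring.
Qed.

Lemma RIC_shift f a b d : ctsR f -> RIC (fun t => f (t + d)) a b = RIC f (a + d) (b + d).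
Proof.
move=> Hf; rewrite /RIC.
have K : forall g : R -> R, (forall x, continuous g x) ->
   RInt (fun t => g (t + d)) a b = RInt g (a + d) (b + d).
  move=> g Hg; have := RInt_comp_lin g 1 d a b; rewrite !Rmult_1_l => <-.
    by apply: RInt_ext => t _; rewrite /scal /= /mult /= !Rmult_1_l.
  by apply: (ex_RInt_continuous (V := R_CompleteNormedModule)) => z _.
f_equal.
  by apply: (K (fun t => Re (f t))) => x; exact: ctsR_Re.
by apply: (K (fun t => Im (f t))) => x; exact: ctsR_Im.
Qed.

Lemma RIC_Chasles f a b c : ctsR f -> (RIC f a b + RIC f b c = RIC f a c)%C.
Proof.
move=> Hf; have [F1 F2] := ex_RInt_ctsR f a b Hf; have [G1 G2] := ex_RInt_ctsR f b c Hf.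
apply: C_ext; rewrite /RIC /Re /Im /=.
  exact: (RInt_Chasles (fun t => Re (f t))).
exact: (RInt_Chasles (fun t => Im (f t))).
Qed.

Lemma RIC_derive f f' a b : (forall x, is_Dv f x (f' x)) -> ctsR f' -> RIC f' a b = (f b - f a)%C.
Proof.
move=> H Hc; apply: C_ext; rewrite /RIC /Re /Im /=.
  apply: (is_RInt_unique (fun t => Re (f' t))).
  apply: (is_RInt_derive (fun t => Re (f t))) => x _; first by have [] := H x.
  exact: ctsR_Re.
apply: (is_RInt_unique (fun t => Im (f' t))).
apply: (is_RInt_derive (fun t => Im (f t))) => x _; first by have [] := H x.
exact: ctsR_Im.
Qed.

(** Real and imaginary parts are estimated separately; the factor 2 lost is harmless, since only
    orders of magnitude are used. *)
Lemma Cmod_RIC_le f a b M : a <= b -> ctsR f ->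
  (forall t, a <= t <= b -> Cmod (f t) <= M) -> Cmod (RIC f a b) <= 2 * ((b - a) * M).
Proof.
move=> Hab Hf H; have [F1 F2] := ex_RInt_ctsR f a b Hf.
apply: (Rle_trans _ _ _ (Cmod_le_ReIm _)); rewrite /RIC /=.
have K1 : Rabs (RInt (fun t => Re (f t)) a b) <= (b - a) * M.
  by apply: abs_RInt_le_const => // t /H; move: (re_le_Cmod (f t)); lra.
have K2 : Rabs (RInt (fun t => Im (f t)) a b) <= (b - a) * M.
  by apply: abs_RInt_le_const => // t /H; move: (im_le_Cmod (f t)); lra.
lra.
Qed.

Definition periodic (f : R -> C) : Prop := forall t, f (t + 2 * PI) = f t.

Lemma RIC_period f a : ctsR f -> periodic f -> RIC f a (a + 2 * PI) = RIC f 0 (2 * PI).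
Proof.
move=> Hc Hp.
have E1 := RIC_Chasles f a 0 (a + 2 * PI) Hc.
have E2 := RIC_Chasles f 0 (2 * PI) (a + 2 * PI) Hc.
have E3 : RIC f (2 * PI) (a + 2 * PI) = RIC f 0 a.
  rewrite -{1}(Rplus_0_l (2 * PI)) -RIC_shift //; exact: RIC_ext.
have E4 := RIC_Chasles f a 0 a Hc.
have E5 : RIC f a a = RtoC 0.
  by rewrite /RIC !(RInt_point (V := R_CompleteNormedModule)).
rewrite -E1 -E2 E3.
transitivity ((RIC f a 0 + RIC f 0 a) + RIC f 0 (2 * PI))%C; first by ring.
by rewrite E4 E5; ring.
Qed.

(** The index is real, so that [n - k] and [- INR n] need no casts; results that rest on periodicity
    are stated at [IZR n]. *)
Definition fourier (f : R -> C) (n : R) : C :=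
  (RIC (fun t => f t * expi (- n * t)) 0 (2 * PI) / (2 * PI))%C.

Lemma PI2_neq_0 : (2 * PI : C)%C <> RtoC 0.
Proof. by rewrite -RtoC_mult => -[]; move: PI_RGT_0; lra. Qed.

Lemma ctsR_fourier f n : ctsR f -> ctsR (fun t => f t * expi (- n * t))%C.
Proof. by move=> H; apply: ctsR_mult => //; exact: ctsR_expi. Qed.

Lemma fourier_plus f g n : ctsR f -> ctsR g ->
  fourier (fun t => f t + g t)%C n = (fourier f n + fourier g n)%C.
Proof.
move=> Hf Hg; rewrite /fourier.
rewrite (RIC_ext _ (fun t => f t * expi (- n * t) + g t * expi (- n * t))%C); last by move=> t; ring.
rewrite RIC_plus; try exact: ctsR_fourier.
by rewrite /Cdiv; ring.
Qed.

Lemma fourier_scal f c n : ctsR f -> fourier (fun t => c * f t)%C n = (c * fourier f n)%C.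
Proof.
move=> Hf; rewrite /fourier.
rewrite (RIC_ext _ (fun t => c * (f t * expi (- n * t)))%C); last by move=> t; ring.
rewrite RIC_scal; last exact: ctsR_fourier.
by rewrite /Cdiv; ring.
Qed.

Lemma fourier_ext f g n : (forall t, f t = g t) -> fourier f n = fourier g n.
Proof. by move=> E; rewrite /fourier; congr (_ / _)%C; apply: RIC_ext => t; rewrite E. Qed.

Lemma fourier_expi_mult f k n : fourier (fun t => expi (k * t) * f t)%C n = fourier f (n - k).
Proof.
rewrite /fourier; congr (_ / _)%C; apply: RIC_ext => t.
have -> : - (n - k) * t = k * t + - n * t by ring.
by rewrite expi_plus; ring.
Qed.

Lemma Cmod_fourier_le f n M : ctsR f -> (forall t, Cmod (f t) <= M) -> Cmod (fourier f n) <= 2 * M.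
Proof.
move=> Hc H; have HP := PI_RGT_0.
rewrite /fourier Cmod_div; last exact: PI2_neq_0.
rewrite -RtoC_mult Cmod_R Rabs_pos_eq; last lra.
apply/Rle_div_l; first lra.
have -> : 2 * M * (2 * PI) = 2 * ((2 * PI - 0) * M) by ring.
apply: Cmod_RIC_le; [lra | exact: ctsR_fourier | move=> t _].
by rewrite Cmod_mult Cmod_expi Rmult_1_r.
Qed.

Lemma expi_2PI_Z (k : Z) : expi (2 * IZR k * PI) = RtoC 1.
Proof.
have N : forall n : nat, expi (2 * INR n * PI) = RtoC 1.
  move=> n; rewrite /expi -(Rplus_0_l (2 * INR n * PI)) cos_period sin_period cos_0 sin_0.
  by [].
case: (Z.le_ge_cases 0 k) => Hk.
  by rewrite -(Z2Nat.id k) // -INR_IZR_INZ.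
have -> : 2 * IZR k * PI = - (2 * INR (Z.to_nat (- k)) * PI).
  rewrite INR_IZR_INZ Z2Nat.id; last lia.
  by rewrite opp_IZR; ring.
by rewrite expi_opp N; field; move=> []; lra.
Qed.

Lemma periodic_expi (n : Z) : periodic (fun t => expi (IZR n * t)).
Proof.
move=> t; have -> : IZR n * (t + 2 * PI) = IZR n * t + 2 * IZR n * PI by ring.
by rewrite expi_plus expi_2PI_Z; ring.
Qed.

Lemma periodic_mult f g : periodic f -> periodic g -> periodic (fun t => f t * g t)%C.
Proof. by move=> H1 H2 t; rewrite H1 H2. Qed.

Lemma periodic_Z f (k : Z) t : periodic f -> f (t + 2 * IZR k * PI) = f t.
Proof.
move=> Hp.
have N : forall (n : nat) u, f (u + 2 * INR n * PI) = f u.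
  elim=> [|n IH] u; first by rewrite /= Rmult_0_r Rmult_0_l Rplus_0_r.
  rewrite S_INR; have -> : u + 2 * (INR n + 1) * PI = (u + 2 * INR n * PI) + 2 * PI by ring.
  by rewrite Hp.
case: (Z.le_ge_cases 0 k) => Hk.
  by rewrite -(Z2Nat.id k) // -INR_IZR_INZ.
rewrite -(N (Z.to_nat (- k)) (t + _)) INR_IZR_INZ Z2Nat.id; last lia.
by rewrite opp_IZR; congr f; ring.
Qed.

Lemma fourier_const c (n : Z) : fourier (fun _ => c) (IZR n) = if Z.eqb n 0 then c else RtoC 0.
Proof.
rewrite /fourier; case: Z.eqb_spec => [-> | Hn].
  rewrite (RIC_ext _ (fun _ => c)); last first.
    by move=> t; rewrite (_ : - 0 * t = 0) ?expi_0; ring.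
  have D : forall x, is_Dv (fun t => RtoC t * c)%C x c.
    move=> x; apply/(is_Dv_Wd _ (RtoC x)).
    apply: (is_Wd_ext (fun z => (/2 * c) * (z + Cconj z))%C).
      by move=> z; rewrite re_alt; field.
    have := is_Wd_scal (/2 * c)%C _ _ _ _ (is_Wd_plus _ _ _ _ _ _ _ (is_Wd_id (RtoC x)) (is_Wd_conj_id (RtoC x))) => D.
    by apply: (is_Wd_eq _ _ _ _ _ _ D); field.
  rewrite (RIC_derive _ _ _ _ D); last exact: ctsR_const.
  by rewrite RtoC_mult; field; move=> []; move: PI_RGT_0; lra.
have Hn' : IZR n <> 0 by move=> /eq_IZR.
have Hn2 : RtoC (IZR n) <> RtoC 0 by move=> [].
have Hi : Ci <> RtoC 0 by move=> []; lra.
have D : forall x, is_Dv (fun t => expi (- IZR n * t)) x (- IZR n * (Ci * expi (- IZR n * x)))%C.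
  move=> x; rewrite -RtoC_opp; apply: (is_Dv_comp_R expi); last exact: is_Dv_expi.
  by auto_derive => //; ring.
rewrite (RIC_ext _ (fun t => (- c / (IZR n * Ci)) * (- IZR n * (Ci * expi (- IZR n * t))))%C); last first.
  by move=> t; field.
rewrite RIC_scal; last first.
  apply: ctsR_mult; first exact: ctsR_const.
  by apply: ctsR_mult; [exact: ctsR_const | exact: ctsR_expi].
rewrite (RIC_derive _ _ _ _ D); last first.
  apply: ctsR_mult; first exact: ctsR_const.
  by apply: ctsR_mult; [exact: ctsR_const | exact: ctsR_expi].
have := periodic_expi (- n) 0; rewrite opp_IZR Rplus_0_l => ->.
by rewrite /Cdiv; ring.
Qed.

Lemma fourier_shift f (n : Z) d : ctsR f -> periodic f ->
  fourier (fun t => f (t + d)) (IZR n) = (expi (IZR n * d) * fourier f (IZR n))%C.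
Proof.
move=> Hc Hp; rewrite /fourier.
rewrite (RIC_ext _ (fun t => expi (IZR n * d) * (f (t + d)%R * expi (- IZR n * (t + d))))%C); last first.
  move=> t; have -> : - IZR n * t = - IZR n * (t + d) + IZR n * d by ring.
  by rewrite (expi_plus (- IZR n * (t + d))); ring.
have C0 := ctsR_fourier f (IZR n) Hc.
rewrite RIC_scal; last first.
  apply: (ctsR_comp (fun t => f t * expi (- IZR n * t))%C (fun t => t + d)) => // x.
  by apply: (continuous_plus (fun t => t) (fun _ => d)); [exact: continuous_id | exact: continuous_const].
rewrite (RIC_shift (fun t => f t * expi (- IZR n * t))%C) //.
rewrite (Rplus_comm 0) Rplus_0_r (Rplus_comm (2 * PI)) RIC_period //; first by rewrite /Cdiv; ring.
by apply: periodic_mult => //; rewrite -opp_IZR; exact: periodic_expi.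
Qed.

(* Riemann-Lebesgue: shifting the variable by [PI / n] changes the sign of the exponential. *)
Lemma fourier_vanish f : ctsR f -> periodic f -> forall eps, 0 < eps ->
  exists N : nat, forall n : Z, (Z.of_nat N <= Z.abs n)%Z -> Cmod (fourier f (IZR n)) <= eps.
Proof.
move=> Hc Hp eps Heps; have HP := PI_RGT_0.
(* The interval contains both [t] and its shift by [PI / n], for [t] in one period and $|n|\ge1$. *)
have [d Hd] := unifcont_normed_1d (K := C_AbsRing) (V := C_NormedModule) f (- PI) (3 * PI) (fun x _ => Hc x) (mkposreal _ Heps).
have [N HN] : exists N : nat, PI / d < INR N.
  have [N HN] := INR_archimed 1 (PI / d) Rlt_0_1; exists N; lra.
have Hdp := cond_pos d.
have HPd : 0 < PI / d by apply: Rdiv_lt_0_compat.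
exists N => n Hn.
have Hn1 : INR N <= Rabs (IZR n) by rewrite INR_IZR_INZ Rabs_Zabs; apply: IZR_le.
have Hn0 : IZR n <> 0 by move=> E; rewrite E Rabs_R0 in Hn1; lra.
have Hs : Rabs (PI / IZR n) < d.
  rewrite Rabs_div // (Rabs_pos_eq PI); last lra.
  apply/Rlt_div_l; first lra.
  have : PI < INR N * d by apply/Rlt_div_l.
  nra.
have Hs2 : Rabs (PI / IZR n) <= PI.
  rewrite Rabs_div // (Rabs_pos_eq PI); last lra.
  apply/Rle_div_l; first lra.
  suff : 1 <= Rabs (IZR n) by nra.
  rewrite Rabs_Zabs; apply: IZR_le.
  have : n <> 0%Z by move=> E; apply: Hn0; rewrite E.
  lia.
have Cf : ctsR (fun t => f (t + PI / IZR n)).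
  apply: (ctsR_comp f (fun t => t + PI / IZR n)) => // x.
  by apply: (continuous_plus (fun t => t) (fun _ => PI / IZR n)); [exact: continuous_id | exact: continuous_const].
have E1 := fourier_shift f n (PI / IZR n) Hc Hp.
have Ee : expi (IZR n * (PI / IZR n)) = (-1)%C.
  have -> : IZR n * (PI / IZR n) = PI by field.
  by rewrite /expi cos_PI sin_PI; apply: C_ext; rewrite /=; ring.
rewrite Ee in E1.
set g := fun t => (f t + -1 * f (t + PI / IZR n)%R)%C.
have E2 : fourier g (IZR n) = (2 * fourier f (IZR n))%C.
  rewrite /g fourier_plus //; last by apply: ctsR_mult => //; exact: ctsR_const.
  by rewrite fourier_scal // E1; ring.
have Cg : ctsR g by apply: ctsR_plus => //; apply: ctsR_mult => //; exact: ctsR_const.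
have Pg : periodic g.
  move=> t; rewrite /g Hp; congr (_ + _ * _)%C.
  by have -> : t + 2 * PI + PI / IZR n = t + PI / IZR n + 2 * PI by ring.
have B : Cmod (fourier g (IZR n)) <= 2 * eps.
  rewrite /fourier Cmod_div; last exact: PI2_neq_0.
  rewrite -RtoC_mult Cmod_R Rabs_pos_eq; last lra.
  apply/Rle_div_l; first lra.
  have -> : 2 * eps * (2 * PI) = 2 * ((2 * PI - 0) * eps) by ring.
  apply: Cmod_RIC_le; [lra | exact: ctsR_fourier | move=> t Ht].
  rewrite Cmod_mult Cmod_expi Rmult_1_r.
  move: Hs2 => /Rabs_le_between Hs2.
  have := Hd (t + PI / IZR n) t ltac:(lra) ltac:(lra).
  have Hb : ball (t + PI / IZR n) d t.
    rewrite /ball /= /AbsRing_ball /abs /minus /plus /opp /=.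
    have -> : t + - (t + PI / IZR n) = - (PI / IZR n) by ring.
    by rewrite Rabs_Ropp.
  move=> /(_ Hb); rewrite /ball_norm /norm /= /minus /plus /opp /= /g => K.
  have -> : (f t + -1 * f (t + PI / IZR n)%R = f t + - f (t + PI / IZR n)%R)%C by ring.
  lra.
rewrite E2 Cmod_mult Cmod_R Rabs_pos_eq in B; lra.
Qed.

(* The negative part runs one index further, over [-N-1, ..., -1]. *)
Definition symsum (c : R -> C) (N : nat) : C :=
  (sum_n (fun n => c (INR n)) N + sum_n (fun m => c (- INR (S m))%R) N)%C.

(** * Pointwise convergence of Fourier series at points of differentiability *)

Lemma cos_1_2PI t : cos t = 1 -> exists k : Z, t = 2 * IZR k * PI.
Proof.
move=> H; have E : sin (t / 2) = 0.
  have := cos_2a_sin (t / 2); have -> : 2 * (t / 2) = t by field.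
  rewrite H => E; have : sin (t / 2) * sin (t / 2) = 0 by lra.
  by move=> /Rmult_integral [].
have [k Hk] := sin_eq_0_0 _ E; exists k; lra.
Qed.

(** For [l] the derivative of [f] at 0, the value [l / Ci] is the limit of the quotient where
    $e^{it}=1$. The factor $e^{it}-1$ acts on Fourier coefficients as a difference, which makes the
    partial sums telescope. *)
Definition dquot (f : R -> C) (l : C) (t : R) : C :=
  match Req_dec_T (cos t) 1 with
  | left _ => (l / Ci)%C
  | right _ => ((f t - f 0%R) / (expi t - 1))%C
  end.

Lemma expi_neq_1 t : cos t <> 1 -> (expi t - 1)%C <> RtoC 0.
Proof. by move=> H [E _]; apply: H; move: E; rewrite /=; lra. Qed.

Lemma dquot_eq f l t : periodic f -> f t = (f 0%R + (expi t - 1) * dquot f l t)%C.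
Proof.
move=> Hp; rewrite /dquot; case: Req_dec_T => [/cos_1_2PI [k ->] | H].
  rewrite -{1}(Rplus_0_l (2 * IZR k * PI)) periodic_Z // expi_2PI_Z; ring.
by field; exact: expi_neq_1.
Qed.

Lemma dquot_periodic f l : periodic f -> periodic (dquot f l).
Proof.
move=> Hp t; rewrite /dquot Hp.
have -> : expi (t + 2 * PI) = expi t.
  by have := periodic_expi 1 t; rewrite !Rmult_1_l.
have -> : cos (t + 2 * PI) = cos t by have := cos_period t 1; rewrite /= Rmult_1_r.
by [].
Qed.

Lemma dquot_continuous_0 f l : is_Dv f 0 l -> continuous (dquot f l) 0.
Proof.
move=> Hl; apply/continuous_RC => eps Heps.
have Hi : Ci <> RtoC 0 by move=> []; lra.
have D : is_Dv (fun t => f t - (l / Ci) * expi t)%C 0 0.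
  apply/(is_Dv_Wd _ (RtoC 0)).
  have D1 : is_Wd (fun z => f (Re z)) (RtoC 0) (l / 2) (l / 2) by apply/is_Dv_Wd.
  have D2 : is_Wd (fun z => expi (Re z)) (RtoC 0) (Ci * expi 0 / 2) (Ci * expi 0 / 2).
    by apply/(is_Dv_Wd expi); exact: is_Dv_expi.
  have D := is_Wd_minus _ _ _ _ _ _ _ D1 (is_Wd_scal (l / Ci)%C _ _ _ _ D2).
  by apply: (is_Wd_eq _ _ _ _ _ _ D); rewrite expi_0; field.
have De := is_Dv_expi 0; rewrite expi_0 in De.
have He4 : 0 < eps / 4 by lra.
have Hhalf : 0 < 1 / 2 by lra.
move: D De => /is_Dv_eps D /is_Dv_eps De.
case: (D _ He4) => d1 [Hd1 K1]; case: (De _ Hhalf) => d2 [Hd2 K2].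
exists (Rmin d1 d2); split; first exact: Rmin_pos.
move=> h Hh; have := Rmin_l d1 d2; have := Rmin_r d1 d2 => m1 m2.
have B1 := K1 h ltac:(lra); have B2 := K2 h ltac:(lra).
rewrite Rplus_0_l in B1 B2 *.
have -> : dquot f l 0 = (l / Ci)%C.
  by rewrite /dquot; case: Req_dec_T => //; rewrite cos_0.
rewrite /dquot; case: Req_dec_T => [_ | Hc].
  by rewrite /Cminus Cplus_opp_r Cmod_0.
have Hq := expi_neq_1 _ Hc.
have Hh0 : 0 < Rabs h.
  by apply: Rabs_pos_lt => E; apply: Hc; rewrite E cos_0.
have B3 : Rabs h / 2 <= Cmod (expi h - 1)%C.
  have := Cmod_triangle (expi h - 1)%C (- (expi h - expi 0 - Ci * 1 * h))%C.
  rewrite Cmod_opp expi_0.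
  have -> : (expi h - 1 + - (expi h - 1 - Ci * 1 * h) = Ci * h)%C by ring.
  rewrite Cmod_mult Cmod_Ci Cmod_R Rmult_1_l.
  by rewrite expi_0 in B2; lra.
have -> : ((f h - f 0%R) / (expi h - 1) - l / Ci =
   (f h - l / Ci * expi h - (f 0%R - l / Ci * expi 0%R) - 0 * h) / (expi h - 1))%C.
  by rewrite expi_0; field.
rewrite Cmod_div //; apply/Rlt_div_l; first by lra.
apply: (Rle_lt_trans _ _ _ B1); nra.
Qed.

Lemma dquot_continuous f l : ctsR f -> periodic f -> is_Dv f 0 l -> ctsR (dquot f l).
Proof.
move=> Hc Hp Hl x; case: (Req_dec (cos x) 1) => [/cos_1_2PI [k Hk] | Hx].
  have P := dquot_periodic f l Hp.
  apply: (continuous_ext (fun t => dquot f l (t + - x))).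
    move=> t; rewrite -(periodic_Z _ k (t + - x)) // Hk; congr dquot; ring.
  apply: (continuous_comp (fun t => t + - x) (dquot f l)).
    by apply: (continuous_plus (fun t => t) (fun _ => - x)); [exact: continuous_id | exact: continuous_const].
  by rewrite Rplus_opp_r; exact: dquot_continuous_0.
have Hn := expi_neq_1 _ Hx.
have C1 : continuous (fun z : C => ((f (Re z) - f 0%R) * / (expi (Re z) - 1))%C) (RtoC x).
  have Ce : continuous (fun z : C => expi (Re z)) (RtoC x).
    apply: (continuous_comp (fun z : C => fst z) expi); first exact: continuous_fst.
    exact: is_Dv_continuous (is_Dv_expi _).
  have Cf : continuous (fun z : C => f (Re z)) (RtoC x).
    by apply: (continuous_comp (fun z : C => fst z) f); [exact: continuous_fst | exact: Hc].
  apply: continuous_Cmult.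
    by apply: (continuous_minus (fun z : C => f (Re z)) (fun _ => f 0%R)) => //; exact: continuous_const.
  apply: (continuous_comp (fun z : C => expi (Re z) - 1)%C Cinv).
    by apply: (continuous_minus (fun z : C => expi (Re z)) (fun _ => RtoC 1)) => //; exact: continuous_const.
  exact: is_Wd_continuous (is_Wd_inv _ Hn).
have C2 : continuous (fun t => (f t - f 0%R) * / (expi t - 1))%C x.
  by apply: (continuous_comp RtoC (fun z : C => ((f (Re z) - f 0%R) * / (expi (Re z) - 1))%C)) => //; exact: continuous_RtoC.
apply: (continuous_ext_loc _ (fun t => (f t - f 0%R) * / (expi t - 1))%C) => //.
have L : locally x (fun t => cos t <> 1).
  have Cc : continuous cos x by exact: continuous_cos.
  by apply: (Cc (fun u => u <> 1)); exact: open_neq.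
by apply: filter_imp L => t Ht; rewrite /dquot; case: Req_dec_T.
Qed.

Lemma symsum_S c N : symsum c (S N) = (symsum c N + (c (INR (S N)) + c (- INR (S (S N)))%R))%C.
Proof. by rewrite /symsum !sum_Sn /plus /=; ring. Qed.

Lemma fourier_dquot f l (n : Z) : ctsR f -> periodic f -> is_Dv f 0 l ->
  fourier f (IZR n) = ((if Z.eqb n 0 then f 0%R else 0) + fourier (dquot f l) (IZR n - 1)%R - fourier (dquot f l) (IZR n))%C.
Proof.
move=> Hc Hp Hl; have Cg := dquot_continuous _ _ Hc Hp Hl.
have Ce := ctsR_expi 1.
rewrite (fourier_ext f (fun t => f 0%R + (expi (1 * t) * dquot f l t + -1 * dquot f l t))%C); last first.
  by move=> t; rewrite Rmult_1_l {1}(dquot_eq f l t Hp); ring.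
have C1 : ctsR (fun t => expi (1 * t) * dquot f l t)%C by exact: ctsR_mult.
have C2 : ctsR (fun t => -1 * dquot f l t)%C by apply: ctsR_mult => //; exact: ctsR_const.
rewrite fourier_plus; [|exact: ctsR_const | exact: ctsR_plus].
by rewrite fourier_plus // fourier_scal // fourier_expi_mult fourier_const; ring.
Qed.

(** Telescoping leaves the value at 0 and two coefficients of a continuous function, which tend to
    zero by Riemann-Lebesgue. No Dirichlet kernel is involved. *)
Lemma symsum_fourier f l N : ctsR f -> periodic f -> is_Dv f 0 l ->
  symsum (fourier f) N = (f 0%R + fourier (dquot f l) (- INR (S (S N)))%R - fourier (dquot f l) (INR N))%C.
Proof.
move=> Hc Hp Hl.
have E1 (n : nat) : fourier f (INR (S n)) = (fourier (dquot f l) (INR n) - fourier (dquot f l) (INR (S n)))%C.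
  rewrite INR_IZR_INZ (fourier_dquot _ l) //.
  have -> : Z.eqb (Z.of_nat (S n)) 0 = false by apply/Z.eqb_neq; lia.
  by rewrite -INR_IZR_INZ S_INR (_ : INR n + 1 - 1 = INR n); [ring | ring].
have E2 (n : nat) : fourier f (- INR (S n))%R = (fourier (dquot f l) (- INR (S (S n)))%R - fourier (dquot f l) (- INR (S n))%R)%C.
  rewrite INR_IZR_INZ -opp_IZR (fourier_dquot _ l) //.
  have -> : Z.eqb (- Z.of_nat (S n)) 0 = false by apply/Z.eqb_neq; lia.
  by rewrite opp_IZR -INR_IZR_INZ (S_INR (S n)) (_ : - INR (S n) - 1 = - (INR (S n) + 1)); [ring | ring].
elim: N => [|N IH].
  rewrite /symsum !sum_O E2; have := fourier_dquot f l 0 Hc Hp Hl => /= ->.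
  have -> : 0 - 1 = - INR 1 by rewrite /=; ring.
  by rewrite /=; ring.
by rewrite symsum_S IH E1 E2; ring.
Qed.

Lemma symsum_ext c c' N : (forall n : Z, c (IZR n) = c' (IZR n)) -> symsum c N = symsum c' N.
Proof.
move=> E; rewrite /symsum; congr (_ + _)%C; apply: sum_n_ext => n.
  by rewrite INR_IZR_INZ.
by rewrite INR_IZR_INZ -opp_IZR.
Qed.

Lemma dirichlet f x l : ctsR f -> periodic f -> is_Dv f x l ->
  forall eps, 0 < eps -> exists N0, forall N, (N0 <= N)%nat ->
    Cmod (symsum (fun n => fourier f n * expi (n * x)%R)%C N - f x)%C <= eps.
Proof.
move=> Hc Hp Hl eps Heps.
(* Translation moves the point to 0 and multiplies the coefficients by $e^{inx}$. *)
set f0 := fun t => f (t + x).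
have D : is_derive (fun t => t + x) 0 1 by auto_derive.
have Hl0 : is_Dv f0 0 l.
  have := is_Dv_comp_R f (fun t => t + x) 0 l 1 D; rewrite Rplus_0_l => /(_ Hl).
  by rewrite Cmult_1_l.
have Hc0 : ctsR f0.
  apply: (ctsR_comp f (fun t => t + x)) => // y.
  by apply: (continuous_plus (fun t => t) (fun _ => x)); [exact: continuous_id | exact: continuous_const].
have Hp0 : periodic f0.
  by move=> t; rewrite /f0 (_ : t + 2 * PI + x = t + x + 2 * PI); [exact: Hp | ring].
have Cg := dquot_continuous _ _ Hc0 Hp0 Hl0.
have [N0 HN] := fourier_vanish _ Cg (dquot_periodic f0 l Hp0) (eps / 2) ltac:(lra).
exists N0 => N HNN.
rewrite (symsum_ext _ (fourier f0)); last by move=> n; rewrite /f0 (fourier_shift f n x) //= Cmult_comm.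
rewrite (symsum_fourier _ l) //.
have E0 : f0 0 = f x by rewrite /f0 Rplus_0_l.
rewrite E0.
have -> : (f x + fourier (dquot f0 l) (- INR (S (S N)))%R - fourier (dquot f0 l) (INR N) - f x =
  fourier (dquot f0 l) (- INR (S (S N)))%R + - fourier (dquot f0 l) (INR N))%C by ring.
apply: (Rle_trans _ _ _ (Cmod_triangle _ _)); rewrite Cmod_opp.
have B1 := HN (- Z.of_nat (S (S N)))%Z ltac:(lia).
have B2 := HN (Z.of_nat N) ltac:(lia).
rewrite opp_IZR -INR_IZR_INZ in B1; rewrite -INR_IZR_INZ in B2; lra.
Qed.

(** * Fourier coefficients along the circles of an annulus *)

Definition Ann (R0 R1 : R) (w : C) : Prop := R0 < Cmod w < R1.

Lemma Cmod_lipschitz (u v : C) : Rabs (Cmod u - Cmod v) <= Cmod (u - v)%C.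
Proof.
have A := Cmod_triangle (u - v) v; have B := Cmod_triangle (v - u) u.
have E1 : (u - v + v = u)%C by ring.
have E2 : (v - u + u = v)%C by ring.
have E3 : Cmod (v - u)%C = Cmod (u - v)%C by rewrite -Cmod_opp; congr Cmod; ring.
rewrite E1 in A; rewrite E2 E3 in B.
by apply: Rabs_le; lra.
Qed.

Lemma open_Ann R0 R1 : open (Ann R0 R1).
Proof.
move=> w [H1 H2]; apply/locally_Cmod.
exists (Rmin (Cmod w - R0) (R1 - Cmod w)); split; first by apply: Rmin_pos; lra.
move=> h Hh; have := Rmin_l (Cmod w - R0) (R1 - Cmod w); have := Rmin_r (Cmod w - R0) (R1 - Cmod w).
have := Cmod_lipschitz (w + h) w; have -> : (w + h - w = h)%C by ring.
move=> /Rabs_le_between A B D; rewrite /Ann; lra.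
Qed.

Lemma RIC_derive_param (h h' : R -> R -> C) (R0 R1 a b : R) :
  (forall u t, R0 < u < R1 -> is_Dv (fun u => h u t) u (h' u t)) ->
  (forall u, R0 < u < R1 -> ctsR (h u)) ->
  (forall u t, R0 < u < R1 -> continuous (fun p : C => h' (Re p) (Im p)) (u, t)) ->
  forall u, R0 < u < R1 -> is_Dv (fun u => RIC (h u) a b) u (RIC (h' u) a b).
Proof.
move=> D Cc C' u Hu.
have L : locally u (fun y => R0 < y < R1).
  have Hd : 0 < Rmin (u - R0) (R1 - u) by apply: Rmin_pos; lra.
  exists (mkposreal _ Hd) => y; rewrite /ball /= /AbsRing_ball /abs /minus /plus /opp /= => Hy.
  have := Rmin_l (u - R0) (R1 - u); have := Rmin_r (u - R0) (R1 - u).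
  by move: Hy => /Rabs_lt_between; lra.
have K : forall (pr : C -> R) (G : R -> R -> R) (G' : R -> R -> R),
   (forall v t, R0 < v < R1 -> is_derive (fun x => G x t) v (G' v t)) ->
   (forall v, R0 < v < R1 -> ex_RInt (G v) a b) ->
   (forall v t, R0 < v < R1 -> continuous (fun p : C => G' (Re p) (Im p)) (v, t)) ->
   is_derive (fun v => RInt (G v) a b) u (RInt (G' u) a b).
  move=> _ G G' D1 I1 K1.
  have -> : RInt (G' u) a b = RInt (fun t => Derive (fun x => G x t) u) a b.
    by apply: RInt_ext => t _; rewrite (is_derive_unique _ _ _ (D1 u t Hu)).
  apply: is_derive_RInt_param.
  - by apply: filter_imp L => y Hy t _; exists (G' y t); exact: D1.
  - move=> t _; apply/continuity_2d_pt_filterlim.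
    have := K1 u t Hu; rewrite /continuous /Re /Im /= => K2.
    rewrite (is_derive_unique _ _ _ (D1 u t Hu)).
    apply: (filterlim_ext_loc (fun p : R * R => G' (fst p) (snd p))) => //.
    have [d Hd] := L; exists d => y [Hy _].
    by rewrite (is_derive_unique _ _ _ (D1 (fst y) (snd y) (Hd _ Hy))).
  - by apply: filter_imp L => y Hy; exact: I1.
split; rewrite /RIC /=.
  apply: (K Re (fun u t => Re (h u t)) (fun u t => Re (h' u t))).
  - by move=> v t Hv; have [] := D v t Hv.
  - by move=> v Hv; have [] := ex_RInt_ctsR (h v) a b (Cc _ Hv).
  - move=> v t Hv; apply: (continuous_comp (fun p : C => h' (Re p) (Im p)) (fun z : C => fst z)).
      exact: C'.
    exact: continuous_fst.
apply: (K Im (fun u t => Im (h u t)) (fun u t => Im (h' u t))).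
- by move=> v t Hv; have [] := D v t Hv.
- by move=> v Hv; have [] := ex_RInt_ctsR (h v) a b (Cc _ Hv).
- move=> v t Hv; apply: (continuous_comp (fun p : C => h' (Re p) (Im p)) (fun z : C => snd z)).
    exact: C'.
  exact: continuous_snd.
Qed.

Definition circ (f : C -> C) (rho t : R) : C := f (RtoC rho * expi t)%C.

Definition cf (f : C -> C) (rho n : R) : C := fourier (circ f rho) n.

Lemma Cmod_circ rho t : 0 <= rho -> Cmod (RtoC rho * expi t)%C = rho.
Proof. by move=> H; rewrite Cmod_mult Cmod_expi Cmod_R Rabs_pos_eq //; ring. Qed.

Lemma continuous_polar (p : C) : continuous (fun p : C => RtoC (Re p) * expi (Im p))%C p.
Proof.
apply: continuous_Cmult.
  by apply: (continuous_comp (fun p : C => fst p) RtoC); [exact: continuous_fst | exact: continuous_RtoC].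
apply: (continuous_comp (fun p : C => snd p) expi); first exact: continuous_snd.
exact: is_Dv_continuous (is_Dv_expi _).
Qed.

Lemma circ_periodic f rho : periodic (circ f rho).
Proof. by move=> t; rewrite /circ; have := periodic_expi 1 t; rewrite !Rmult_1_l => ->. Qed.

Section Annulus.
Variables (R0 R1 : R) (HR0 : 0 <= R0).

Lemma Ann_circ rho t : R0 < rho < R1 -> Ann R0 R1 (RtoC rho * expi t)%C.
Proof. by move=> H; rewrite /Ann Cmod_circ //; lra. Qed.

Lemma circ_ctsR (f : C -> C) rho : (forall w, Ann R0 R1 w -> continuous f w) ->
  R0 < rho < R1 -> ctsR (circ f rho).
Proof.
move=> Hf Hr x; apply: (continuous_comp (fun t => RtoC rho * expi t)%C f); last first.
  by apply: Hf; exact: Ann_circ.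
apply: (is_Dv_continuous _ _ (rho * (Ci * expi x))); apply/(is_Dv_Wd _ (RtoC x)).
have D : is_Wd (fun z => expi (Re z)) (RtoC x) (Ci * expi x / 2) (Ci * expi x / 2).
  by apply/(is_Dv_Wd expi); exact: is_Dv_expi.
by apply: (is_Wd_eq _ _ _ _ _ _ (is_Wd_scal rho _ _ _ _ D)); field.
Qed.

Variables (f fa fb : C -> C).
Hypothesis Df : forall w, Ann R0 R1 w -> is_Wd f w (fa w) (fb w).
Hypothesis Ca : forall w, Ann R0 R1 w -> continuous fa w.
Hypothesis Cb : forall w, Ann R0 R1 w -> continuous fb w.

Lemma is_Dv_circ_angle rho t : R0 < rho < R1 ->
  is_Dv (circ f rho) t (Ci * circ (fun w => w * fa w)%C rho t - Ci * circ (fun w => Cconj w * fb w)%C rho t)%C.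
Proof.
move=> Hr.
have D : is_Dv (fun t => RtoC rho * expi t)%C t (rho * (Ci * expi t)).
  apply/(is_Dv_Wd _ (RtoC t)).
  have D : is_Wd (fun z => expi (Re z)) (RtoC t) (Ci * expi t / 2) (Ci * expi t / 2).
    by apply/(is_Dv_Wd expi); exact: is_Dv_expi.
  by apply: (is_Wd_eq _ _ _ _ _ _ (is_Wd_scal rho _ _ _ _ D)); field.
have := is_Dv_comp f _ _ _ _ _ D (Df _ (Ann_circ _ t Hr)).
rewrite /circ !Cmult_conj Cconj_R Cconj_Ci => K.
match type of K with is_Dv _ _ ?a => match goal with |- is_Dv _ _ ?b => have <- : a = b; [ring | exact: K] end end.
Qed.

Lemma is_Dv_circ_radius rho t : R0 < rho < R1 ->
  is_Dv (fun u => circ f u t) rho (expi t * circ fa rho t + expi (- t) * circ fb rho t)%C.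
Proof.
move=> Hr.
have D : is_Dv (fun u => RtoC u * expi t)%C rho (expi t).
  apply/(is_Dv_Wd (fun u => RtoC u * expi t)%C (RtoC rho)).
  apply: (is_Wd_ext (fun z => (/2 * expi t) * (z + Cconj z))%C).
    by move=> z; rewrite re_alt; field.
  apply: (is_Wd_eq _ _ _ _ _ _ (is_Wd_scal (/2 * expi t)%C _ _ _ _ (is_Wd_plus _ _ _ _ _ _ _ (is_Wd_id (RtoC rho)) (is_Wd_conj_id (RtoC rho))))); field.
have := is_Dv_comp f _ _ _ _ _ D (Df _ (Ann_circ _ t Hr)).
rewrite Cconj_expi => K.
match type of K with is_Dv _ _ ?a => match goal with |- is_Dv _ _ ?b => have <- : a = b; [rewrite /circ; ring | exact: K] end end.
Qed.

Lemma continuous_mult_id (g : C -> C) (w : C) : continuous g w -> continuous (fun w => w * g w)%C w.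
Proof. by move=> H; apply: (continuous_Cmult (fun w => w) g) => //; exact: continuous_id. Qed.

Lemma continuous_mult_conj (g : C -> C) (w : C) : continuous g w -> continuous (fun w => Cconj w * g w)%C w.
Proof.
move=> H; apply: (continuous_Cmult Cconj g) => //.
exact: is_Wd_continuous (is_Wd_conj_id _).
Qed.

(** Integration by parts in the angle: the angular derivative of $f$ is $i(wf_w-\bar wf_{\bar w})$,
    and the derivative of the periodic function $fe^{-int}$ has mean zero. *)
Lemma cf_angle rho (n : Z) : R0 < rho < R1 ->
  cf (fun w => w * fa w)%C rho (IZR n) =
  (cf (fun w => Cconj w * fb w)%C rho (IZR n) + IZR n * cf f rho (IZR n))%C.
Proof.
move=> Hr.
have C1 : ctsR (circ (fun w => w * fa w)%C rho).
  by apply: circ_ctsR => // w /Ca; exact: continuous_mult_id.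
have C2 : ctsR (circ (fun w => Cconj w * fb w)%C rho).
  by apply: circ_ctsR => // w /Cb; exact: continuous_mult_conj.
have C0 : ctsR (circ f rho).
  by apply: circ_ctsR => // w /Df /is_Wd_continuous.
set A := circ _ rho in C1; set B := circ _ rho in C2; set F := circ f rho in C0.
have D : forall t, is_Dv (fun t => F t * expi (- IZR n * t))%C t
   ((Ci * A t + - Ci * B t + (- IZR n * Ci)%C * F t) * expi (- IZR n * t))%C.
  move=> t; apply/(is_Dv_Wd _ (RtoC t)).
  have D1 := is_Dv_circ_angle rho t Hr; move/(is_Dv_Wd _ (RtoC t)) in D1.
  have D2 : is_Dv (fun t => expi (- IZR n * t)) t ((- IZR n)%R * (Ci * expi (- IZR n * t))).
    by apply: (is_Dv_comp_R expi); [auto_derive => //; ring | exact: is_Dv_expi].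
  move/(is_Dv_Wd _ (RtoC t)) in D2.
  have D3 := is_Wd_mult _ _ _ _ _ _ _ D1 D2.
  by apply: (is_Wd_eq _ _ _ _ _ _ D3); rewrite RtoC_opp /F /A /B /=; field.
have Ct : ctsR (fun t => Ci * A t + - Ci * B t + (- IZR n * Ci)%C * F t)%C.
  by repeat (apply: ctsR_plus || apply: ctsR_mult) => //; exact: ctsR_const.
have K := RIC_derive _ _ 0 (2 * PI) D (ctsR_fourier _ (IZR n) Ct).
have Pr : periodic (fun t => F t * expi (- IZR n * t))%C.
  by apply: periodic_mult; [exact: circ_periodic | rewrite -opp_IZR; exact: periodic_expi].
have E0 : fourier (fun t => Ci * A t + - Ci * B t + (- IZR n * Ci)%C * F t)%C (IZR n) = RtoC 0.
  rewrite /fourier K; have := Pr 0; rewrite Rplus_0_l => ->.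
  by rewrite /Cdiv; ring.
have Cs c G : ctsR G -> ctsR (fun t => c * G t)%C.
  by move=> HG; apply: ctsR_mult => //; exact: ctsR_const.
rewrite fourier_plus in E0; [|by apply: ctsR_plus; exact: Cs | exact: Cs].
rewrite fourier_plus ?fourier_scal in E0; try exact: Cs; try done.
rewrite /cf -/A -/B -/F.
have Hi : Ci <> RtoC 0 by move=> []; lra.
apply: Cminus_eq.
transitivity (/ Ci * (Ci * fourier A (IZR n) + - Ci * fourier B (IZR n) + - IZR n * Ci * fourier F (IZR n)))%C.
  by field.
by rewrite E0; ring.
Qed.

(** Here $\rho\,\partial_\rho f=wf_w+\bar wf_{\bar w}$, and [cf_angle] eliminates $wf_w$. The radial
    equation then involves only $f_{\bar w}$, which [disk_harm] prescribes. *)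
Lemma cf_radius rho (n : Z) : R0 < rho < R1 ->
  is_Dv (fun u => cf f u (IZR n)) rho
    ((IZR n * cf f rho (IZR n) + 2 * cf (fun w => Cconj w * fb w)%C rho (IZR n)) / rho)%C.
Proof.
move=> Hr.
have Hrho : RtoC rho <> RtoC 0 by move=> []; lra.
have C1 : ctsR (circ (fun w => w * fa w)%C rho).
  by apply: circ_ctsR => // w /Ca; exact: continuous_mult_id.
have C2 : ctsR (circ (fun w => Cconj w * fb w)%C rho).
  by apply: circ_ctsR => // w /Cb; exact: continuous_mult_conj.
set h' := fun u t => ((expi t * circ fa u t + expi (- t) * circ fb u t) * expi (- IZR n * t))%C.
have K := RIC_derive_param (fun u t => circ f u t * expi (- IZR n * t))%C h' R0 R1 0 (2 * PI) _ _ _ rho Hr.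
have Dm : forall g u l c, is_Dv g u l -> is_Dv (fun x => g x * c)%C u (l * c).
  move=> g u l c /(is_Dv_Wd _ (RtoC u)) H; apply/(is_Dv_Wd _ (RtoC u)).
  apply: (is_Wd_ext (fun z => c * g (Re z))%C); first by move=> z; ring.
  by apply: (is_Wd_eq _ _ _ _ _ _ (is_Wd_scal c _ _ _ _ H)); field.
have {}K : is_Dv (fun u => RIC (fun t => circ f u t * expi (- IZR n * t))%C 0 (2 * PI)) rho (RIC (h' rho) 0 (2 * PI)).
  apply: K.
  - by move=> u t Hu; apply: Dm; exact: is_Dv_circ_radius.
  - move=> u Hu; apply: ctsR_fourier; apply: circ_ctsR => // w /Df; exact: is_Wd_continuous.
  - move=> u t Hu.
    have Ce : forall k, continuous (fun p : C => expi (k * Im p)) (u, t).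
      move=> k; apply: (continuous_comp (fun p : C => snd p) (fun x => expi (k * x))).
        exact: continuous_snd.
      exact: ctsR_expi.
    have Cc : forall g, (forall w, Ann R0 R1 w -> continuous g w) ->
       continuous (fun p : C => circ g (Re p) (Im p)) (u, t).
      move=> g Hg; apply: (continuous_comp (fun p : C => RtoC (Re p) * expi (Im p))%C g).
        exact: continuous_polar.
      by apply: Hg; exact: Ann_circ.
    rewrite /h'; apply: continuous_Cmult; last exact: Ce.
    apply: (continuous_plus (fun p : C => expi (Im p) * circ fa (Re p) (Im p))%C (fun p : C => expi (- Im p) * circ fb (Re p) (Im p))%C); apply: continuous_Cmult.
    + by apply: (continuous_ext _ _ _ _ (Ce 1)) => p; rewrite Rmult_1_l.
    + exact: Cc.
    + apply: (continuous_ext _ _ _ _ (Ce (-1))) => p; congr expi; ring.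
    + exact: Cc.
have {K} := Dm _ _ _ (/ (2 * PI))%C K => K.
suff -> : ((IZR n * cf f rho (IZR n) + 2 * cf (fun w => Cconj w * fb w)%C rho (IZR n)) / rho)%C =
   (RIC (h' rho) 0 (2 * PI) * / (2 * PI))%C by exact: K.
rewrite (RIC_ext (h' rho) (fun t => / rho * (circ (fun w => w * fa w)%C rho t + circ (fun w => Cconj w * fb w)%C rho t) * expi (- IZR n * t))%C); last first.
  by move=> t; rewrite /h' /circ Cmult_conj Cconj_R Cconj_expi; field.
have -> : (RIC (fun t => / rho * (circ (fun w => w * fa w)%C rho t + circ (fun w => Cconj w * fb w)%C rho t) * expi (- IZR n * t))%C 0 (2 * PI) * / (2 * PI))%C
  = fourier (fun t => / rho * (circ (fun w => w * fa w)%C rho t + circ (fun w => Cconj w * fb w)%C rho t))%C (IZR n).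
  by [].
rewrite fourier_scal; last exact: ctsR_plus.
rewrite fourier_plus // -/(cf (fun w => w * fa w)%C rho _) cf_angle // -/(cf (fun w => Cconj w * fb w)%C rho _).
by field.
Qed.

Lemma cf_dirichlet rho t eps : R0 < rho < R1 -> 0 < eps ->
  exists N0, forall N, (N0 <= N)%nat ->
    Cmod (symsum (fun n => cf f rho n * expi (n * t)%R)%C N - circ f rho t)%C <= eps.
Proof.
move=> Hr Heps; apply: (dirichlet (circ f rho) t _ _ _ (is_Dv_circ_angle rho t Hr)) => //.
  by apply: circ_ctsR => // w /Df; exact: is_Wd_continuous.
exact: circ_periodic.
Qed.

End Annulus.

Lemma fourier_bounded f : ctsR f -> exists M, forall n, Cmod (fourier f n) <= M.
Proof.
move=> Hc; have HP := PI_RGT_0.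
have Cm : forall x, 0 <= x <= 2 * PI -> continuity_pt (fun t => Cmod (f t)) x.
  move=> x _; apply/continuity_pt_filterlim.
  apply: (filterlim_comp _ _ _ f Cmod _ (locally (f x))); first exact: Hc.
  exact: (filterlim_norm (K := C_AbsRing) (V := C_NormedModule)).
have [m [Hm _]] := continuity_ab_maj _ 0 (2 * PI) ltac:(lra) Cm.
exists (2 * Cmod (f m)) => n.
rewrite /fourier Cmod_div; last exact: PI2_neq_0.
rewrite -RtoC_mult Cmod_R Rabs_pos_eq; last lra.
apply/Rle_div_l; first lra.
have -> : 2 * Cmod (f m) * (2 * PI) = 2 * ((2 * PI - 0) * Cmod (f m)) by ring.
apply: Cmod_RIC_le; [lra | exact: ctsR_fourier | move=> t Ht].
by rewrite Cmod_mult Cmod_expi Rmult_1_r; exact: Hm.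
Qed.

Lemma cf_conj_mult g rho n : ctsR (circ g rho) ->
  cf (fun w => Cconj w * g w)%C rho n = (rho * cf g rho (n + 1)%R)%C.
Proof.
move=> Hg; have -> : n + 1 = n - (- 1) by ring.
rewrite /cf -fourier_expi_mult -fourier_scal; last by apply: ctsR_mult => //; exact: ctsR_expi.
apply: fourier_ext => t; rewrite /circ Cmult_conj Cconj_R Cconj_expi.
rewrite (_ : -1 * t = - t); ring.
Qed.

Lemma cf_id_mult g rho n : ctsR (circ g rho) ->
  cf (fun w => w * g w)%C rho n = (rho * cf g rho (n - 1)%R)%C.
Proof.
move=> Hg; rewrite /cf -fourier_expi_mult -fourier_scal; last by apply: ctsR_mult => //; exact: ctsR_expi.
by apply: fourier_ext => t; rewrite /circ Rmult_1_l; ring.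
Qed.

(** * Absolutely convergent series of complex numbers *)

Definition CSer (u : nat -> C) : C :=
  (Series (fun n => Re (u n)), Series (fun n => Im (u n))).

Definition asum (u : nat -> C) : Prop := ex_series (fun n => Cmod (u n)).

Lemma Series_sum_n_cvg (v : nat -> R) : ex_series v -> forall eps, 0 < eps ->
  exists N0, forall N, (N0 <= N)%nat -> Rabs (sum_n v N - Series v) < eps.
Proof.
move=> /Series_correct H eps Heps.
have L : is_lim_seq (sum_n v) (Series v) by exact: H.
by move/is_lim_seq_spec: L => /(_ (mkposreal _ Heps)) [N HN]; exists N.
Qed.

Lemma sum_n_le_Series (v : nat -> R) N : (forall n, 0 <= v n) -> ex_series v -> sum_n v N <= Series v.
Proof.
move=> Hp /Series_correct H.
apply: (is_lim_seq_incr_compare (sum_n v) (Series v)) => // n.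
by rewrite sum_Sn /plus /=; move: (Hp (S n)); lra.
Qed.

Lemma ex_series_bounded (v : nat -> R) M : (forall n, 0 <= v n) -> (forall N, sum_n v N <= M) -> ex_series v.
Proof.
move=> Hp HM.
have [l Hl] : ex_finite_lim_seq (sum_n v).
  apply: (ex_finite_lim_seq_incr _ M) => // n.
  by rewrite sum_Sn /plus /=; move: (Hp (S n)); lra.
by exists l.
Qed.

Lemma Series_le_bound (v : nat -> R) M : ex_series v -> (forall N, sum_n v N <= M) -> Series v <= M.
Proof.
move=> He HM; apply: le_epsilon => eps Heps.
have [N0 HN] := Series_sum_n_cvg v He eps Heps.
by have := HN N0 (le_n _) => /Rabs_lt_between; move: (HM N0); lra.
Qed.

Lemma Series_ge_0 (v : nat -> R) : (forall n, 0 <= v n) -> ex_series v -> 0 <= Series v.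
Proof. by move=> Hp He; move: (sum_n_le_Series v 0 Hp He); rewrite sum_O; move: (Hp 0%nat); lra. Qed.

Lemma asum_le (u : nat -> C) (v : nat -> R) : (forall n, Cmod (u n) <= v n) -> ex_series v -> asum u.
Proof.
move=> H; apply: (ex_series_le (K := R_AbsRing) (V := R_CompleteNormedModule)) => n.
by rewrite /norm /= /abs /= Rabs_pos_eq; [exact: H | exact: Cmod_ge_0].
Qed.

Lemma asum_ReIm u : asum u -> ex_series (fun n => Re (u n)) /\ ex_series (fun n => Im (u n)).
Proof.
move=> H; split; apply: (ex_series_le (K := R_AbsRing) (V := R_CompleteNormedModule) _ (fun n => Cmod (u n))) => // n;
  rewrite /norm /= /abs /=; [exact: re_le_Cmod | exact: im_le_Cmod].
Qed.

Lemma sum_n_ReIm (u : nat -> C) N :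
  sum_n u N = (sum_n (fun n => Re (u n)) N, sum_n (fun n => Im (u n)) N) :> C.
Proof.
elim: N => [|N IH]; first by rewrite !sum_O; case: (u 0%nat).
by rewrite !sum_Sn IH.
Qed.

Lemma CSer_cvg u : asum u -> forall eps, 0 < eps ->
  exists N0, forall N, (N0 <= N)%nat -> Cmod (sum_n u N - CSer u)%C <= eps.
Proof.
move=> /asum_ReIm [H1 H2] eps Heps.
have [N1 K1] := Series_sum_n_cvg _ H1 (eps / 2) ltac:(lra).
have [N2 K2] := Series_sum_n_cvg _ H2 (eps / 2) ltac:(lra).
exists (N1 + N2)%nat => N HN.
apply: (Rle_trans _ _ _ (Cmod_le_ReIm _)); rewrite sum_n_ReIm /CSer /=.
have := K1 N ltac:(lia); have := K2 N ltac:(lia); rewrite /Rminus; lra.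
Qed.

Lemma CSer_unique u l : asum u ->
  (forall eps, 0 < eps -> exists N0, forall N, (N0 <= N)%nat -> Cmod (sum_n u N - l)%C <= eps) ->
  CSer u = l.
Proof.
move=> Ha H; apply: Cminus_eq; apply: Cmod_eq_0; apply: Rle_antisym; last exact: Cmod_ge_0.
apply: le_epsilon => eps Heps; rewrite Rplus_0_l.
have [N1 K1] := CSer_cvg _ Ha (eps / 2) ltac:(lra).
have [N2 K2] := H (eps / 2) ltac:(lra).
have := K1 (N1 + N2)%nat ltac:(lia); have := K2 (N1 + N2)%nat ltac:(lia).
set S := sum_n u _ => B2 B1.
have -> : (CSer u - l = (S - l) + - (S - CSer u))%C by ring.
apply: (Rle_trans _ _ _ (Cmod_triangle _ _)); rewrite Cmod_opp; lra.
Qed.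

Lemma CSer_ext u v : (forall n, u n = v n) -> CSer u = CSer v.
Proof. by move=> E; rewrite /CSer; f_equal; apply: Series_ext => n; rewrite E. Qed.

Lemma CSer_plus u v : asum u -> asum v -> CSer (fun n => u n + v n)%C = (CSer u + CSer v)%C.
Proof.
move=> /asum_ReIm [H1 H2] /asum_ReIm [H3 H4]; apply: C_ext; rewrite /CSer /=.
  exact: (Series_plus (fun n => Re (u n)) (fun n => Re (v n))).
exact: (Series_plus (fun n => Im (u n)) (fun n => Im (v n))).
Qed.

Lemma CSer_scal c u : asum u -> CSer (fun n => c * u n)%C = (c * CSer u)%C.
Proof.
move=> /asum_ReIm [H1 H2].
have S1 k := ex_series_scal_l k _ H1; have S2 k := ex_series_scal_l k _ H2.
apply: C_ext; rewrite /CSer.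
  rewrite [Re _]/=.
  rewrite (Series_ext _ (fun n => Re c * Re (u n) - Im c * Im (u n))); last by [].
  by rewrite Series_minus ?Series_scal_l //.
rewrite [Im _]/=.
rewrite (Series_ext _ (fun n => Re c * Im (u n) + Im c * Re (u n))); last by [].
by rewrite Series_plus ?Series_scal_l //.
Qed.

Lemma asum_plus u v : asum u -> asum v -> asum (fun n => u n + v n)%C.
Proof.
move=> H1 H2; apply: (asum_le _ (fun n => Cmod (u n) + Cmod (v n))).
  by move=> n; exact: Cmod_triangle.
exact: (ex_series_plus (fun n => Cmod (u n)) (fun n => Cmod (v n))).
Qed.

Lemma asum_scal c u : asum u -> asum (fun n => c * u n)%C.
Proof.
move=> H; apply: (asum_le _ (fun n => Cmod c * Cmod (u n))).
  by move=> n; rewrite Cmod_mult; lra.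
exact: (ex_series_scal_l (Cmod c) (fun n => Cmod (u n))).
Qed.

Lemma asum_ext u v : (forall n, u n = v n) -> asum u -> asum v.
Proof. by move=> E; apply: ex_series_ext => n; rewrite E. Qed.

Lemma CSer_minus u v : asum u -> asum v -> CSer (fun n => u n - v n)%C = (CSer u - CSer v)%C.
Proof.
move=> H1 H2; rewrite (CSer_ext _ (fun n => u n + -1 * v n)%C); last by move=> n; ring.
by rewrite CSer_plus ?CSer_scal //; [ring | exact: asum_scal].
Qed.

Lemma CSer_tail (u : nat -> C) (v : nat -> R) N : (forall n, Cmod (u n) <= v n) -> ex_series v ->
  Cmod (CSer u - sum_n u N)%C <= Series v - sum_n v N.
Proof.
move=> H Hv; have Ha := asum_le _ _ H Hv.
have Hp n : 0 <= v n by move: (H n) (Cmod_ge_0 (u n)); lra.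
apply: le_epsilon => eps Heps.
have [N0 K] := CSer_cvg _ Ha eps Heps.
have B : forall k, Cmod (sum_n u (N + k) - sum_n u N)%C <= sum_n v (N + k) - sum_n v N.
  elim=> [|k IH].
    by rewrite Nat.add_0_r Rminus_diag /Cminus Cplus_opp_r Cmod_0; lra.
  rewrite Nat.add_succ_r !sum_Sn /plus /=.
  have -> : (sum_n u (N + k) + u (S (N + k)) - sum_n u N = (sum_n u (N + k) - sum_n u N) + u (S (N + k)))%C by ring.
  apply: (Rle_trans _ _ _ (Cmod_triangle _ _)); move: (H (S (N + k))); lra.
have -> : (CSer u - sum_n u N = - (sum_n u (N + N0) - CSer u) + (sum_n u (N + N0) - sum_n u N))%C by ring.
apply: (Rle_trans _ _ _ (Cmod_triangle _ _)); rewrite Cmod_opp.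
have := K (N + N0)%nat ltac:(lia); have := B N0.
have := sum_n_le_Series v (N + N0) Hp Hv; lra.
Qed.

Lemma Cmod_CSer_le (u : nat -> C) (v : nat -> R) : (forall n, Cmod (u n) <= v n) -> ex_series v ->
  Cmod (CSer u) <= Series v.
Proof.
move=> H Hv; have := CSer_tail u v 0 H Hv; rewrite !sum_O => B.
have -> : (CSer u = (CSer u - u 0%nat) + u 0%nat)%C by ring.
apply: (Rle_trans _ _ _ (Cmod_triangle _ _)); move: (H 0%nat); lra.
Qed.

Lemma CSer_sum_n (u : nat -> nat -> C) N : (forall i, asum (u i)) ->
  asum (fun j => sum_n (fun i => u i j) N) /\
  CSer (fun j => sum_n (fun i => u i j) N) = sum_n (fun i => CSer (u i)) N.
Proof.
move=> H; elim: N => [|N [IH1 IH2]].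
  split; first by apply: (asum_ext (u 0%nat)) => // n; rewrite sum_O.
  by rewrite sum_O; apply: CSer_ext => n; rewrite sum_O.
split.
  apply: (asum_ext (fun j => sum_n (fun i => u i j) N + u (S N) j)%C); last exact: asum_plus.
  by move=> n; rewrite sum_Sn.
rewrite (CSer_ext _ (fun j => sum_n (fun i => u i j) N + u (S N) j)%C); last first.
  by move=> n; rewrite sum_Sn.
by rewrite CSer_plus // IH2 sum_Sn.
Qed.

(** With a product majorant, the tail of column [j] is at most [B j] times the tail of [A]; summing
    over [j] leaves [Series B] times that tail, which tends to zero. *)
Lemma CSer_Fubini (u : nat -> nat -> C) (A B : nat -> R) :
  (forall i j, Cmod (u i j) <= A i * B j) -> (forall i, 0 <= A i) -> (forall j, 0 <= B j) ->
  ex_series A -> ex_series B ->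
  CSer (fun i => CSer (u i)) = CSer (fun j => CSer (fun i => u i j)).
Proof.
move=> H HA HB SA SB.
have S1 i : asum (u i).
  apply: (asum_le _ (fun j => A i * B j)) => //; exact: (ex_series_scal_l (A i) B).
have B1 i : Cmod (CSer (u i)) <= A i * Series B.
  rewrite -Series_scal_l; apply: Cmod_CSer_le => //; exact: (ex_series_scal_l (A i) B).
have SAB : ex_series (fun i => A i * Series B) by exact: (ex_series_scal_r (Series B) A).
have T j N : Cmod (CSer (fun i => u i j) - sum_n (fun i => u i j) N)%C <= B j * (Series A - sum_n A N).
  have := CSer_tail (fun i => u i j) (fun i => B j * A i) N.
  rewrite Series_scal_l (_ : sum_n (fun i => B j * A i) N = B j * sum_n A N); last first.
    by elim: N => [|N IH]; rewrite ?sum_O // !sum_Sn IH /plus /=; ring.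
  rewrite -Rmult_minus_distr_l; apply; last exact: (ex_series_scal_l (B j) A).
  by move=> i; rewrite Rmult_comm.
have S2 : asum (fun j => CSer (fun i => u i j)).
  apply: (asum_le _ (fun j => B j * Series A)); last exact: (ex_series_scal_r (Series A) B).
  move=> j; rewrite -Series_scal_l; apply: Cmod_CSer_le; last exact: (ex_series_scal_l (B j) A).
  by move=> i; rewrite Rmult_comm.
apply: CSer_unique; first by apply: asum_le SAB.
move=> eps Heps.
have SB0 := Series_ge_0 B HB SB.
have [N0 K] := Series_sum_n_cvg A SA (eps / (Series B + 1)) ltac:(apply: Rdiv_lt_0_compat; lra).
exists N0 => N HN; have [Sn <-] := CSer_sum_n u N S1.
have -> : (CSer (fun j => sum_n (fun i => u i j) N) - CSer (fun j => CSer (fun i => u i j)) =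
  - CSer (fun j => CSer (fun i => u i j) - sum_n (fun i => u i j) N))%C by rewrite CSer_minus //; ring.
have D := K N HN; move: D => /Rabs_lt_between D.
have HAN := sum_n_le_Series A N HA SA.
rewrite Cmod_opp; apply: (Rle_trans _ (Series (fun j => B j * (Series A - sum_n A N)))).
  apply: Cmod_CSer_le; last exact: (ex_series_scal_r (Series A - sum_n A N) B).
  by move=> j; exact: T.
rewrite Series_scal_r.
have : Series A - sum_n A N <= eps / (Series B + 1) by lra.
move=> D2; have : Series B * (Series A - sum_n A N) <= Series B * (eps / (Series B + 1)) by apply: Rmult_le_compat_l.
have : Series B * (eps / (Series B + 1)) <= eps.
  have -> : Series B * (eps / (Series B + 1)) = eps - eps / (Series B + 1) by field; lra.
  have : 0 < eps / (Series B + 1) by apply: Rdiv_lt_0_compat; lra.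
  lra.
lra.
Qed.

Lemma ex_series_geom' M q : 0 <= q < 1 -> ex_series (fun n => M * q ^ n).
Proof.
move=> Hq; apply: (ex_series_scal_l M (fun n => q ^ n)); apply: ex_series_geom.
by rewrite Rabs_pos_eq; lra.
Qed.

Lemma asum_geom (u : nat -> C) M q : 0 <= q < 1 -> (forall n, Cmod (u n) <= M * q ^ n) -> asum u.
Proof. by move=> Hq H; apply: asum_le H (ex_series_geom' M q Hq). Qed.

Lemma Series_geom' M q : 0 <= q < 1 -> Series (fun n => M * q ^ n) = M / (1 - q).
Proof. by move=> Hq; rewrite Series_scal_l Series_geom // Rabs_pos_eq; lra. Qed.

(** * Double power series *)

Definition DS (u : nat -> nat -> C) : C := CSer (fun j => CSer (u j)).

(** A geometric majorant in [j + k] gives summability of every row and of the sequence of row sums,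
    with explicit constants, and is stable under sums and scalars. *)
Definition geo (u : nat -> nat -> C) (M q : R) : Prop :=
  0 <= q < 1 /\ forall j k, Cmod (u j k) <= M * q ^ (j + k).

Lemma geo_row u M q j : geo u M q -> asum (u j) /\ Cmod (CSer (u j)) <= M / (1 - q) * q ^ j.
Proof.
move=> [Hq H].
have B k : Cmod (u j k) <= M * q ^ j * q ^ k by rewrite Rmult_assoc -pow_add.
split; first exact: (asum_geom _ (M * q ^ j) q).
have -> : M / (1 - q) * q ^ j = M * q ^ j / (1 - q) by field; lra.
rewrite -Series_geom' //; apply: Cmod_CSer_le => //; exact: ex_series_geom'.
Qed.

Lemma geo_asum u M q : geo u M q -> asum (fun j => CSer (u j)).
Proof.
move=> H; apply: (asum_geom _ (M / (1 - q)) q); first by case: H.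
by move=> j; have [] := geo_row u M q j H.
Qed.

Lemma geo_le u M q : geo u M q -> Cmod (DS u) <= M / (1 - q) / (1 - q).
Proof.
move=> H; have [Hq _] := H; rewrite -Series_geom' //.
apply: Cmod_CSer_le; last exact: ex_series_geom'.
by move=> j; have [] := geo_row u M q j H.
Qed.

Lemma DS_plus u v M q M' q' : geo u M q -> geo v M' q' ->
  DS (fun j k => u j k + v j k)%C = (DS u + DS v)%C.
Proof.
move=> H1 H2; rewrite /DS -(CSer_plus _ _ (geo_asum _ _ _ H1) (geo_asum _ _ _ H2)).
apply: CSer_ext => j; apply: CSer_plus.
  by have [] := geo_row u M q j H1.
by have [] := geo_row v M' q' j H2.
Qed.

Lemma DS_scal c u M q : geo u M q -> DS (fun j k => c * u j k)%C = (c * DS u)%C.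
Proof.
move=> H; rewrite /DS -(CSer_scal _ _ (geo_asum _ _ _ H)).
by apply: CSer_ext => j; apply: CSer_scal; have [] := geo_row u M q j H.
Qed.

Lemma DS_ext u v : (forall j k, u j k = v j k) -> DS u = DS v.
Proof. by move=> E; apply: CSer_ext => j; apply: CSer_ext => k; exact: E. Qed.

Lemma geo_scal c u M q : geo u M q -> geo (fun j k => c * u j k)%C (Cmod c * M) q.
Proof.
move=> [Hq H]; split=> // j k; rewrite Cmod_mult Rmult_assoc.
by apply: Rmult_le_compat_l => //; exact: Cmod_ge_0.
Qed.

Lemma geo_weaken u M q M' q' : geo u M q -> M <= M' -> q <= q' -> q' < 1 -> 0 <= M' -> geo u M' q'.
Proof.
move=> [Hq H] HM Hqq Hq' HM'; split; first lra.
move=> j k; apply: (Rle_trans _ _ _ (H j k)).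
have : q ^ (j + k) <= q' ^ (j + k) by apply: pow_incr; lra.
have := pow_le q (j + k) ltac:(lra).
move=> p1 p2; apply: (Rle_trans _ (M' * q ^ (j + k))); first exact: Rmult_le_compat_r.
exact: Rmult_le_compat_l.
Qed.

Lemma geo_plus u v M q M' q' : geo u M q -> geo v M' q' ->
  geo (fun j k => u j k + v j k)%C (Rabs M + Rabs M') (Rmax q q').
Proof.
move=> H1 H2; have [Hq _] := H1; have [Hq' _] := H2.
have L : Rmax q q' < 1 by apply: Rmax_lub_lt; lra.
have [L1 K1] := geo_weaken _ _ _ (Rabs M) _ H1 (Rle_abs M) (Rmax_l q q') L (Rabs_pos M).
have [_ K2] := geo_weaken _ _ _ (Rabs M') _ H2 (Rle_abs M') (Rmax_r q q') L (Rabs_pos M').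
split=> // j k; apply: (Rle_trans _ _ _ (Cmod_triangle _ _)).
by rewrite Rmult_plus_distr_r; apply: Rplus_le_compat.
Qed.

(** By Bernoulli $(n+1)a\le(1+a)^n$, so two powers of $1+a$ absorb the polynomial factor;
    [a = (1 - x) / 4] is small enough for $(1+a)^2x<1$. *)
Lemma poly_geom x : 0 <= x < 1 -> exists K q, 0 <= q < 1 /\ 0 <= K /\
  forall n, (INR n + 1) ^ 2 * x ^ n <= K * q ^ n.
Proof.
move=> Hx; set a := (1 - x) / 4; set z := 1 + a.
have Ha : 0 < a <= 1 / 4 by rewrite /a; lra.
have Hq : 0 <= z * z * x < 1.
  split; first by apply: Rmult_le_pos; [rewrite /z; nra | lra].
  have E : z * z * x = x + (2 * a + a * a) * x by rewrite /z; ring.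
  have : (2 * a + a * a) * x <= 3 * a by nra.
  rewrite /a in E Ha *; lra.
exists (/ a ^ 2), (z * z * x); split=> //; split.
  by apply: Rlt_le; apply: Rinv_0_lt_compat; apply: pow_lt; lra.
move=> n.
have B : (INR n + 1) * a <= z ^ n.
  have := poly n a ltac:(lra); rewrite -/z; lra.
have -> : / a ^ 2 * (z * z * x) ^ n = (z ^ n / a) ^ 2 * x ^ n.
  by rewrite (Rpow_mult_distr (z * z) x) (Rpow_mult_distr z z); field; lra.
apply: Rmult_le_compat_r; first by apply: pow_le; lra.
apply: pow_incr; split; first by move: (pos_INR n); lra.
by apply/Rle_div_r; lra.
Qed.

Definition DSf (g : nat -> nat -> C) (P Q : C) : C := DS (fun j k => g j k * (P ^ j * Q ^ k))%C.

(* Cauchy estimates on the polydisk of radius [R0], hence absolute convergence there. *)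
Definition PD (g : nat -> nat -> C) (R0 : R) : Prop :=
  forall r, 0 <= r < R0 -> exists M, forall j k, Cmod (g j k) * r ^ (j + k) <= M.

Definition gP (g : nat -> nat -> C) (j k : nat) : C := (INR (S j) * g (S j) k)%C.
Definition gQ (g : nat -> nat -> C) (j k : nat) : C := (INR (S k) * g j (S k))%C.

Lemma PD_between r R0 : 0 <= r < R0 -> 0 < (r + R0) / 2 < R0 /\ 0 <= r / ((r + R0) / 2) < 1.
Proof.
move=> H; split; first lra.
split; first by apply: Rdiv_le_0_compat; lra.
by apply/Rlt_div_l; lra.
Qed.

Lemma PD_gPQ g R0 : PD g R0 -> PD (gP g) R0 /\ PD (gQ g) R0.
Proof.
move=> H.
(* The index [l] stands for either [j] or [k], so both derivatives share one estimate. The factor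
   [l + 1] is absorbed by passing from the radius [r] to the larger [r']. *)
suff K : forall r, 0 <= r < R0 -> exists M, forall j k l, (l <= j + k)%nat ->
   Cmod (INR (S l) * g (S j) k)%C * r ^ (j + k) <= M /\ Cmod (INR (S l) * g j (S k))%C * r ^ (j + k) <= M.
  split=> r /K [M HM]; exists M => j k.
    by have [] := HM j k j ltac:(lia).
  by have [] := HM j k k ltac:(lia).
move=> r Hr; have [Hr' Hx] := PD_between _ _ Hr.
set r' := (r + R0) / 2 in Hr' Hx.
have [M HM] := H r' ltac:(lra).
have [K [q [Hq [HK HB]]]] := poly_geom _ Hx.
have HM0 : 0 <= M.
  apply: Rle_trans (HM 0%nat 0%nat); rewrite Rmult_1_r; exact: Cmod_ge_0.
exists (K * (M / r')) => j k l Hl.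
have B c : c * r' ^ (S (j + k)) <= M -> 0 <= c -> INR (S l) * c * r ^ (j + k) <= K * (M / r').
  move=> Hc Hc0.
  have E : r ^ (j + k) = (r / r') ^ (j + k) * r' ^ (j + k).
    by rewrite -Rpow_mult_distr; congr pow; field; lra.
  have -> : INR (S l) * c * r ^ (j + k) = (INR (S l) * (r / r') ^ (j + k)) * (c * r' ^ (S (j + k)) / r').
    by rewrite E /=; field; lra.
  have P1 : 0 <= (r / r') ^ (j + k) by apply: pow_le; lra.
  apply: Rmult_le_compat.
  - by apply: Rmult_le_pos => //; exact: pos_INR.
  - apply: Rdiv_le_0_compat; last lra.
    by apply: Rmult_le_pos => //; apply: pow_le; lra.
  - apply: (Rle_trans _ ((INR (j + k) + 1) ^ 2 * (r / r') ^ (j + k))).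
      apply: Rmult_le_compat_r => //; rewrite S_INR.
      have : INR l <= INR (j + k) by apply: le_INR.
      have := pos_INR l; nra.
    apply: (Rle_trans _ _ _ (HB _)).
    have : q ^ (j + k) <= 1 by rewrite -(pow1 (j + k)); apply: pow_incr; lra.
    have := pow_le q (j + k) ltac:(lra); nra.
  - apply: Rmult_le_compat_r => //; apply: Rlt_le; apply: Rinv_0_lt_compat; lra.
rewrite !Cmod_mult !Cmod_R Rabs_pos_eq; last exact: pos_INR.
split; apply: B; try exact: Cmod_ge_0.
  exact: (HM (S j) k).
by have := HM j (S k); rewrite Nat.add_succ_r.
Qed.

Lemma PD_geo g R0 P Q rho : PD g R0 -> 0 <= rho < R0 -> Cmod P <= rho -> Cmod Q <= rho ->
  exists M q, geo (fun j k => g j k * (P ^ j * Q ^ k))%C M q.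
Proof.
move=> H Hr HP HQ; have [Hr' Hx] := PD_between _ _ Hr; set r' := (rho + R0) / 2 in Hr' Hx.
have [M HM] := H r' ltac:(lra).
exists M, (rho / r'); split=> // j k; rewrite !Cmod_mult !Cmod_pow.
have E : (rho / r') ^ (j + k) * r' ^ (j + k) = rho ^ j * rho ^ k.
  by rewrite -Rpow_mult_distr -pow_add; congr pow; field; lra.
have I : Cmod P ^ j * Cmod Q ^ k <= rho ^ j * rho ^ k.
  by apply: Rmult_le_compat; try (apply: pow_le; exact: Cmod_ge_0);
    apply: pow_incr; split=> //; exact: Cmod_ge_0.
apply: (Rle_trans _ (Cmod (g j k) * (rho ^ j * rho ^ k))).
  by apply: Rmult_le_compat_l => //; exact: Cmod_ge_0.
rewrite -E (_ : forall a b c, a * (b * c) = a * c * b); last by move=> a b c; ring.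
apply: Rmult_le_compat_r; first by apply: pow_le; lra.
exact: HM.
Qed.

Lemma CSer_S u : asum (fun n => u (S n)) -> asum u /\ CSer u = (u 0%nat + CSer (fun n => u (S n)))%C.
Proof.
move=> H.
have Ha : asum u by apply/(ex_series_incr_1 (fun n => Cmod (u n))).
split=> //; have [H1 H2] := asum_ReIm _ Ha.
by apply: C_ext; rewrite /CSer /=; [rewrite (Series_incr_1 _ H1) | rewrite (Series_incr_1 _ H2)].
Qed.

Section Monomial.
Variables (rho e : R) (Hrho : 0 <= rho) (He : 0 <= e).

(** [m], [m'] and [dm] are the old value, the new value and the differential of a monomial of degree
    [n]; [e] is the size of the increments relative to [rho]. The quadratic bound survives one more
    factor because $n+n^2\le(n+1)^2$. *)
Definition taylor1 (n : nat) (m m' dm : C) : Prop :=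
  Cmod m <= rho ^ n /\ Cmod dm <= INR n * rho ^ n * e /\
  Cmod (m' - m - dm)%C <= (INR n) ^ 2 * rho ^ n * e ^ 2.

Lemma taylor1_step n m m' dm (p p' : C) : taylor1 n m m' dm ->
  Cmod p <= rho -> Cmod p' <= rho -> Cmod (p' - p)%C <= rho * e ->
  taylor1 (S n) (p * m) (p' * m') ((p' - p) * m + p * dm).
Proof.
move=> [H1 [H2 H3]] K1 K2 K3.
have Pn := pow_le rho n Hrho; have Nn := pos_INR n.
have G := Cmod_ge_0.
split.
  by rewrite Cmod_mult /=; apply: Rmult_le_compat.
rewrite S_INR /= -/(pow rho n); split.
  apply: (Rle_trans _ _ _ (Cmod_triangle _ _)); rewrite !Cmod_mult.
  have : Cmod (p' - p)%C * Cmod m <= (rho * e) * rho ^ n by apply: Rmult_le_compat.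
  have : Cmod p * Cmod dm <= rho * (INR n * rho ^ n * e) by apply: Rmult_le_compat.
  lra.
have -> : (p' * m' - p * m - ((p' - p) * m + p * dm) = (p' - p) * dm + p' * (m' - m - dm))%C by ring.
apply: (Rle_trans _ _ _ (Cmod_triangle _ _)); rewrite !Cmod_mult.
have I1 : Cmod (p' - p)%C * Cmod dm <= (rho * e) * (INR n * rho ^ n * e) by apply: Rmult_le_compat.
have I2 : Cmod p' * Cmod (m' - m - dm)%C <= rho * (INR n ^ 2 * rho ^ n * e ^ 2) by apply: Rmult_le_compat.
have I3 : 0 <= rho * rho ^ n * e * e * (INR n + 1).
  by repeat apply: Rmult_le_pos => //; lra.
have : (INR n + 1) ^ 2 * (rho * rho ^ n) * e ^ 2 =
  (rho * e) * (INR n * rho ^ n * e) + rho * (INR n ^ 2 * rho ^ n * e ^ 2) + rho * rho ^ n * e * e * (INR n + 1) by ring.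
rewrite /= in I2 *; lra.
Qed.

Lemma taylor1_monomial (P P' Q Q' : C) j k : Cmod P <= rho -> Cmod P' <= rho ->
  Cmod Q <= rho -> Cmod Q' <= rho -> Cmod (P' - P)%C <= rho * e -> Cmod (Q' - Q)%C <= rho * e ->
  taylor1 (j + k) (P ^ j * Q ^ k) (P' ^ j * Q' ^ k)
   ((INR j * P ^ pred j * Q ^ k) * (P' - P) + (INR k * (P ^ j * Q ^ pred k)) * (Q' - Q)).
Proof.
move=> HP HP' HQ HQ' Hh Hk.
(* The factor [INR n] hides the value [pred 0 = 0], so the formula for the differential also holds
   for the exponent 0. *)
have X (x : C) n : (INR n * x ^ n = x * (INR n * x ^ pred n))%C.
  by case: n => [|n]; [rewrite /=; ring | simpl pred; rewrite Cpow_S; ring].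
have C0 : forall m m' dm n, taylor1 n m m' dm -> forall a b c, m = a -> m' = b -> dm = c -> taylor1 n a b c.
  by move=> m m' dm n H a b c <- <- <-.
elim: j => [|j IH].
  elim: k => [|k IH].
    rewrite /taylor1 /= !Cmult_0_l !Cmult_1_l !Rmult_0_l Cplus_0_l Cmod_1 Cmod_0.
    have -> : (1 - 1 - 0 = 0)%C by ring.
    by rewrite Cmod_0; lra.
  have H := taylor1_step _ _ _ _ _ _ IH HQ HQ' Hk.
  apply: C0 H _ _ _ _ _ _; rewrite ?(Cpow_S _ k); try ring.
  rewrite (S_INR k) RtoC_plus; simpl pred.
  transitivity ((Q' - Q) * (P ^ 0 * Q ^ k) + (Q * (INR k * Q ^ pred k)) * P ^ 0 * (Q' - Q))%C;
    first by rewrite /=; ring.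
  by rewrite -X /=; ring.
have H := taylor1_step _ _ _ _ _ _ IH HP HP' Hh.
apply: C0 H _ _ _ _ _ _; rewrite ?(Cpow_S _ j); try ring.
rewrite (S_INR j) RtoC_plus; simpl pred.
transitivity ((P' - P) * (P ^ j * Q ^ k) + (P * (INR j * P ^ pred j)) * Q ^ k * (P' - P)
  + INR k * (P * P ^ j * Q ^ pred k) * (Q' - Q))%C; first by ring.
by rewrite -X; ring.
Qed.

End Monomial.

Lemma geo_pos u M q : geo u M q -> 0 <= M.
Proof. by move=> [_ /(_ 0%nat 0%nat)]; rewrite /= Rmult_1_r; move: (Cmod_ge_0 (u 0%nat 0%nat)); lra. Qed.

Lemma geo_pos_ratio u M q : geo u M q -> exists q', 0 < q' /\ geo u M q'.
Proof.
move=> H; have [Hq _] := H; exists ((q + 1) / 2); split; first lra.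
by apply: (geo_weaken _ _ _ _ _ H); try lra; exact: geo_pos H.
Qed.

Lemma CSer_0 : CSer (fun _ => 0) = 0.
Proof.
apply: CSer_unique.
  by apply: (asum_geom _ 0 0); [lra | move=> n; rewrite Cmod_0; lra].
move=> eps Heps; exists 0%nat => N _.
have -> : sum_n (fun _ => RtoC 0) N = RtoC 0.
  by elim: N => [|N IH]; rewrite ?sum_O // sum_Sn IH /plus /=; ring.
by rewrite (_ : (0 - 0)%C = 0); [rewrite Cmod_0; lra | ring].
Qed.

(** Termwise differentiation is estimated with the original exponents, whereas [gP] has them lowered
    by one; this lemma and [DS_shiftQ] reconcile the two indexings. *)
Lemma DS_shiftP u M q : geo (fun j k => u (S j) k) M q -> (forall k, u 0%nat k = 0) ->
  (exists M' q', geo u M' q') /\ DS u = DS (fun j k => u (S j) k).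
Proof.
move=> H H0; have [q' [Hq' H']] := geo_pos_ratio _ _ _ H; have HM := geo_pos _ _ _ H'.
split.
  exists (M / q'), q'; have [Hq B] := H'; split=> // -[|j] k.
    rewrite H0 Cmod_0; apply: Rmult_le_pos; first by apply: Rdiv_le_0_compat.
    by apply: pow_le; lra.
  apply: (Rle_trans _ _ _ (B j k)); rewrite /=; apply: Req_le; field; lra.
rewrite /DS; have [_ ->] := CSer_S (fun j => CSer (u j)) (geo_asum _ _ _ H).
by rewrite (CSer_ext (u 0%nat) _ H0) CSer_0 Cplus_0_l.
Qed.

Lemma DS_shiftQ u M q : geo (fun j k => u j (S k)) M q -> (forall j, u j 0%nat = 0) ->
  (exists M' q', geo u M' q') /\ DS u = DS (fun j k => u j (S k)).
Proof.
move=> H H0; have [q' [Hq' H']] := geo_pos_ratio _ _ _ H; have HM := geo_pos _ _ _ H'.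
split.
  exists (M / q'), q'; have [Hq B] := H'; split=> // j [|k].
    rewrite H0 Cmod_0; apply: Rmult_le_pos; first by apply: Rdiv_le_0_compat.
    by apply: pow_le; lra.
  apply: (Rle_trans _ _ _ (B j k)); rewrite Nat.add_succ_r /=; apply: Req_le; field; lra.
apply: CSer_ext => j.
have [R _] := geo_row _ _ _ j H.
by have [_ ->] := CSer_S (u j) R; rewrite H0 Cplus_0_l.
Qed.

(** Termwise Taylor estimate: each monomial of degree $n$ contributes at most $n^2\rho^ne^2$, and
    the Cauchy bound at a larger radius together with [poly_geom] makes the sum geometric. *)
Lemma DSf_frechet g R0 P Q : PD g R0 -> Cmod P < R0 -> Cmod Q < R0 ->
  exists K d, 0 <= K /\ 0 < d /\ forall h k, Cmod h <= d -> Cmod k <= d ->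
    Cmod (DSf g (P + h) (Q + k) - DSf g P Q - DSf (gP g) P Q * h - DSf (gQ g) P Q * k)%C
      <= K * (Cmod h + Cmod k) ^ 2.
Proof.
move=> H HP HQ; have [HgP HgQ] := PD_gPQ _ _ H.
set r0 := Rmax (Cmod P) (Cmod Q).
have r1 : Cmod P <= r0 by exact: Rmax_l.
have r2 : Cmod Q <= r0 by exact: Rmax_r.
have r3 : r0 < R0 by apply: Rmax_lub_lt.
have r4 : 0 <= r0 by move: (Cmod_ge_0 P); lra.
(* The radii [r0 < rho < r'] below [R0] serve the base point, the perturbed point and the Cauchy
   estimate. *)
have [Hrho _] := PD_between r0 R0 ltac:(lra); set rho := (r0 + R0) / 2 in Hrho.
have [Hr' Hx] := PD_between rho R0 ltac:(lra); set r' := (rho + R0) / 2 in Hr' Hx.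
have [M HM] := H r' ltac:(lra).
have HM0 : 0 <= M by apply: Rle_trans (HM 0%nat 0%nat); rewrite Rmult_1_r; exact: Cmod_ge_0.
have [K [q [Hq [HK HB]]]] := poly_geom _ Hx.
have Hrr : r0 < rho by rewrite /rho; lra.
exists (M * (K * (/ rho) ^ 2) / (1 - q) / (1 - q)), (rho - r0).
have Hir : 0 <= (/ rho) ^ 2 by apply: pow2_ge_0.
split; first by apply: Rdiv_le_0_compat; [apply: Rdiv_le_0_compat; [repeat apply: Rmult_le_pos => // | lra] | lra].
split; first lra.
move=> h k Hh Hk.
have hP : Cmod (P + h)%C <= rho by apply: (Rle_trans _ _ _ (Cmod_triangle _ _)); lra.
have hQ : Cmod (Q + k)%C <= rho by apply: (Rle_trans _ _ _ (Cmod_triangle _ _)); lra.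
set e := (Cmod h + Cmod k) / rho.
have G := Cmod_ge_0.
have He : 0 <= e by apply: Rdiv_le_0_compat; [move: (G h) (G k); lra | lra].
have Ee : rho * e = Cmod h + Cmod k by rewrite /e; field; lra.
have [M1 [q1 G1]] := PD_geo _ _ (P + h) (Q + k) rho H ltac:(lra) hP hQ.
have [M2 [q2 G2]] := PD_geo _ _ P Q r0 H ltac:(lra) r1 r2.
have [M3 [q3 G3]] := PD_geo _ _ P Q r0 HgP ltac:(lra) r1 r2.
have [M4 [q4 G4]] := PD_geo _ _ P Q r0 HgQ ltac:(lra) r1 r2.
set u1 := fun j k0 => (g j k0 * ((P + h) ^ j * (Q + k) ^ k0))%C in G1.
set u2 := fun j k0 => (g j k0 * (P ^ j * Q ^ k0))%C in G2.
set u3 := fun j k0 => (g j k0 * (INR j * P ^ pred j * Q ^ k0))%C.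
set u4 := fun j k0 => (g j k0 * (INR k0 * (P ^ j * Q ^ pred k0)))%C.
have G3' : geo (fun j k0 => u3 (S j) k0) M3 q3.
  case: G3 => Hq3 B3; split=> // j k0; apply: Rle_trans (B3 j k0).
  by rewrite /u3 /gP; simpl pred; apply: Req_le; congr Cmod; ring.
have G4' : geo (fun j k0 => u4 j (S k0)) M4 q4.
  case: G4 => Hq4 B4; split=> // j k0; apply: Rle_trans (B4 j k0).
  by rewrite /u4 /gQ; simpl pred; apply: Req_le; congr Cmod; ring.
have [[M5 [q5 G5]] E3] := DS_shiftP u3 M3 q3 G3' ltac:(move=> ?; rewrite /u3 /=; ring).
have [[M6 [q6 G6]] E4] := DS_shiftQ u4 M4 q4 G4' ltac:(move=> ?; rewrite /u4 /=; ring).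
have F3 : DSf (gP g) P Q = DS u3.
  by rewrite E3; apply: DS_ext => j k0; rewrite /u3 /gP; simpl pred; ring.
have F4 : DSf (gQ g) P Q = DS u4.
  by rewrite E4; apply: DS_ext => j k0; rewrite /u4 /gQ; simpl pred; ring.
have S2 := geo_scal (-1) _ _ _ G2.
have S5 := geo_scal (- h) _ _ _ G5; have S6 := geo_scal (- k) _ _ _ G6.
have T1 := geo_plus _ _ _ _ _ _ G1 S2; have T2 := geo_plus _ _ _ _ _ _ S5 S6.
have -> : (DSf g (P + h) (Q + k) - DSf g P Q - DSf (gP g) P Q * h - DSf (gQ g) P Q * k =
   DS (fun j k0 => (u1 j k0 + -1 * u2 j k0) + (- h * u3 j k0 + - k * u4 j k0)))%C.
  rewrite (DS_plus _ _ _ _ _ _ T1 T2) (DS_plus _ _ _ _ _ _ G1 S2) (DS_plus _ _ _ _ _ _ S5 S6).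
  rewrite (DS_scal _ _ _ _ G2) (DS_scal _ _ _ _ G5) (DS_scal _ _ _ _ G6) F3 F4.
  by rewrite /DSf -/u1 -/u2; ring.
have -> : M * (K * (/ rho) ^ 2) / (1 - q) / (1 - q) * (Cmod h + Cmod k) ^ 2 =
   (M * K * e ^ 2) / (1 - q) / (1 - q).
  by rewrite /e; field; lra.
apply: geo_le; split=> // j l.
have hh : Cmod (P + h - P)%C <= rho * e.
  by rewrite Ee (_ : (P + h - P)%C = h); [move: (G k); lra | ring].
have kk : Cmod (Q + k - Q)%C <= rho * e.
  by rewrite Ee (_ : (Q + k - Q)%C = k); [move: (G h); lra | ring].
have r5 : 0 <= rho by lra.
have [_ [_ R]] := taylor1_monomial rho e r5 He P (P + h) Q (Q + k) j l
  ltac:(lra) hP ltac:(lra) hQ hh kk.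
have -> : (u1 j l + -1 * u2 j l + (- h * u3 j l + - k * u4 j l) =
  g j l * ((P + h) ^ j * (Q + k) ^ l - P ^ j * Q ^ l -
   (INR j * P ^ pred j * Q ^ l * (P + h - P) + INR l * (P ^ j * Q ^ pred l) * (Q + k - Q))))%C.
  by rewrite /u1 /u2 /u3 /u4; ring.
rewrite Cmod_mult.
apply: (Rle_trans _ (Cmod (g j l) * (INR (j + l) ^ 2 * rho ^ (j + l) * e ^ 2))).
  exact: Rmult_le_compat_l.
have E : rho ^ (j + l) = (rho / r') ^ (j + l) * r' ^ (j + l).
  by rewrite -Rpow_mult_distr; congr pow; field; lra.
rewrite E (_ : Cmod (g j l) * (INR (j + l) ^ 2 * ((rho / r') ^ (j + l) * r' ^ (j + l)) * e ^ 2) =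
  (Cmod (g j l) * r' ^ (j + l)) * (INR (j + l) ^ 2 * (rho / r') ^ (j + l)) * e ^ 2); last by ring.
rewrite (_ : M * K * e ^ 2 * q ^ (j + l) = M * (K * q ^ (j + l)) * e ^ 2); last by ring.
apply: Rmult_le_compat_r; first exact: pow2_ge_0.
have p1 : 0 <= (rho / r') ^ (j + l) by apply: pow_le; lra.
apply: Rmult_le_compat => //.
- by apply: Rmult_le_pos => //; apply: pow_le; lra.
- by apply: Rmult_le_pos => //; exact: pow2_ge_0.
- apply: Rle_trans (HB _); apply: Rmult_le_compat_r => //.
  by apply: pow_incr; move: (pos_INR (j + l)); lra.
Qed.

Lemma is_Wd_DSf g R0 (P Q : C -> C) z p1 p2 q1 q2 : PD g R0 ->
  Cmod (P z) < R0 -> Cmod (Q z) < R0 -> is_Wd P z p1 p2 -> is_Wd Q z q1 q2 ->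
  is_Wd (fun z => DSf g (P z) (Q z)) z
    (DSf (gP g) (P z) (Q z) * p1 + DSf (gQ g) (P z) (Q z) * q1)
    (DSf (gP g) (P z) (Q z) * p2 + DSf (gQ g) (P z) (Q z) * q2).
Proof.
move=> H HP HQ DP DQ.
have [K [d [HK [Hd F]]]] := DSf_frechet _ _ _ _ H HP HQ.
have [d1 [k1 [Hd1 [Hk1 L1]]]] := is_Wd_lipschitz _ _ _ _ DP.
have [d2 [k2 [Hd2 [Hk2 L2]]]] := is_Wd_lipschitz _ _ _ _ DQ.
set A := DSf (gP g) (P z) (Q z) in F *; set B := DSf (gQ g) (P z) (Q z) in F *.
have G := Cmod_ge_0.
apply: (is_Wd_scaled _ _ _ _ (Cmod A + Cmod B + K * (k1 + k2) ^ 2)) => eps Heps.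
case: (DP _ Heps) => d3 [Hd3 K1]; case: (DQ _ Heps) => d4 [Hd4 K2].
exists (Rmin (Rmin (Rmin d1 d2) (Rmin d3 d4)) (Rmin eps (Rmin (d / k1) (d / k2)))); split.
  by repeat apply: Rmin_pos => //; apply: Rdiv_lt_0_compat.
move=> h Hh.
have [[l1 l2] [l3 l4]] : (Cmod h < Rmin d1 d2 /\ Cmod h < Rmin d3 d4) /\ (Cmod h < eps /\ Cmod h < Rmin (d / k1) (d / k2)).
  move: (Rmin_Rgt_l _ _ _ Hh) => [/Rmin_Rgt_l [? ?] /Rmin_Rgt_l [? ?]]; tauto.
have [l5 l6] := Rmin_Rgt_l _ _ _ l1; have [l7 l8] := Rmin_Rgt_l _ _ _ l2; have [l9 l10] := Rmin_Rgt_l _ _ _ l4.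
have B1 := K1 h ltac:(lra). have B2 := K2 h ltac:(lra).
have B3 := L1 h ltac:(lra). have B4 := L2 h ltac:(lra).
have C1 : Cmod (P (z + h) - P z)%C <= d.
  have : Cmod h * k1 < d by apply/Rlt_div_r; lra.
  lra.
have C2 : Cmod (Q (z + h) - Q z)%C <= d.
  have : Cmod h * k2 < d by apply/Rlt_div_r; lra.
  lra.
have := F _ _ C1 C2.
rewrite (_ : (P z + (P (z + h) - P z))%C = P (z + h)%C); last by ring.
rewrite (_ : (Q z + (Q (z + h) - Q z))%C = Q (z + h)%C); last by ring.
set w := (DSf g (P (z + h)) (Q (z + h)) - _ - _ - _)%C => B5.
move: B1 B2; set e1 := (P _ - _ - _ - _)%C; set e2 := (Q _ - _ - _ - _)%C => B1 B2.
have -> : (DSf g (P (z + h)) (Q (z + h)) - DSf g (P z) (Q z) - (A * p1 + B * q1) * h -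
   (A * p2 + B * q2) * Cconj h = w + (A * e1 + B * e2))%C.
  by rewrite /w /e1 /e2; ring.
apply: (Rle_trans _ _ _ (Cmod_triangle _ _)).
apply: (Rle_trans _ _ _ (Rplus_le_compat_l _ _ _ (Cmod_triangle _ _))).
rewrite !Cmod_mult.
have I1 : Cmod A * Cmod e1 <= Cmod A * (eps * Cmod h) by apply: Rmult_le_compat_l.
have I2 : Cmod B * Cmod e2 <= Cmod B * (eps * Cmod h) by apply: Rmult_le_compat_l.
have I3 : K * (Cmod (P (z + h) - P z)%C + Cmod (Q (z + h) - Q z)%C) ^ 2 <= K * (k1 + k2) ^ 2 * eps * Cmod h.
  rewrite (Rmult_assoc K) (Rmult_assoc K); apply: Rmult_le_compat_l => //.
  apply: (Rle_trans _ ((k1 * Cmod h + k2 * Cmod h) ^ 2)).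
    by apply: pow_incr; split; [apply: Rplus_le_le_0_compat | lra].
  have -> : (k1 * Cmod h + k2 * Cmod h) ^ 2 = (k1 + k2) ^ 2 * Cmod h * Cmod h by ring.
  apply: Rmult_le_compat_r => //; apply: Rmult_le_compat_l; [exact: pow2_ge_0 | lra].
lra.
Qed.

Lemma Sm_DSf R0 (W : C -> Prop) (P Q : C -> C) : open W ->
  (forall z, W z -> Cmod (P z) < R0 /\ Cmod (Q z) < R0) ->
  (forall k, Sm k W P) -> (forall k, Sm k W Q) ->
  forall k g, PD g R0 -> Sm k W (fun z => DSf g (P z) (Q z)).
Proof.
move=> HW HB HP HQ.
have D g : PD g R0 -> forall z, W z -> is_Wd (fun z => DSf g (P z) (Q z)) z
    (DSf (gP g) (P z) (Q z) * dz P z + DSf (gQ g) (P z) (Q z) * dz Q z)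
    (DSf (gP g) (P z) (Q z) * dzb P z + DSf (gQ g) (P z) (Q z) * dzb Q z).
  move=> Hg z Hz; have [? ?] := HB _ Hz.
  by apply: (is_Wd_DSf _ _ _ _ _ _ _ _ _ Hg) => //; [have [+ _] := HP 1%nat | have [+ _] := HQ 1%nat]; apply.
elim=> [|k IH] g Hg; first by move=> z Hz; exact: is_Wd_continuous (D g Hg z Hz).
have [Hg1 Hg2] := PD_gPQ _ _ Hg.
have [_ [P1 P2]] := HP (S k); have [_ [Q1 Q2]] := HQ (S k).
apply: (Sm_intro _ _ _ _ _ HW (D g Hg)).
  by apply: Sm_plus => //; apply: Sm_mult => //; exact: IH.
by apply: Sm_plus => //; apply: Sm_mult => //; exact: IH.
Qed.

(** * Power series in one variable *)

Definition OSer (a : nat -> C) (z : C) : C := CSer (fun j => a j * z ^ j)%C.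

Definition PS1 (a : nat -> C) (R0 : R) : Prop :=
  forall x, 0 <= x < R0 -> exists M, forall j, Cmod (a j) * x ^ j <= M.

(** Embeds a series in one variable into those in two, evaluated at 0 in the second, so that the
    differentiation theorem is reused. *)
Definition lift1 (a : nat -> C) (j k : nat) : C := match k with O => a j | S _ => RtoC 0 end.

Lemma PS1_PD a R0 : PS1 a R0 -> PD (lift1 a) R0.
Proof.
move=> H x Hx; have [M HM] := H x Hx; exists (Rmax M 0) => j [|k] /=.
  by rewrite Nat.add_0_r; apply: Rle_trans (HM j) (Rmax_l _ _).
by rewrite Cmod_0 Rmult_0_l; exact: Rmax_r.
Qed.

Lemma CSer_single (u : nat -> C) : (forall n, u (S n) = 0) -> CSer u = u 0%nat.
Proof.
move=> H; have A : asum (fun n => u (S n)).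
  by apply: (asum_geom _ 0 0); [lra | move=> n; rewrite H Cmod_0; lra].
by have [_ ->] := CSer_S u A; rewrite (CSer_ext _ (fun _ => 0) H) CSer_0; ring.
Qed.

Lemma DSf_lift1 a z : DSf (lift1 a) z 0 = OSer a z.
Proof.
apply: CSer_ext => j; rewrite CSer_single /=; first by ring.
by move=> n; ring.
Qed.

Lemma PS1_asum a R0 z : PS1 a R0 -> Cmod z < R0 -> asum (fun j => a j * z ^ j)%C.
Proof.
move=> H Hz; have H0 := Cmod_ge_0 z.
have [M [q G]] := PD_geo _ _ z 0 (Cmod z) (PS1_PD _ _ H) ltac:(lra) (Rle_refl _) ltac:(rewrite Cmod_0; lra).
apply: (asum_ext (fun j => CSer (fun k => lift1 a j k * (z ^ j * 0 ^ k))%C)); last exact: geo_asum G.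
move=> j; rewrite CSer_single /=; first by ring.
by move=> n; ring.
Qed.

Definition deriv1 (a : nat -> C) (j : nat) : C := (INR (S j) * a (S j))%C.

Lemma PS1_deriv1 a R0 : PS1 a R0 -> PS1 (deriv1 a) R0.
Proof.
move=> /PS1_PD /PD_gPQ [H _] x Hx; have [M HM] := H x Hx; exists M => j.
by have := HM j 0%nat; rewrite Nat.add_0_r.
Qed.

Lemma is_Wd_OSer a R0 z : PS1 a R0 -> Cmod z < R0 -> is_Wd (OSer a) z (OSer (deriv1 a) z) 0.
Proof.
move=> H Hz; have H0 := Cmod_ge_0 z.
apply: (is_Wd_ext (fun z => DSf (lift1 a) z 0)); first by move=> x; exact: DSf_lift1.
have := is_Wd_DSf _ R0 (fun z => z) (fun _ => RtoC 0) z _ _ _ _ (PS1_PD _ _ H) Hz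
  ltac:(rewrite Cmod_0; lra) (is_Wd_id z) (is_Wd_const 0 z) => D.
have E : DSf (gP (lift1 a)) z 0 = OSer (deriv1 a) z.
  by rewrite -DSf_lift1; apply: DS_ext => j [|k]; rewrite /gP /lift1 /deriv1 //; ring.
by apply: (is_Wd_eq _ _ _ _ _ _ D); rewrite ?E; ring.
Qed.

Lemma OSer_deriv1 a R0 z : PS1 a R0 -> Cmod z < R0 ->
  asum (fun j => INR j * a j * z ^ j)%C /\
  (z * OSer (deriv1 a) z)%C = CSer (fun j => INR j * a j * z ^ j)%C.
Proof.
move=> H Hz; have A := PS1_asum _ _ _ (PS1_deriv1 _ _ H) Hz.
have A' : asum (fun j => INR (S j) * a (S j) * z ^ (S j))%C.
  by apply: asum_ext (asum_scal z _ A) => j; rewrite /deriv1 Cpow_S; ring.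
have [A'' ->] := CSer_S (fun j => INR j * a j * z ^ j)%C A'; split=> //.
rewrite /OSer -CSer_scal //; rewrite [INR 0]/=.
rewrite (CSer_ext (fun n => z * (deriv1 a n * z ^ n))%C (fun j => INR (S j) * a (S j) * z ^ (S j))%C).
  by ring.
by move=> j; rewrite /deriv1 Cpow_S; ring.
Qed.

Lemma OSer_at_0 a : OSer a 0 = a 0%nat.
Proof. by rewrite /OSer CSer_single /=; [ring | move=> n; ring]. Qed.

Lemma CSer_geom z : Cmod z < 1 -> CSer (fun j => z ^ j)%C = (/ (1 - z))%C.
Proof.
move=> Hz; have H0 := Cmod_ge_0 z.
have Hz1 : (1 - z)%C <> RtoC 0.
  by move=> /Cminus_eq E; rewrite -E Cmod_1 in Hz; lra.
have A : asum (fun j => z ^ j)%C.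
  by apply: (asum_geom _ 1 (Cmod z)); [lra | move=> n; rewrite Cmod_pow; lra].
have [A' E] : asum (fun n => z ^ n)%C /\ CSer (fun j => z ^ j)%C = (1 + CSer (fun n => z ^ (S n)))%C.
  by apply: (CSer_S (fun j => z ^ j)%C); apply: asum_ext (asum_scal z _ A) => j; rewrite Cpow_S.
have E2 : CSer (fun n => z ^ (S n))%C = (z * CSer (fun j => z ^ j))%C.
  by rewrite -CSer_scal //; apply: CSer_ext => n; rewrite Cpow_S.
rewrite E2 in E; move: E; set X := CSer _ => E.
transitivity ((X - z * X) / (1 - z))%C; first by field.
rewrite {1}E; field; exact: Hz1.
Qed.

Lemma is_Dv_const f a b : (forall x, a < x < b -> is_Dv f x 0) ->
  forall x y, a < x < b -> a < y < b -> f x = f y.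
Proof.
move=> H x y Hx Hy.
have K (g : R -> R) : (forall x, a < x < b -> is_derive g x 0) -> g x = g y.
  move=> D.
  have H1 : forall u, Rmin x y < u < Rmax x y -> is_derive g u 0.
    by move=> u Hu; apply: D; move: Hu; rewrite /Rmin /Rmax; case: Rle_dec => _; lra.
  have H2 : forall u, Rmin x y <= u <= Rmax x y -> continuity_pt g u.
    move=> u Hu; apply/continuity_pt_filterlim.
    apply: (ex_derive_continuous (K := R_AbsRing) (V := R_NormedModule)); exists 0; apply: D.
    by move: Hu; rewrite /Rmin /Rmax; case: Rle_dec => _; lra.
  have [c [Hc E]] := MVT_gen g x y (fun _ => 0) H1 H2.
  by move: E; rewrite Rmult_0_l; lra.
apply: C_ext; [apply: (K (fun t => Re (f t))) | apply: (K (fun t => Im (f t)))] => u /H; by case.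
Qed.

(** * Growth of recursive sequences *)

Lemma bounded_eventually (u : nat -> R) N M : (forall n, (N <= n)%nat -> u n <= M) ->
  exists M', M <= M' /\ 0 <= M' /\ forall n, u n <= M'.
Proof.
elim: N M => [|N IH] M H.
  exists (Rmax M 0); split; first exact: Rmax_l.
  split; first exact: Rmax_r.
  by move=> n; apply: Rle_trans (Rmax_l _ _); apply: H; lia.
have K : forall n, (N <= n)%nat -> u n <= Rmax M (u N).
  move=> n Hn; case: (Nat.eq_dec n N) => [-> | Hne]; first exact: Rmax_r.
  by apply: Rle_trans (Rmax_l _ _); apply: H; lia.
have [M' [H1 [H2 H3]]] := IH _ K.
by exists M'; split=> //; apply: Rle_trans (Rmax_l _ _) H1.
Qed.

(** Binomial coefficients, inverses of [Bm] and the majorants of [Qp] and [Qn] all obey such a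
    recursion: ratio tending to 1, forcing of order [lam ^ n]. No growth rate beyond [lam]
    results. *)
Lemma subexponential (u : nat -> R) K lam : 1 <= lam -> 0 <= K -> (forall n, 0 <= u n) ->
  (forall eps, 0 < eps -> exists N, forall n, (N <= n)%nat -> u (S n) <= (1 + eps) * u n + K * lam ^ n) ->
  forall mu, lam < mu -> exists M, 0 <= M /\ forall n, u n <= M * mu ^ n.
Proof.
move=> Hl HK Hu H mu Hmu.
(* With [eps = (mu - 1) / 2] the ratio and the forcing contribute [1 + eps] and [eps], which add up
   to [mu]. *)
have [N HN] := H ((mu - 1) / 2) ltac:(lra).
have Hmu1 n : 1 <= mu ^ n by apply: pow_R1_Rle; lra.
have L n : lam ^ n <= mu ^ n by apply: pow_incr; lra.
set C0 := K / ((mu - 1) / 2).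
have HC0 : 0 <= C0 by apply: Rdiv_le_0_compat; lra.
have EK : K = C0 * ((mu - 1) / 2) by rewrite /C0; field; lra.
have B n : (N <= n)%nat -> u n <= (u N + C0) * mu ^ n.
  move=> Hn; rewrite -(Nat.sub_add _ _ Hn) Nat.add_comm; elim: (n - N)%nat => [|k IH].
    by rewrite Nat.add_0_r; have := Hmu1 N; move: (Hu N); nra.
  rewrite Nat.add_succ_r; apply: (Rle_trans _ _ _ (HN (N + k)%nat ltac:(lia))).
  have I1 : (1 + (mu - 1) / 2) * u (N + k)%nat <= (1 + (mu - 1) / 2) * ((u N + C0) * mu ^ (N + k)).
    by apply: Rmult_le_compat_l; lra.
  have I2 : K * lam ^ (N + k) <= K * mu ^ (N + k) by apply: Rmult_le_compat_l.
  have I3 : K * mu ^ (N + k) <= (u N + C0) * ((mu - 1) / 2) * mu ^ (N + k).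
    apply: Rmult_le_compat_r; first by have := Hmu1 (N + k)%nat; lra.
    rewrite {1}EK; apply: Rmult_le_compat_r; move: (Hu N); lra.
  rewrite /=; lra.
have [M [_ [HM HB]]] := bounded_eventually (fun n => u n / mu ^ n) N (u N + C0) ltac:(move=> n /B Hn; apply/Rle_div_l => //; have := Hmu1 n; lra).
exists M; split=> // n; apply/Rle_div_l; last exact: HB.
have := Hmu1 n; lra.
Qed.

Lemma INR_ratio (A eps : R) : 0 < eps -> exists N, forall n, (N <= n)%nat ->
  A <= eps * (INR n + 1) /\ A <= INR n.
Proof.
move=> Heps.
have [N HN] := INR_archimed 1 (A / eps) Rlt_0_1; have [N' HN'] := INR_archimed 1 A Rlt_0_1.
exists (N + N')%nat => n Hn.
have H1 : INR N <= INR n by apply: le_INR; lia.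
have H2 : INR N' <= INR n by apply: le_INR; lia.
split; last lra.
have : A / eps * eps <= (INR n + 1) * eps by apply: Rmult_le_compat_r; lra.
have -> : A / eps * eps = A by field; lra.
lra.
Qed.

(** * Radial solutions *)

Definition not_pos_int (r : C) : Prop := forall n : nat, r <> RtoC (INR (S n)).

(** The divisor produced by integrating $s^{n-r}$; the hypothesis on $r$ enters through its not
    vanishing. *)
Definition den (r : C) (n : nat) : C := (INR (S n) - r)%C.

(* With [s = 1 - t], both families solve [d/ds (s^(1-r) Q) = s^(-r) t^m], for the exponents
   [m >= 0] and [m = -q-1 < 0] respectively, and are analytic at [s = 0]. *)
Fixpoint Qp (r : C) (m : nat) (t : C) : C :=
  match m with
  | O => / den r 0
  | S m => (INR (S m) * Qp r m t + t ^ (S m)) / den r (S m)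
  end%C.

Fixpoint Qn (r : C) (q : nat) (t : C) : C :=
  match q with
  | O => OSer (fun k => / den r k)%C (1 - t)
  | S q => ((INR q + r) * Qn r q t + / t ^ (S q)) / INR (S q)
  end%C.

(* Taylor coefficients of [(1 - t)^(-r)]. *)
Fixpoint binc (r : C) (k : nat) : C :=
  match k with
  | O => RtoC 1
  | S k => binc r k * (r + INR k) / INR (S k)
  end%C.

(** The incomplete Beta integral $\int_0^t\tau^m(1-\tau)^{-r}\,d\tau$, expanded at the origin. *)
Definition Gm (r : C) (m : nat) (t : C) : C :=
  (t ^ (S m) * OSer (fun k => binc r k / INR (S (m + k))) t)%C.

(** The Beta value $B(m+1,1-r)$, continued to all admissible $r$: the integral itself converges at
    $t=1$ only for $\mathrm{Re}\,r<1$, but the recursion for [Qp] makes sense without it. *)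
Definition Bm (r : C) (m : nat) : C := Qp r m 0.

Lemma den_neq_0 r n : not_pos_int r -> den r n <> RtoC 0.
Proof. by move=> H /Cminus_eq E; apply: (H n). Qed.

Lemma INR_S_neq_0 n : RtoC (INR (S n)) <> RtoC 0.
Proof. by move=> /RtoC_inj; apply: not_0_INR. Qed.

Lemma Bm_neq_0 r m : not_pos_int r -> Bm r m <> RtoC 0.
Proof.
move=> H; elim: m => [|m IH].
  rewrite /Bm /= => E; apply: (C1_nz).
  by rewrite -(Cinv_r (den r 0)) ?E; [ring | exact: den_neq_0].
rewrite /Bm -/(Bm r m) /= -/(Bm r m) => E; apply: IH.
have Hd := den_neq_0 r (S m) H; have Hm := INR_S_neq_0 m.
move: E; rewrite -/(INR (S m)) => E.
transitivity ((INR (S m) * Bm r m + 0 * 0 ^ m) / den r (S m) * (den r (S m) / INR (S m)))%C.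
  by field.
by rewrite E; ring.
Qed.

Lemma den_bounded r : not_pos_int r -> exists M, 0 <= M /\ forall k, Cmod (/ den r k)%C <= M.
Proof.
move=> H.
have [N HN] := INR_ratio (Cmod r + 1) 1 Rlt_0_1.
have [|M [_ [H0 HM]]] := bounded_eventually (fun k => Cmod (/ den r k)%C) N 1; last by exists M.
move=> n /HN [_ Hn]; rewrite Cmod_inv; last exact: den_neq_0.
have Hd : 1 <= Cmod (den r n).
  have := Cmod_triangle (den r n) r; rewrite (_ : (den r n + r)%C = INR (S n)); last by rewrite /den; ring.
  rewrite Cmod_R Rabs_pos_eq S_INR; first lra.
  by move: (pos_INR n); lra.
by rewrite -Rinv_1; apply: Rinv_le_contravar; lra.
Qed.

Lemma PS1_bounded a M : (forall k, Cmod (a k) <= M) -> PS1 a 1.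
Proof.
move=> H x Hx; exists M => j.
have p1 : x ^ j <= 1 by rewrite -(pow1 j); apply: pow_incr; lra.
have p0 : 0 <= x ^ j by apply: pow_le; lra.
have := H j; have := Cmod_ge_0 (a j); nra.
Qed.

Lemma PS1_den r : not_pos_int r -> PS1 (fun k => / den r k)%C 1.
Proof. by move=> /den_bounded [M [_ H]]; exact: PS1_bounded H. Qed.

Lemma PS1_subexp (a : nat -> C) : (forall mu, 1 < mu -> exists M, 0 <= M /\ forall n, Cmod (a n) <= M * mu ^ n) -> PS1 a 1.
Proof.
move=> H x Hx.
(* This [mu] exceeds 1 and still satisfies [mu * x <= 1]. *)
have [M [HM HB]] := H (2 / (1 + x)) ltac:(apply/Rlt_div_r; lra).
exists M => j.
apply: (Rle_trans _ (M * (2 / (1 + x)) ^ j * x ^ j)).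
  by apply: Rmult_le_compat_r; [apply: pow_le; lra | exact: HB].
rewrite Rmult_assoc -Rpow_mult_distr -{2}(Rmult_1_r M); apply: Rmult_le_compat_l => //.
apply: (Rle_trans _ (1 ^ j)); last by rewrite pow1; lra.
apply: pow_incr.
have -> : 2 / (1 + x) * x = 2 * x / (1 + x) by field; lra.
split; first by apply: Rdiv_le_0_compat; lra.
by apply/Rle_div_l; lra.
Qed.

Lemma PS1_binc r : PS1 (binc r) 1.
Proof.
apply: PS1_subexp => mu Hmu.
apply: (subexponential (fun n => Cmod (binc r n)) 0 1) => //; try lra.
  by move=> n; exact: Cmod_ge_0.
move=> eps Heps; have [N HN] := INR_ratio (Cmod r) eps Heps; exists N => n /HN [Hn _].
have Hp := pos_INR n.
rewrite /= -/(INR (S n)) Cmod_div; last exact: INR_S_neq_0.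
rewrite Cmod_mult Cmod_R S_INR Rabs_pos_eq; last lra.
rewrite Rmult_0_l Rplus_0_r; apply/Rle_div_l; first lra.
rewrite (Rmult_comm (1 + eps)) Rmult_assoc; apply: Rmult_le_compat_l; first exact: Cmod_ge_0.
apply: (Rle_trans _ _ _ (Cmod_triangle _ _)); rewrite Cmod_R Rabs_pos_eq; lra.
Qed.

Lemma PS1_le a b R0 : (forall k, Cmod (a k) <= Cmod (b k)) -> PS1 b R0 -> PS1 a R0.
Proof.
move=> H Hb x Hx; have [M HM] := Hb x Hx; exists M => j; apply: Rle_trans (HM j).
by apply: Rmult_le_compat_r => //; apply: pow_le; lra.
Qed.

Lemma PS1_Gm r m : PS1 (fun k => binc r k / INR (S (m + k)))%C 1.
Proof.
apply: (PS1_le _ (binc r)); last exact: PS1_binc.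
move=> k; rewrite Cmod_div; last exact: INR_S_neq_0.
have Hp := pos_INR (m + k).
rewrite Cmod_R S_INR Rabs_pos_eq; last lra.
apply/Rle_div_l; first lra.
have := Cmod_ge_0 (binc r k); nra.
Qed.

Definition spow (c t : C) : C := Cpowc (1 - t) c.

Lemma is_Wd_spow c t : 0 < Re (1 - t)%C -> is_Wd (spow c) t (- c * spow c t / (1 - t)) 0.
Proof.
move=> Ht; have H0 := Re_pos_neq_0 _ Ht.
have := is_Wd_comp _ _ _ _ _ _ _ (is_Wd_minus _ _ _ _ _ _ _ (is_Wd_const 1 t) (is_Wd_id t)) (is_Wd_Cpowc _ c Ht) => D.
by apply: (is_Wd_eq _ _ _ _ _ _ D); rewrite ?Cminus_conj ?Cconj_R /spow; [field | ring].
Qed.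

Lemma spow_1_minus r t : 0 < Re (1 - t)%C -> spow (1 - r) t = ((1 - t) * spow (- r) t)%C.
Proof. by move=> Ht; rewrite /spow /Cminus Cpowc_plus Cpowc_1. Qed.

Lemma is_Wd_spow_1 r t : 0 < Re (1 - t)%C -> is_Wd (spow (1 - r)) t (- (1 - r) * spow (- r) t) 0.
Proof.
move=> Ht; have H0 := Re_pos_neq_0 _ Ht.
by apply: (is_Wd_eq _ _ _ _ _ _ (is_Wd_spow (1 - r) t Ht)); rewrite // spow_1_minus //; field.
Qed.

Lemma is_Wd_pow_id (t : C) n : is_Wd (fun t => t ^ S n)%C t (INR (S n) * t ^ n) 0.
Proof.
by apply: (is_Wd_eq _ _ _ _ _ _ (is_Wd_pow _ _ _ _ (S n) (is_Wd_id t))); simpl pred; ring.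
Qed.

(** Integration by parts: the derivative of $s^{1-r}t^{m+1}$ is
    $s^{-r}\bigl((m+1)t^m-(m+2-r)t^{m+1}\bigr)$, and the induction hypothesis cancels the first
    term. *)
Lemma is_Wd_Qp r m t : not_pos_int r -> 0 < Re (1 - t)%C ->
  is_Wd (fun t => spow (1 - r) t * Qp r m t)%C t (- (spow (- r) t * t ^ m)) 0.
Proof.
move=> Hr Ht; have DS := is_Wd_spow_1 r t Ht.
elim: m => [|m IH].
  have Hd := den_neq_0 r 0 Hr.
  have D := is_Wd_mult _ _ _ _ _ _ _ DS (is_Wd_const (/ den r 0)%C t).
  apply: (is_Wd_eq _ _ _ _ _ _ D) => /=; last by ring.
  transitivity (- (den r 0 * / den r 0 * spow (- r) t))%C; first by rewrite /den /=; ring.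
  by rewrite Cinv_r //; ring.
have Hd := den_neq_0 r (S m) Hr.
have D1 := is_Wd_scal (INR (S m) / den r (S m))%C _ _ _ _ IH.
have D2 := is_Wd_scal (/ den r (S m))%C _ _ _ _ (is_Wd_mult _ _ _ _ _ _ _ DS (is_Wd_pow_id t m)).
apply: (is_Wd_ext (fun t => INR (S m) / den r (S m) * (spow (1 - r) t * Qp r m t) + / den r (S m) * (spow (1 - r) t * t ^ S m))%C).
  move=> x; rewrite [Qp r (S m) x]/= -/(INR (S m)) -/(den r (S m)) -Cpow_S.
  by field.
apply: (is_Wd_eq _ _ _ _ _ _ (is_Wd_plus _ _ _ _ _ _ _ D1 D2)); last by ring.
rewrite spow_1_minus // Cpow_S.
have Ed : den r (S m) = (INR (S m) + 1 - r)%C by rewrite /den (S_INR (S m)) RtoC_plus.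
transitivity (- (spow (- r) t * (t * t ^ m)) * ((INR (S m) + 1 - r) * / den r (S m)))%C.
  by rewrite /Cdiv; ring.
by rewrite -Ed Cinv_r //; ring.
Qed.

(** For [q = 0] one expands $1/t=\sum s^k$ and integrates $s^{k-r}$ termwise, which explains both
    the series in [Qn] and the restriction $|1-t|<1$. The other exponents follow by integration by
    parts. *)
Lemma is_Wd_Qn r q t : not_pos_int r -> 0 < Re (1 - t)%C -> 0 < Re t -> Cmod (1 - t)%C < 1 ->
  is_Wd (fun t => spow (1 - r) t * Qn r q t)%C t (- (spow (- r) t / t ^ S q)) 0.
Proof.
move=> Hr Ht Ht0 Hs; have DS := is_Wd_spow_1 r t Ht.
have Ht1 := Re_pos_neq_0 _ Ht0; have Hs1 := Re_pos_neq_0 _ Ht.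
elim: q => [|q IH].
  have PL := PS1_den r Hr.
  have DL := is_Wd_comp _ _ _ _ _ _ _ (is_Wd_minus _ _ _ _ _ _ _ (is_Wd_const 1 t) (is_Wd_id t)) (is_Wd_OSer _ 1 _ PL Hs).
  have D := is_Wd_mult _ _ _ _ _ _ _ DS DL.
  apply: (is_Wd_eq _ _ _ _ _ _ D); last by rewrite Cminus_conj !Cconj_R; ring.
  rewrite Cminus_conj !Cconj_R spow_1_minus //.
  set s := (1 - t)%C in Hs Hs1 *.
  have [A1 E1] := OSer_deriv1 _ 1 s PL Hs.
  have A0 := PS1_asum _ _ s PL Hs.
  (* The coefficient of $s^k$ on the left is $(k+1-r)$ times [/ den r k], that is 1; the sum is
     geometric with value $1/(1-s)$. *)
  have K : ((1 - r) * OSer (fun k => / den r k)%C s + s * OSer (deriv1 (fun k => / den r k)%C) s = / t)%C.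
    rewrite E1 /OSer -CSer_scal // -CSer_plus //; last exact: asum_scal.
    rewrite (_ : t = 1 - s)%C; last by rewrite /s; ring.
    rewrite -CSer_geom //; apply: CSer_ext => k.
    have Hd := den_neq_0 r k Hr.
    have Ed : (1 - r + INR k)%C = den r k by rewrite /den S_INR RtoC_plus; ring.
    transitivity ((1 - r + INR k) * / den r k * s ^ k)%C; first by ring.
    by rewrite Ed Cinv_r //; ring.
  transitivity (- spow (- r) t * ((1 - r) * OSer (fun k => / den r k)%C s + s * OSer (deriv1 (fun k => / den r k)%C) s))%C.
    by ring.
  by rewrite K /=; field.
have Hq := INR_S_neq_0 q.
have Htq : (t ^ S q)%C <> RtoC 0 by apply: Cpow_nz.
have Hq' : (t ^ q)%C <> RtoC 0 by apply: Cpow_nz.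
have D1 := is_Wd_scal ((INR q + r) / INR (S q))%C _ _ _ _ IH.
have D2 := is_Wd_scal (/ INR (S q))%C _ _ _ _ (is_Wd_mult _ _ _ _ _ _ _ DS
  (is_Wd_comp _ _ _ _ _ _ _ (is_Wd_pow_id t q) (is_Wd_inv _ Htq))).
apply: (is_Wd_ext (fun t => (INR q + r) / INR (S q) * (spow (1 - r) t * Qn r q t) + / INR (S q) * (spow (1 - r) t * / t ^ S q))%C).
  by move=> x; rewrite [Qn r (S q) x]/= -/(INR (S q)) -Cpow_S /Cdiv; ring.
apply: (is_Wd_eq _ _ _ _ _ _ (is_Wd_plus _ _ _ _ _ _ _ D1 D2)); last by ring.
rewrite spow_1_minus // !Cpow_S.
have Eq : RtoC (INR q) = (INR (S q) - 1)%C by rewrite S_INR RtoC_plus; ring.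
by rewrite Eq; field.
Qed.

Lemma is_Dv_of_Wd (f : C -> C) (t : R) a b : is_Wd f t a b -> is_Dv (fun t => f (RtoC t)) t (a + b).
Proof.
move=> H; have D : is_Dv RtoC t 1.
  apply/(is_Dv_Wd RtoC (RtoC t)); apply: (is_Wd_ext (fun z => / 2 * (z + Cconj z))%C).
    by move=> z; rewrite re_alt; field.
  apply: (is_Wd_eq _ _ _ _ _ _ (is_Wd_scal (/2)%C _ _ _ _ (is_Wd_plus _ _ _ _ _ _ _ (is_Wd_id (RtoC t)) (is_Wd_conj_id (RtoC t))))); field.
have := is_Dv_comp f _ _ _ _ _ D H; rewrite Cconj_R => K.
by have <- : (a * 1 + b * 1 = a + b)%C; [ring | exact: K].
Qed.

Lemma Re_1_minus (t : R) : Re (1 - t)%C = 1 - t.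
Proof. by rewrite /Re /=; ring. Qed.

(** The product of the series with $(1-t)^r$ has derivative zero and value 1 at the origin. A real
    interval suffices, as the argument will be $|w|^2$. *)
Lemma binomial_series r (t : R) : -1 < t < 1 -> OSer (binc r) t = spow (- r) t.
Proof.
move=> Ht.
have Hm x : -1 < x < 1 -> Cmod (RtoC x) < 1 by move=> ?; rewrite Cmod_R; apply: Rabs_def1; lra.
have D x : -1 < x < 1 -> is_Dv (fun x => OSer (binc r) (RtoC x) * spow r (RtoC x))%C x 0.
  move=> Hx; have Hs : 0 < Re (1 - x)%C by rewrite Re_1_minus; lra.
  have Hs0 := Re_pos_neq_0 _ Hs.
  have PB := PS1_binc r.
  have D1 := is_Wd_mult _ _ _ _ _ _ _ (is_Wd_OSer _ 1 (RtoC x) PB (Hm _ Hx)) (is_Wd_spow r x Hs).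
  have [A1 E1] := OSer_deriv1 _ 1 (RtoC x) PB (Hm _ Hx).
  have A0 := PS1_asum _ _ (RtoC x) PB (Hm _ Hx).
  have E2 : (OSer (deriv1 (binc r)) x = r * OSer (binc r) x + x * OSer (deriv1 (binc r)) x)%C.
    rewrite E1 /OSer -CSer_scal // -CSer_plus //; last exact: asum_scal.
    apply: CSer_ext => k; rewrite /deriv1 [binc r (S k)]/= -/(INR (S k)).
    have Hk := INR_S_neq_0 k; by field.
  have := is_Dv_of_Wd _ _ _ _ D1 => K.
  suff <- : ((OSer (deriv1 (binc r)) x * spow r x + OSer (binc r) x * (- r * spow r x / (1 - x)) +
     (0 * spow r x + OSer (binc r) x * 0)) = 0)%C by exact: K.
  transitivity (spow r x / (1 - x) * (OSer (deriv1 (binc r)) x - (r * OSer (binc r) x + x * OSer (deriv1 (binc r)) x)))%C.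
    by field.
  by rewrite -E2; ring.
have := is_Dv_const _ _ _ D t 0 Ht ltac:(lra) => /=.
rewrite OSer_at_0 /= {2}/spow (_ : (1 - 0)%C = RtoC 1) ?Cpowc_1_base; last by ring.
move=> E; rewrite /spow Cpowc_opp -/(spow r t).
have Hn : spow r t <> RtoC 0 by exact: Cpowc_neq_0.
transitivity (OSer (binc r) t * spow r t / spow r t)%C; first by field.
by rewrite E; field.
Qed.

Lemma is_Wd_Gm r m z : Cmod z < 1 -> is_Wd (Gm r m) z (z ^ m * OSer (binc r) z) 0.
Proof.
move=> Hz; have PG := PS1_Gm r m.
have D := is_Wd_mult _ _ _ _ _ _ _ (is_Wd_pow_id z m) (is_Wd_OSer _ 1 z PG Hz).
apply: (is_Wd_eq _ _ _ _ _ _ D); last by ring.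
have [A1 E1] := OSer_deriv1 _ 1 z PG Hz.
have A0 := PS1_asum _ _ z PG Hz.
transitivity (z ^ m * (INR (S m) * OSer (fun k => binc r k / INR (S (m + k))) z + z * OSer (deriv1 (fun k => binc r k / INR (S (m + k)))) z))%C.
  by rewrite Cpow_S; ring.
rewrite E1 /OSer -CSer_scal // -CSer_plus //; last exact: asum_scal.
congr (_ * _)%C; apply: CSer_ext => k; have Hk := INR_S_neq_0 (m + k).
have -> : (INR (S m) * (binc r k / INR (S (m + k)) * z ^ k) + INR k * (binc r k / INR (S (m + k))) * z ^ k =
   (INR (S m) + INR k) * / INR (S (m + k)) * (binc r k * z ^ k))%C by rewrite /Cdiv; ring.
have -> : (INR (S m) + INR k)%C = INR (S (m + k)).
  by rewrite -RtoC_plus -plus_INR.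
by rewrite Cinv_r //; ring.
Qed.

(* The solution [Gm] regular at the origin is a constant minus the one with exponent [1 - r] at [s = 0]. *)
Lemma connection r m (t : R) : not_pos_int r -> -1 < t < 1 ->
  Bm r m = (spow (1 - r) t * Qp r m t + Gm r m t)%C.
Proof.
move=> Hr Ht.
have Hm x : -1 < x < 1 -> Cmod (RtoC x) < 1 by move=> ?; rewrite Cmod_R; apply: Rabs_def1; lra.
have D x : -1 < x < 1 -> is_Dv (fun x => spow (1 - r) (RtoC x) * Qp r m (RtoC x) + Gm r m (RtoC x))%C x 0.
  move=> Hx; have Hs : 0 < Re (1 - x)%C by rewrite Re_1_minus; lra.
  have := is_Dv_of_Wd _ _ _ _ (is_Wd_plus _ _ _ _ _ _ _ (is_Wd_Qp r m x Hr Hs) (is_Wd_Gm r m (RtoC x) (Hm _ Hx))).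
  rewrite binomial_series // => K.
  by have <- : (- (spow (- r) x * x ^ m) + x ^ m * spow (- r) x + (0 + 0) = 0)%C; [ring | exact: K].
rewrite (is_Dv_const _ _ _ D t 0 Ht ltac:(lra)) /=.
rewrite /Gm /spow (_ : (1 - 0)%C = RtoC 1) ?Cpowc_1_base; last by ring.
by rewrite /Bm Cpow_S; ring.
Qed.

(** * Fourier modes of harmonic functions on an annulus *)

Lemma is_Dv_plus f g x l m : is_Dv f x l -> is_Dv g x m -> is_Dv (fun t => f t + g t)%C x (l + m).
Proof.
move=> /(is_Dv_Wd f (RtoC x)) H1 /(is_Dv_Wd g (RtoC x)) H2; apply/(is_Dv_Wd _ (RtoC x)).
by apply: (is_Wd_eq _ _ _ _ _ _ (is_Wd_plus _ _ _ _ _ _ _ H1 H2)); field.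
Qed.

Lemma is_Dv_mult f g x l m : is_Dv f x l -> is_Dv g x m ->
  is_Dv (fun t => f t * g t)%C x (l * g x + f x * m).
Proof.
move=> /(is_Dv_Wd f (RtoC x)) H1 /(is_Dv_Wd g (RtoC x)) H2; apply/(is_Dv_Wd _ (RtoC x)).
by apply: (is_Wd_eq _ _ _ _ _ _ (is_Wd_mult _ _ _ _ _ _ _ H1 H2)); rewrite /=; field.
Qed.

Lemma is_Dv_scal c f x l : is_Dv f x l -> is_Dv (fun t => c * f t)%C x (c * l).
Proof.
move=> /(is_Dv_Wd f (RtoC x)) H1; apply/(is_Dv_Wd _ (RtoC x)).
by apply: (is_Wd_eq _ _ _ _ _ _ (is_Wd_scal c _ _ _ _ H1)); field.
Qed.

Lemma is_Dv_eq f x l m : is_Dv f x l -> l = m -> is_Dv f x m.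
Proof. by move=> H <-. Qed.

Lemma is_Dv_pow (x : R) n : is_Dv (fun t => RtoC t ^ S n)%C x (INR (S n) * x ^ n).
Proof. by apply: (is_Dv_eq _ _ _ _ (is_Dv_of_Wd _ _ _ _ (is_Wd_pow_id x n))); ring. Qed.

Lemma is_Dv_powinv (x : R) n : x <> 0 -> is_Dv (fun t => / RtoC t ^ n)%C x (- INR n / x ^ S n).
Proof.
move=> Hx; have Hx' : RtoC x <> RtoC 0 by move=> /RtoC_inj.
have Hn := Cpow_nz _ n Hx'.
have D := is_Wd_comp _ _ _ _ _ _ _ (is_Wd_pow _ _ _ _ n (is_Wd_id (RtoC x))) (is_Wd_inv _ Hn).
apply: (is_Dv_eq _ _ _ _ (is_Dv_of_Wd _ _ _ _ D)).
case: n {D} Hn => [|n] Hn; first by rewrite /= Cmult_0_l; field.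
have Hn' : (RtoC x ^ n)%C <> RtoC 0 by apply: Cpow_nz.
by simpl pred; rewrite !Cpow_S; field.
Qed.

(* On the annulus, [Phi_wbar = (1 - |w|^2)^(-r) phi] with [phi] antiholomorphic. *)
Definition disk_harm (r : C) (R0 : R) (Phi phi : C -> C) : Prop :=
  exists Phia phib : C -> C, forall w, Ann R0 1 w ->
    is_Wd Phi w (Phia w) (spow (- r) (w * Cconj w) * phi w) /\ continuous Phia w /\
    is_Wd phi w 0 (phib w) /\ continuous phib w.

Lemma circ_sqr rho t : (RtoC rho * expi t * Cconj (RtoC rho * expi t))%C = (RtoC rho * RtoC rho)%C.
Proof.
rewrite Cmult_conj Cconj_R Cconj_expi expi_opp; field; exact: expi_neq_0.
Qed.

Lemma disk_sqr_lt_1 (w : C) : Cmod w < 1 -> 0 < Re (1 - w * Cconj w)%C.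
Proof.
move=> H; rewrite -Cmod2_conj Re_1_minus; have := Cmod_ge_0 w; nra.
Qed.

Section Modes.
Variables (r : C) (Hr : not_pos_int r) (R0 : R) (HR : 0 <= R0 < 1) (Phi phi : C -> C).
Hypothesis H : disk_harm r R0 Phi phi.

Let phi_ctsR rho : R0 < rho < 1 -> ctsR (circ phi rho).
Proof.
move: H => [Phia [phib K]] Hrho.
apply: (circ_ctsR R0 1 (proj1 HR)) => // w /K [_ [_ [D _]]]; exact: is_Wd_continuous D.
Qed.

(** Since [phi] has no $w$-derivative, [cf_angle] expresses the coefficient of $\bar w\phi_{\bar w}$
    by that of $\phi$; the radial equation becomes $\rho c'=-nc$. *)
Lemma phi_mode rho (n : Z) : R0 < rho < 1 ->
  is_Dv (fun u => cf phi u (IZR n)) rho (- IZR n / rho * cf phi rho (IZR n)).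
Proof.
move: H => [Phia [phib K]] Hrho.
have Hr0 : RtoC rho <> RtoC 0 by move=> /RtoC_inj; lra.
have D w : Ann R0 1 w -> is_Wd phi w ((fun _ => 0) w) (phib w) by move=> /K; tauto.
have Ca w : Ann R0 1 w -> continuous (fun _ : C => RtoC 0) w by move=> _; exact: continuous_const.
have Cb w : Ann R0 1 w -> continuous phib w by move=> /K; tauto.
have A := cf_angle R0 1 (proj1 HR) phi (fun _ => 0) phib D Ca Cb rho n Hrho.
have B := cf_radius R0 1 (proj1 HR) phi (fun _ => 0) phib D Ca Cb rho n Hrho.
apply: (is_Dv_eq _ _ _ _ B).
have E0 : cf (fun w => w * 0)%C rho (IZR n) = RtoC 0.
  rewrite /cf (fourier_ext _ (fun t => 0 * circ phi rho t)%C); last by move=> t; rewrite /circ; ring.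
  by rewrite fourier_scal; [ring | exact: phi_ctsR].
rewrite E0 in A.
have -> : cf (fun w => Cconj w * phib w)%C rho (IZR n) = (- IZR n * cf phi rho (IZR n))%C.
  transitivity (cf (fun w => Cconj w * phib w)%C rho (IZR n) + IZR n * cf phi rho (IZR n) - IZR n * cf phi rho (IZR n))%C; first by ring.
  by rewrite -A; ring.
by field.
Qed.

(** Here and in [phi_mode_neg] the sign is that of the exponent of $\bar w$ in the Laurent expansion
    of [phi], opposite to the Fourier index. *)
Lemma phi_mode_pos m rho rho' : R0 < rho < 1 -> R0 < rho' < 1 ->
  (cf phi rho (- INR m) / rho ^ m = cf phi rho' (- INR m) / rho' ^ m)%C.
Proof.
apply: (is_Dv_const (fun u => cf phi u (- INR m) / u ^ m)%C) => u Hu.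
have Hu0 : RtoC u <> RtoC 0 by move=> /RtoC_inj; lra.
have Hn := Cpow_nz _ m Hu0.
have := phi_mode u (- Z.of_nat m) Hu; rewrite opp_IZR -INR_IZR_INZ RtoC_opp => D.
apply: (is_Dv_eq _ _ _ _ (is_Dv_mult _ _ _ _ _ D (is_Dv_powinv u m ltac:(lra)))).
by rewrite Cpow_S; field.
Qed.

Lemma phi_mode_neg q rho rho' : R0 < rho < 1 -> R0 < rho' < 1 ->
  (cf phi rho (INR (S q)) * rho ^ S q = cf phi rho' (INR (S q)) * rho' ^ S q)%C.
Proof.
apply: (is_Dv_const (fun u => cf phi u (INR (S q)) * u ^ S q)%C) => u Hu.
have Hu0 : RtoC u <> RtoC 0 by move=> /RtoC_inj; lra.
have := phi_mode u (Z.of_nat (S q)) Hu; rewrite -INR_IZR_INZ => D.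
apply: (is_Dv_eq _ _ _ _ (is_Dv_mult _ _ _ _ _ D (is_Dv_pow u q))).
by rewrite Cpow_S; field.
Qed.

Definition rho_mid := (R0 + 1) / 2.
(** [aP m] and [aN q] are the Laurent coefficients of [phi] at $\bar w^m$ and $\bar w^{-q-1}$. The
    reading radius is arbitrary by the two preceding lemmas. *)
Definition aP (m : nat) : C := (cf phi rho_mid (- INR m) / rho_mid ^ m)%C.
Definition aN (q : nat) : C := (cf phi rho_mid (INR (S q)) * rho_mid ^ S q)%C.

Lemma cf_phi_pos m rho : R0 < rho < 1 -> cf phi rho (- INR m) = (aP m * rho ^ m)%C.
Proof.
move=> Hrho; have Hu0 : RtoC rho <> RtoC 0 by move=> /RtoC_inj; lra.
have Hn := Cpow_nz _ m Hu0.
rewrite /aP -(phi_mode_pos m rho rho_mid) //; last by rewrite /rho_mid; lra.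
by field.
Qed.

Lemma cf_phi_neg q rho : R0 < rho < 1 -> cf phi rho (INR (S q)) = (aN q / rho ^ S q)%C.
Proof.
move=> Hrho; have Hu0 : RtoC rho <> RtoC 0 by move=> /RtoC_inj; lra.
have Hn := Cpow_nz _ (S q) Hu0.
rewrite /aN -(phi_mode_neg q rho rho_mid) //; last by rewrite /rho_mid; lra.
by field.
Qed.

(** The factor $\bar w$ in [cf_radius] shifts the index: mode [n] of [Phi] is driven by mode [n + 1]
    of [phi]. This pairs mode [-m-1] with [aP m] and mode [q] with [aN q]. *)
Lemma Phi_mode rho (n : Z) : R0 < rho < 1 ->
  is_Dv (fun u => cf Phi u (IZR n)) rho
    (IZR n / rho * cf Phi rho (IZR n) + 2 * spow (- r) (rho * rho) * cf phi rho (IZR n + 1)%R).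
Proof.
move: (H) => [Phia [phib K]] Hrho.
have Hr0 : RtoC rho <> RtoC 0 by move=> /RtoC_inj; lra.
set Phib := fun w => (spow (- r) (w * Cconj w) * phi w)%C.
have D w : Ann R0 1 w -> is_Wd Phi w (Phia w) (Phib w) by move=> /K; tauto.
have Ca w : Ann R0 1 w -> continuous Phia w by move=> /K; tauto.
have Cb w : Ann R0 1 w -> continuous Phib w.
  move=> Hw; apply: continuous_Cmult; last by have [_ [_ [D' _]]] := K _ Hw; exact: is_Wd_continuous D'.
  have Hs := disk_sqr_lt_1 w (proj2 Hw).
  exact: is_Wd_continuous (is_Wd_comp _ _ _ _ _ _ _ (is_Wd_mult _ _ _ _ _ _ _ (is_Wd_id w) (is_Wd_conj_id w)) (is_Wd_spow _ _ Hs)).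
have B := cf_radius R0 1 (proj1 HR) Phi Phia Phib D Ca Cb rho n Hrho.
apply: (is_Dv_eq _ _ _ _ B).
rewrite cf_conj_mult; last exact: (circ_ctsR R0 1 (proj1 HR)).
have -> : cf Phib rho (IZR n + 1)%R = (spow (- r) (rho * rho) * cf phi rho (IZR n + 1)%R)%C.
  rewrite /cf -fourier_scal; last exact: phi_ctsR.
  by apply: fourier_ext => t; rewrite /circ /Phib circ_sqr.
by field.
Qed.

Lemma is_Wd_sqr_comp (f : C -> C) (u a : C) : is_Wd f (u * u)%C a 0 ->
  is_Wd (fun z => f (z * z)%C) u (2 * u * a) 0.
Proof.
move=> D; apply: (is_Wd_eq _ _ _ _ _ _ (is_Wd_comp _ _ _ _ _ _ _ (is_Wd_mult _ _ _ _ _ _ _ (is_Wd_id u) (is_Wd_id u)) D)); first by ring.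
by ring.
Qed.

Lemma Re_1_minus_sqr u : 0 <= u < 1 -> 0 < Re (1 - RtoC u * RtoC u)%C.
Proof. by move=> Hu; rewrite -RtoC_mult Re_1_minus; nra. Qed.

(** Variation of constants: after division by the homogeneous solution $u^{-m-1}$ the forcing is
    $2us^{-r}t^m$ times [aP m], with $t=u^2$, and [is_Wd_Qp] supplies the negative of its
    primitive. *)
Lemma Phi_mode_neg m rho rho' : R0 < rho < 1 -> R0 < rho' < 1 ->
  (cf Phi rho (- INR (S m))%R * rho ^ S m + aP m * (spow (1 - r) (rho * rho) * Qp r m (rho * rho)) =
   cf Phi rho' (- INR (S m))%R * rho' ^ S m + aP m * (spow (1 - r) (rho' * rho') * Qp r m (rho' * rho')))%C.
Proof.
apply: (is_Dv_const (fun u => cf Phi u (- INR (S m))%R * u ^ S m + aP m * (spow (1 - r) (u * u) * Qp r m (u * u)))%C) => u Hu.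
have Hu0 : RtoC u <> RtoC 0 by move=> /RtoC_inj; lra.
have Hs := Re_1_minus_sqr u ltac:(lra).
have := Phi_mode u (- Z.of_nat (S m)) Hu; rewrite opp_IZR -INR_IZR_INZ.
have -> : - INR (S m) + 1 = - INR m by rewrite S_INR; ring.
rewrite cf_phi_pos // RtoC_opp => D.
have D2 := is_Dv_of_Wd _ _ _ _ (is_Wd_sqr_comp _ _ _ (is_Wd_Qp r m _ Hr Hs)).
apply: (is_Dv_eq _ _ _ _ (is_Dv_plus _ _ _ _ _ (is_Dv_mult _ _ _ _ _ D (is_Dv_pow u m)) (is_Dv_scal (aP m) _ _ _ D2))).
by rewrite Cpow_mult_l Cpow_S; field.
Qed.

Lemma Phi_mode_pos q rho rho' : R0 < rho < 1 -> R0 < rho' < 1 ->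
  (cf Phi rho (INR q) / rho ^ q + aN q * (spow (1 - r) (rho * rho) * Qn r q (rho * rho)) =
   cf Phi rho' (INR q) / rho' ^ q + aN q * (spow (1 - r) (rho' * rho') * Qn r q (rho' * rho')))%C.
Proof.
apply: (is_Dv_const (fun u => cf Phi u (INR q) / u ^ q + aN q * (spow (1 - r) (u * u) * Qn r q (u * u)))%C) => u Hu.
have Hu0 : RtoC u <> RtoC 0 by move=> /RtoC_inj; lra.
have Hn := Cpow_nz _ q Hu0.
have Hs := Re_1_minus_sqr u ltac:(lra).
have Hu2 : 0 < Re (RtoC u * RtoC u)%C by rewrite -RtoC_mult /=; nra.
have Hs2 : Cmod (1 - RtoC u * RtoC u)%C < 1.
  by rewrite -RtoC_mult -RtoC_minus Cmod_R; apply: Rabs_def1; nra.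
have := Phi_mode u (Z.of_nat q) Hu; rewrite -INR_IZR_INZ -S_INR.
rewrite cf_phi_neg // => D.
have D2 := is_Dv_of_Wd _ _ _ _ (is_Wd_sqr_comp _ _ _ (is_Wd_Qn r q _ Hr Hs Hu2 Hs2)).
apply: (is_Dv_eq _ _ _ _ (is_Dv_plus _ _ _ _ _ (is_Dv_mult _ _ _ _ _ D (is_Dv_powinv u q ltac:(lra))) (is_Dv_scal (aN q) _ _ _ D2))).
by rewrite Cpow_mult_l !Cpow_S; field.
Qed.

Definition bP (m : nat) : C :=
  (cf Phi rho_mid (- INR (S m))%R * rho_mid ^ S m +
    aP m * (spow (1 - r) (rho_mid * rho_mid) * Qp r m (rho_mid * rho_mid)))%C.
Definition bN (q : nat) : C :=
  (cf Phi rho_mid (INR q) / rho_mid ^ q +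
    aN q * (spow (1 - r) (rho_mid * rho_mid) * Qn r q (rho_mid * rho_mid)))%C.

Lemma cf_Phi_neg m rho : R0 < rho < 1 ->
  bP m = (cf Phi rho (- INR (S m))%R * rho ^ S m + aP m * (spow (1 - r) (rho * rho) * Qp r m (rho * rho)))%C.
Proof. by move=> Hrho; apply: Phi_mode_neg => //; rewrite /rho_mid; lra. Qed.

Lemma cf_Phi_pos q rho : R0 < rho < 1 ->
  bN q = (cf Phi rho (INR q) / rho ^ q + aN q * (spow (1 - r) (rho * rho) * Qn r q (rho * rho)))%C.
Proof. by move=> Hrho; apply: Phi_mode_pos => //; rewrite /rho_mid; lra. Qed.

Lemma cf_phi_bounded rho : R0 < rho < 1 -> exists M, forall n, Cmod (cf phi rho n) <= M.
Proof. by move=> Hrho; apply: fourier_bounded; exact: phi_ctsR. Qed.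

Lemma cf_Phi_bounded rho : R0 < rho < 1 -> exists M, forall n, Cmod (cf Phi rho n) <= M.
Proof.
move=> Hrho; apply: fourier_bounded; move: H => [Phia [phib K]].
by apply: (circ_ctsR R0 1 (proj1 HR)) => // w /K [D _]; exact: is_Wd_continuous D.
Qed.

Lemma Phi_dirichlet rho t eps : R0 < rho < 1 -> 0 < eps ->
  exists N0, forall N, (N0 <= N)%nat ->
    Cmod (symsum (fun n => cf Phi rho n * expi (n * t)%R)%C N - circ Phi rho t)%C <= eps.
Proof.
move=> Hrho Heps; move: H => [Phia [phib K]].
set Phib := fun w => (spow (- r) (w * Cconj w) * phi w)%C.
apply: (cf_dirichlet R0 1 (proj1 HR) Phi Phia Phib) => // w /K; tauto.
Qed.

End Modes.

(** * Growth of the coefficients *)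

Lemma den_lower r m : INR (S m) - Cmod r <= Cmod (den r m).
Proof.
have := Cmod_triangle (den r m) r; rewrite (_ : (den r m + r)%C = INR (S m)); last by rewrite /den; ring.
rewrite Cmod_R Rabs_pos_eq; [lra | exact: pos_INR].
Qed.

Lemma den_upper r m : Cmod (den r m) <= INR (S m) + Cmod r.
Proof.
apply: (Rle_trans _ _ _ (Cmod_triangle _ _)).
rewrite Cmod_opp Cmod_R Rabs_pos_eq; [lra | exact: pos_INR].
Qed.

Lemma Bm_S r m : Bm r (S m) = (INR (S m) * Bm r m / den r (S m))%C.
Proof.
rewrite /Bm -/(Bm r m) [Qp r (S m) 0]/= -/(INR (S m)) /Bm /Cdiv Cmult_0_l.
by rewrite Cplus_0_r.
Qed.

Lemma Bm_inv_growth r : not_pos_int r -> forall mu, 1 < mu ->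
  exists M, 0 <= M /\ forall m, Cmod (/ Bm r m)%C <= M * mu ^ m.
Proof.
move=> Hr; apply: (subexponential _ 0 1); try lra; first by move=> n; exact: Cmod_ge_0.
move=> eps Heps; have [N HN] := INR_ratio (1 + Cmod r) eps Heps; exists N => n /HN [Hn _].
have Hp := pos_INR n; have HB := Bm_neq_0 r n Hr; have HI := INR_S_neq_0 n.
have Hd := den_neq_0 r (S n) Hr.
rewrite Bm_S; have -> : (/ (INR (S n) * Bm r n / den r (S n)) = / Bm r n * (den r (S n) / INR (S n)))%C by field.
rewrite Cmod_mult Rmult_0_l Rplus_0_r Rmult_comm; apply: Rmult_le_compat_r; first exact: Cmod_ge_0.
rewrite Cmod_div // Cmod_R Rabs_pos_eq; last exact: pos_INR.
have := den_upper r (S n); rewrite !S_INR => U.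
by apply/Rle_div_l; lra.
Qed.

Lemma Qp_growth r (u : nat -> R) tau : not_pos_int r -> 1 <= tau -> (forall n, 0 <= u n) ->
  (forall m, u (S m) <= (INR (S m) * u m + tau ^ S m) / Cmod (den r (S m))) ->
  forall mu, tau < mu -> exists M, 0 <= M /\ forall m, u m <= M * mu ^ m.
Proof.
move=> Hr Ht Hu H; apply: (subexponential u tau tau) => //; first lra.
move=> eps Heps.
(* This margin turns the lower bound $n+2-|r|$ for the modulus of [den r (S n)] into
   [n + 1 <= (1 + eps) * Cmod (den r (S n))]. *)
have He : 0 < eps / (1 + eps) by apply: Rdiv_lt_0_compat; lra.
have [N HN] := INR_ratio (Cmod r) (eps / (1 + eps)) He; exists N => n /HN [Hn1 Hn2].
have Hp := pos_INR n; have := den_lower r (S n); rewrite !S_INR => D.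
have HD : 0 < Cmod (den r (S n)) by lra.
apply: (Rle_trans _ _ _ (H n)); apply/Rle_div_l => //.
have P := pow_le tau n ltac:(lra); rewrite S_INR -tech_pow_Rmult.
have I1 : INR n + 1 <= (1 + eps) * Cmod (den r (S n)).
  have : (1 + eps) * Cmod r <= eps * (INR n + 1).
    have -> : eps * (INR n + 1) = (1 + eps) * (eps / (1 + eps) * (INR n + 1)) by field; lra.
    by apply: Rmult_le_compat_l; lra.
  nra.
have I2 : (INR n + 1) * u n <= (1 + eps) * Cmod (den r (S n)) * u n by apply: Rmult_le_compat_r.
have I3 : tau * tau ^ n * 1 <= tau * tau ^ n * Cmod (den r (S n)).
  by apply: Rmult_le_compat_l; [nra | lra].
nra.
Qed.

(** Stated for an abstract sequence, because it serves both for the values of [Qn] at a point and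
    for the norms [normQn] on a box. *)
Lemma Qn_growth (u : nat -> R) A tau : 1 <= tau -> 0 <= A -> (forall n, 0 <= u n) ->
  (forall q, u (S q) <= ((INR q + A) * u q + tau ^ S q) / INR (S q)) ->
  forall mu, tau < mu -> exists M, 0 <= M /\ forall q, u q <= M * mu ^ q.
Proof.
move=> Ht HA Hu H; apply: (subexponential u tau tau) => //; first lra.
move=> eps Heps; have [N HN] := INR_ratio A eps Heps; exists N => n /HN [Hn _].
have Hp := pos_INR n.
apply: (Rle_trans _ _ _ (H n)); rewrite S_INR; apply/Rle_div_l; first lra.
have P := pow_le tau n ltac:(lra); rewrite -tech_pow_Rmult.
have I2 : (INR n + A) * u n <= (1 + eps) * (INR n + 1) * u n by apply: Rmult_le_compat_r => //; nra.
have I3 : tau * tau ^ n * 1 <= tau * tau ^ n * (INR n + 1).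
  by apply: Rmult_le_compat_l; nra.
nra.
Qed.

Lemma Qn_growth_at r (t mu : R) : 0 < t < 1 -> / t < mu ->
  exists M, 0 <= M /\ forall q, Cmod (Qn r q t) <= M * mu ^ q.
Proof.
move=> Ht; have Hit : 1 < / t by rewrite -Rinv_1; apply: Rinv_lt_contravar; lra.
apply: (Qn_growth (fun q => Cmod (Qn r q t)) (Cmod r)); try lra; try exact: Cmod_ge_0.
  by move=> n; exact: Cmod_ge_0.
move=> q; rewrite [Qn r (S q) t]/= -/(INR (S q)) -Cpow_S.
have Hp := pos_INR q; have Ht0 : RtoC t <> RtoC 0 by move=> /RtoC_inj; lra.
rewrite Cmod_div; last exact: INR_S_neq_0.
rewrite Cmod_R Rabs_pos_eq; last exact: pos_INR.
apply: Rmult_le_compat_r.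
  by apply: Rlt_le; apply: Rinv_0_lt_compat; rewrite S_INR; lra.
apply: (Rle_trans _ _ _ (Cmod_triangle _ _)); apply: Rplus_le_compat.
  rewrite Cmod_mult; apply: Rmult_le_compat_r; first exact: Cmod_ge_0.
  apply: (Rle_trans _ _ _ (Cmod_triangle _ _)); rewrite Cmod_R Rabs_pos_eq; lra.
rewrite Cmod_inv; last exact: Cpow_nz.
by rewrite Cmod_pow Cmod_R Rabs_pos_eq ?pow_inv; lra.
Qed.

Lemma Gm_bound r (t : R) : 0 <= t < 1 ->
  exists M, 0 <= M /\ forall m, Cmod (Gm r m t) <= M * t ^ S m.
Proof.
move=> Ht; have Hm : Cmod (RtoC t) < 1 by rewrite Cmod_R Rabs_pos_eq; lra.
have A := PS1_asum _ _ _ (PS1_binc r) Hm.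
exists (Series (fun k => Cmod (binc r k * t ^ k)%C)); split.
  by apply: Series_ge_0 => // n; exact: Cmod_ge_0.
move=> m; rewrite /Gm Cmod_mult Cmod_pow Cmod_R Rabs_pos_eq; last lra.
rewrite Rmult_comm; apply: Rmult_le_compat_r; first by apply: pow_le; lra.
apply: Cmod_CSer_le => // k; rewrite !Cmod_mult; apply: Rmult_le_compat_r; first exact: Cmod_ge_0.
rewrite Cmod_inv; last exact: INR_S_neq_0.
rewrite Cmod_R Rabs_pos_eq; last exact: pos_INR.
rewrite -{2}(Rmult_1_r (Cmod (binc r k))); apply: Rmult_le_compat_l; first exact: Cmod_ge_0.
by rewrite -Rinv_1; apply: Rinv_le_contravar; rewrite ?S_INR; move: (pos_INR (m + k)); lra.
Qed.

Section CoefGrowth.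
Variables (r : C) (Hr : not_pos_int r) (R0 : R) (HR : 0 <= R0 < 1) (Phi phi : C -> C).
Hypothesis H : disk_harm r R0 Phi phi.

Lemma aP_growth rho : R0 < rho < 1 -> exists M, 0 <= M /\ forall m, Cmod (aP R0 phi m) <= M / rho ^ m.
Proof.
move=> Hrho; have [M HM] := cf_phi_bounded r R0 HR Phi phi H rho Hrho.
exists M; split; first by apply: Rle_trans (Cmod_ge_0 _) (HM 0).
move=> m; have P : 0 < rho ^ m by apply: pow_lt; lra.
apply/Rle_div_r => //.
have := HM (- INR m); rewrite (cf_phi_pos r R0 HR Phi phi H) // Cmod_mult Cmod_pow Cmod_R Rabs_pos_eq; lra.
Qed.

(** The decay comes from circles close to [R0], whereas [aP] is controlled best by circles close to
    1. *)
Lemma aN_growth rho : R0 < rho < 1 -> exists M, 0 <= M /\ forall q, Cmod (aN R0 phi q) <= M * rho ^ q.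
Proof.
move=> Hrho; have [M HM] := cf_phi_bounded r R0 HR Phi phi H rho Hrho.
have HM0 : 0 <= M by apply: Rle_trans (Cmod_ge_0 _) (HM 0).
exists M; split=> // q; have P : 0 < rho ^ S q by apply: pow_lt; lra.
have := HM (INR (S q)); rewrite (cf_phi_neg r R0 HR Phi phi H) // Cmod_div; last first.
  by apply: Cpow_nz => /RtoC_inj; lra.
rewrite Cmod_pow Cmod_R Rabs_pos_eq; last lra.
move=> /Rle_div_l => /(_ P) B; apply: (Rle_trans _ _ _ B).
apply: Rmult_le_compat_l => //; rewrite /=; have := pow_le rho q ltac:(lra); nra.
Qed.

(** The term with [Qn] is the danger: [Qn] at $\rho^2$ may grow almost like $\rho^{-2q}$, and only
    the decay of [aN] compensates this. *)
Lemma bN_growth : PS1 (bN r R0 Phi phi) 1.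
Proof.
move=> x Hx.
set rho1 := (R0 + 1) / 2.
have H1 : R0 < rho1 < 1 by rewrite /rho1; lra.
set y := Rmax x rho1.
have Hy1 : x <= y by exact: Rmax_l.
have Hy2 : rho1 <= y by exact: Rmax_r.
have Hy3 : y < 1 by apply: Rmax_lub_lt; lra.
(* Since $((1+y)/2)^2>y$, the square of [rho] exceeds [rho1]: the growth of [Qn] at $\rho^2$ is then
   at most that of [(/ rho1) ^ q] and meets the decay [rho1 ^ q] of [aN]. *)
set rho := (1 + y) / 2.
have H2 : y < rho < 1 by rewrite /rho; lra.
have H3 : rho1 < rho * rho by rewrite /rho; nra.
have H4 : / (rho * rho) < / rho1 by apply: Rinv_lt_contravar => //; apply: Rmult_lt_0_compat; nra.
have [M1 HM1] := cf_Phi_bounded r R0 HR Phi phi H rho ltac:(lra).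
have [M2 [HM2 B2]] := aN_growth rho1 H1.
have [M3 [HM3 B3]] := Qn_growth_at r (rho * rho) (/ rho1) ltac:(nra) H4.
set S := Cmod (spow (1 - r) (rho * rho)).
have HS : 0 <= S by exact: Cmod_ge_0.
have HM10 : 0 <= M1 by apply: Rle_trans (Cmod_ge_0 _) (HM1 0).
exists (M1 + M2 * (S * M3)) => q.
rewrite (cf_Phi_pos r Hr R0 HR Phi phi H q rho) //; last lra.
have px0 : 0 <= x ^ q by apply: pow_le; lra.
have px1 : x ^ q <= 1 by rewrite -(pow1 q); apply: pow_incr; lra.
have px2 : x ^ q <= rho ^ q by apply: pow_incr; lra.
have pr : 0 < rho ^ q by apply: pow_lt; lra.
have pr1 : 0 < rho1 ^ q by apply: pow_lt; lra.
apply: (Rle_trans _ ((M1 / rho ^ q + M2 * rho1 ^ q * (S * (M3 * (/ rho1) ^ q))) * x ^ q)).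
  apply: Rmult_le_compat_r => //; apply: (Rle_trans _ _ _ (Cmod_triangle _ _)).
  rewrite Cmod_div; last by apply: Cpow_nz => /RtoC_inj; lra.
  rewrite (Cmod_mult (aN _ _ _)) (Cmod_mult (spow _ _)) Cmod_pow Cmod_R (Rabs_pos_eq rho); last lra.
  apply: Rplus_le_compat.
    by apply: Rmult_le_compat_r; [apply: Rlt_le; exact: Rinv_0_lt_compat | exact: HM1].
  apply: Rmult_le_compat => //; try exact: Cmod_ge_0.
    by apply: Rmult_le_pos => //; exact: Cmod_ge_0.
  by apply: Rmult_le_compat_l => //; rewrite -RtoC_mult.
rewrite pow_inv Rmult_plus_distr_r; apply: Rplus_le_compat.
  have -> : M1 / rho ^ q * x ^ q = M1 * (x ^ q / rho ^ q) by field; lra.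
  rewrite -{2}(Rmult_1_r M1); apply: Rmult_le_compat_l => //.
  by apply/Rle_div_l; lra.
have -> : M2 * rho1 ^ q * (S * (M3 * / rho1 ^ q)) = M2 * (S * M3) by field; lra.
rewrite -{2}(Rmult_1_r (M2 * (S * M3))); apply: Rmult_le_compat_l => //.
by repeat apply: Rmult_le_pos.
Qed.

(* [alpha m] times the solution regular at the origin has the same [|w|^n] part as [Phi] in the mode
   [n = -m-1]; [aK m] is what remains on the other solution. *)
Definition alpha (m : nat) : C := (bP r R0 Phi phi m / Bm r m)%C.
Definition aK (m : nat) : C := (aP R0 phi m - alpha m)%C.

(** Inserting [connection] into [aP - bP / Bm] cancels the terms with [Qp]. What remains,
    [aP m * Gm] and a coefficient of [Phi] times $x^{m+1}$, is of order $x^m$ on the circle of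
    radius $x$, because [Gm] at $x^2$ brings $x^{2m+2}$ against $x^{-m}$ from [aP]. Taking $x$
    between [R0] and [rho] leaves a ratio above 1 for the growth of [/ Bm]. *)
Lemma aK_growth rho : R0 < rho < 1 -> exists M, 0 <= M /\ forall m, Cmod (aK m) <= M * rho ^ m.
Proof.
move=> Hrho; set x := (R0 + rho) / 2.
have Hx : R0 < x < rho by rewrite /x; lra.
have Hx0 : 0 < x by lra.
have [M1 HM1] := cf_Phi_bounded r R0 HR Phi phi H x ltac:(lra).
have HM10 : 0 <= M1 by apply: Rle_trans (Cmod_ge_0 _) (HM1 0).
have [M2 [HM2 B2]] := aP_growth x ltac:(lra).
have [M3 [HM3 B3]] := Gm_bound r (x * x) ltac:(nra).
have [M4 [HM4 B4]] := Bm_inv_growth r Hr (rho / x) ltac:(apply/Rlt_div_r; lra).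
exists (M4 * (M2 * M3 + M1)); split; first by apply: Rmult_le_pos => //; nra.
move=> m; have HB := Bm_neq_0 r m Hr.
have px : 0 < x ^ m by apply: pow_lt.
have E : aK m = (/ Bm r m * (aP R0 phi m * Gm r m (x * x) - cf Phi x (- INR (S m)) * x ^ S m))%C.
  rewrite /aK /alpha (cf_Phi_neg r Hr R0 HR Phi phi H m x); last lra.
  have C := connection r m (x * x) Hr ltac:(nra); rewrite RtoC_mult in C.
  transitivity (/ Bm r m * (aP R0 phi m * Bm r m - (cf Phi x (- INR (S m)) * x ^ S m + aP R0 phi m * (spow (1 - r) (x * x) * Qp r m (x * x)))))%C; first by field.
  by rewrite {2}C; ring.
rewrite E Cmod_mult.
have I1 : Cmod (aP R0 phi m * Gm r m (x * x) - cf Phi x (- INR (S m)) * x ^ S m)%C <= (M2 * M3 + M1) * x ^ m.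
  apply: (Rle_trans _ _ _ (Cmod_triangle _ _)); rewrite Cmod_opp (Cmod_mult (aP _ _ _)) (Cmod_mult (cf _ _ _)) Rmult_plus_distr_r.
  apply: Rplus_le_compat.
    apply: (Rle_trans _ (M2 / x ^ m * (M3 * (x * x) ^ S m))).
      by apply: Rmult_le_compat; try exact: Cmod_ge_0; [exact: B2 | rewrite -RtoC_mult; exact: B3].
    have -> : M2 / x ^ m * (M3 * (x * x) ^ S m) = M2 * M3 * x ^ m * (x * x).
      by rewrite /= Rpow_mult_distr; field; lra.
    rewrite -{2}(Rmult_1_r (M2 * M3 * x ^ m)); apply: Rmult_le_compat_l; last nra.
    by repeat apply: Rmult_le_pos => //; lra.
  rewrite Cmod_pow Cmod_R Rabs_pos_eq; last lra.
  apply: Rmult_le_compat => //; try exact: Cmod_ge_0; first by apply: pow_le; lra.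
  rewrite /=; nra.
apply: (Rle_trans _ ((M4 * (rho / x) ^ m) * ((M2 * M3 + M1) * x ^ m))).
  by apply: Rmult_le_compat => //; exact: Cmod_ge_0.
apply: Req_le; rewrite /Rdiv Rpow_mult_distr pow_inv; field; lra.
Qed.

(** Read from [alpha = aP - aK]: the first term is controlled by circles near 1 and the second even
    decays, so [bP] itself need not be bounded. *)
Lemma alpha_growth : PS1 alpha 1.
Proof.
move=> x Hx; set rho := (Rmax x R0 + 1) / 2.
have h1 := Rmax_l x R0; have h2 := Rmax_r x R0.
have h3 : Rmax x R0 < 1 by apply: Rmax_lub_lt; lra.
have Hrho : R0 < rho < 1 /\ x < rho by rewrite /rho; lra.
have [M1 [HM1 B1]] := aP_growth rho (proj1 Hrho).
have [M2 [HM2 B2]] := aK_growth rho (proj1 Hrho).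
exists (M1 + M2) => m.
have -> : alpha m = (aP R0 phi m - aK m)%C by rewrite /aK; ring.
have pr : 0 < rho ^ m by apply: pow_lt; lra.
have px0 : 0 <= x ^ m by apply: pow_le; lra.
have px1 : x ^ m <= 1 by rewrite -(pow1 m); apply: pow_incr; lra.
have pr1 : rho ^ m <= 1 by rewrite -(pow1 m); apply: pow_incr; lra.
have px2 : x ^ m <= rho ^ m by apply: pow_incr; lra.
apply: (Rle_trans _ ((M1 / rho ^ m + M2 * rho ^ m) * x ^ m)).
  apply: Rmult_le_compat_r => //; apply: (Rle_trans _ _ _ (Cmod_triangle _ _)).
  by rewrite Cmod_opp; apply: Rplus_le_compat.
rewrite Rmult_plus_distr_r; apply: Rplus_le_compat.
  have -> : M1 / rho ^ m * x ^ m = M1 * (x ^ m / rho ^ m) by field; lra.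
  rewrite -{2}(Rmult_1_r M1); apply: Rmult_le_compat_l => //.
  by apply/Rle_div_l; lra.
rewrite Rmult_assoc -{2}(Rmult_1_r M2); apply: Rmult_le_compat_l => //; nra.
Qed.

End CoefGrowth.

(** * The globally harmonic part *)

Lemma CSer_shift (v : nat -> C) j : asum v ->
  CSer (fun k => if Nat.leb j k then v (k - j)%nat else 0) = CSer v /\
  asum (fun k => if Nat.leb j k then v (k - j)%nat else 0).
Proof.
move=> H; elim: j => [|j [IH1 IH2]].
  by split; [apply: CSer_ext | apply: asum_ext H] => k /=; rewrite Nat.sub_0_r.
have [A E] := CSer_S (fun k => if Nat.leb (S j) k then v (k - S j)%nat else 0) IH2.
split=> //; rewrite E -IH1 /=; ring.
Qed.

(* The function on the disk with holomorphic part [sum b_j w^j] and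
   [d/dwbar = (1 - |w|^2)^(-r) sum al_m wbar^m]. *)
Definition Gcoef (r : C) (b al : nat -> C) (j l : nat) : C :=
  match l with
  | O => b j
  | S k => if Nat.leb j k then (al (k - j)%nat * binc r j / INR (S k))%C else 0
  end.

Definition Gd (r : C) (b al : nat -> C) (w : C) : C := DSf (Gcoef r b al) w (Cconj w).

Section Gdisk.
Variables (r : C) (b al : nat -> C) (Hb : PS1 b 1) (Hal : PS1 al 1).

Lemma PD_Gcoef : PD (Gcoef r b al) 1.
Proof.
move=> x Hx.
have [M1 B1] := Hb x Hx; have [M2 B2] := Hal x Hx; have [M3 B3] := PS1_binc r x Hx.
exists (Rmax M1 (Rmax 0 (M2 * M3))) => j [|k] /=.
  by rewrite Nat.add_0_r; apply: Rle_trans (B1 j) (Rmax_l _ _).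
apply: Rle_trans (Rmax_r _ _); case: (Nat.leb_spec j k) => Hjk; last first.
  by rewrite Cmod_0 Rmult_0_l; exact: Rmax_l.
apply: Rle_trans (Rmax_r _ _); rewrite -/(INR (S k)).
rewrite Cmod_div; last exact: INR_S_neq_0.
rewrite Cmod_R Rabs_pos_eq; last exact: pos_INR.
(* For $j\le k$ the exponent is split so that $k-j$ goes with [al] and one [j] with [binc]; the
   surplus power is at most 1. *)
have E : (j + S k)%nat = (S j + ((k - j) + j))%nat by lia.
have px n : 0 <= x ^ n by apply: pow_le; lra.
have px1 n : x ^ n <= 1 by rewrite -(pow1 n); apply: pow_incr; lra.
rewrite E !pow_add.
have G := Cmod_ge_0.
have Ik : / INR (S k) <= 1.
  by rewrite -Rinv_1; apply: Rinv_le_contravar; rewrite ?S_INR; move: (pos_INR k); lra.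
have Ik0 : 0 <= / INR (S k) by apply: Rlt_le; apply: Rinv_0_lt_compat; rewrite S_INR; move: (pos_INR k); lra.
rewrite Cmod_mult /Rdiv.
have -> : Cmod (al (k - j)%nat) * Cmod (binc r j) * / INR (S k) * (x ^ S j * (x ^ (k - j) * x ^ j)) =
  (Cmod (al (k - j)%nat) * x ^ (k - j)) * (Cmod (binc r j) * x ^ j) * (/ INR (S k) * x ^ S j) by ring.
have I1 : (Cmod (al (k - j)%nat) * x ^ (k - j)) * (Cmod (binc r j) * x ^ j) <= M2 * M3.
  by apply: Rmult_le_compat => //; apply: Rmult_le_pos.
have I2 : / INR (S k) * x ^ S j <= 1.
  by rewrite -(Rmult_1_r 1); apply: Rmult_le_compat.
have I3 : 0 <= / INR (S k) * x ^ S j by apply: Rmult_le_pos.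
have I4 : 0 <= (Cmod (al (k - j)%nat) * x ^ (k - j)) * (Cmod (binc r j) * x ^ j).
  by repeat apply: Rmult_le_pos.
nra.
Qed.

Definition unit_disk (w : C) : Prop := Cmod w < 1.

Lemma open_unit_disk : open unit_disk.
Proof.
move=> w Hw; apply/locally_Cmod; exists (1 - Cmod w); split; first by move: Hw; rewrite /unit_disk; lra.
move=> h Hh; apply: (Rle_lt_trans _ _ _ (Cmod_triangle _ _)); lra.
Qed.

Lemma Sm_Gd k : Sm k unit_disk (Gd r b al).
Proof.
apply: (Sm_DSf 1 unit_disk (fun w => w) Cconj open_unit_disk) => //.
- by move=> z Hz; rewrite Cmod_conj.
- by move=> n; apply: Sm_id; exact: open_unit_disk.
- by move=> n; apply: (Sm_conj _ _ (fun z => z)); [exact: open_unit_disk | apply: Sm_id; exact: open_unit_disk].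
- exact: PD_Gcoef.
Qed.

Lemma disk_mod_sqr (w : C) : Cmod w < 1 -> Cmod (w * Cconj w)%C < 1.
Proof. by move=> H; rewrite Cmod_mult Cmod_conj; have := Cmod_ge_0 w; nra. Qed.

(** Differentiation in $\bar w$ removes the denominators and leaves $\sum_{j\le
    k}\beta_j\alpha_{k-j}w^j\bar w^k$, which factors into the binomial series in $w\bar w$ and the
    series of [al] in $\bar w$. *)
Lemma Gd_wbar w : Cmod w < 1 ->
  is_Wd (Gd r b al) w (dz (Gd r b al) w) (spow (- r) (w * Cconj w) * OSer al (Cconj w)).
Proof.
move=> Hw.
have Hc : Cmod (Cconj w) < 1 by rewrite Cmod_conj.
have D := is_Wd_DSf _ 1 (fun w => w) Cconj w _ _ _ _ PD_Gcoef Hw Hc (is_Wd_id w) (is_Wd_conj_id w).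
have [E1 _] := is_Wd_dz _ _ _ _ D.
apply: (is_Wd_eq _ _ _ _ _ _ D); first by rewrite -E1.
have A := PS1_asum _ _ _ Hal Hc.
have -> : DSf (gQ (Gcoef r b al)) w (Cconj w) = (OSer (binc r) (w * Cconj w) * OSer al (Cconj w))%C.
  rewrite Cmult_comm {2}/OSer -CSer_scal; last first.
    by apply: (PS1_asum _ _ _ (PS1_binc r)); exact: disk_mod_sqr.
  apply: CSer_ext => j.
  have [E A'] := CSer_shift (fun m => al m * Cconj w ^ m)%C j A.
  transitivity (binc r j * (w * Cconj w) ^ j * CSer (fun k => if Nat.leb j k then al (k - j)%nat * Cconj w ^ (k - j) else 0))%C; last by rewrite E /OSer; ring.
  rewrite -CSer_scal //; apply: CSer_ext => k; rewrite /gQ /Gcoef.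
  case: (Nat.leb_spec j k) => Hjk; last by ring.
  have -> : (Cconj w ^ k = Cconj w ^ j * Cconj w ^ (k - j))%C by rewrite -Cpow_add_r; congr Cpow; lia.
  by rewrite Cpow_mult_l; field; exact: INR_S_neq_0.
have -> : (w * Cconj w)%C = RtoC (Cmod w ^ 2) by rewrite Cmod2_conj.
rewrite binomial_series; first by ring.
have := Cmod_ge_0 w; nra.
Qed.

(** Regroups the double series by the index of [al], that is by Fourier modes, the form in which it
    is compared with the expansion of [Phi]. *)
Lemma Gd_expand w : Cmod w < 1 ->
  Gd r b al w = (OSer b w +
   CSer (fun m => al m * (Cconj w ^ S m * OSer (fun k => binc r k / INR (S (m + k))) (w * Cconj w))))%C.
Proof.
move=> Hw.
have Hc : Cmod (Cconj w) < 1 by rewrite Cmod_conj.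
have A := PS1_asum _ _ _ Hal Hc.
have AB := PS1_asum _ _ _ (PS1_binc r) (disk_mod_sqr _ Hw).
have Ab := PS1_asum _ _ _ Hb Hw.
have G := Cmod_ge_0.
set u := fun m j => (al m * binc r j / INR (S (m + j)) * (w ^ j * Cconj w ^ S (m + j)))%C.
have B m j : Cmod (u m j) <= Cmod (al m * Cconj w ^ m)%C * Cmod (binc r j * (w * Cconj w) ^ j)%C.
  have -> : u m j = ((al m * Cconj w ^ m) * (binc r j * (w * Cconj w) ^ j) * (Cconj w / INR (S (m + j))))%C.
    by rewrite /u Cpow_S Cpow_add_r Cpow_mult_l; field; exact: INR_S_neq_0.
  rewrite Cmod_mult (Cmod_mult (_ * _)) -[X in _ <= X]Rmult_1_r; apply: Rmult_le_compat_l.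
    exact: Rmult_le_pos.
  rewrite Cmod_div; last exact: INR_S_neq_0.
  rewrite Cmod_R Rabs_pos_eq; last exact: pos_INR.
  have Hp : 0 < INR (S (m + j)) by apply: lt_0_INR; lia.
  apply/Rle_div_l => //; rewrite S_INR; have := pos_INR (m + j); lra.
have Au j : asum (fun m => u m j).
  apply: (asum_le _ _ (fun m => B m j)).
  exact: (ex_series_scal_r (Cmod (binc r j * (w * Cconj w) ^ j)%C) (fun m => Cmod (al m * Cconj w ^ m)%C)).
have Row j : CSer (fun l => Gcoef r b al j l * (w ^ j * Cconj w ^ l))%C = (b j * w ^ j + CSer (fun m => u m j))%C.
  have [E A'] := CSer_shift (fun m => u m j) j (Au j).
  have P k : (if Nat.leb j k then u (k - j)%nat j else 0) = (Gcoef r b al j (S k) * (w ^ j * Cconj w ^ S k))%C.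
    rewrite /Gcoef; case: (Nat.leb_spec j k) => Hjk; last by ring.
    by rewrite /u (_ : (k - j + j)%nat = k); last lia.
  have A'' := asum_ext _ _ P A'.
  have [_ ->] := CSer_S (fun l => Gcoef r b al j l * (w ^ j * Cconj w ^ l))%C A''.
  by rewrite -(CSer_ext _ _ P) E /=; ring.
rewrite /Gd /DSf /DS (CSer_ext _ _ Row).
have S1 : ex_series (fun m => Cmod (al m * Cconj w ^ m)%C) := A.
have S2 : ex_series (fun j => Cmod (binc r j * (w * Cconj w) ^ j)%C) := AB.
have Au2 : asum (fun j => CSer (fun m => u m j)).
  apply: (asum_le _ (fun j => Series (fun m => Cmod (al m * Cconj w ^ m)%C) * Cmod (binc r j * (w * Cconj w) ^ j)%C)).
    move=> j; rewrite -Series_scal_r; apply: Cmod_CSer_le => //.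
    exact: (ex_series_scal_r (Cmod (binc r j * (w * Cconj w) ^ j)%C) (fun m => Cmod (al m * Cconj w ^ m)%C)).
  exact: (ex_series_scal_l (Series (fun m => Cmod (al m * Cconj w ^ m)%C))).
rewrite CSer_plus // -/(OSer b w); congr (_ + _)%C.
rewrite -(CSer_Fubini u _ _ B) //.
apply: CSer_ext => m; rewrite /OSer -CSer_scal; last first.
  by apply: (PS1_asum _ _ _ (PS1_Gm r m)); exact: disk_mod_sqr.
rewrite -CSer_scal; last first.
  by apply: asum_scal; apply: (PS1_asum _ _ _ (PS1_Gm r m)); exact: disk_mod_sqr.
apply: CSer_ext => j; rewrite /u !Cpow_S Cpow_add_r Cpow_mult_l; field; exact: INR_S_neq_0.
Qed.

Lemma Gd_expand_asum w : Cmod w < 1 ->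
  asum (fun m => al m * (Cconj w ^ S m * OSer (fun k => binc r k / INR (S (m + k))) (w * Cconj w)))%C.
Proof.
move=> Hw.
have Hc : Cmod (Cconj w) < 1 by rewrite Cmod_conj.
have A := PS1_asum _ _ _ Hal Hc.
have AB := PS1_asum _ _ _ (PS1_binc r) (disk_mod_sqr _ Hw).
have G := Cmod_ge_0.
set N := Series (fun j => Cmod (binc r j * (w * Cconj w) ^ j)%C).
have HN : 0 <= N by apply: Series_ge_0.
apply: (asum_le _ (fun m => Cmod (al m * Cconj w ^ m)%C * N)); last first.
  exact: (ex_series_scal_r N (fun m => Cmod (al m * Cconj w ^ m)%C)).
move=> m; rewrite Cpow_S.
have -> : (al m * (Cconj w * Cconj w ^ m * OSer (fun k => binc r k / INR (S (m + k))) (w * Cconj w)) =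
  (al m * Cconj w ^ m) * (Cconj w * OSer (fun k => binc r k / INR (S (m + k))) (w * Cconj w)))%C by ring.
rewrite Cmod_mult; apply: Rmult_le_compat_l => //; rewrite Cmod_mult.
have I : Cmod (OSer (fun k => binc r k / INR (S (m + k))) (w * Cconj w))%C <= N.
  apply: Cmod_CSer_le => // k; rewrite !(Cmod_mult _ (_ ^ _)); apply: Rmult_le_compat_r => //.
  rewrite Cmod_div; last exact: INR_S_neq_0.
  rewrite Cmod_R Rabs_pos_eq; last exact: pos_INR.
  have Hp : 0 < INR (S (m + k)) by apply: lt_0_INR; lia.
  by apply/Rle_div_l => //; rewrite S_INR; have := pos_INR (m + k); have := G (binc r k); nra.
have := G (Cconj w); have := G (OSer (fun k => binc r k / INR (S (m + k))) (w * Cconj w))%C; nra.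
Qed.

End Gdisk.

(** * Summing the Fourier modes: the remainder on the exponent $1-r$ *)

Lemma polar (w : C) : w <> RtoC 0 -> exists t, w = (RtoC (Cmod w) * expi t)%C.
Proof.
move=> Hw; have Hm : 0 < Cmod w by apply Cmod_gt_0.
have Hm0 : RtoC (Cmod w) <> RtoC 0 by move=> /RtoC_inj; lra.
set x := Re w / Cmod w; set y := Im w / Cmod w.
have E : x * x + y * y = 1.
  have := Cmod2_alt w; rewrite /x /y => E.
  have -> : Re w / Cmod w * (Re w / Cmod w) + Im w / Cmod w * (Im w / Cmod w) = (Re w ^ 2 + Im w ^ 2) / Cmod w ^ 2 by field; lra.
  by rewrite -E; field; lra.
have Hx : -1 <= x <= 1 by nra.
have Es : sqrt (1 - x²) = Rabs y.
  by rewrite -sqrt_Rsqr_abs; congr sqrt; rewrite /Rsqr; lra.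
suff [t Ht] : exists t, expi t = (x, y).
  exists t; rewrite Ht; apply: C_ext; rewrite /Re /Im /= /x /y /Re /Im; field; lra.
case: (Rle_dec 0 y) => Hy.
  by exists (acos x); rewrite /expi cos_acos // sin_acos // Es Rabs_pos_eq.
exists (- acos x); rewrite /expi cos_neg sin_neg cos_acos // sin_acos // Es Rabs_left ?Ropp_involutive //; lra.
Qed.

(** The part of [Phi] with exponent $1-r$, divided by $s^{1-r}$ and multiplied by the $w$ of
    $1/f_r$; that factor raises each mode by one, to [q + 1] and [-m]. The minus sign comes from
    solving [cf_Phi_pos] and [cf_Phi_neg] for the coefficients of [Phi]. *)
Definition Kcirc (r : C) (an ak : nat -> C) (w : C) : C :=
  (- (CSer (fun q => an q * (w ^ S q * Qn r q (w * Cconj w)))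
      + CSer (fun m => ak m * (/ w ^ m * Qp r m (w * Cconj w)))))%C.

Lemma symsum_CSer (c : R -> C) (l : C) :
  asum (fun q => c (INR q)) -> asum (fun m => c (- INR (S m))%R) ->
  (forall eps, 0 < eps -> exists N0, forall N, (N0 <= N)%nat -> Cmod (symsum c N - l)%C <= eps) ->
  l = (CSer (fun q => c (INR q)) + CSer (fun m => c (- INR (S m))%R))%C.
Proof.
move=> A1 A2 H; apply: Cminus_eq; apply: Cmod_eq_0; apply: Rle_antisym; last exact: Cmod_ge_0.
apply: le_epsilon => eps Heps; rewrite Rplus_0_l.
have He : 0 < eps / 3 by lra.
have [N1 K1] := H _ He; have [N2 K2] := CSer_cvg _ A1 _ He; have [N3 K3] := CSer_cvg _ A2 _ He.
have B1 := K1 (N1 + N2 + N3)%nat ltac:(lia); have B2 := K2 (N1 + N2 + N3)%nat ltac:(lia).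
have B3 := K3 (N1 + N2 + N3)%nat ltac:(lia); move: B1 B2 B3; rewrite /symsum.
set U := sum_n (fun n => c (INR n)) _; set V := sum_n (fun m => c (- INR (S m))%R) _.
set X := CSer _; set Y := CSer _ => B1 B2 B3.
have -> : (l - (X + Y) = - (U + V - l) + ((U - X) + (V - Y)))%C by ring.
apply: (Rle_trans _ _ _ (Cmod_triangle _ _)); rewrite Cmod_opp.
apply: (Rle_trans _ _ _ (Rplus_le_compat_l _ _ _ (Cmod_triangle _ _))); lra.
Qed.

Lemma expi_INR n t : expi (INR n * t) = (expi t ^ n)%C.
Proof.
elim: n => [|n IH]; first by rewrite /= Rmult_0_l expi_0.
by rewrite S_INR Rmult_plus_distr_r Rmult_1_l expi_plus IH Cpow_S Cmult_comm.
Qed.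

(** The identity holds mode by mode and is summed by the pointwise convergence of the Fourier
    series. Summability of the two remainder series is assumed here, as it will come from the same
    majorants as their analyticity. *)
Lemma K_expand r R0 Phi phi w : not_pos_int r -> 0 <= R0 < 1 -> disk_harm r R0 Phi phi ->
  Ann R0 1 w ->
  let t := (w * Cconj w)%C in
  asum (fun q => aN R0 phi q * (w ^ S q * Qn r q t))%C ->
  asum (fun m => aK r R0 Phi phi m * (/ w ^ m * Qp r m t))%C ->
  (w * (Phi w - Gd r (bN r R0 Phi phi) (alpha r R0 Phi phi) w) =
   spow (1 - r) t * Kcirc r (aN R0 phi) (aK r R0 Phi phi) w)%C.
Proof.
move=> Hr HR H Hw t A1 A2.
have Hb := bN_growth r Hr R0 HR Phi phi H; have Hal := alpha_growth r Hr R0 HR Phi phi H.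
have [Hw0 Hw1] := Hw.
have Hwn : w <> RtoC 0 by apply/Cmod_gt_0; lra.
have [th Eth] := polar w Hwn.
have Hrho : R0 < Cmod w < 1 by lra.
move: (Cmod w) Eth Hrho => rho Eth Hrho.
have Hrn : RtoC rho <> RtoC 0 by move=> /RtoC_inj; lra.
have Et : t = (RtoC rho * RtoC rho)%C by rewrite /t Eth circ_sqr.
set b := bN r R0 Phi phi in Hb *; set al := alpha r R0 Phi phi in Hal *.
set an := aN R0 phi in A1 *; set ak := aK r R0 Phi phi in A2 *.
set S0 := spow (1 - r) t.
have Eq q : (cf Phi rho (INR q) * expi (INR q * th) = b q * w ^ q + (- S0 / w) * (an q * (w ^ S q * Qn r q t)))%C.
  have B := cf_Phi_pos r Hr R0 HR Phi phi H q rho Hrho; rewrite -Et -/S0 in B.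
  have Hp := Cpow_nz _ q Hrn.
  have Ew : expi th = (w / rho)%C by rewrite Eth; field.
  have Hwq := Cpow_nz _ q Hwn.
  rewrite /b B expi_INR Cpow_S Ew /Cdiv Cpow_mult_l Cpow_inv // -/an; by field.
(* Writing [bP] as [al m * Bm] and expanding [Bm] by [connection] turns [al m] into a multiple of
   the regular solution [Gm]; only [aP - al], that is [ak], is left on [Qp]. *)
have Em m : (cf Phi rho (- INR (S m)) * expi (- INR (S m) * th) =
   al m * (Cconj w ^ S m * OSer (fun k => binc r k / INR (S (m + k))) t) + (- S0 / w) * (ak m * (/ w ^ m * Qp r m t)))%C.
  have B := cf_Phi_neg r Hr R0 HR Phi phi H m rho Hrho; rewrite -Et -/S0 in B.
  have Cn := connection r m (rho * rho) Hr ltac:(nra); rewrite RtoC_mult -Et -/S0 in Cn.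
  have HB := Bm_neq_0 r m Hr.
  have Hp := Cpow_nz _ (S m) Hrn; have Hwm := Cpow_nz _ m Hwn; have Hws := Cpow_nz _ (S m) Hwn.
  have He := Cpow_nz _ (S m) (expi_neq_0 th).
  have Ex : expi (- INR (S m) * th) = (rho ^ S m / w ^ S m)%C.
    by rewrite Ropp_mult_distr_l_reverse expi_opp expi_INR Eth Cpow_mult_l; field.
  have Eg : (al m * (Cconj w ^ S m * OSer (fun k => binc r k / INR (S (m + k))) t) = al m * Gm r m t / w ^ S m)%C.
    by rewrite /Gm /t Cpow_mult_l; field.
  have Ea : (al m * Bm r m = bP r R0 Phi phi m)%C by rewrite /al /alpha; field.
  rewrite Eg Ex.
  have -> : (cf Phi rho (- INR (S m)) * (rho ^ S m / w ^ S m) = (bP r R0 Phi phi m - aP R0 phi m * (S0 * Qp r m t)) / w ^ S m)%C.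
    by rewrite B; field.
  have -> : aP R0 phi m = (ak m + al m)%C by rewrite /ak /aK -/al; ring.
  rewrite -Ea Cn Cpow_S; by field.
have Ab := PS1_asum _ _ _ Hb Hw1.
have Ag := Gd_expand_asum r al Hal w Hw1; rewrite -/t in Ag.
have A1' := asum_scal (- S0 / w) _ A1; have A2' := asum_scal (- S0 / w) _ A2.
have L := symsum_CSer (fun n => cf Phi rho n * expi (n * th)%R)%C (circ Phi rho th)
  (asum_ext _ _ (fun q => eq_sym (Eq q)) (asum_plus _ _ Ab A1'))
  (asum_ext _ _ (fun q => eq_sym (Em q)) (asum_plus _ _ Ag A2'))
  (fun eps => Phi_dirichlet r R0 HR Phi phi H rho th eps Hrho).
rewrite {1}/circ -Eth in L.
rewrite L (CSer_ext _ _ Eq) (CSer_ext _ _ Em) !CSer_plus // !CSer_scal //.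
rewrite (Gd_expand r b al Hb Hal w Hw1) -/t /Kcirc -/t -/S0 /OSer -/(OSer _ _); by field.
Qed.

(** * Normed algebras of real-analytic germs *)

Lemma sum_n_Series (v : nat -> nat -> R) n : (forall j, ex_series (v j)) ->
  ex_series (fun i => sum_n (fun j => v j i) n) /\
  sum_n (fun j => Series (v j)) n = Series (fun i => sum_n (fun j => v j i) n).
Proof.
move=> H; elim: n => [|n [IH1 IH2]].
  split; first by apply: ex_series_ext (H 0%nat) => i; rewrite sum_O.
  by rewrite sum_O; apply: Series_ext => i; rewrite sum_O.
have E i : sum_n (fun j => v j i) n + v (S n) i = sum_n (fun j => v j i) (S n) by rewrite sum_Sn.
split.
  apply: ex_series_ext E _; exact: (ex_series_plus (fun i => sum_n (fun j => v j i) n) (v (S n))).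
rewrite sum_Sn IH2 -(Series_ext _ _ E).
by rewrite (Series_plus (fun i => sum_n (fun j => v j i) n) (v (S n))).
Qed.

Lemma sum_n_shift (v : nat -> R) n : sum_n v (S n) = v 0%nat + sum_n (fun i => v (S i)) n.
Proof.
elim: n => [|n IH]; first by rewrite sum_Sn !sum_O.
by rewrite sum_Sn IH sum_Sn /plus /=; ring.
Qed.

Lemma sum_n_nonneg (v : nat -> R) n : (forall i, 0 <= v i) -> 0 <= sum_n v n.
Proof. by move=> H; elim: n => [|n IH]; rewrite ?sum_O // sum_Sn /plus /=; move: (H (S n)); lra. Qed.

Lemma sum_n_term_le (v : nat -> R) n j : (forall i, 0 <= v i) -> (j <= n)%nat -> v j <= sum_n v n.
Proof.
move=> H; elim: n => [|n IH] Hj.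
  by rewrite sum_O (_ : j = 0%nat); [lra | lia].
rewrite sum_Sn /plus /=; case: (Nat.eq_dec j (S n)) => [-> | Hne].
  by have := sum_n_nonneg v n H; lra.
by have := IH ltac:(lia); move: (H (S n)); lra.
Qed.

Lemma sum_n_le_idx (v : nat -> R) m n : (forall i, 0 <= v i) -> (m <= n)%nat -> sum_n v m <= sum_n v n.
Proof.
move=> H; elim: n => [|n IH] Hm; first by rewrite (_ : m = 0%nat); [lra | lia].
case: (Nat.eq_dec m (S n)) => [-> | Hne]; first lra.
by rewrite sum_Sn /plus /=; have := IH ltac:(lia); move: (H (S n)); lra.
Qed.

Lemma sum_n_le_ext (u v : nat -> R) n : (forall i, u i <= v i) -> sum_n u n <= sum_n v n.
Proof. by move=> H; elim: n => [|n IH]; rewrite ?sum_O // !sum_Sn /plus /=; move: (H (S n)); lra. Qed.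

Lemma dsumR_term_le (b : nat -> nat -> R) n j k : (forall j k, 0 <= b j k) -> (j <= n)%nat -> (k <= n)%nat -> b j k <= dsumR b n.
Proof.
move=> H Hj Hk; apply: Rle_trans (sum_n_term_le (fun j => sum_n (b j) n) n j _ Hj).
  exact: sum_n_term_le.
by move=> i; exact: sum_n_nonneg.
Qed.

Lemma dsumR_le (b c : nat -> nat -> R) n : (forall j k, b j k <= c j k) -> dsumR b n <= dsumR c n.
Proof. by move=> H; apply: sum_n_le_ext => j; exact: sum_n_le_ext. Qed.

Lemma dsumR_bound (b : nat -> nat -> R) M : (forall j k, 0 <= b j k) -> (forall n, dsumR b n <= M) ->
  forall j k, b j k <= M.
Proof.
move=> H HM j k; apply: Rle_trans (HM (j + k)%nat); apply: dsumR_term_le => //; lia.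
Qed.

Lemma sum_n_scal_r (v : nat -> R) c n : sum_n (fun i => v i * c) n = sum_n v n * c.
Proof. by elim: n => [|n IH]; rewrite ?sum_O // !sum_Sn IH /plus /=; ring. Qed.

Lemma dsumR_scal b c n : dsumR (fun j k => b j k * c) n = dsumR b n * c.
Proof.
rewrite /dsumR -sum_n_scal_r; apply: sum_n_ext => j; exact: sum_n_scal_r.
Qed.

Lemma sum_n_plusR (u v : nat -> R) n : sum_n (fun i => u i + v i) n = sum_n u n + sum_n v n.
Proof. by elim: n => [|n IH]; rewrite ?sum_O // !sum_Sn IH /plus /=; ring. Qed.

Lemma dsumR_plus b c n : dsumR (fun j k => b j k + c j k) n = dsumR b n + dsumR c n.
Proof.
rewrite /dsumR -sum_n_plusR; apply: sum_n_ext => j; exact: sum_n_plusR.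
Qed.

(** [real_analytic_on] expresses absolute convergence by square partial sums, while the series here
    are iterated; this lemma passes from one to the other. *)
Lemma iterated_bound (b : nat -> nat -> R) M : (forall j k, 0 <= b j k) -> (forall n, dsumR b n <= M) ->
  (forall j, ex_series (b j)) /\ ex_series (fun j => Series (b j)) /\ Series (fun j => Series (b j)) <= M.
Proof.
move=> H HM.
have R m n : sum_n (fun j => sum_n (b j) n) m <= M.
  apply: Rle_trans (HM (m + n)%nat); rewrite /dsumR.
  apply: (Rle_trans _ (sum_n (fun j => sum_n (b j) n) (m + n))).
    by apply: sum_n_le_idx; [move=> i; exact: sum_n_nonneg | lia].
  by apply: sum_n_le_ext => j; apply: sum_n_le_idx; [exact: H | lia].
have E j : ex_series (b j).
  apply: (ex_series_bounded _ M) => // n.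
  apply: Rle_trans (R j n); apply: (sum_n_term_le (fun j => sum_n (b j) n)) => //.
  by move=> i; exact: sum_n_nonneg.
have P m : sum_n (fun j => Series (b j)) m <= M.
  have [E1 ->] := sum_n_Series b m E; apply: Series_le_bound => // n.
  by rewrite sum_n_switch.
have HS j : 0 <= Series (b j) by apply: Series_ge_0.
split=> //; have ES := ex_series_bounded _ M HS P; split=> //.
exact: Series_le_bound.
Qed.

Definition box (z0 : C) (rho : R) (z : C) : Prop :=
  Rabs (Re z - Re z0) < rho /\ Rabs (Im z - Im z0) < rho.

Definition mono (z0 z : C) (j k : nat) : C :=
  (RtoC (Re z - Re z0) ^ j * RtoC (Im z - Im z0) ^ k)%C.

(** Norm at most [N] in the Banach algebra of power series in the two real coordinates, with the
    weighted $\ell^1$ norm of the coefficients. [N] is only an upper bound, so that sums and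
    products need no exact norms. *)
Definition An (z0 : C) (rho : R) (f : C -> C) (N : R) : Prop :=
  exists a : nat -> nat -> C,
    (forall n, dsumR (fun j k => Cmod (a j k) * rho ^ (j + k)) n <= N) /\
    forall z, box z0 rho z -> f z = DS (fun j k => a j k * mono z0 z j k)%C.

Lemma box_ratio z0 rho z : 0 < rho -> box z0 rho z ->
  exists q, 0 <= q < 1 /\ forall j k, Cmod (mono z0 z j k) <= rho ^ (j + k) * q ^ (j + k).
Proof.
move=> Hr [Hx Hy].
set q := Rmax (Rabs (Re z - Re z0)) (Rabs (Im z - Im z0)) / rho.
have H1 := Rmax_l (Rabs (Re z - Re z0)) (Rabs (Im z - Im z0)).
have H2 := Rmax_r (Rabs (Re z - Re z0)) (Rabs (Im z - Im z0)).
have P1 := Rabs_pos (Re z - Re z0); have P2 := Rabs_pos (Im z - Im z0).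
exists q; split.
  split; first by apply: Rdiv_le_0_compat; lra.
  by apply/Rlt_div_l => //; rewrite Rmult_1_l; apply: Rmax_lub_lt.
move=> j k; rewrite /mono Cmod_mult !Cmod_pow !Cmod_R -Rpow_mult_distr.
have -> : rho * q = Rmax (Rabs (Re z - Re z0)) (Rabs (Im z - Im z0)) by rewrite /q; field; lra.
rewrite pow_add; apply: Rmult_le_compat; try (by apply: pow_le); apply: pow_incr; lra.
Qed.

Section AnAlgebra.
Variables (z0 : C) (rho : R) (Hrho : 0 < rho).

Let bnonneg (a : nat -> nat -> C) j k : 0 <= Cmod (a j k) * rho ^ (j + k).
Proof. by apply: Rmult_le_pos; [exact: Cmod_ge_0 | apply: pow_le; lra]. Qed.

Lemma An_geo a N z : (forall n, dsumR (fun j k => Cmod (a j k) * rho ^ (j + k)) n <= N) ->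
  box z0 rho z -> exists q, 0 <= q < 1 /\ geo (fun j k => a j k * mono z0 z j k)%C N q.
Proof.
move=> HN Hz; have [q [Hq B]] := box_ratio z0 rho z Hrho Hz; exists q; split=> //; split=> // j k.
rewrite Cmod_mult.
apply: (Rle_trans _ (Cmod (a j k) * (rho ^ (j + k) * q ^ (j + k)))).
  by apply: Rmult_le_compat_l => //; exact: Cmod_ge_0.
rewrite -Rmult_assoc; apply: Rmult_le_compat_r; first by apply: pow_le; lra.
exact: (dsumR_bound _ N (bnonneg a) HN).
Qed.

Lemma An_pos f N : An z0 rho f N -> 0 <= N.
Proof.
move=> [a [HN _]]; apply: Rle_trans (HN 0%nat); apply: Rle_trans (dsumR_term_le _ 0 0 0 (bnonneg a) (le_n _) (le_n _)).
exact: bnonneg.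
Qed.

Lemma An_weaken f N N' : An z0 rho f N -> N <= N' -> An z0 rho f N'.
Proof. by move=> [a [HN E]] H; exists a; split=> // n; apply: Rle_trans (HN n) H. Qed.

Lemma An_ext f g N : (forall z, box z0 rho z -> f z = g z) -> An z0 rho f N -> An z0 rho g N.
Proof. by move=> E [a [HN Ef]]; exists a; split=> // z Hz; rewrite -E // Ef. Qed.

Lemma An_const c : An z0 rho (fun _ => c) (Cmod c).
Proof.
exists (fun j k => match j, k with O, O => c | _, _ => RtoC 0 end); split.
  move=> n; rewrite /dsumR.
  have E j : sum_n (fun k => Cmod (match j, k with O, O => c | _, _ => RtoC 0 end) * rho ^ (j + k)) n
    = match j with O => Cmod c | S _ => 0 end.
    elim: n => [|n IH]; first by rewrite sum_O; case: j => [|j]; rewrite ?Cmod_0 /=; ring.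
    rewrite sum_Sn IH /plus /=; case: j {IH} => [|j]; rewrite Cmod_0; ring.
  rewrite (sum_n_ext _ _ _ E); elim: n {E} => [|n IH]; rewrite ?sum_O; first lra.
  by rewrite sum_Sn; apply: (Rle_trans _ (_ + 0)); [exact: Rle_refl | rewrite Rplus_0_r].
move=> z _; rewrite /DS CSer_single.
  by rewrite CSer_single /mono /=; [ring | move=> n; ring].
by move=> n; rewrite (CSer_ext _ (fun _ => 0)) ?CSer_0 // => k; ring.
Qed.

Lemma An_scal c f N : An z0 rho f N -> An z0 rho (fun z => c * f z)%C (Cmod c * N).
Proof.
move=> [a [HN E]]; exists (fun j k => c * a j k)%C; split.
  move=> n; rewrite (Rmult_comm (Cmod c)).
  apply: (Rle_trans _ (dsumR (fun j k => Cmod (a j k) * rho ^ (j + k) * Cmod c) n)).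
    by apply: dsumR_le => j k; rewrite Cmod_mult; lra.
  by rewrite dsumR_scal; apply: Rmult_le_compat_r => //; exact: Cmod_ge_0.
move=> z Hz; have [q [_ G]] := An_geo a N z HN Hz.
by rewrite E // -(DS_scal _ _ _ _ G); apply: DS_ext => j k; ring.
Qed.

Lemma An_plus f g N N' : An z0 rho f N -> An z0 rho g N' -> An z0 rho (fun z => f z + g z)%C (N + N').
Proof.
move=> [a [HN E]] [a' [HN' E']]; exists (fun j k => a j k + a' j k)%C; split.
  move=> n; apply: (Rle_trans _ _ _ _ (Rplus_le_compat _ _ _ _ (HN n) (HN' n))).
  rewrite -dsumR_plus; apply: dsumR_le => j k; rewrite -Rmult_plus_distr_r.
  by apply: Rmult_le_compat_r; [apply: pow_le; lra | exact: Cmod_triangle].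
move=> z Hz; have [q [_ G]] := An_geo a N z HN Hz; have [q' [_ G']] := An_geo a' N' z HN' Hz.
by rewrite E // E' // -(DS_plus _ _ _ _ _ _ G G'); apply: DS_ext => j k; ring.
Qed.

Lemma An_X f N : An z0 rho f N -> An z0 rho (fun z => RtoC (Re z - Re z0) * f z)%C (rho * N).
Proof.
move=> [a [HN E]]; set a' := fun j k => match j with O => RtoC 0 | S j => a j k end.
have B n : dsumR (fun j k => Cmod (a' j k) * rho ^ (j + k)) n <= rho * N.
  have Z m : sum_n (fun k => Cmod (a' 0%nat k) * rho ^ (0 + k)) m = 0.
    by elim: m => [|m IH]; rewrite ?sum_O ?sum_Sn ?IH Cmod_0 /plus /=; ring.
  apply: (Rle_trans _ (dsumR (fun j k => Cmod (a j k) * rho ^ (j + k) * rho) n)); last first.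
    by rewrite dsumR_scal Rmult_comm; apply: Rmult_le_compat_l => //; lra.
  rewrite /dsumR; case: n => [|n].
    rewrite !sum_O Cmod_0 Rmult_0_l; move: (bnonneg a 0 0) => /=; nra.
  rewrite sum_n_shift Z Rplus_0_l.
  apply: (Rle_trans _ (sum_n (fun j => sum_n (fun k => Cmod (a j k) * rho ^ (j + k) * rho) (S n)) n)).
    apply: sum_n_le_ext => j; apply: sum_n_le_ext => k.
    by rewrite /= (Rmult_comm rho) Rmult_assoc; lra.
  apply: sum_n_le_idx; last lia.
  move=> j; apply: sum_n_nonneg => k; apply: Rmult_le_pos; [exact: bnonneg | lra].
exists a'; split=> // z Hz; have [q' [_ G']] := An_geo a' _ z B Hz.
have [q [_ G]] := An_geo a N z HN Hz.
rewrite E // -(DS_scal _ _ _ _ G).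
have G2 := geo_scal (RtoC (Re z - Re z0)) _ _ _ G.
have Ex j k : (RtoC (Re z - Re z0) * (a j k * mono z0 z j k) = a' (S j) k * mono z0 z (S j) k)%C.
  by rewrite /mono Cpow_S /=; ring.
have G3 : geo (fun j k => a' (S j) k * mono z0 z (S j) k)%C (Cmod (RtoC (Re z - Re z0)) * N) q.
  by case: G2 => Hq H2; split=> // j k; rewrite -Ex.
have [_ ->] := DS_shiftP (fun j k => a' j k * mono z0 z j k)%C _ _ G3 ltac:(move=> k /=; ring).
by apply: DS_ext.
Qed.

Lemma An_Y f N : An z0 rho f N -> An z0 rho (fun z => RtoC (Im z - Im z0) * f z)%C (rho * N).
Proof.
move=> [a [HN E]]; set a' := fun j k => match k with O => RtoC 0 | S k => a j k end.
have B n : dsumR (fun j k => Cmod (a' j k) * rho ^ (j + k)) n <= rho * N.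
  apply: (Rle_trans _ (dsumR (fun j k => Cmod (a j k) * rho ^ (j + k) * rho) n)); last first.
    by rewrite dsumR_scal Rmult_comm; apply: Rmult_le_compat_l => //; lra.
  apply: sum_n_le_ext => j; case: n => [|n].
    rewrite !sum_O Cmod_0 Rmult_0_l; move: (bnonneg a j 0) => /=; nra.
  rewrite sum_n_shift Cmod_0 Rmult_0_l Rplus_0_l.
  apply: (Rle_trans _ (sum_n (fun k => Cmod (a j k) * rho ^ (j + k) * rho) n)).
    apply: sum_n_le_ext => k.
    by rewrite /= Nat.add_succ_r /= (Rmult_comm rho) Rmult_assoc; lra.
  apply: sum_n_le_idx; last lia.
  move=> k; apply: Rmult_le_pos; [exact: bnonneg | lra].
exists a'; split=> // z Hz; have [q' [_ G']] := An_geo a' _ z B Hz.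
have [q [_ G]] := An_geo a N z HN Hz.
rewrite E // -(DS_scal _ _ _ _ G).
have G2 := geo_scal (RtoC (Im z - Im z0)) _ _ _ G.
have Ex j k : (RtoC (Im z - Im z0) * (a j k * mono z0 z j k) = a' j (S k) * mono z0 z j (S k))%C.
  by rewrite /mono Cpow_S /=; ring.
have G3 : geo (fun j k => a' j (S k) * mono z0 z j (S k))%C (Cmod (RtoC (Im z - Im z0)) * N) q.
  by case: G2 => Hq H2; split=> // j k; rewrite -Ex.
have [_ ->] := DS_shiftQ (fun j k => a' j k * mono z0 z j k)%C _ _ G3 ltac:(move=> k /=; ring).
by apply: DS_ext.
Qed.

Lemma An_value f N z : An z0 rho f N -> box z0 rho z -> Cmod (f z) <= N.
Proof.
move=> [a [HN E]] Hz; rewrite E //.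
have [I1 [I2 I3]] := iterated_bound _ N (bnonneg a) HN.
have [q [Hq B]] := box_ratio z0 rho z Hrho Hz.
have Bm' j k : Cmod (a j k * mono z0 z j k)%C <= Cmod (a j k) * rho ^ (j + k).
  rewrite Cmod_mult; apply: Rmult_le_compat_l; first exact: Cmod_ge_0.
  apply: Rle_trans (B j k) _; rewrite -[X in _ <= X]Rmult_1_r; apply: Rmult_le_compat_l.
    by apply: pow_le; lra.
  by rewrite -(pow1 (j + k)); apply: pow_incr; lra.
apply: Rle_trans I3; apply: Cmod_CSer_le => // j; exact: Cmod_CSer_le.
Qed.

(** Completeness of the algebra: absolutely convergent series have their sum in it. This replaces
    all arguments by locally uniform limits. *)
Lemma An_CSer (f : nat -> C -> C) (N : nat -> R) : (forall i, An z0 rho (f i) (N i)) -> ex_series N ->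
  An z0 rho (fun z => CSer (fun i => f i z)) (Series N).
Proof.
move=> H SN.
have NN i : 0 <= N i by exact: An_pos (H i).
(* The coefficients of all the [f i] are needed simultaneously, which takes a choice. *)
pose a i := proj1_sig (constructive_indefinite_description _ (H i)).
have Ha i : (forall n, dsumR (fun j k => Cmod (a i j k) * rho ^ (j + k)) n <= N i) /\ forall z, box z0 rho z -> f i z = DS (fun j k => a i j k * mono z0 z j k)%C.
  exact: (proj2_sig (constructive_indefinite_description _ (H i))).
have T i j k : Cmod (a i j k) * rho ^ (j + k) <= N i.
  exact: (dsumR_bound _ (N i) (bnonneg (a i)) (proj1 (Ha i))).
have ST j k : ex_series (fun i => Cmod (a i j k) * rho ^ (j + k)).
  apply: (ex_series_le (K := R_AbsRing) (V := R_CompleteNormedModule) _ N) => // i.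
  by rewrite /norm /= /abs /= Rabs_pos_eq; [exact: T | exact: (bnonneg (a i))].
have rp n : 0 < rho ^ n by apply: pow_lt.
have Sa j k : asum (fun i => a i j k).
  apply: (asum_le _ (fun i => (Cmod (a i j k) * rho ^ (j + k)) * / rho ^ (j + k))).
    by move=> i; apply: Req_le; field; have := rp (j + k)%nat; lra.
  exact: (ex_series_scal_r (/ rho ^ (j + k)) (fun i => Cmod (a i j k) * rho ^ (j + k))).
exists (fun j k => CSer (fun i => a i j k)); split.
  move=> n.
  apply: (Rle_trans _ (dsumR (fun j k => Series (fun i => Cmod (a i j k) * rho ^ (j + k))) n)).
    apply: dsumR_le => j k; rewrite Series_scal_r; apply: Rmult_le_compat_r; first by have := rp (j + k)%nat; lra.
    by apply: Cmod_CSer_le; [move=> i; lra | exact: Sa].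
  have E1 j := sum_n_Series (fun k i => Cmod (a i j k) * rho ^ (j + k)) n (ST j).
  rewrite /dsumR (sum_n_ext _ _ _ (fun j => proj2 (E1 j))).
  have [E2 ->] := sum_n_Series (fun j i => sum_n (fun k => Cmod (a i j k) * rho ^ (j + k)) n) n (fun j => proj1 (E1 j)).
  apply: Series_le => // i; split; last exact: (proj1 (Ha i)).
  by apply: sum_n_nonneg => j; apply: sum_n_nonneg => k; exact: (bnonneg (a i)).
move=> z Hz; have [q [Hq B]] := box_ratio z0 rho z Hrho Hz.
have U i j k : Cmod (a i j k * mono z0 z j k)%C <= N i * q ^ j * q ^ k.
  rewrite Cmod_mult Rmult_assoc -pow_add.
  apply: (Rle_trans _ (Cmod (a i j k) * (rho ^ (j + k) * q ^ (j + k)))).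
    by apply: Rmult_le_compat_l => //; exact: Cmod_ge_0.
  by rewrite -Rmult_assoc; apply: Rmult_le_compat_r => //; apply: pow_le; lra.
have gq : ex_series (fun k => q ^ k) by apply: ex_series_geom; rewrite Rabs_pos_eq; lra.
have qn k : 0 <= q ^ k by apply: pow_le; lra.
rewrite (CSer_ext _ _ (fun i => proj2 (Ha i) z Hz)).
transitivity (CSer (fun j => CSer (fun i => CSer (fun k => a i j k * mono z0 z j k)%C))).
  apply: (CSer_Fubini _ (fun i => N i * Series (fun k => q ^ k)) (fun j => q ^ j)) => //.
  - move=> i j; rewrite (_ : N i * Series (fun k => q ^ k) * q ^ j = N i * q ^ j * Series (fun k => q ^ k)); last by ring.
    rewrite -Series_scal_l; apply: Cmod_CSer_le => //.
    exact: (ex_series_scal_l (N i * q ^ j) (fun k => q ^ k)).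
  - by move=> i; apply: Rmult_le_pos => //; exact: Series_ge_0.
  - exact: (ex_series_scal_r (Series (fun k => q ^ k)) N).
apply: CSer_ext => j.
rewrite (CSer_Fubini _ (fun i => N i * q ^ j) (fun k => q ^ k)) //; first last.
- exact: (ex_series_scal_r (q ^ j) N).
- by move=> i; apply: Rmult_le_pos.
apply: CSer_ext => k; rewrite Cmult_comm -CSer_scal //; apply: CSer_ext => i; ring.
Qed.

Lemma An_mono f N j k : An z0 rho f N -> An z0 rho (fun z => mono z0 z j k * f z)%C (rho ^ (j + k) * N).
Proof.
move=> H; elim: j => [|j IHj].
  elim: k => [|k IHk].
    by rewrite /= Rmult_1_l; apply: An_ext H => z _; rewrite /mono /=; ring.
  have := An_Y _ _ IHk; rewrite -Rmult_assoc => K; apply: An_ext K => z _.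
  by rewrite /mono Cpow_S; ring.
have := An_X _ _ IHj; rewrite -Rmult_assoc => K; apply: An_ext K => z _.
by rewrite /mono Cpow_S; ring.
Qed.

(** [f * g] is the series of the elements [a j k * mono * g] of the algebra, so completeness
    replaces the formula for the coefficients of a product. *)
Lemma An_mult f g N N' : An z0 rho f N -> An z0 rho g N' -> An z0 rho (fun z => f z * g z)%C (N * N').
Proof.
move=> Hf Hg; have PN' := An_pos _ _ Hg; move: Hf => [a [HN E]].
have [I1 [I2 I3]] := iterated_bound _ N (bnonneg a) HN.
have R j k : An z0 rho (fun z => a j k * (mono z0 z j k * g z))%C (Cmod (a j k) * rho ^ (j + k) * N').
  by rewrite Rmult_assoc; apply: An_scal; exact: An_mono.
have S1 j := An_CSer (fun k z => a j k * (mono z0 z j k * g z))%C _ (R j) (ex_series_scal_r N' _ (I1 j)).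
have S2 := An_CSer _ _ S1.
have E2 j : Series (fun k => Cmod (a j k) * rho ^ (j + k) * N') = Series (fun k => Cmod (a j k) * rho ^ (j + k)) * N'.
  by rewrite Series_scal_r.
have {}S2 := S2 (ex_series_ext _ _ (fun j => eq_sym (E2 j)) (ex_series_scal_r N' _ I2)).
rewrite (Series_ext _ _ E2) Series_scal_r in S2.
have := An_weaken _ _ (N * N') S2 (Rmult_le_compat_r _ _ _ PN' I3).
apply: An_ext => z Hz; rewrite E //.
have [q [_ G]] := An_geo a N z HN Hz.
rewrite Cmult_comm -(DS_scal _ _ _ _ G); apply: DS_ext => j k; ring.
Qed.

Lemma An_pow f N n : An z0 rho f N -> An z0 rho (fun z => f z ^ n)%C (N ^ n).
Proof.
move=> H; elim: n => [|n IH].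
  by have := An_const 1; rewrite Cmod_1.
by apply: (An_ext (fun z => f z * f z ^ n)%C); [move=> z _; rewrite Cpow_S | exact: An_mult].
Qed.

End AnAlgebra.

(** * Germs of real-analytic functions *)

Definition AG (z0 : C) (f : C -> C) : Prop := exists rho N, 0 < rho /\ An z0 rho f N.

Lemma dsumR_delta c n : dsumR (fun j k => match j, k with O, O => c | _, _ => 0 end) n = c.
Proof.
have Z m : sum_n (fun _ : nat => 0) m = 0 by elim: m => [|m IH]; rewrite ?sum_O // sum_Sn IH /plus /=; ring.
rewrite /dsumR; case: n => [|n]; first by rewrite !sum_O.
rewrite sum_n_shift sum_n_shift Z Rplus_0_r.
by rewrite (sum_n_ext _ (fun _ => 0)) ?Z ?Rplus_0_r // => j; rewrite (sum_n_ext _ (fun _ => 0)).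
Qed.

Lemma box_center z0 rho : 0 < rho -> box z0 rho z0.
Proof. by move=> H; rewrite /box !Rminus_diag Rabs_R0. Qed.

(** Shrinking the box by a factor $x$ multiplies each nonconstant term by at least one $x$, so the
    norm comes as close as desired to the value at the centre. Strict inequalities at a point thus
    become bounds on norms. *)
Lemma AG_norm z0 f : AG z0 f -> forall eps, 0 < eps ->
  exists rho0, 0 < rho0 /\ forall rho, 0 < rho <= rho0 -> An z0 rho f (Cmod (f z0) + eps).
Proof.
move=> [rho1 [N [Hr1 [a [HN E]]]]] eps Heps.
have HN0 : 0 <= N by apply: (An_pos z0 rho1 Hr1 f); exists a.
have E0 : f z0 = a 0%nat 0%nat.
  rewrite (E _ (box_center z0 rho1 Hr1)) /DS CSer_single.
    by rewrite CSer_single /mono /=; [ring | move=> n; rewrite !Rminus_diag; ring].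
  move=> n; rewrite (CSer_ext _ (fun _ => 0)) ?CSer_0 // => k.
  by rewrite /mono !Rminus_diag Cpow_S; ring.
have Hd : 0 < eps / (N + 1) by apply: Rdiv_lt_0_compat; lra.
exists (rho1 * Rmin 1 (eps / (N + 1))); split; first by apply: Rmult_lt_0_compat => //; apply: Rmin_pos; lra.
move=> rho [Hr0 Hr]; exists a; split; last first.
  move=> z [Hx Hy]; apply: E; have := Rmin_l 1 (eps / (N + 1)) => M; split; nra.
move=> n; set x := rho / rho1.
have Hx : 0 < x by apply: Rdiv_lt_0_compat.
have Hx1 : x <= Rmin 1 (eps / (N + 1)) by apply/Rle_div_l => //; lra.
have Hx2 := Rmin_l 1 (eps / (N + 1)); have Hx3 := Rmin_r 1 (eps / (N + 1)).
have G := Cmod_ge_0.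
apply: (Rle_trans _ (dsumR (fun j k => match j, k with O, O => Cmod (f z0) | _, _ => 0 end + Cmod (a j k) * rho1 ^ (j + k) * x) n)).
  apply: dsumR_le => j k.
  have Er : rho ^ (j + k) = x ^ (j + k) * rho1 ^ (j + k).
    by rewrite -Rpow_mult_distr; congr pow; rewrite /x; field; lra.
  have P : 0 <= Cmod (a j k) * rho1 ^ (j + k) by apply: Rmult_le_pos => //; apply: pow_le; lra.
  have K m : x ^ S m <= x.
    rewrite /= -[X in _ <= X]Rmult_1_r; apply: Rmult_le_compat_l; first lra.
    by rewrite -(pow1 m); apply: pow_incr; lra.
  rewrite Er (_ : Cmod (a j k) * (x ^ (j + k) * rho1 ^ (j + k)) = Cmod (a j k) * rho1 ^ (j + k) * x ^ (j + k)); last by ring.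
  case: j k P {Er} => [|j] [|k] P.
  - by rewrite E0 /=; move: (G (a 0%nat 0%nat)); nra.
  - by apply: (Rle_trans _ (0 + Cmod (a 0%nat (S k)) * rho1 ^ (0%nat + (S k)) * x)); [rewrite Rplus_0_l; apply: Rmult_le_compat_l => //; exact: K | exact: Rle_refl].
  - by apply: (Rle_trans _ (0 + Cmod (a (S j) 0%nat) * rho1 ^ ((S j) + 0%nat) * x)); [rewrite Rplus_0_l; apply: Rmult_le_compat_l => //; exact: K | exact: Rle_refl].
  - by apply: (Rle_trans _ (0 + Cmod (a (S j) (S k)) * rho1 ^ ((S j) + (S k)) * x)); [rewrite Rplus_0_l; apply: Rmult_le_compat_l => //; exact: K | exact: Rle_refl].
rewrite dsumR_plus dsumR_delta dsumR_scal; apply: Rplus_le_compat_l.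
apply: (Rle_trans _ (N * x)); first by apply: Rmult_le_compat_r; [lra | exact: HN].
apply: (Rle_trans _ (N * (eps / (N + 1)))); first by apply: Rmult_le_compat_l; lra.
have -> : N * (eps / (N + 1)) = eps - eps / (N + 1) by field; lra.
lra.
Qed.

Lemma AG_common z0 f g : AG z0 f -> AG z0 g ->
  exists rho N N', 0 < rho /\ An z0 rho f N /\ An z0 rho g N'.
Proof.
move=> Hf Hg; have [r1 [H1 K1]] := AG_norm _ _ Hf 1 Rlt_0_1; have [r2 [H2 K2]] := AG_norm _ _ Hg 1 Rlt_0_1.
have Hm : 0 < Rmin r1 r2 by apply: Rmin_pos.
exists (Rmin r1 r2), (Cmod (f z0) + 1), (Cmod (g z0) + 1); split=> //.
by split; [apply: K1 | apply: K2]; split=> //; [exact: Rmin_l | exact: Rmin_r].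
Qed.

Lemma AG_plus z0 f g : AG z0 f -> AG z0 g -> AG z0 (fun z => f z + g z)%C.
Proof.
by move=> Hf Hg; have [rho [N [N' [H [K1 K2]]]]] := AG_common _ _ _ Hf Hg; exists rho, (N + N'); split=> //; exact: An_plus.
Qed.

Lemma AG_mult z0 f g : AG z0 f -> AG z0 g -> AG z0 (fun z => f z * g z)%C.
Proof.
by move=> Hf Hg; have [rho [N [N' [H [K1 K2]]]]] := AG_common _ _ _ Hf Hg; exists rho, (N * N'); split=> //; exact: An_mult.
Qed.

Lemma AG_const z0 c : AG z0 (fun _ => c).
Proof. by exists 1, (Cmod c); split; [lra | exact: An_const]. Qed.

Lemma AG_scal z0 c f : AG z0 f -> AG z0 (fun z => c * f z)%C.
Proof. by move=> H; apply: AG_mult => //; exact: AG_const. Qed.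

Lemma AG_ext_loc z0 (f g : C -> C) rho : 0 < rho -> (forall z, box z0 rho z -> f z = g z) -> AG z0 f -> AG z0 g.
Proof.
move=> Hr E /AG_norm /(_ 1 Rlt_0_1) [r1 [H1 K1]].
have Hm : 0 < Rmin r1 rho by apply: Rmin_pos.
exists (Rmin r1 rho), (Cmod (f z0) + 1); split=> //.
apply: (An_ext _ _ f); last by apply: K1; split=> //; exact: Rmin_l.
by move=> z [Hx Hy]; apply: E; split; have := Rmin_r r1 rho; lra.
Qed.

Lemma AG_ext z0 (f g : C -> C) : (forall z, f z = g z) -> AG z0 f -> AG z0 g.
Proof. by move=> E; apply: (AG_ext_loc _ _ _ 1); [lra | move=> z _; exact: E]. Qed.

Lemma AG_id z0 : AG z0 (fun z => z) /\ AG z0 Cconj.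
Proof.
have C1 := An_const z0 1 1.
have X : AG z0 (fun z => RtoC (Re z - Re z0) * 1)%C by exists 1, (1 * Cmod 1); split; [lra | apply: An_X => //; lra].
have Y : AG z0 (fun z => RtoC (Im z - Im z0) * 1)%C by exists 1, (1 * Cmod 1); split; [lra | apply: An_Y => //; lra].
split.
  apply: (AG_ext _ (fun z => z0 + (RtoC (Re z - Re z0) * 1 + Ci * (RtoC (Im z - Im z0) * 1)))%C).
    by move=> z; apply: C_ext; rewrite /Re /Im /=; ring.
  by apply: AG_plus; [exact: AG_const | apply: AG_plus => //; exact: AG_scal].
apply: (AG_ext _ (fun z => Cconj z0 + (RtoC (Re z - Re z0) * 1 + - Ci * (RtoC (Im z - Im z0) * 1)))%C).
  by move=> z; apply: C_ext; rewrite /Re /Im /=; ring.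
by apply: AG_plus; [exact: AG_const | apply: AG_plus => //; exact: AG_scal].
Qed.

(** Neumann series around [f z0]: on a small box the difference has norm at most half of the modulus
    at the centre. *)
Lemma AG_inv z0 f : AG z0 f -> f z0 <> RtoC 0 -> AG z0 (fun z => / f z)%C.
Proof.
move=> Hf Hn; have Hm : 0 < Cmod (f z0) by apply Cmod_gt_0.
set m := Cmod (f z0) in Hm.
have Hg : AG z0 (fun z => f z + - f z0)%C by apply: AG_plus => //; exact: AG_const.
have [r1 [H1 K1]] := AG_norm _ _ Hg (m / 2) ltac:(lra).
have {}K1 := K1 r1 ltac:(lra).
rewrite Cplus_opp_r Cmod_0 Rplus_0_l in K1.
have S : ex_series (fun n => Cmod (/ f z0 * (-1 / f z0) ^ n)%C * (m / 2) ^ n).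
  apply: (ex_series_ext (fun n => / m * (/ 2) ^ n)); last by apply: ex_series_geom'; lra.
  move=> n; rewrite Cmod_mult Cmod_pow Cmod_div // Cmod_inv // -/m Cmod_R Rabs_Ropp Rabs_R1.
  by rewrite Rmult_assoc -Rpow_mult_distr; congr (_ * _ ^ n); field; lra.
exists r1, (Series (fun n => Cmod (/ f z0 * (-1 / f z0) ^ n)%C * (m / 2) ^ n)); split=> //.
have K := An_CSer z0 r1 H1 (fun n z => (/ f z0 * (-1 / f z0) ^ n) * (f z + - f z0) ^ n)%C _ (fun n => An_scal _ _ H1 _ _ _ (An_pow _ _ H1 _ _ n K1)) S.
apply: An_ext K => z Hz.
have B := An_value _ _ H1 _ _ _ K1 Hz.
set q := (-1 / f z0 * (f z + - f z0))%C.
have Hq : Cmod q < 1.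
  rewrite /q Cmod_mult Cmod_div // Cmod_R Rabs_Ropp Rabs_R1 -/m.
  have : 1 / m * Cmod (f z + - f z0)%C <= 1 / m * (m / 2).
    by apply: Rmult_le_compat_l => //; apply: Rdiv_le_0_compat; lra.
  have -> : 1 / m * (m / 2) = 1 / 2 by field; lra.
  lra.
have Hfz : f z <> RtoC 0.
  move=> Ez; move: Hq; rewrite /q Ez (_ : (-1 / f z0 * (0 + - f z0))%C = RtoC 1) ?Cmod_1; first lra.
  by field.
rewrite (CSer_ext _ (fun n => / f z0 * q ^ n)%C); last by move=> n; rewrite /q Cpow_mult_l; ring.
rewrite CSer_scal; last first.
  by apply: (asum_geom _ 1 (Cmod q)); [split=> //; exact: Cmod_ge_0 | move=> n; rewrite Cmod_pow; lra].
rewrite CSer_geom // /q.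
have E : (1 - -1 / f z0 * (f z + - f z0) = f z / f z0)%C by field.
by rewrite E; field.
Qed.

(** * Analyticity of the remainder on both sides of the circle *)

Section Kanalytic.
Variables (r : C) (Hr : not_pos_int r).

(** Majorants that follow the recursions of [Qp] and [Qn] with every term replaced by a bound for
    its norm on a box; [lam] bounds $t$ in the first and $1/t$ in the second. *)
Fixpoint normQp (lam : R) (m : nat) : R :=
  match m with
  | O => Cmod (/ den r 0)%C
  | S m => (INR (S m) * normQp lam m + lam ^ S m) / Cmod (den r (S m))
  end.

Fixpoint normQn (L lam : R) (q : nat) : R :=
  match q with
  | O => L
  | S q => ((INR q + Cmod r) * normQn L lam q + lam ^ S q) / INR (S q)
  end.

Lemma normQp_pos lam m : 0 <= lam -> 0 <= normQp lam m.
Proof.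
move=> Hl; elim: m => [|m IH]; first exact: Cmod_ge_0.
apply: Rdiv_le_0_compat; last by apply Cmod_gt_0; exact: den_neq_0.
by apply: Rplus_le_le_0_compat; [apply: Rmult_le_pos => //; exact: pos_INR | exact: pow_le].
Qed.

Lemma normQn_pos L lam q : 0 <= L -> 0 <= lam -> 0 <= normQn L lam q.
Proof.
move=> HL Hl; elim: q => [|q IH] //.
apply: Rdiv_le_0_compat; last by apply: lt_0_INR; lia.
apply: Rplus_le_le_0_compat; last exact: pow_le.
by apply: Rmult_le_pos => //; apply: Rplus_le_le_0_compat; [exact: pos_INR | exact: Cmod_ge_0].
Qed.

(** The recursion of [normQp] consists of the norms of its terms on the box. In the analogue [An_Qn]
    a separate function [ti] represents $1/t$, whose norm does not follow from that of $t$. *)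
Lemma An_Qp z0 rho t lam m : 0 < rho -> An z0 rho t lam -> An z0 rho (fun z => Qp r m (t z)) (normQp lam m).
Proof.
move=> Hrho Ht; elim: m => [|m IH]; first exact: An_const.
have Hd := den_neq_0 r (S m) Hr.
have K := An_scal _ _ Hrho (/ den r (S m))%C _ _ (An_plus _ _ Hrho _ _ _ _ (An_scal _ _ Hrho (INR (S m)) _ _ IH) (An_pow _ _ Hrho _ _ (S m) Ht)).
rewrite Cmod_R Rabs_pos_eq in K; last exact: pos_INR.
rewrite Cmod_inv // Rmult_comm in K.
by apply: An_ext K => z _; rewrite Cmult_comm.
Qed.

Lemma An_Qn z0 rho t ti lam L q : 0 < rho -> An z0 rho ti lam -> (forall z, box z0 rho z -> ti z = / t z)%C ->
  (forall z, box z0 rho z -> t z <> RtoC 0) ->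
  An z0 rho (fun z => Qn r 0 (t z)) L ->
  An z0 rho (fun z => Qn r q (t z)) (normQn L lam q).
Proof.
move=> Hrho Hti Eti Hn HL; elim: q => [|q IH] //.
have K1 := An_scal _ _ Hrho (INR q + r)%C _ _ IH.
have K2 := An_plus _ _ Hrho _ _ _ _ K1 (An_pow _ _ Hrho _ _ (S q) Hti).
have K := An_scal _ _ Hrho (/ INR (S q))%C _ _ K2.
have Hq := INR_S_neq_0 q.
rewrite (Cmod_inv (INR (S q))) // (Cmod_R (INR (S q))) Rabs_pos_eq in K; last exact: pos_INR.
rewrite Rmult_comm in K.
have {}K := An_weaken z0 rho _ _ (normQn L lam (S q)) K _.
apply: (An_ext _ _ (fun z => / INR (S q) * ((INR q + r) * Qn r q (t z) + ti z ^ S q))%C).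
  move=> z Hz; rewrite Eti // Cpow_inv; last exact: Hn.
  by rewrite Cmult_comm.
apply: K; apply: Rmult_le_compat_r; first by apply: Rlt_le; apply: Rinv_0_lt_compat; apply: lt_0_INR; lia.
apply: Rplus_le_compat_r; apply: Rmult_le_compat_r; first exact: An_pos IH.
by apply: (Rle_trans _ _ _ (Cmod_triangle _ _)); rewrite Cmod_R Rabs_pos_eq; [lra | exact: pos_INR].
Qed.

Variables (rho1 lam M1 M2 : R) (an ak : nat -> C).
Hypothesis Hrho1 : 0 <= rho1.
Hypothesis Hlam : 1 < lam <= 3 / 2.
Hypothesis Hsmall : rho1 * lam ^ 3 < 1.
Hypothesis Han : forall q, Cmod (an q) <= M1 * rho1 ^ q.
Hypothesis Hak : forall m, Cmod (ak m) <= M2 * rho1 ^ m.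

(** [g] is the Cayley transform in one of the two charts. Its powers cost [lam] per step and the
    radial factors [lam ^ 2], so coefficients decaying like [rho1 ^ q] suffice when
    [rho1 * lam ^ 3 < 1]. The same majorants give the summability required by [K_expand]. *)
Lemma AG_Kcirc z0 g : AG z0 g -> AG z0 (fun z => Cconj (g z)) -> / lam < Cmod (g z0) ^ 2 < lam ->
  AG z0 (fun z => Kcirc r an ak (g z)) /\
  asum (fun q => an q * (g z0 ^ S q * Qn r q (g z0 * Cconj (g z0))))%C /\
  asum (fun m => ak m * (/ g z0 ^ m * Qp r m (g z0 * Cconj (g z0))))%C.
Proof.
move=> Hg Hgc Hw; set w0 := g z0 in Hw *.
have Hil : 2 / 3 <= / lam.
  by rewrite (_ : 2 / 3 = / (3 / 2)); [apply: Rinv_le_contravar; lra | field].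
have Hm0 : 0 < Cmod w0.
  case: (Req_dec (Cmod w0) 0) => [E|]; last by move: (Cmod_ge_0 w0); lra.
  by rewrite E /= in Hw; lra.
have Hw0 : w0 <> RtoC 0 by apply Cmod_gt_0.
have Hwc0 : Cconj w0 <> RtoC 0 by apply Cmod_gt_0; rewrite Cmod_conj.
have Ht := AG_mult _ _ _ Hg Hgc; set t := fun z => (g z * Cconj (g z))%C in Ht.
have Et0 : t z0 = RtoC (Cmod w0 ^ 2) by rewrite /t Cmod2_conj.
have Ht0 : t z0 <> RtoC 0 by apply: Cmult_neq_0.
have Hti := AG_inv _ _ Ht Ht0; have Hgi := AG_inv _ _ Hg Hw0.
have Hs : AG z0 (fun z => 1 + -1 * t z)%C by apply: AG_plus; [exact: AG_const | exact: AG_scal].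
have Mt : Cmod (t z0) = Cmod w0 ^ 2 by rewrite Et0 Cmod_R Rabs_pos_eq //; apply: pow2_ge_0.
have Mti : Cmod (/ t z0)%C < lam.
  rewrite Cmod_inv // Mt -(Rinv_inv lam); apply: Rinv_lt_contravar; last lra.
  by apply: Rmult_lt_0_compat; lra.
have Mg : Cmod w0 < lam by nra.
have Mgi : Cmod (/ w0)%C < lam.
  rewrite Cmod_inv // -(Rinv_inv lam); apply: Rinv_lt_contravar; first by apply: Rmult_lt_0_compat; lra.
  have : / lam < 1 by rewrite -Rinv_1; apply: Rinv_lt_contravar; lra.
  nra.
(* The bound [lam <= 3 / 2] keeps $t$ between $2/3$ and $3/2$, well inside the disk $|1-t|<1$ where
   the series [Qn r 0] converges. *)
have Ms : Cmod (1 + -1 * t z0)%C < 1 / 2.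
  rewrite Et0 -RtoC_mult -RtoC_plus Cmod_R; apply: Rabs_def1; lra.
have [r1 [P1 K1]] := AG_norm _ _ Hg (lam - Cmod w0) ltac:(lra).
have [r2 [P2 K2]] := AG_norm _ _ Hgi (lam - Cmod (/ w0)%C) ltac:(lra).
have [r3 [P3 K3]] := AG_norm _ _ Ht (lam - Cmod (t z0)) ltac:(lra).
have [r4 [P4 K4]] := AG_norm _ _ Hti (lam - Cmod (/ t z0)%C) ltac:(lra).
have [r5 [P5 K5]] := AG_norm _ _ Hs (1 / 2 - Cmod (1 + -1 * t z0)%C) ltac:(lra).
set rho := Rmin (Rmin (Rmin r1 r2) (Rmin r3 r4)) r5.
have Hrho : 0 < rho by repeat apply: Rmin_pos.
have [[l1 l2] [[l3 l4] l5]] : (rho <= r1 /\ rho <= r2) /\ ((rho <= r3 /\ rho <= r4) /\ rho <= r5).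
  have := Rmin_l (Rmin (Rmin r1 r2) (Rmin r3 r4)) r5; have := Rmin_r (Rmin (Rmin r1 r2) (Rmin r3 r4)) r5.
  have := Rmin_l (Rmin r1 r2) (Rmin r3 r4); have := Rmin_r (Rmin r1 r2) (Rmin r3 r4).
  have := Rmin_l r1 r2; have := Rmin_r r1 r2; have := Rmin_l r3 r4; have := Rmin_r r3 r4.
  rewrite -/rho; lra.
have {}K1 : An z0 rho g lam by apply: An_weaken (K1 rho _) _ => //; rewrite -/w0; lra.
have {}K2 : An z0 rho (fun z => / g z)%C lam by apply: An_weaken (K2 rho _) _ => //; rewrite -/w0; lra.
have {}K3 : An z0 rho t lam by apply: An_weaken (K3 rho _) _ => //; lra.
have {}K4 : An z0 rho (fun z => / t z)%C lam by apply: An_weaken (K4 rho _) _ => //; lra.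
have {}K5 : An z0 rho (fun z => 1 + -1 * t z)%C (1 / 2) by apply: An_weaken (K5 rho _) _ => //; lra.
have Htn z : box z0 rho z -> t z <> RtoC 0.
  move=> Hz Ez; have := An_value _ _ Hrho _ _ _ K5 Hz; rewrite Ez Cmult_0_r Cplus_0_r Cmod_1; lra.
have [M [HM0 HM]] := den_bounded r Hr.
have SL : ex_series (fun k => Cmod (/ den r k)%C * (1 / 2) ^ k).
  apply: (ex_series_le (K := R_AbsRing) (V := R_CompleteNormedModule) _ (fun k => M * (1 / 2) ^ k)); last by apply: ex_series_geom'; lra.
  have p2 k : 0 <= (1 / 2) ^ k by apply: pow_le; lra.
  move=> k; rewrite /norm /= /abs /= Rabs_pos_eq; first by apply: Rmult_le_compat_r.
  by apply: Rmult_le_pos => //; exact: Cmod_ge_0.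
have KL := An_CSer z0 rho Hrho (fun k z => / den r k * (1 + -1 * t z) ^ k)%C _ (fun k => An_scal _ _ Hrho _ _ _ (An_pow _ _ Hrho _ _ k K5)) SL.
set L := Series _ in KL.
have HL0 : 0 <= L by exact: An_pos KL.
have {}KL : An z0 rho (fun z => Qn r 0 (t z)) L.
  apply: An_ext KL => z _; rewrite /Qn /OSer; apply: CSer_ext => k; congr (_ * _ ^ k)%C; ring.
(* The growth lemmas need a rate strictly above [lam]; taking [lam ^ 2] is what leads to the cube in
   [Hsmall]. *)
have Hlam2 : lam < lam ^ 2 by nra.
have [M3 [HM3 B3]] := Qp_growth r (normQp lam) lam Hr ltac:(lra) (fun n => normQp_pos lam n ltac:(lra)) (fun m => Rle_refl _) _ Hlam2.
have [M4 [HM4 B4]] := Qn_growth (normQn L lam) (Cmod r) lam ltac:(lra) (Cmod_ge_0 r) (fun n => normQn_pos L lam n HL0 ltac:(lra)) (fun m => Rle_refl _) _ Hlam2.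
have A1 q : An z0 rho (fun z => an q * (g z ^ S q * Qn r q (t z)))%C (Cmod (an q) * (lam ^ S q * normQn L lam q)).
  apply: An_scal => //; apply: An_mult => //; first exact: An_pow.
  exact: (An_Qn z0 rho t (fun z => / t z)%C).
have A2 m : An z0 rho (fun z => ak m * (/ g z ^ m * Qp r m (t z)))%C (Cmod (ak m) * (lam ^ m * normQp lam m)).
  apply: An_scal => //; apply: An_mult => //; last exact: An_Qp.
  apply: An_ext (An_pow _ _ Hrho _ _ m K2) => z Hz; rewrite Cpow_inv // => Eg.
  by apply: (Htn z Hz); rewrite /t Eg; ring.
have Hx : 0 <= rho1 * lam ^ 3 < 1 by split=> //; apply: Rmult_le_pos => //; apply: pow_le; lra.
have pl n : 0 <= lam ^ n by apply: pow_le; lra.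
have pr n : 0 <= rho1 ^ n by apply: pow_le; lra.
have S1 : ex_series (fun q => Cmod (an q) * (lam ^ S q * normQn L lam q)).
  apply: (ex_series_le (K := R_AbsRing) (V := R_CompleteNormedModule) _ (fun k => M1 * M4 * lam * (rho1 * lam ^ 3) ^ k)); last exact: ex_series_geom'.
  move=> k; rewrite /norm /= /abs /=.
  have Pn := normQn_pos L lam k HL0 ltac:(lra).
  rewrite Rabs_pos_eq; last by apply: Rmult_le_pos; [exact: Cmod_ge_0 | apply: Rmult_le_pos => //; exact: (pl (S k))].
  apply: (Rle_trans _ (M1 * rho1 ^ k * (lam ^ S k * (M4 * (lam ^ 2) ^ k)))).
    apply: Rmult_le_compat => //; first exact: Cmod_ge_0.
      by apply: Rmult_le_pos => //; exact: (pl (S k)).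
    by apply: Rmult_le_compat_l; [exact: (pl (S k)) | exact: B4].
  apply: Req_le; rewrite -(pow_mult lam 2 k) Rpow_mult_distr -(pow_mult lam 3 k) (_ : (3 * k = k + 2 * k)%nat); last lia.
  by rewrite pow_add /=; ring.
have S2 : ex_series (fun m => Cmod (ak m) * (lam ^ m * normQp lam m)).
  apply: (ex_series_le (K := R_AbsRing) (V := R_CompleteNormedModule) _ (fun k => M2 * M3 * (rho1 * lam ^ 3) ^ k)); last exact: ex_series_geom'.
  move=> k; rewrite /norm /= /abs /=.
  have Pn := normQp_pos lam k ltac:(lra).
  rewrite Rabs_pos_eq; last by apply: Rmult_le_pos; [exact: Cmod_ge_0 | apply: Rmult_le_pos => //; exact: pl].
  apply: (Rle_trans _ (M2 * rho1 ^ k * (lam ^ k * (M3 * (lam ^ 2) ^ k)))).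
    apply: Rmult_le_compat => //; first exact: Cmod_ge_0.
      by apply: Rmult_le_pos => //; exact: pl.
    by apply: Rmult_le_compat_l; [exact: pl | exact: B3].
  apply: Req_le; rewrite -(pow_mult lam 2 k) Rpow_mult_distr -(pow_mult lam 3 k) (_ : (3 * k = k + 2 * k)%nat); last lia.
  by rewrite pow_add /=; ring.
split.
  exists rho, (Cmod (-1) * (Series (fun q => Cmod (an q) * (lam ^ S q * normQn L lam q)) + Series (fun m => Cmod (ak m) * (lam ^ m * normQp lam m)))).
  split=> //.
  have := An_scal _ _ Hrho (-1) _ _ (An_plus _ _ Hrho _ _ _ _ (An_CSer _ _ Hrho _ _ A1 S1) (An_CSer _ _ Hrho _ _ A2 S2)).
  by apply: An_ext => z _; rewrite /Kcirc -/(t z); ring.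
split.
  apply: (asum_le _ _ _ S1) => q; exact: (An_value _ _ Hrho _ _ _ (A1 q) (box_center _ _ Hrho)).
apply: (asum_le _ _ _ S2) => m; exact: (An_value _ _ Hrho _ _ _ (A2 m) (box_center _ _ Hrho)).
Qed.

End Kanalytic.

(** * Square partial sums and the definition of real analyticity *)

Lemma pow_small (M q eps : R) : 0 <= M -> 0 <= q < 1 -> 0 < eps ->
  exists N0, forall N, (N0 <= N)%nat -> M * q ^ N <= eps.
Proof.
move=> HM Hq Heps.
have L : is_lim_seq (fun n => q ^ n) 0 by apply: is_lim_seq_geom; rewrite Rabs_pos_eq; lra.
have He : 0 < eps / (M + 1) by apply: Rdiv_lt_0_compat; lra.
move/is_lim_seq_spec: L => /(_ (mkposreal _ He)) [N0 HN]; exists N0 => N /HN /=.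
rewrite Rminus_0_r Rabs_pos_eq; last by apply: pow_le; lra.
move=> /Rlt_le B; apply: (Rle_trans _ (M * (eps / (M + 1)))); first exact: Rmult_le_compat_l.
have -> : M * (eps / (M + 1)) = eps - eps / (M + 1) by field; lra.
lra.
Qed.

Lemma sum_n_geom q n : q <> 1 -> sum_n (fun k => q ^ k) n = (1 - q ^ S n) / (1 - q).
Proof.
move=> Hq; elim: n => [|n IH]; first by rewrite sum_O /=; field; lra.
by rewrite sum_Sn IH /plus /=; field; lra.
Qed.

Lemma sum_n_Cminus (u v : nat -> C) n : sum_n (fun j => u j - v j)%C n = (sum_n u n - sum_n v n)%C.
Proof. by elim: n => [|n IH]; rewrite ?sum_O // !sum_Sn IH /plus /=; ring. Qed.

Lemma Cmod_sum_n_le (u : nat -> C) n : Cmod (sum_n u n) <= sum_n (fun j => Cmod (u j)) n.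
Proof.
elim: n => [|n IH]; first by rewrite !sum_O; lra.
rewrite !sum_Sn; apply: (Rle_trans _ _ _ (Cmod_triangle _ _)); rewrite /plus /=; lra.
Qed.

(** The error of a square sum is a tail of the outer series plus the tails of the first [N + 1]
    rows; row [j] contributes [q ^ j] times a constant multiple of [q ^ (N + 1)]. *)
Lemma geo_dsum u M q : geo u M q -> forall eps, 0 < eps ->
  exists N0, forall N, (N0 <= N)%nat -> Cmod (dsum u N - DS u)%C <= eps.
Proof.
move=> G eps Heps; have HM := geo_pos _ _ _ G; have [Hq B] := G.
have [N1 K1] := CSer_cvg _ (geo_asum _ _ _ G) (eps / 2) ltac:(lra).
have HK : 0 <= M / (1 - q) / (1 - q) by repeat (apply: Rdiv_le_0_compat; last lra).
have [N2 K2] := pow_small (M / (1 - q) / (1 - q)) q (eps / 2) HK Hq ltac:(lra).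
exists (N1 + N2)%nat => N HN.
have B1 := K1 N ltac:(lia); have B2 := K2 (S N) ltac:(lia).
have -> : (dsum u N - DS u = (sum_n (fun j => CSer (u j)) N - DS u) - sum_n (fun j => CSer (u j) - sum_n (u j) N)%C N)%C.
  by rewrite sum_n_Cminus (_ : dsum u N = sum_n (fun j => sum_n (u j) N) N) //; ring.
apply: (Rle_trans _ _ _ (Cmod_triangle _ _)); rewrite Cmod_opp.
have qn k : 0 <= q ^ k by apply: pow_le; lra.
suff : Cmod (sum_n (fun j => CSer (u j) - sum_n (u j) N)%C N) <= M / (1 - q) / (1 - q) * q ^ S N.
  by move: B1; rewrite /DS; lra.
apply: (Rle_trans _ _ _ (Cmod_sum_n_le _ _)).
apply: (Rle_trans _ (sum_n (fun j => q ^ j * (M / (1 - q) * q ^ S N)) N)).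
  apply: sum_n_le_ext => j.
  have := CSer_tail (u j) (fun k => M * q ^ j * q ^ k) N.
  rewrite Series_geom' //.
  have -> : sum_n (fun k => M * q ^ j * q ^ k) N = M * q ^ j * ((1 - q ^ S N) / (1 - q)).
    rewrite -sum_n_geom; last lra.
    by rewrite (Rmult_comm (M * q ^ j)) -sum_n_scal_r; apply: sum_n_ext => k; exact: Rmult_comm.
  have -> : M * q ^ j / (1 - q) - M * q ^ j * ((1 - q ^ S N) / (1 - q)) = q ^ j * (M / (1 - q) * q ^ S N) by field; lra.
  apply; last exact: ex_series_geom'.
  by move=> k; rewrite Rmult_assoc -pow_add.
rewrite sum_n_scal_r sum_n_geom; last lra.
have -> : M / (1 - q) / (1 - q) * q ^ S N = 1 / (1 - q) * (M / (1 - q) * q ^ S N) by field; lra.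
apply: Rmult_le_compat_r.
  by apply: Rmult_le_pos; [apply: Rdiv_le_0_compat; lra | exact: (qn (S N))].
apply: Rmult_le_compat_r; first by apply: Rlt_le; apply: Rinv_0_lt_compat; lra.
move: (qn (S N)); lra.
Qed.

Lemma AG_real_analytic (W : C -> Prop) A : open W -> (forall z, W z -> AG z A) -> real_analytic_on W A.
Proof.
move=> HW H z0 Hz0.
have [rho [N [Hrho [a [HN E]]]]] := H _ Hz0.
have [d [Hd K]] := open_Cmod _ _ HW Hz0.
exists a, (Rmin rho d); split; first exact: Rmin_pos.
have Bx z : Cmod (z - z0)%C < Rmin rho d -> box z0 rho z.
  move=> Hz; have := Rmin_l rho d; have := re_le_Cmod (z - z0)%C; have := im_le_Cmod (z - z0)%C.
  rewrite /box (_ : Re (z - z0)%C = Re z - Re z0) // (_ : Im (z - z0)%C = Im z - Im z0) //; lra.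
split.
  move=> z Hz; rewrite (_ : z = (z0 + (z - z0))%C); last by ring.
  by apply: K; move: (Rmin_r rho d); lra.
move=> z Hz; have Hb := Bx z Hz; split.
  exists N => n; apply: Rle_trans (HN n); apply: dsumR_le => j k.
  rewrite Rmult_assoc pow_add; apply: Rmult_le_compat_l; first exact: Cmod_ge_0.
  case: Hb => Hx Hy.
  by apply: Rmult_le_compat; try (by apply: pow_le; exact: Rabs_pos);
    apply: pow_incr; (split; [exact: Rabs_pos | lra]).
have [q [Hq G]] := An_geo z0 rho Hrho a N z HN Hb.
rewrite E // => P /locally_Cmod [e [He Pe]].
have [N0 K0] := geo_dsum _ _ _ G (e / 2) ltac:(lra).
exists N0 => n Hn.
have -> : dsum (fun j k => (a j k * RtoC ((Re z - Re z0) ^ j * (Im z - Im z0) ^ k))%C) n =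
  (DS (fun j k => a j k * mono z0 z j k) + (dsum (fun j k => a j k * mono z0 z j k) n - DS (fun j k => a j k * mono z0 z j k)))%C.
  transitivity (dsum (fun j k => a j k * mono z0 z j k)%C n); last by ring.
  apply: sum_n_ext => j; apply: sum_n_ext => k.
  by rewrite /mono RtoC_mult !RtoC_pow.
by apply: Pe; have := K0 n Hn; lra.
Qed.

Lemma real_analytic_Sm (W : C -> Prop) A k : open W -> real_analytic_on W A -> Sm k W A.
Proof.
move=> HW H; apply: Sm_loc => z0 Hz0.
have [a [rho [Hrho [HV K]]]] := H z0 Hz0.
(* The point [z0 + (s, s)] lies in the disk of convergence, as [2 * s < rho]. Absolute convergence
   there bounds the terms and yields Cauchy estimates of radius [s]. *)
set s := rho / 4; have Hs : 0 < s by rewrite /s; lra.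
have [|[M HM] _] := K (z0 + (s, s))%C.
  rewrite (_ : (z0 + (s, s) - z0)%C = (s, s)); last by apply: C_ext; rewrite /Re /Im /=; ring.
  by apply: (Rle_lt_trans _ _ _ (Cmod_le_ReIm _)); rewrite /= Rabs_pos_eq /s; lra.
have EX : Re (z0 + (s, s))%C - Re z0 = s by rewrite /Re /=; ring.
have EY : Im (z0 + (s, s))%C - Im z0 = s by rewrite /Im /=; ring.
rewrite EX EY Rabs_pos_eq in HM; last lra.
have HM' j l : Cmod (a j l) * s ^ j * s ^ l <= M.
  apply: (dsumR_bound _ M _ HM) => j' l'.
  by repeat apply: Rmult_le_pos; try (apply: pow_le; lra); exact: Cmod_ge_0.
have HPD : PD a s.
  move=> x Hx; exists M => j l; apply: Rle_trans (HM' j l); rewrite Rmult_assoc -pow_add.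
  by apply: Rmult_le_compat_l; [exact: Cmod_ge_0 | apply: pow_incr; lra].
set V := fun z => Cmod (z - z0)%C < s.
have OV : open V.
  move=> z Hz; apply/locally_Cmod; exists (s - Cmod (z - z0)%C); split; first by move: Hz; rewrite /V; lra.
  move=> h Hh; rewrite /V (_ : (z + h - z0)%C = ((z - z0) + h)%C); last by ring.
  by apply: (Rle_lt_trans _ _ _ (Cmod_triangle _ _)); lra.
exists V; split; first by rewrite /V /Cminus Cplus_opp_r Cmod_0.
have nz2 := C2_neq_0.
have SX n : Sm n V (fun z => RtoC (Re z - Re z0)).
  apply: (Sm_ext _ _ (fun z => / 2 * (z + Cconj z) - RtoC (Re z0))%C) => //.
    by move=> z _; rewrite RtoC_minus (re_alt z); field.
  apply: Sm_minus => //; last exact: Sm_const.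
  apply: Sm_mult => //; first exact: Sm_const.
  by apply: Sm_plus => //; [exact: Sm_id | apply: (Sm_conj _ _ (fun z => z)) => //; exact: Sm_id].
have i0 : Ci <> RtoC 0 by move=> []; lra.
have SY n : Sm n V (fun z => RtoC (Im z - Im z0)).
  apply: (Sm_ext _ _ (fun z => / (2 * Ci) * (z - Cconj z) - RtoC (Im z0))%C) => //.
    by move=> z _; rewrite RtoC_minus im_alt'; field.
  apply: Sm_minus => //; last exact: Sm_const.
  apply: Sm_mult => //; first exact: Sm_const.
  by apply: Sm_minus => //; [exact: Sm_id | apply: (Sm_conj _ _ (fun z => z)) => //; exact: Sm_id].
have HB z : V z -> Cmod (RtoC (Re z - Re z0)) < s /\ Cmod (RtoC (Im z - Im z0)) < s.
  rewrite /V !Cmod_R => Hz; have := re_le_Cmod (z - z0)%C; have := im_le_Cmod (z - z0)%C.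
  rewrite (_ : Re (z - z0)%C = Re z - Re z0) // (_ : Im (z - z0)%C = Im z - Im z0) //; lra.
apply: (Sm_ext _ _ (fun z => DSf a (RtoC (Re z - Re z0)) (RtoC (Im z - Im z0)))) => //; last exact: (Sm_DSf s).
move=> z Hz; have [_ L] := K z ltac:(move: Hz; rewrite /V /s; lra).
have [b1 b2] := HB z Hz.
set x := RtoC (Re z - Re z0) in b1 *; set y := RtoC (Im z - Im z0) in b2 *.
have Hm : Rmax (Cmod x) (Cmod y) < s by apply: Rmax_lub_lt.
have Hm0 : 0 <= Rmax (Cmod x) (Cmod y) by apply: Rle_trans (Cmod_ge_0 x) (Rmax_l _ _).
have [M1 [q1 G]] := PD_geo a s x y (Rmax (Cmod x) (Cmod y)) HPD ltac:(lra) (Rmax_l _ _) (Rmax_r _ _).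
apply: Cminus_eq; apply: Cmod_eq_0; apply: Rle_antisym; last exact: Cmod_ge_0.
apply: le_epsilon => eps Heps; rewrite Rplus_0_l.
have [N0 K0] := geo_dsum _ _ _ G (eps / 2) ltac:(lra).
have : locally (A z) (fun u => Cmod (u - A z)%C < eps / 2).
  apply/locally_Cmod; exists (eps / 2); split; first lra.
  by move=> h Hh; rewrite (_ : (A z + h - A z)%C = h); last by ring.
move=> /L [N1 K1].
have := K1 (N0 + N1)%nat ltac:(lia); have := K0 (N0 + N1)%nat ltac:(lia).
have -> : dsum (fun j k => (a j k * RtoC ((Re z - Re z0) ^ j * (Im z - Im z0) ^ k))%C) (N0 + N1) =
  dsum (fun j k => a j k * (x ^ j * y ^ k))%C (N0 + N1).
  by apply: sum_n_ext => j; apply: sum_n_ext => l; rewrite /x /y RtoC_mult !RtoC_pow.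
set D := dsum _ _ => B1 B2.
rewrite -/(DSf a x y) in B1.
have -> : (DSf a x y - A z = - (D - DSf a x y) + (D - A z))%C by ring.
apply: (Rle_trans _ _ _ (Cmod_triangle _ _)); rewrite Cmod_opp; lra.
Qed.

(** * The Cayley transform *)

Definition Wz (z : C) : C := ((z - Ci) / (z + Ci))%C.
Definition Zw (w : C) : C := (Ci * (1 + w) / (1 - w))%C.

Lemma Ci_neq_0 : Ci <> RtoC 0.
Proof. by move=> []; lra. Qed.

Lemma Hp_plus_Ci z : Hp z -> (z + Ci)%C <> RtoC 0.
Proof. by rewrite /Hp => H [_ E]; move: E H; rewrite /Im /=; lra. Qed.

Lemma one_minus_Wz z : (z + Ci)%C <> RtoC 0 -> (1 - Wz z = 2 * Ci / (z + Ci))%C.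
Proof. by move=> H; rewrite /Wz; field. Qed.

Lemma Wz_neq_1 z : (z + Ci)%C <> RtoC 0 -> (1 - Wz z)%C <> RtoC 0.
Proof.
move=> H; rewrite one_minus_Wz //; apply: Cmult_neq_0.
  by apply: Cmult_neq_0; [exact: C2_neq_0 | exact: Ci_neq_0].
by move=> E; apply: C1_nz; rewrite -(Cinv_r (z + Ci)%C) // E; ring.
Qed.

Lemma Zw_Wz z : (z + Ci)%C <> RtoC 0 -> Zw (Wz z) = z.
Proof.
move=> H; rewrite /Zw one_minus_Wz // /Wz.
have h2 := C2_neq_0; have hi := Ci_neq_0.
by field.
Qed.

Lemma Zw_plus_Ci w : (1 - w)%C <> RtoC 0 -> (Zw w + Ci = 2 * Ci / (1 - w))%C.
Proof. by move=> H; rewrite /Zw; field. Qed.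

Lemma Zw_plus_Ci_neq_0 w : (1 - w)%C <> RtoC 0 -> (Zw w + Ci)%C <> RtoC 0.
Proof.
move=> H; rewrite Zw_plus_Ci //; apply: Cmult_neq_0.
  by apply: Cmult_neq_0; [exact: C2_neq_0 | exact: Ci_neq_0].
by move=> E; apply: C1_nz; rewrite -(Cinv_r (1 - w)%C) // E; ring.
Qed.

Lemma Wz_Zw w : (1 - w)%C <> RtoC 0 -> Wz (Zw w) = w.
Proof.
move=> H; rewrite /Wz Zw_plus_Ci // /Zw.
have h2 := C2_neq_0; have hi := Ci_neq_0.
by field.
Qed.

Lemma Cmod_sqr_R (z : C) : RtoC (Cmod z ^ 2) = (z * Cconj z)%C.
Proof. by rewrite Cmod2_conj. Qed.

Lemma Cconj_neq_0 (z : C) : z <> RtoC 0 -> Cconj z <> RtoC 0.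
Proof. by move=> H E; apply: H; rewrite -(Cconj_conj z) E Cconj_R. Qed.

Lemma one_minus_Wz_sqr z : (z + Ci)%C <> RtoC 0 -> 1 - Cmod (Wz z) ^ 2 = 4 * Im z / Cmod (z + Ci)%C ^ 2.
Proof.
move=> H; have Hc := Cconj_neq_0 _ H.
have Hm : 0 < Cmod (z + Ci)%C by apply Cmod_gt_0.
apply: RtoC_inj; rewrite RtoC_minus Cmod_sqr_R RtoC_div; last by apply: pow_nonzero; lra.
rewrite RtoC_mult Cmod_sqr_R /Wz Cdiv_conj // Cminus_conj.
rewrite Cplus_conj Cconj_Ci in Hc *.
have hi := Ci_neq_0; have h2 := C2_neq_0.
rewrite im_alt; have H2 := Ci_sqr; field [H2]; repeat split => //.
Qed.

Lemma Wz_disk z : Hp z -> Cmod (Wz z) < 1.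
Proof.
move=> H; have H0 := Hp_plus_Ci _ H; have E := one_minus_Wz_sqr z H0.
have Hm : 0 < Cmod (z + Ci)%C by apply Cmod_gt_0.
have : 0 < 4 * Im z / Cmod (z + Ci)%C ^ 2.
  by apply: Rdiv_lt_0_compat; [move: H; rewrite /Hp; lra | apply: pow_lt].
have := Cmod_ge_0 (Wz z); nra.
Qed.

Lemma disk_neq_1 w : Cmod w < 1 -> (1 - w)%C <> RtoC 0.
Proof. by move=> H /Cminus_eq E; rewrite -E Cmod_1 in H; lra. Qed.

Lemma disk_Re w : Cmod w < 1 -> 0 < Re (1 - w)%C.
Proof.
move=> H; rewrite (_ : Re (1 - w)%C = 1 - Re w); last by rewrite /Re /=; ring.
by have := re_le_Cmod w => /Rabs_le_between; lra.
Qed.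

Lemma Hp_Zw w : Cmod w < 1 -> Hp (Zw w).
Proof.
move=> H; have H1 := disk_neq_1 _ H; have H0 := Zw_plus_Ci_neq_0 w H1.
have E := one_minus_Wz_sqr (Zw w) H0; rewrite Wz_Zw // in E.
have Hm : 0 < Cmod (Zw w + Ci)%C by apply Cmod_gt_0.
rewrite /Hp; have -> : Im (Zw w) = (1 - Cmod w ^ 2) * Cmod (Zw w + Ci)%C ^ 2 / 4.
  by rewrite E; field; lra.
have := Cmod_ge_0 w => Hw.
apply: Rdiv_lt_0_compat; last lra.
by apply: Rmult_lt_0_compat; [nra | apply: pow_lt].
Qed.

Lemma open_Hp : open Hp.
Proof.
move=> z Hz; apply/locally_Cmod; exists (Im z); split=> // h Hh.
rewrite /Hp im_plus; have := im_le_Cmod h => /Rabs_le_between; lra.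
Qed.

Definition dZ (w : C) : C := (2 * Ci / ((1 - w) * (1 - w)))%C.
Definition dW (z : C) : C := (2 * Ci / ((z + Ci) * (z + Ci)))%C.

Lemma is_Wd_Zw w : (1 - w)%C <> RtoC 0 -> is_Wd Zw w (dZ w) 0.
Proof.
move=> H.
have D := is_Wd_div (fun w => Ci * (1 + w))%C (fun w => 1 - w)%C w _ _ _ _ H
  (is_Wd_scal Ci _ _ _ _ (is_Wd_plus _ _ _ _ _ _ _ (is_Wd_const 1 w) (is_Wd_id w)))
  (is_Wd_minus _ _ _ _ _ _ _ (is_Wd_const 1 w) (is_Wd_id w)).
by apply: (is_Wd_eq _ _ _ _ _ _ D); rewrite /dZ; field.
Qed.

Lemma is_Wd_Wz z : (z + Ci)%C <> RtoC 0 -> is_Wd Wz z (dW z) 0.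
Proof.
move=> H.
have D := is_Wd_div (fun z => z - Ci)%C (fun z => z + Ci)%C z _ _ _ _ H
  (is_Wd_minus _ _ _ _ _ _ _ (is_Wd_id z) (is_Wd_const Ci z))
  (is_Wd_plus _ _ _ _ _ _ _ (is_Wd_id z) (is_Wd_const Ci z)).
by apply: (is_Wd_eq _ _ _ _ _ _ D); rewrite /dW; field.
Qed.

Lemma Sm_Cpowc k (W : C -> Prop) (g : C -> C) c : open W -> (forall z, W z -> 0 < Re (g z)) ->
  (forall n, Sm n W g) -> Sm k W (fun z => Cpowc (g z) c).
Proof.
move=> HW Hg Sg.
have D z : W z -> is_Wd (fun z => Cpowc (g z) c) z (c * (Cpowc (g z) c * (/ g z * dz g z))) (c * (Cpowc (g z) c * (/ g z * dzb g z))).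
  move=> Hz; have Hn := Re_pos_neq_0 _ (Hg _ Hz).
  have := is_Wd_comp _ _ _ _ _ _ _ (Sm_is_Wd 0 W g z (Sg 1%nat) Hz) (is_Wd_Cpowc _ c (Hg _ Hz)) => D.
  by apply: (is_Wd_eq _ _ _ _ _ _ D); field.
have Si n : Sm n W (fun z => / g z)%C.
  by apply: Sm_inv => // z Hz; apply: Re_pos_neq_0; exact: Hg.
elim: k => [|k IH]; first by move=> z Hz; exact: is_Wd_continuous (D z Hz).
have [_ [S1 S2]] := Sg (S k).
apply: (Sm_intro _ _ _ (fun z => c * (Cpowc (g z) c * (/ g z * dz g z)))%C (fun z => c * (Cpowc (g z) c * (/ g z * dzb g z)))%C) => //.
  by apply: Sm_mult => //; [exact: Sm_const | apply: Sm_mult => //; exact: Sm_mult].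
by apply: Sm_mult => //; [exact: Sm_const | apply: Sm_mult => //; exact: Sm_mult].
Qed.

Lemma Sm_mod_sqr k (W : C -> Prop) : open W -> Sm k W (fun w => w * Cconj w)%C.
Proof.
move=> HW; apply: Sm_mult => //; first exact: Sm_id.
by apply: (Sm_conj _ _ (fun z => z)) => //; exact: Sm_id.
Qed.

Lemma Sm_spow k (W : C -> Prop) c : open W -> (forall w, W w -> Cmod w < 1) ->
  Sm k W (fun w => spow c (w * Cconj w)).
Proof.
move=> HW Hd; apply: (Sm_Cpowc k W (fun w => 1 - w * Cconj w)%C c) => //.
  by move=> w /Hd; exact: disk_sqr_lt_1.
by move=> n; apply: Sm_minus => //; [exact: Sm_const | exact: Sm_mod_sqr].
Qed.

Lemma spow_opp c t : (spow (- c) t * spow c t = 1)%C.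
Proof. by rewrite /spow -Cpowc_plus (_ : (- c + c)%C = RtoC 0) ?Cpowc_0 //; ring. Qed.

(** * Harmonic functions in the disk model *)

Definition PhiF (r : C) (F : C -> C) (w : C) : C := (Cpowc (1 - w) (- r) * F (Zw w))%C.

Lemma is_Wd_one_minus_pow w c : Cmod w < 1 ->
  is_Wd (fun w => Cpowc (1 - w) c) w (- c * Cpowc (1 - w) c / (1 - w)) 0.
Proof. by move=> H; exact: is_Wd_spow (disk_Re _ H). Qed.

(** [R0] may be negative: with [R0 = -1] the annulus is the whole disk including the origin, the
    case needed for uniqueness. *)
Lemma PhiF_disk_harm r R0 (V : C -> Prop) F : rHarm r V F ->
  (forall w, Ann R0 1 w -> V (Zw w)) -> exists phi, disk_harm r R0 (PhiF r F) phi.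
Proof.
move=> [OV [HV [HF PDE]]] HA.
have OA := open_Ann R0 1.
have Hd w : Ann R0 1 w -> Cmod w < 1 by case.
have H1 w : Ann R0 1 w -> (1 - w)%C <> RtoC 0 by move=> /Hd; exact: disk_neq_1.
have SF := C2_on_Sm _ _ OV HF.
have S1w n : Sm n (Ann R0 1) (fun w => 1 - w)%C by apply: Sm_minus => //; [exact: Sm_const | exact: Sm_id].
have SdZ n : Sm n (Ann R0 1) dZ.
  apply: Sm_mult => //; first exact: Sm_const.
  apply: Sm_inv => //; last exact: Sm_mult.
  by move=> w /H1 Hw; exact: Cmult_neq_0.
have SFZ n G : Sm n V G -> Sm n (Ann R0 1) (fun w => G (Zw w)).
  move=> SG; apply: (Sm_comp n V (Ann R0 1) G Zw dZ) => //.
  by move=> w /H1; exact: is_Wd_Zw.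
have SP n : Sm n (Ann R0 1) (fun w => Cpowc (1 - w) (- r)).
  by apply: (Sm_Cpowc n _ (fun w => 1 - w)%C) => // w /Hd; exact: disk_Re.
have SPhi : Sm 2 (Ann R0 1) (PhiF r F) by apply: Sm_mult => //; exact: SFZ.
have [DPhi [SPa SPb]] := SPhi.
(* Multiplying by $s^r$ undoes the factor prescribed in [disk_harm]; the differential equation of
   [F] amounts to the vanishing of the $w$-derivative of this [phi]. *)
set phi := fun w => (spow r (w * Cconj w) * dzb (PhiF r F) w)%C.
have Sphi : Sm 1 (Ann R0 1) phi by apply: Sm_mult => //; exact: Sm_spow.
have [Dphi [_ Sphib]] := Sphi.
have [SF1 [SF2 SF3]] := SF; have [SFb1 [SFb2 SFb3]] := SF3.
have Eb w : Ann R0 1 w -> dzb (PhiF r F) w = (Cpowc (1 - w) (- r) * (dzb F (Zw w) * Cconj (dZ w)))%C.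
  move=> Hw.
  have D1 := is_Wd_comp _ _ _ _ _ _ _ (is_Wd_Zw _ (H1 _ Hw)) (SF1 _ (HA _ Hw)).
  have D := is_Wd_mult _ _ _ _ _ _ _ (is_Wd_one_minus_pow w (- r) (Hd _ Hw)) D1.
  have [_ ->] := is_Wd_dz _ _ _ _ D; ring.
exists phi, (dz (PhiF r F)), (dzb phi) => w Hw.
split.
  have -> : (spow (- r) (w * Cconj w) * phi w)%C = dzb (PhiF r F) w.
    by rewrite /phi Cmult_assoc spow_opp Cmult_1_l.
  exact: DPhi.
split; first exact: (Sm_continuous 1 (Ann R0 1) (dz (PhiF r F)) w SPa Hw).
split; last exact: (Sm_continuous 0 (Ann R0 1) (dzb phi) w Sphib Hw).
have := Dphi _ Hw; suff -> : dz phi w = RtoC 0 by [].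
have Hs := disk_sqr_lt_1 w (Hd _ Hw); have Hs0 := Re_pos_neq_0 _ Hs.
have Hw1 := H1 _ Hw; have Hwc1 : (1 - Cconj w)%C <> RtoC 0.
  by have := Cconj_neq_0 _ Hw1; rewrite Cminus_conj Cconj_R.
have Ds := is_Wd_comp _ _ _ _ _ _ _ (is_Wd_mult _ _ _ _ _ _ _ (is_Wd_id w) (is_Wd_conj_id w)) (is_Wd_spow r _ Hs).
have DF := is_Wd_comp _ _ _ _ _ _ _ (is_Wd_Zw _ Hw1) (SFb1 _ (HA _ Hw)).
have DZ := is_Wd_conj _ _ _ _ (Sm_is_Wd 0 _ dZ w (SdZ 1%nat) Hw).
have [_ EZ] : dz dZ w = dz dZ w /\ dzb dZ w = RtoC 0.
  split=> //.
  have D2 := is_Wd_minus _ _ _ _ _ _ _ (is_Wd_const 1 w) (is_Wd_id w).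
  have D3 := is_Wd_div (fun _ => 2 * Ci)%C (fun w => (1 - w) * (1 - w))%C w _ _ _ _ (Cmult_neq_0 _ _ Hw1 Hw1) (is_Wd_const (2 * Ci) w) (is_Wd_mult _ _ _ _ _ _ _ D2 D2).
  have [_ ->] := is_Wd_dz dZ _ _ _ D3; field; exact: Hw1.
rewrite EZ Cconj_R in DZ.
have D := is_Wd_mult _ _ _ _ _ _ _ Ds (is_Wd_mult _ _ _ _ _ _ _ (is_Wd_one_minus_pow w (- r) (Hd _ Hw)) (is_Wd_mult _ _ _ _ _ _ _ DF DZ)).
(* The closed form agrees with [phi] on the annulus only, which is enough to differentiate it
   there. *)
set prod := fun w => (spow r (w * Cconj w) * (Cpowc (1 - w) (- r) * (dzb F (Zw w) * Cconj (dZ w))))%C.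
have E : exists d, 0 < d /\ forall h, Cmod h < d -> prod (w + h)%C = phi (w + h)%C.
  have [d [Hdd K]] := open_Cmod _ _ OA Hw.
  by exists d; split=> // h /K Hh; rewrite /phi Eb.
have D' := is_Wd_ext_loc prod phi w _ _ E D.
have [-> _] := is_Wd_dz _ _ _ _ D'.
have Hy := HV _ (HA _ Hw).
have Ey : RtoC (Im (Zw w)) = ((1 - w * Cconj w) / ((1 - w) * (1 - Cconj w)))%C.
  have hi := Ci_neq_0; have h2 := C2_neq_0.
  rewrite im_alt /Zw Cdiv_conj // Cminus_conj Cmult_conj Cplus_conj !Cconj_R Cconj_Ci.
  by field.
have Ezz : dz (dzb F) (Zw w) = (Ci * r / (2 * Im (Zw w)) * dzb F (Zw w))%C.
  have Hy0 : RtoC (Im (Zw w)) <> RtoC 0 by move=> /RtoC_inj Ey0; rewrite /Hp Ey0 in Hy; lra.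
  have P := PDE _ (HA _ Hw); have h2 := C2_neq_0.
  apply: Cminus_eq.
  transitivity ((- 4 * Im (Zw w) ^ 2 * dz (dzb F) (Zw w) + 2 * Ci * r * Im (Zw w) * dzb F (Zw w)) * (-1 / (4 * Im (Zw w) ^ 2)))%C.
    by field.
  by rewrite P; ring.
rewrite Ezz Ey /dZ.
have h2 := C2_neq_0; have hi := Ci_neq_0.
rewrite !(Cconj_R, Cdiv_conj, Cmult_conj, Cminus_conj, Cconj_Ci); try by apply: Cmult_neq_0.
have H := Ci_sqr.
field [H]; repeat split => //.
Qed.

Lemma Im_of_Wz z : Hp z -> RtoC (Im z) = ((1 - Wz z * Cconj (Wz z)) / ((1 - Wz z) * (1 - Cconj (Wz z))))%C.
Proof.
move=> Hz; have H0 := Hp_plus_Ci _ Hz.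
have Hw := Wz_neq_1 _ H0; move: (Zw_Wz _ H0) Hw; move: (Wz z) => w Ew Hw; rewrite -Ew.
have Hwc := Cconj_neq_0 _ Hw; rewrite Cminus_conj Cconj_R in Hwc.
have hi := Ci_neq_0; have h2 := C2_neq_0.
rewrite im_alt /Zw Cdiv_conj // Cminus_conj Cmult_conj Cplus_conj !Cconj_R Cconj_Ci.
by field.
Qed.

Definition Ghat (r : C) (G : C -> C) (z : C) : C := (Cpowc (1 - Wz z) r * G (Wz z))%C.

Lemma Sm_dW n : Sm n Hp dW.
Proof.
have O := open_Hp.
have S1 : Sm n Hp (fun z => z + Ci)%C by apply: Sm_plus => //; [exact: Sm_id | exact: Sm_const].
apply: Sm_mult => //; first exact: Sm_const.
apply: Sm_inv => //; last exact: Sm_mult.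
by move=> z /Hp_plus_Ci Hz; exact: Cmult_neq_0.
Qed.

Lemma Sm_Wz n : Sm n Hp Wz.
Proof.
have O := open_Hp.
apply: Sm_mult => //; first by apply: Sm_minus => //; [exact: Sm_id | exact: Sm_const].
apply: Sm_inv => //; first exact: Hp_plus_Ci.
by apply: Sm_plus => //; [exact: Sm_id | exact: Sm_const].
Qed.

(** The computation of [PhiF_disk_harm] read backwards, with [Gd_wbar] giving the derivative in
    $\bar w$ on the whole disk. *)
Lemma Ghat_rHarm r b al : PS1 b 1 -> PS1 al 1 -> rHarm r Hp (Ghat r (Gd r b al)).
Proof.
move=> Hb Hal; have O := open_Hp.
have HD z : Hp z -> unit_disk (Wz z) by exact: Wz_disk.
have SG n : Sm n Hp (fun z => Gd r b al (Wz z)).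
  apply: (Sm_comp n unit_disk Hp _ Wz dW) => //; try exact: open_unit_disk.
  - by move=> z /Hp_plus_Ci; exact: is_Wd_Wz.
  - by move=> k; exact: Sm_dW.
  - exact: Sm_Gd.
have SP n : Sm n Hp (fun z => Cpowc (1 - Wz z) r).
  apply: (Sm_Cpowc n _ (fun z => 1 - Wz z)%C) => //; first by move=> z /HD; exact: disk_Re.
  by move=> k; apply: Sm_minus => //; [exact: Sm_const | exact: Sm_Wz].
have S n : Sm n Hp (Ghat r (Gd r b al)) by exact: Sm_mult.
split=> //; split=> //; split; first by apply: Sm_C2_on.
have [_ [_ Sb]] := S 2%nat.
have Eb z : Hp z -> dzb (Ghat r (Gd r b al)) z =
   (Cpowc (1 - Wz z) r * ((spow (- r) (Wz z * Cconj (Wz z)) * OSer al (Cconj (Wz z))) * Cconj (dW z)))%C.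
  move=> Hz; have DW := is_Wd_Wz _ (Hp_plus_Ci _ Hz).
  have D1 := is_Wd_comp _ _ _ _ _ _ _ DW (Gd_wbar r b al Hb Hal _ (HD _ Hz)).
  have D2 := is_Wd_comp _ _ _ _ _ _ _ DW (is_Wd_one_minus_pow (Wz z) r (HD _ Hz)).
  have [_ ->] := is_Wd_dz _ _ _ _ (is_Wd_mult _ _ _ _ _ _ _ D2 D1); rewrite ?Cconj_R; ring.
move=> z Hz; have Hd := HD _ Hz.
have DW := is_Wd_Wz _ (Hp_plus_Ci _ Hz).
set w := Wz z in Hd.
have Hs := disk_sqr_lt_1 w Hd; have Hs0 := Re_pos_neq_0 _ Hs.
have Hcw : Cmod (Cconj w) < 1 by rewrite Cmod_conj.
have D2 := is_Wd_comp _ _ _ _ _ _ _ DW (is_Wd_one_minus_pow w r Hd).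
have Ds := is_Wd_comp _ _ _ _ _ _ _ (is_Wd_mult _ _ _ _ _ _ _ (is_Wd_id w) (is_Wd_conj_id w)) (is_Wd_spow (- r) _ Hs).
have Da := is_Wd_comp _ _ _ _ _ _ _ (is_Wd_conj_id w) (is_Wd_OSer al 1 (Cconj w) Hal Hcw).
have D3 := is_Wd_comp _ _ _ _ _ _ _ DW (is_Wd_mult _ _ _ _ _ _ _ Ds Da).
have DZ := is_Wd_conj _ _ _ _ (Sm_is_Wd 0 _ dW z (Sm_dW 1%nat) Hz).
have H0 := Hp_plus_Ci _ Hz.
have EZ : dzb dW z = RtoC 0.
  have D4 := is_Wd_plus _ _ _ _ _ _ _ (is_Wd_id z) (is_Wd_const Ci z).
  have D5 := is_Wd_div (fun _ => 2 * Ci)%C (fun z => (z + Ci) * (z + Ci))%C z _ _ _ _ (Cmult_neq_0 _ _ H0 H0) (is_Wd_const (2 * Ci) z) (is_Wd_mult _ _ _ _ _ _ _ D4 D4).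
  have [_ ->] := is_Wd_dz dW _ _ _ D5; field; exact: H0.
rewrite EZ Cconj_R in DZ.
have D := is_Wd_mult _ _ _ _ _ _ _ D2 (is_Wd_mult _ _ _ _ _ _ _ D3 DZ).
set prod := fun z => (Cpowc (1 - Wz z) r * ((spow (- r) (Wz z * Cconj (Wz z)) * OSer al (Cconj (Wz z))) * Cconj (dW z)))%C.
have E : exists d, 0 < d /\ forall h, Cmod h < d -> prod (z + h)%C = dzb (Ghat r (Gd r b al)) (z + h)%C.
  have [d [Hdd K]] := open_Cmod _ _ O Hz.
  by exists d; split=> // h /K Hh; rewrite Eb.
have D' := is_Wd_ext_loc prod _ z _ _ E D.
have [-> _] := is_Wd_dz _ _ _ _ D'.
rewrite Eb // (Im_of_Wz _ Hz) -/w.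
have Hw1 := disk_neq_1 _ Hd; have Hwc1 := disk_neq_1 _ Hcw.
have EdW : dW z = ((1 - w) * (1 - w) / (2 * Ci))%C.
  have hi := Ci_neq_0; have h2 := C2_neq_0; have H2 := Ci_sqr.
  by rewrite /w one_minus_Wz // /dW; field.
rewrite EdW.
clear D' D D3 D2 Ds Da DZ E EdW DW; clearbody w.
have h2 := C2_neq_0; have hi := Ci_neq_0.
rewrite !(Cconj_R, Cdiv_conj, Cmult_conj, Cminus_conj, Cconj_Ci); try by apply: Cmult_neq_0.
have H := Ci_sqr.
field [H]; repeat split => //.
Qed.

Lemma rHarm_sub r (V V' : C -> Prop) F : open V' -> (forall z, V' z -> V z) -> rHarm r V F -> rHarm r V' F.
Proof.
move=> O S [OV [HV [[C1 [C2 C3]] P]]].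
split=> //; split; first by move=> z /S /HV.
split; last by move=> z /S /P.
by split; [|split] => z /S; [move=> /C1 | move=> /C2 | move=> /C3].
Qed.

Lemma rHarm_minus r (V : C -> Prop) F G : rHarm r V F -> rHarm r V G -> rHarm r V (fun z => F z - G z)%C.
Proof.
move=> [OV [HV [CF PF]]] [_ [_ [CG PG]]].
have SF := C2_on_Sm _ _ OV CF; have SG := C2_on_Sm _ _ OV CG.
have [F1 [F2 F3]] := SF; have [G1 [G2 G3]] := SG.
have [F4 _] := F3; have [G4 _] := G3.
split=> //; split=> //; split; first by apply: Sm_C2_on => //; exact: Sm_minus.
have Eb z : V z -> dzb (fun z => F z - G z)%C z = (dzb F z - dzb G z)%C.
  by move=> Hz; have [_ ->] := is_Wd_dz _ _ _ _ (is_Wd_minus _ _ _ _ _ _ _ (F1 _ Hz) (G1 _ Hz)).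
move=> z Hz.
have D := is_Wd_minus _ _ _ _ _ _ _ (F4 _ Hz) (G4 _ Hz).
have E : exists d, 0 < d /\ forall h, Cmod h < d -> (fun z => dzb F z - dzb G z)%C (z + h)%C = dzb (fun z => F z - G z)%C (z + h)%C.
  have [d [Hdd K]] := open_Cmod _ _ OV Hz.
  by exists d; split=> // h /K Hh; rewrite Eb.
have D' := is_Wd_ext_loc _ _ z _ _ E D.
have [-> _] := is_Wd_dz _ _ _ _ D'; rewrite Eb //.
have P1 := PF _ Hz; have P2 := PG _ Hz.
transitivity ((- 4 * Im z ^ 2 * dz (dzb F) z + 2 * Ci * r * Im z * dzb F z) - (- 4 * Im z ^ 2 * dz (dzb G) z + 2 * Ci * r * Im z * dzb G z))%C; first by ring.
by rewrite P1 P2; ring.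
Qed.

(** In the disk coordinate $2i/(z-i)=(1-w)/w$ and the base of the power is $(1-w)/s$, so that
    $f_r=(1-w)^rs^{1-r}/w$. *)
Lemma div_f_r r z X : Hp z -> z <> Ci ->
  (X / f_r r z)%C = (Wz z * (spow (r - 1) (Wz z * Cconj (Wz z)) * (Cpowc (1 - Wz z) (- r) * X)))%C.
Proof.
move=> Hz Hzi; have H0 := Hp_plus_Ci _ Hz; have Hd := Wz_disk _ Hz.
have Hw1 := disk_neq_1 _ Hd; have HRe := disk_Re _ Hd.
have hi := Ci_neq_0; have h2 := C2_neq_0.
set w := Wz z in Hd Hw1 HRe *.
have Hs : 0 < 1 - Cmod w ^ 2 by have := Cmod_ge_0 w; nra.
have Es : (1 - w * Cconj w)%C = RtoC (1 - Cmod w ^ 2) by rewrite RtoC_minus Cmod_sqr_R.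
have Hs0 : (1 - w * Cconj w)%C <> RtoC 0 by rewrite Es => /RtoC_inj; lra.
have Hcw : Cmod (Cconj w) < 1 by rewrite Cmod_conj.
have Hwc1 := disk_neq_1 _ Hcw.
have Ez : z = Zw w by rewrite /w Zw_Wz.
have Ezc : Cconj z = (- Ci * (1 + Cconj w) / (1 - Cconj w))%C.
  by rewrite Ez /Zw Cdiv_conj // Cmult_conj Cminus_conj Cplus_conj Cconj_Ci !Cconj_R.
have Hzz : (Cconj z - z)%C <> RtoC 0.
  move=> E; have := im_alt' z; have : (z - Cconj z = 0)%C by transitivity (- (Cconj z - z))%C; [ring | rewrite E; ring].
  move=> -> E2; move: Hz; rewrite /Hp.
  have : RtoC (Im z) = RtoC 0.
    by transitivity ((2 * Ci * Im z) / (2 * Ci))%C; [field | rewrite -E2; field].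
  by move=> /RtoC_inj ->; lra.
(* The second factor is a positive real, which permits splitting the principal power. *)
have Ebase : ((Cconj z - Ci) / (Cconj z - z) = (1 - w) * RtoC (/ (1 - Cmod w ^ 2)))%C.
  rewrite RtoC_inv; last lra.
  rewrite -Es.
  have Hx : (Cconj z - z)%C = (- (2 * Ci) * (1 - w * Cconj w) / ((1 - w) * (1 - Cconj w)))%C.
    by rewrite Ezc Ez /Zw; field.
  rewrite Hx Ezc; field; repeat split => //.
have Hi := Rinv_0_lt_compat _ Hs.
rewrite /f_r Ebase Cpowc_scal // Cpowc_inv_R // -Es -/(spow (- (r - 1)) (w * Cconj w)).
have S1 := spow_opp (r - 1) (w * Cconj w).
have Hsp : spow (- (r - 1)) (w * Cconj w) <> RtoC 0 by exact: Cpowc_neq_0.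
have Ep : (Cpowc (1 - w) (- r) * (Cpowc (1 - w) (r - 1) * (1 - w)) = 1)%C.
  transitivity (Cpowc (1 - w) (- r) * (Cpowc (1 - w) (r - 1) * Cpowc (1 - w) 1))%C.
    by rewrite Cpowc_1.
  by rewrite -!Cpowc_plus (_ : (- r + (r - 1 + 1))%C = RtoC 0) ?Cpowc_0 //; ring.
have Hp1 : Cpowc (1 - w) (r - 1) <> RtoC 0 by exact: Cpowc_neq_0.
have Hzi' : (z - Ci)%C <> RtoC 0 by move=> /Cminus_eq.
have E1 : Cpowc (1 - w) (- r) = (/ (Cpowc (1 - w) (r - 1) * (1 - w)))%C.
  transitivity (Cpowc (1 - w) (- r) * (Cpowc (1 - w) (r - 1) * (1 - w)) / (Cpowc (1 - w) (r - 1) * (1 - w)))%C; first by field.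
  by rewrite Ep; field.
have E2 : spow (r - 1) (w * Cconj w) = (/ spow (- (r - 1)) (w * Cconj w))%C.
  transitivity (spow (- (r - 1)) (w * Cconj w) * spow (r - 1) (w * Cconj w) / spow (- (r - 1)) (w * Cconj w))%C; first by field.
  by rewrite S1; field.
have Ew : w = ((z - Ci) / (2 * Ci) * (1 - w))%C.
  by rewrite {2}/w one_minus_Wz // /w /Wz; field.
rewrite E1 E2.
transitivity ((z - Ci) / (2 * Ci) * (1 - w) * (/ spow (- (r - 1)) (w * Cconj w) * (/ (Cpowc (1 - w) (r - 1) * (1 - w)) * X)))%C;
  last by rewrite -Ew.
field; repeat split => //.
Qed.

(** * Neighbourhoods of the real projective line *)

Definition Wp (p : P1C) : C := match p with Some z => Wz z | None => RtoC 1 end.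

Definition Winf (w : C) : C := ((1 - Ci * w) / (1 + Ci * w))%C.

Lemma chart_inf_0 : chart_inf 0 = None.
Proof. by rewrite /chart_inf /=; case: Req_dec_T => // _; case: Req_dec_T. Qed.

Lemma chart_inf_neq_0 (w : C) : w <> RtoC 0 -> chart_inf w = Some (/ w)%C.
Proof.
move=> H; rewrite /chart_inf; case: Req_dec_T => // H1; case: Req_dec_T => // H2.
by case: H; exact: C_ext.
Qed.

(** Division by zero gives the Cayley transform the value 0 at its pole. Hence [Wp p <> 0] excludes
    the pole too, and the sets [thin] stay away from it. *)
Lemma Wz_minus_Ci : Wz (- Ci)%C = RtoC 0.
Proof.
rewrite /Wz; have -> : (- Ci + Ci)%C = RtoC 0 by ring.
by rewrite /Cdiv (_ : (/ 0)%C = RtoC 0); [ring | apply: C_ext; rewrite /Cinv /Re /Im /= /Rdiv ?Ropp_0 Rmult_0_l].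
Qed.

Lemma Wz_neq_0 z : Wz z <> RtoC 0 -> (z + Ci)%C <> RtoC 0.
Proof.
move=> H E; apply: H; rewrite -Wz_minus_Ci; congr Wz.
by transitivity (z + Ci - Ci)%C; [ring | rewrite E; ring].
Qed.

Lemma Wp_chart_inf (w : C) : (1 + Ci * w)%C <> RtoC 0 -> Wp (chart_inf w) = Winf w.
Proof.
move=> H; case: (excluded_middle_informative (w = RtoC 0)) => [-> | Hw].
  by rewrite chart_inf_0 /Winf /=; field.
rewrite chart_inf_neq_0 //= /Wz /Winf; field; repeat split => //.
Qed.

Lemma Wp_chart_inf_neq_0 (w : C) : Wp (chart_inf w) <> RtoC 0 -> (1 + Ci * w)%C <> RtoC 0.
Proof.
move=> H E; apply: H.
have Ew : w = Ci.
  transitivity (- (Ci * Ci) * w)%C; first by rewrite Ci_sqr; ring.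
  by transitivity (- Ci * (1 + Ci * w) + Ci)%C; [ring | rewrite E; ring].
rewrite Ew chart_inf_neq_0; last exact: Ci_neq_0.
by rewrite Ci_inv /= Wz_minus_Ci.
Qed.

Definition thin (mu : R) (p : P1C) : Prop := Ann (/ mu) mu (Wp p).

Lemma thin_neq_0 mu p : 1 < mu -> thin mu p -> Wp p <> RtoC 0.
Proof.
move=> Hm [H _] E; rewrite E Cmod_0 in H.
have := Rinv_0_lt_compat mu ltac:(lra); lra.
Qed.

Lemma locally_neq_0 (f : C -> C) (z : C) : continuous f z -> f z <> RtoC 0 -> locally z (fun u => f u <> RtoC 0).
Proof.
move=> /continuous_Cmod H Hn; have Hm : 0 < Cmod (f z) by apply Cmod_gt_0.
apply/locally_Cmod; have [d [Hd K]] := H _ Hm; exists d; split=> // h /K B E.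
by rewrite E (_ : (0 - f z)%C = (- f z)%C) ?Cmod_opp in B; [lra | ring].
Qed.

Lemma continuous_plus_Ci z : continuous (fun z : C => z + Ci)%C z.
Proof. exact: is_Wd_continuous (is_Wd_plus _ _ _ _ _ _ _ (is_Wd_id z) (is_Wd_const Ci z)). Qed.

Lemma is_Wd_1_Ci z : is_Wd (fun z : C => 1 + Ci * z)%C z (0 + Ci * 1) (0 + Ci * 0).
Proof. exact: is_Wd_plus (is_Wd_const 1 z) (is_Wd_scal Ci _ _ _ _ (is_Wd_id z)). Qed.

Lemma openP1_thin mu : 1 < mu -> openP1 (thin mu).
Proof.
move=> Hm; split.
  move=> z Hz; have H0 := Wz_neq_0 _ (thin_neq_0 _ (Some z) Hm Hz).
  apply: (is_Wd_continuous _ _ _ _ (is_Wd_Wz _ H0) (Ann (/ mu) mu)); exact: open_Ann.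
move=> w Hw; have H0 := Wp_chart_inf_neq_0 _ (thin_neq_0 _ _ Hm Hw).
have L0 := locally_neq_0 _ w (is_Wd_continuous _ _ _ _ (is_Wd_1_Ci w)) H0.
have D := is_Wd_div (fun w => 1 + -1 * (Ci * w))%C (fun w => 1 + Ci * w)%C w _ _ _ _ H0
  (is_Wd_plus _ _ _ _ _ _ _ (is_Wd_const 1 w) (is_Wd_scal (-1) _ _ _ _ (is_Wd_scal Ci _ _ _ _ (is_Wd_id w)))) (is_Wd_1_Ci w).
have L1 : locally w (fun u => Ann (/ mu) mu ((1 + -1 * (Ci * u)) / (1 + Ci * u))%C).
  apply: (is_Wd_continuous _ _ _ _ D (Ann (/ mu) mu)); apply: open_Ann.
  move: Hw; rewrite /thin Wp_chart_inf // /Winf.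
  by rewrite (_ : (1 - Ci * w)%C = (1 + -1 * (Ci * w))%C); last by ring.
apply: filter_imp (filter_and _ _ L0 L1) => u [H1 H2].
rewrite /thin Wp_chart_inf // /Winf.
by rewrite (_ : (1 - Ci * u)%C = (1 + -1 * (Ci * u))%C); last by ring.
Qed.

Lemma Wz_real z : Im z = 0 -> Cmod (Wz z) = 1.
Proof.
move=> H; have H0 : (z + Ci)%C <> RtoC 0 by move=> [_]; rewrite /Im in H; rewrite /= H; lra.
have := one_minus_Wz_sqr z H0; rewrite H Rmult_0_r /Rdiv Rmult_0_l => E.
have := Cmod_ge_0 (Wz z); nra.
Qed.

Lemma nbhd_thin mu : 1 < mu -> nbhdP1R (thin mu).
Proof.
move=> Hm; have Hi : / mu < 1 by rewrite -Rinv_1; apply: Rinv_lt_contravar; lra.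
split; first exact: openP1_thin.
by case=> [z|] /= H; rewrite /thin /Ann /= ?Wz_real // ?Cmod_1; lra.
Qed.

Lemma nbhd_inter U V : nbhdP1R U -> nbhdP1R V -> nbhdP1R (fun p => U p /\ V p).
Proof.
move=> [[O1 O2] H] [[O3 O4] H']; split; last by move=> p Hp; split; [exact: H | exact: H'].
split; first by apply: open_and.
by apply: open_and.
Qed.

(** The chart at infinity covers all points of large modulus; the rest of the real line is a
    segment, and compactness gives the strip around it a uniform height. *)
Lemma nbhd_contains U : nbhdP1R U -> exists M d, 0 < M /\ 0 < d /\
  forall z, (M < Cmod z -> U (Some z)) /\ (Cmod z <= M -> Rabs (Im z) < d -> U (Some z)).
Proof.
move=> [[O1 O2] H].
have U0 : U (chart_inf 0) by apply: H; rewrite chart_inf_0.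
have [d0 [Hd0 K0]] := open_Cmod _ _ O2 U0.
set M := / d0; have HM : 0 < M by exact: Rinv_0_lt_compat.
have D x : exists d : posreal, forall z, Rabs (Re z - x) < d -> Rabs (Im z) < d -> U (Some z).
  have Ux : U (Some (RtoC x)) by exact: H.
  have [d [Hd K]] := open_Cmod _ (RtoC x) O1 Ux.
  have Hd2 : 0 < d / 2 by lra.
  exists (mkposreal _ Hd2) => z /= H1 H2.
  rewrite (_ : z = (RtoC x + (z - RtoC x))%C); last by ring.
  apply: K; apply: (Rle_lt_trans _ _ _ (Cmod_le_ReIm _)).
  rewrite (_ : Re (z - x)%C = Re z - x) // (_ : Im (z - x)%C = Im z); last by rewrite /Im /=; ring.
  lra.
pose delta x := proj1_sig (constructive_indefinite_description _ (D x)).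
have Hdelta x : forall z, Rabs (Re z - x) < delta x -> Rabs (Im z) < delta x -> U (Some z).
  exact: (proj2_sig (constructive_indefinite_description _ (D x))).
have [d Hd] := compactness_value_1d (- M) M delta.
exists M, d; split=> //; split; first exact: cond_pos.
move=> z; split.
  move=> Hz; have Hz0 : z <> RtoC 0 by apply Cmod_gt_0; lra.
  have Hi : (/ z)%C <> RtoC 0 by move=> E; apply: C1_nz; rewrite -(Cinv_r z) // E; ring.
  have Eii : (/ / z = z)%C by field.
  have := K0 (/ z)%C; rewrite Cplus_0_l chart_inf_neq_0 // Eii; apply.
  rewrite Cmod_inv // -(Rinv_inv d0); apply: Rinv_lt_contravar => //.
  by apply: Rmult_lt_0_compat => //; lra.
move=> Hz Hy.
(* [compactness_value_1d] yields only a doubly negated existence, hence the argument by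
   contradiction. *)
case: (classic (U (Some z))) => // Hn; exfalso.
have Hx : - M <= Re z <= M by have := re_le_Cmod z => /Rabs_le_between; lra.
apply: (Hd _ Hx) => -[t [_ [H1 H2]]]; apply: Hn.
by apply: (Hdelta t) => //; lra.
Qed.

Lemma nbhd_annulus U : nbhdP1R U -> exists e, 0 < e <= 1 / 2 /\
  forall z, (z + Ci)%C <> RtoC 0 -> Rabs (1 - Cmod (Wz z) ^ 2) < e -> U (Some z).
Proof.
move=> /nbhd_contains [M [d [HM [Hd K]]]].
have HM2 : 0 < (M + 1) ^ 2 by apply: pow_lt; lra.
exists (Rmin (1 / 2) (4 * d / (M + 1) ^ 2)).
have Hp : 0 < 4 * d / (M + 1) ^ 2 by apply: Rdiv_lt_0_compat; lra.
split; first by split; [apply: Rmin_pos; lra | exact: Rmin_l].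
move=> z Hz He; have [K1 K2] := K z.
case: (Rle_dec (Cmod z) M) => Hm; last by apply: K1; lra.
apply: K2 => //.
have Hc : 0 < Cmod (z + Ci)%C by apply Cmod_gt_0.
have Hc2 : Cmod (z + Ci)%C <= M + 1.
  by apply: (Rle_trans _ _ _ (Cmod_triangle _ _)); rewrite Cmod_Ci; lra.
rewrite (one_minus_Wz_sqr _ Hz) in He.
have He2 := Rlt_le_trans _ _ _ He (Rmin_r _ _).
have Hc3 : 0 < Cmod (z + Ci)%C ^ 2 by apply: pow_lt.
have Hc4 : Cmod (z + Ci)%C ^ 2 <= (M + 1) ^ 2 by apply: pow_incr; lra.
rewrite Rabs_div in He2; last lra.
rewrite (Rabs_pos_eq (Cmod _ ^ 2)) in He2; last lra.
rewrite Rabs_mult (Rabs_pos_eq 4) in He2; last lra.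
move: He2 => /Rlt_div_l => /(_ Hc3) B.
have : 4 * d / (M + 1) ^ 2 * Cmod (z + Ci)%C ^ 2 <= 4 * d / (M + 1) ^ 2 * (M + 1) ^ 2.
  by apply: Rmult_le_compat_l => //; lra.
have -> : 4 * d / (M + 1) ^ 2 * (M + 1) ^ 2 = 4 * d by field; lra.
lra.
Qed.

(** The set of definition of a germ inside the upper half-plane is an admissible domain for
    [rHarm]. *)
Lemma open_UH U : openP1 U -> open (UH U).
Proof. by move=> [O _]; apply: open_and => //; exact: open_Hp. Qed.

Lemma decomposition_exists r U F : not_pos_int r -> Brep r U F ->
  exists G K, rHarm r Hp G /\ Wrep r K /\ germ_eq F (fun z => (G z + K z)%C).
Proof.
move=> Hr [HU HF].
have [e [He KU]] := nbhd_annulus U HU.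
set R0 := 1 - e / 2; have HR0 : 0 <= R0 < 1 by rewrite /R0; lra.
have HA w : Ann R0 1 w -> UH U (Zw w).
  move=> [H1 H2]; have Hw := disk_neq_1 _ H2; split; first exact: Hp_Zw.
  apply: KU; first exact: Zw_plus_Ci_neq_0.
  rewrite Wz_Zw //; apply: Rabs_def1; rewrite /R0 in H1; nra.
have [phi Hphi] := PhiF_disk_harm r R0 (UH U) F HF HA.
set Phi := PhiF r F in Hphi.
have Hb := bN_growth r Hr R0 HR0 Phi phi Hphi.
have Hal := alpha_growth r Hr R0 HR0 Phi phi Hphi.
set b := bN r R0 Phi phi in Hb; set al := alpha r R0 Phi phi in Hal.
set G := Ghat r (Gd r b al).
have HG : rHarm r Hp G by exact: Ghat_rHarm.
exists G, (fun z => F z - G z)%C; split=> //.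
have HrhoM : R0 < 1 - e / 4 < 1 by rewrite /R0; lra.
have [M1 [HM1 B1]] := aN_growth r R0 HR0 Phi phi Hphi _ HrhoM.
have [M2 [HM2 B2]] := aK_growth r Hr R0 HR0 Phi phi Hphi _ HrhoM.
set an := aN R0 phi in B1; set ak := aK r R0 Phi phi in B2.
set mu := 1 + e / 256.
have Hmu : 1 < mu by rewrite /mu; lra.
have Hlam : 1 < mu ^ 2 <= 3 / 2 by rewrite /mu; nra.
have Hlame : mu ^ 2 < 1 + e by rewrite /mu; nra.
have Hmu6 : (mu ^ 2) ^ 3 <= 1 + e / 4.
  have Hx : 0 <= e / 256 <= 1 / 512 by lra.
  have E64 : e / 4 = 64 * (e / 256) by field.
  rewrite E64 -pow_mult /= /mu; move: (e / 256) Hx => x Hx.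
  have : (1 + x) * (1 + x) <= 1 + 3 * x by nra.
  move=> y1; have y2 : (1 + x) * ((1 + x) * ((1 + x) * (1 + x))) <= 1 + 7 * x by nra.
  have : (1 + x) * ((1 + x) * ((1 + x) * ((1 + x) * ((1 + x) * ((1 + x) * 1))))) = ((1 + x) * (1 + x)) * ((1 + x) * ((1 + x) * ((1 + x) * (1 + x)))) by ring.
  move=> ->; apply: (Rle_trans _ ((1 + 3 * x) * (1 + 7 * x))); last nra.
  by apply: Rmult_le_compat => //; nra.
have Hsmall : (1 - e / 4) * (mu ^ 2) ^ 3 < 1 by nra.
have Hil : / mu ^ 2 = (/ mu) ^ 2 by rewrite pow_inv.
have Hi0 : 0 < / mu by apply: Rinv_0_lt_compat; lra.
have HAG z0 g : AG z0 g -> AG z0 (fun z => Cconj (g z)) -> Ann (/ mu) mu (g z0) ->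
   AG z0 (fun z => Kcirc r an ak (g z)) /\
   asum (fun q => an q * (g z0 ^ S q * Qn r q (g z0 * Cconj (g z0))))%C /\
   asum (fun m => ak m * (/ g z0 ^ m * Qp r m (g z0 * Cconj (g z0))))%C.
  move=> Hg Hgc [h1 h2].
  apply: (AG_Kcirc r Hr (1 - e / 4) (mu ^ 2) M1 M2) => //; first lra.
  by rewrite Hil; have := Cmod_ge_0 (g z0); nra.
have nz2 := C2_neq_0.
have HWz z0 : (z0 + Ci)%C <> RtoC 0 -> AG z0 Wz /\ AG z0 (fun z => Cconj (Wz z)).
  move=> H0; have [I1 I2] := AG_id z0; have Hc0 := Cconj_neq_0 _ H0.
  rewrite Cplus_conj Cconj_Ci in Hc0.
  split.
    apply: AG_mult; first by apply: AG_plus => //; exact: AG_const.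
    by apply: (AG_inv _ (fun z => z + Ci)%C) => //; apply: AG_plus => //; exact: AG_const.
  have L := locally_neq_0 _ z0 (continuous_plus_Ci z0) H0.
  have [d [Hd Kd]] := proj1 (locally_Cmod _ _) L.
  apply: (AG_ext_loc z0 (fun z => (Cconj z + Ci) * / (Cconj z + - Ci))%C _ (d / 2)); first lra.
    move=> z [Hx Hy]; rewrite /Wz Cdiv_conj; last first.
      rewrite (_ : z = (z0 + (z - z0))%C); last by ring.
      apply: Kd; apply: (Rle_lt_trans _ _ _ (Cmod_le_ReIm _)).
      by rewrite (_ : Re (z - z0)%C = Re z - Re z0) // (_ : Im (z - z0)%C = Im z - Im z0) //; lra.
    by rewrite Cminus_conj Cplus_conj Cconj_Ci /Cdiv; congr (_ * _)%C; ring.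
  apply: AG_mult; first by apply: AG_plus => //; exact: AG_const.
  by apply: (AG_inv _ (fun z => Cconj z + - Ci)%C) => //; apply: AG_plus => //; exact: AG_const.
have HWinf w0 : (1 + Ci * w0)%C <> RtoC 0 -> AG w0 Winf /\ AG w0 (fun w => Cconj (Winf w)).
  move=> H0; have [I1 I2] := AG_id w0; have Hc0 := Cconj_neq_0 _ H0.
  rewrite Cplus_conj Cmult_conj Cconj_Ci Cconj_R in Hc0.
  split.
    apply: (AG_ext _ (fun w => (1 + - Ci * w) * / (1 + Ci * w))%C).
      by move=> w; rewrite /Winf /Cdiv; congr (_ * _)%C; ring.
    apply: AG_mult; first by apply: AG_plus; [exact: AG_const | exact: AG_scal].
    by apply: (AG_inv _ (fun w => 1 + Ci * w)%C) => //; apply: AG_plus; [exact: AG_const | exact: AG_scal].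
  have L := locally_neq_0 _ w0 (is_Wd_continuous _ _ _ _ (is_Wd_1_Ci w0)) H0.
  have [d [Hd Kd]] := proj1 (locally_Cmod _ _) L.
  apply: (AG_ext_loc w0 (fun w => (1 + Ci * Cconj w) * / (1 + - Ci * Cconj w))%C _ (d / 2)); first lra.
    move=> w [Hx Hy]; rewrite /Winf Cdiv_conj; last first.
      rewrite (_ : w = (w0 + (w - w0))%C); last by ring.
      apply: Kd; apply: (Rle_lt_trans _ _ _ (Cmod_le_ReIm _)).
      by rewrite (_ : Re (w - w0)%C = Re w - Re w0) // (_ : Im (w - w0)%C = Im w - Im w0) //; lra.
    by rewrite Cminus_conj Cplus_conj !Cmult_conj Cconj_Ci !Cconj_R /Cdiv; congr (_ * _)%C; ring.
  apply: AG_mult; first by apply: AG_plus; [exact: AG_const | exact: AG_scal].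
  by apply: (AG_inv _ (fun w => 1 + - Ci * Cconj w)%C) => //; apply: AG_plus; [exact: AG_const | exact: AG_scal].
set U' := fun p => U p /\ thin mu p.
have HU' : nbhdP1R U' by apply: nbhd_inter => //; exact: nbhd_thin.
have [[O1' O2'] _] := HU'.
split; last first.
  exists U; split=> // z _; ring.
exists U'; split.
  split=> //; apply: rHarm_minus.
    by apply: (rHarm_sub r (UH U)) => //; [exact: open_UH | move=> z [H1 [H2 _]]].
  by apply: (rHarm_sub r Hp) => //; [exact: open_UH | move=> z []].
exists (fun p => Kcirc r an ak (Wp p)); split.
  split; apply: AG_real_analytic => //.
    move=> z [_ Hz]; have H0 := Wz_neq_0 _ (thin_neq_0 _ _ Hmu Hz).
    by have [W1 W2] := HWz z H0; have [] := HAG z Wz W1 W2 Hz.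
  move=> w [_ Hw]; have H0 := Wp_chart_inf_neq_0 _ (thin_neq_0 _ _ Hmu Hw).
  have [W1 W2] := HWinf w H0.
  have Hw' : Ann (/ mu) mu (Winf w) by rewrite -Wp_chart_inf.
  have [Q _] := HAG w Winf W1 W2 Hw'.
  have L := locally_neq_0 _ w (is_Wd_continuous _ _ _ _ (is_Wd_1_Ci w)) H0.
  have [d [Hd Kd]] := proj1 (locally_Cmod _ _) L.
  apply: (AG_ext_loc w _ _ (d / 2)) Q; first lra.
  move=> u [Hx Hy]; rewrite Wp_chart_inf //.
  rewrite (_ : u = (w + (u - w))%C); last by ring.
  apply: Kd; apply: (Rle_lt_trans _ _ _ (Cmod_le_ReIm _)).
  by rewrite (_ : Re (u - w)%C = Re u - Re w) // (_ : Im (u - w)%C = Im u - Im w) //; lra.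
move=> z [Hz [_ Ht]] Hzi; rewrite [Wp _]/=.
have H0 := Hp_plus_Ci _ Hz; have Hd := Wz_disk _ Hz.
have [W1 W2] := HWz z H0; have [_ [S1 S2]] := HAG z Wz W1 W2 Ht.
have HAw : Ann R0 1 (Wz z).
  split=> //; case: Ht => /= h1 _; apply: Rle_lt_trans h1.
  have : R0 * mu <= 1 by rewrite /R0 /mu; nra.
  by move=> h; rewrite -(Rmult_1_l (/ mu)); apply/Rle_div_r; lra.
have K := K_expand r R0 Phi phi (Wz z) Hr HR0 Hphi HAw S1 S2.
rewrite div_f_r //.
have -> : (Cpowc (1 - Wz z) (- r) * (F z - G z) = Phi (Wz z) - Gd r b al (Wz z))%C.
  rewrite /Phi /PhiF Zw_Wz // /G /Ghat Cpowc_opp; field; exact: Cpowc_neq_0.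
transitivity (spow (r - 1) (Wz z * Cconj (Wz z)) * (Wz z * (Phi (Wz z) - Gd r b al (Wz z))))%C; last by ring.
rewrite K Cmult_assoc.
have -> : (spow (r - 1) (Wz z * Cconj (Wz z)) * spow (1 - r) (Wz z * Cconj (Wz z)))%C = RtoC 1.
  by rewrite (_ : (r - 1 = - (1 - r))%C) ?spow_opp //; ring.
by rewrite Cmult_1_l.
Qed.

(** * Uniqueness *)

Definition strip (R1 R2 : R) (z : C) : Prop := R1 < Re z < R2.

Lemma open_strip R1 R2 : open (strip R1 R2).
Proof.
move=> z [H1 H2]; apply/locally_Cmod; exists (Rmin (Re z - R1) (R2 - Re z)).
split; first by apply: Rmin_pos; lra.
move=> h Hh; have := Rmin_l (Re z - R1) (R2 - Re z); have := Rmin_r (Re z - R1) (R2 - Re z).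
by have := re_le_Cmod h => /Rabs_le_between; rewrite /strip re_plus; lra.
Qed.

Lemma Sm_Re k R1 R2 : Sm k (strip R1 R2) (fun z => RtoC (Re z)).
Proof.
have O := open_strip R1 R2; have h2 := C2_neq_0.
apply: (Sm_ext _ _ (fun z => / 2 * (z + Cconj z))%C) => //.
  by move=> z _; rewrite re_alt; field.
apply: Sm_mult => //; first exact: Sm_const.
by apply: Sm_plus => //; [exact: Sm_id | apply: (Sm_conj _ _ (fun z => z)) => //; exact: Sm_id].
Qed.

Lemma Sm_cf R1 R2 (n : Z) k : 0 <= R1 -> forall f, (forall j, Sm j (Ann R1 R2) f) ->
  Sm k (strip R1 R2) (fun z => cf f (Re z) (IZR n)).
Proof.
move=> HR; have O := open_strip R1 R2; have h2 := C2_neq_0.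
have D f : (forall j, Sm j (Ann R1 R2) f) -> forall z, strip R1 R2 z ->
   is_Wd (fun z => cf f (Re z) (IZR n)) z
    (/ 2 * ((IZR n * cf f (Re z) (IZR n) + 2 * cf (fun w => Cconj w * dzb f w)%C (Re z) (IZR n)) * / RtoC (Re z)))
    (/ 2 * ((IZR n * cf f (Re z) (IZR n) + 2 * cf (fun w => Cconj w * dzb f w)%C (Re z) (IZR n)) * / RtoC (Re z))).
  move=> Hf z Hz; have [H1 [H2 H3]] := Hf 1%nat.
  have := cf_radius R1 R2 HR f (dz f) (dzb f) H1 H2 H3 (Re z) n Hz => /(is_Dv_Wd (fun u => cf f u (IZR n)) z) D.
  have Hz0 : RtoC (Re z) <> RtoC 0 by move=> /RtoC_inj E; move: Hz; rewrite /strip; lra.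
  by apply: (is_Wd_eq _ _ _ _ _ _ D); field.
elim: k => [|k IH] f Hf; first by move=> z Hz; exact: is_Wd_continuous (D f Hf z Hz).
have Hb j : Sm j (Ann R1 R2) (fun w => Cconj w * dzb f w)%C.
  have OA := open_Ann R1 R2; apply: Sm_mult => //.
    by apply: (Sm_conj _ _ (fun z => z)) => //; exact: Sm_id.
  by have [_ []] := Hf (S j).
have S1 : Sm k (strip R1 R2) (fun z => / 2 * ((IZR n * cf f (Re z) (IZR n) + 2 * cf (fun w => Cconj w * dzb f w)%C (Re z) (IZR n)) * / RtoC (Re z)))%C.
  apply: Sm_mult => //; first exact: Sm_const.
  apply: Sm_mult => //.
    by apply: Sm_plus => //; apply: Sm_mult => //; [exact: Sm_const | exact: IH | exact: Sm_const | exact: IH].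
  apply: Sm_inv => //; last exact: Sm_Re.
  by move=> z Hz /RtoC_inj E; move: Hz; rewrite /strip; lra.
exact: (Sm_intro _ _ _ _ _ O (D f Hf)).
Qed.

Fixpoint falling (c : C) (j : nat) : C :=
  match j with O => RtoC 1 | S j => falling c j * (c - INR j) end%C.

Lemma falling_neq_0 c j : (forall n : nat, c <> RtoC (INR n)) -> falling c j <> RtoC 0.
Proof.
move=> H; elim: j => [|j IH] /=; first exact: C1_nz.
by apply: Cmult_neq_0 => // /Cminus_eq E; exact: (H j).
Qed.

(* Differentiating [b s^c] often enough makes it unbounded at [s = 0], unless [c] is a natural number. *)
Lemma power_not_smooth R1 R2 c b M : 0 < R1 < 1 -> 1 < R2 -> (forall n : nat, c <> RtoC (INR n)) ->
  (forall k, Sm k (strip R1 R2) M) ->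
  (forall u, R1 < u < 1 -> (b * spow c (u * u))%C = M (RtoC u)) -> b = RtoC 0.
Proof.
move=> HR1 HR2 Hc HM HE; have O := open_strip R1 R2.
have K j : exists Mj, (forall k, Sm k (strip R1 R2) Mj) /\
   forall u, R1 < u < 1 -> (b * falling c j * spow (c - INR j) (u * u))%C = Mj (RtoC u).
  elim: j => [|j [Mj [SMj Ej]]].
    exists M; split=> // u Hu; rewrite -HE //= (_ : (c - 0)%C = c); ring.
  exists (fun z => (- / 2) * ((dz Mj z + dzb Mj z) * / RtoC (Re z)))%C; split.
    move=> k; have [_ [S1 S2]] := SMj (S k).
    apply: Sm_mult => //; first exact: Sm_const.
    apply: Sm_mult => //; first exact: Sm_plus.
    apply: Sm_inv => //; last exact: Sm_Re.
    by move=> z Hz /RtoC_inj E; move: Hz; rewrite /strip; lra.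
  move=> u Hu.
  have Hs := Re_1_minus_sqr u ltac:(lra); have Hs0 := Re_pos_neq_0 _ Hs.
  have Hu0 : RtoC u <> RtoC 0 by move=> /RtoC_inj; lra.
  set c' := (c - INR j)%C in Ej *.
  have Ht := is_Wd_spow c' (RtoC u * RtoC u)%C Hs.
  have D1 := is_Dv_scal (b * falling c j)%C _ _ _ (is_Dv_of_Wd _ _ _ _ (is_Wd_sqr_comp _ _ _ Ht)).
  have D2 := is_Dv_of_Wd _ _ _ _ (Sm_is_Wd 0 _ Mj (RtoC u) (SMj 1%nat) (conj (proj1 Hu) (Rlt_trans _ _ _ (proj2 Hu) HR2))).
  have D3 : is_Dv (fun t => Mj (RtoC t)) u ((b * falling c j) * (2 * u * (- c' * spow c' (u * u) / (1 - u * u)) + 0)).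
    apply/(is_Dv_Wd _ (RtoC u)); move/(is_Dv_Wd _ (RtoC u)): D1 => D1.
    apply: is_Wd_ext_loc D1.
    exists (Rmin (u - R1) (1 - u)); split; first by apply: Rmin_pos; lra.
    move=> h Hh; apply: Ej; rewrite re_plus re_RtoC.
    have := Rmin_l (u - R1) (1 - u); have := Rmin_r (u - R1) (1 - u).
    by have := re_le_Cmod h => /Rabs_le_between; lra.
  rewrite -(is_Dv_unique _ _ _ _ D3 D2) [Re _]/=.
  have E : spow c' (u * u) = (spow (c - INR (S j)) (u * u) * (1 - u * u))%C.
    transitivity (Cpowc (1 - u * u) (c - INR (S j)) * Cpowc (1 - u * u) 1)%C.
      by rewrite -Cpowc_plus /spow /c' S_INR RtoC_plus; congr Cpowc; ring.
    by rewrite Cpowc_1.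
  have h2 := C2_neq_0.
  by rewrite E [falling c (S j)]/= -/c'; field.
case: (excluded_middle_informative (b = RtoC 0)) => // Hb; exfalso.
have [N HN] := INR_archimed 1 (Re c + 1) Rlt_0_1; rewrite Rmult_1_r in HN.
have [Mj [SM E]] := K N.
set b' := (b * falling c N)%C in E.
have Hb' : 0 < Cmod b' by apply Cmod_gt_0; apply: Cmult_neq_0 => //; exact: falling_neq_0.
have C1 : continuous Mj (RtoC 1) by apply: (Sm_continuous 0 (strip R1 R2)) => //; rewrite /strip /=; lra.
move/continuous_Cmod: C1 => /(_ 1 Rlt_0_1) [d [Hd Kd]].
set B := Cmod (Mj (RtoC 1)) + 1; have HB : 0 < B by rewrite /B; move: (Cmod_ge_0 (Mj (RtoC 1))); lra.
set x := Rmin (Rmin (d / 2) ((1 - R1) / 2)) (Rmin (1 / 2) (Cmod b' / (4 * B))).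
have Hx : 0 < x.
  by repeat apply: Rmin_pos; try lra; apply: Rdiv_lt_0_compat; lra.
have [x1 [x2 [x3 x4]]] : x <= d / 2 /\ x <= (1 - R1) / 2 /\ x <= 1 / 2 /\ x <= Cmod b' / (4 * B).
  have := Rmin_l (Rmin (d / 2) ((1 - R1) / 2)) (Rmin (1 / 2) (Cmod b' / (4 * B))).
  have := Rmin_r (Rmin (d / 2) ((1 - R1) / 2)) (Rmin (1 / 2) (Cmod b' / (4 * B))).
  have := Rmin_l (d / 2) ((1 - R1) / 2); have := Rmin_r (d / 2) ((1 - R1) / 2).
  have := Rmin_l (1 / 2) (Cmod b' / (4 * B)); have := Rmin_r (1 / 2) (Cmod b' / (4 * B)).
  rewrite -/x; lra.
set u := 1 - x; have Hu : R1 < u < 1 by rewrite /u; lra.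
have Bu : Cmod (Mj (RtoC u)) < B.
  have := Kd (RtoC (- x)); rewrite Cmod_R Rabs_Ropp Rabs_pos_eq; last lra.
  move=> /(_ ltac:(lra)); rewrite -RtoC_plus -/(Rminus 1 x) -/u => h.
  rewrite (_ : Mj u = (Mj (RtoC 1) + (Mj (RtoC u) - Mj (RtoC 1)))%C); last by ring.
  apply: (Rle_lt_trans _ _ _ (Cmod_triangle _ _)); rewrite /B; lra.
move: Bu; rewrite -E // Cmod_mult.
set s := 1 - u * u.
have Hs : 0 < s < 1 by rewrite /s; nra.
have Hs2 : s <= 2 * x by rewrite /s /u; nra.
have -> : spow (c - INR N) (u * u) = Cpowc (RtoC s) (c - INR N).
  by rewrite /spow /s RtoC_minus RtoC_mult.
rewrite Cmod_Cpowc_R; last lra.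
have Hln : ln s < 0 by rewrite -ln_1; apply: ln_increasing; lra.
have I1 : / s <= exp (Re (c - INR N)%C * ln s).
  rewrite -{1}(exp_ln s) ?exp_Ropp //; last lra.
  rewrite -exp_Ropp.
  have Ere : Re (c - INR N)%C = Re c - INR N by rewrite /Re /=; ring.
  case: (Rle_lt_or_eq_dec (- ln s) (Re (c - INR N)%C * ln s)) => [|h|->]; first by rewrite Ere; nra.
    by apply: Rlt_le; exact: exp_increasing.
  exact: Rle_refl.
have I2 : Cmod b' * / s <= Cmod b' * exp (Re (c - INR N)%C * ln s) by apply: Rmult_le_compat_l; lra.
have I3 : B <= Cmod b' * / s.
  apply/Rle_div_r; first lra.
  have : B * (2 * x) <= Cmod b'.
    have : x * (4 * B) <= Cmod b' by apply/Rle_div_r; lra.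
    nra.
  nra.
lra.
Qed.

Lemma Sm_Qp r m k (W : C -> Prop) (g : C -> C) : open W -> (forall j, Sm j W g) -> Sm k W (fun z => Qp r m (g z)).
Proof.
move=> O Hg; have Hp n j : Sm j W (fun z => g z ^ n)%C.
  elim: n => [|n IH]; first exact: Sm_const.
  by apply: (Sm_ext _ _ (fun z => g z * g z ^ n)%C) => //; exact: Sm_mult.
elim: m => [|m IH]; first exact: Sm_const.
apply: (Sm_ext _ _ (fun z => (INR (S m) * Qp r m (g z) + g z ^ S m) * / den r (S m))%C) => //.
apply: Sm_mult => //; last exact: Sm_const.
by apply: Sm_plus => //; apply: Sm_mult => //; exact: Sm_const.
Qed.

Lemma cf_near_0 (f : C -> C) : continuous f (RtoC 0) -> (forall w, Ann 0 1 w -> continuous f w) ->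
  exists M d, 0 <= M /\ 0 < d <= 1 / 2 /\ forall u n, 0 < u < d -> Cmod (cf f u n) <= M.
Proof.
move=> /continuous_Cmod /(_ 1 Rlt_0_1) [d [Hd K]] Hc.
have G := Cmod_ge_0 (f 0).
exists (2 * (Cmod (f 0) + 1)), (Rmin d (1 / 2)); split; first lra.
split; first by split; [apply: Rmin_pos; lra | exact: Rmin_r].
move=> u n Hu; have h1 := Rmin_l d (1 / 2); have h2 := Rmin_r d (1 / 2).
apply: Cmod_fourier_le.
  by apply: (circ_ctsR 0 1 (Rle_refl 0)) => //; lra.
move=> t; rewrite /circ.
have := K (RtoC u * expi t)%C; rewrite Cmod_circ; last lra.
move=> /(_ ltac:(lra)); rewrite Cplus_0_l => h.
rewrite (_ : f (u * expi t)%C = (f 0 + (f (u * expi t)%C - f 0))%C); last by ring.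
apply: (Rle_trans _ _ _ (Cmod_triangle _ _)); lra.
Qed.

Lemma eq_0_of_small (a : C) (M d : R) : 0 < d -> 0 <= M ->
  (forall u, 0 < u < d -> Cmod a <= M * u) -> a = RtoC 0.
Proof.
move=> Hd HM H; apply: Cmod_eq_0; apply: Rle_antisym; last exact: Cmod_ge_0.
apply: le_epsilon => eps Heps; rewrite Rplus_0_l.
have Hq : 0 < eps / (M + 1) by apply: Rdiv_lt_0_compat; lra.
have Hm : 0 < Rmin (d / 2) (eps / (M + 1)) by apply: Rmin_pos; lra.
have h1 := Rmin_l (d / 2) (eps / (M + 1)); have h2 := Rmin_r (d / 2) (eps / (M + 1)).
apply: (Rle_trans _ _ _ (H (Rmin (d / 2) (eps / (M + 1))) ltac:(lra))).
apply: (Rle_trans _ (M * (eps / (M + 1)))); first exact: Rmult_le_compat_l.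
have -> : M * (eps / (M + 1)) = eps - eps / (M + 1) by field; lra.
lra.
Qed.

Definition Pz (w : C) : P1C :=
  match excluded_middle_informative (w = RtoC 1) with left _ => None | right _ => Some (Zw w) end.

Lemma Pz_1 : Pz 1 = None.
Proof. by rewrite /Pz; case: excluded_middle_informative. Qed.

Lemma Pz_neq_1 w : (1 - w)%C <> RtoC 0 -> Pz w = Some (Zw w).
Proof. by move=> H; rewrite /Pz; case: excluded_middle_informative => // E; case: H; rewrite E; ring. Qed.

Lemma Sm_neq_0_open k (W : C -> Prop) f : open W -> Sm k W f -> open (fun z => W z /\ f z <> RtoC 0).
Proof.
move=> O S z [Hz Hf]; apply: filter_and; first exact: O.
by apply: locally_neq_0 => //; exact: Sm_continuous S Hz.
Qed.

Lemma Sm_Pz U A R1 R2 k : openP1 U -> (forall w, Ann R1 R2 w -> U (Pz w)) -> real_analytic_P1 U A ->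
  Sm k (Ann R1 R2) (fun w => A (Pz w)).
Proof.
move=> [O1 O2] HU [A1 A2]; have OA := open_Ann R1 R2.
have SA1 := real_analytic_Sm _ _ k O1 A1; have SA2 := real_analytic_Sm _ _ k O2 A2.
have S1 : Sm k (Ann R1 R2) (fun w => 1 - w)%C by apply: Sm_minus => //; [exact: Sm_const | exact: Sm_id].
have S2 : Sm k (Ann R1 R2) (fun w => 1 + w)%C by apply: Sm_plus => //; [exact: Sm_const | exact: Sm_id].
have P1 := Sm_neq_0_open _ _ _ OA S1; have P2 := Sm_neq_0_open _ _ _ OA S2.
have hi := Ci_neq_0; have h2 := C2_neq_0.
apply: Sm_loc => w0 Hw0; case: (excluded_middle_informative ((1 - w0)%C = RtoC 0)) => E0; last first.
  exists (fun w => Ann R1 R2 w /\ (1 - w)%C <> RtoC 0); split=> //.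
  apply: (Sm_ext _ _ (fun w => A (Some (Zw w)))) => //; first by move=> w [_ Hw]; rewrite Pz_neq_1.
  apply: (Sm_comp k (fun z => U (Some z)) _ (fun z => A (Some z)) Zw dZ) => //.
  - by move=> w [Hw H1]; rewrite -Pz_neq_1 //; exact: HU.
  - by move=> w [_ H1]; exact: is_Wd_Zw.
  move=> n; apply: Sm_mult => //; first exact: Sm_const.
  have T1 : Sm n (fun z => Ann R1 R2 z /\ (1 - z)%C <> RtoC 0) (fun w => 1 - w)%C.
    by apply: Sm_minus => //; [exact: Sm_const | exact: Sm_id].
  by apply: Sm_inv => //; [move=> w [_ H1]; exact: Cmult_neq_0 | exact: Sm_mult].
have E1 : (1 + w0)%C <> RtoC 0.
  move=> E; apply: h2; transitivity ((1 - w0) + (1 + w0))%C; first by ring.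
  by rewrite E0 E; ring.
exists (fun w => Ann R1 R2 w /\ (1 + w)%C <> RtoC 0); split=> //.
set zeta := fun w => ((1 - w) / (Ci * (1 + w)))%C.
have Ez w : (1 + w)%C <> RtoC 0 -> chart_inf (zeta w) = Pz w.
  move=> Hw; case: (excluded_middle_informative ((1 - w)%C = RtoC 0)) => E.
    have -> : zeta w = RtoC 0 by rewrite /zeta E; field; split.
    by rewrite chart_inf_0; move/Cminus_eq: E => <-; rewrite Pz_1.
  rewrite chart_inf_neq_0 ?Pz_neq_1 //; first by congr Some; rewrite /zeta /Zw; field.
  move=> /(f_equal (fun x => x * (Ci * (1 + w)))%C); rewrite Cmult_0_l /zeta => E3.
  by apply: E; rewrite -E3; field.
apply: (Sm_ext _ _ (fun w => A (chart_inf (zeta w)))) => //; first by move=> w [_ Hw]; rewrite Ez.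
apply: (Sm_comp k (fun w => U (chart_inf w)) _ (fun w => A (chart_inf w)) zeta
  (fun w => -2 * / (Ci * ((1 + w) * (1 + w))))%C) => //.
- by move=> w [Hw H1]; rewrite Ez //; exact: HU.
- move=> w [_ H1].
  have Hn := Cmult_neq_0 _ _ hi H1.
  have D := is_Wd_div (fun w => 1 - w)%C (fun w => Ci * (1 + w))%C w _ _ _ _ Hn
    (is_Wd_minus _ _ _ _ _ _ _ (is_Wd_const 1 w) (is_Wd_id w))
    (is_Wd_scal Ci _ _ _ _ (is_Wd_plus _ _ _ _ _ _ _ (is_Wd_const 1 w) (is_Wd_id w))).
  by apply: (is_Wd_eq _ _ _ _ _ _ D); field.
move=> n; apply: Sm_mult => //; first exact: Sm_const.
have T1 : Sm n (fun z => Ann R1 R2 z /\ (1 + z)%C <> RtoC 0) (fun w => 1 + w)%C.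
  by apply: Sm_plus => //; [exact: Sm_const | exact: Sm_id].
apply: Sm_inv => //; first by move=> w [_ H1]; apply: Cmult_neq_0 => //; exact: Cmult_neq_0.
by apply: Sm_mult => //; [exact: Sm_const | exact: Sm_mult].
Qed.

Section UniquenessOnDisk.
Variables (r : C) (Hr : not_pos_int r) (Phi phi : C -> C) (H : disk_harm r (-1) Phi phi).
Variables (R1 R2 : R) (HR1 : 0 < R1 < 1) (HR2 : 1 < R2) (B : C -> C).
Hypothesis SB : forall k, Sm k (Ann R1 R2) B.
Hypothesis EB : forall w, Ann R1 1 w -> B w = (w * (spow (r - 1) (w * Cconj w) * Phi w))%C.

Let H0 : disk_harm r 0 Phi phi.
Proof. by move: H => [Pa [pb K]]; exists Pa, pb => w [h1 h2]; apply: K; split=> //; lra. Qed.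

Let HR0 : 0 <= 0 < 1. Proof. lra. Qed.

Let spow_inv u : (spow (r - 1) (u * u) * spow (1 - r) (u * u) = 1)%C.
Proof. by rewrite (_ : (r - 1 = - (1 - r))%C) ?spow_opp //; ring. Qed.

Let cf_B u n : R1 < u < 1 -> cf B u n = (u * (spow (r - 1) (u * u) * cf Phi u (n - 1)%R))%C.
Proof.
move=> Hu.
have cPhi : ctsR (circ Phi u).
  apply: (circ_ctsR 0 1) => //; try lra.
  by move=> w Hw; move: H0 => [Pa [pb K]]; have [D _] := K _ Hw; exact: is_Wd_continuous D.
have cs : ctsR (circ (fun w => spow (r - 1) (u * u) * Phi w)%C u).
  by apply: (ctsR_mult (fun _ => spow (r - 1) (u * u))) => //; exact: ctsR_const.
rewrite /cf (fourier_ext _ (circ (fun w => w * (spow (r - 1) (u * u) * Phi w))%C u)).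
  by apply: (eq_trans (cf_id_mult _ _ n cs)); congr (_ * _)%C; exact: fourier_scal.
move=> t; rewrite /circ EB; last by rewrite /Ann Cmod_circ; lra.
by rewrite circ_sqr.
Qed.

Let c_not_nat n : (r - 1)%C <> RtoC (INR n).
Proof.
move=> E; apply: (Hr n); rewrite S_INR RtoC_plus -E; ring.
Qed.

Let Sm_pow_Re k n : Sm k (strip R1 R2) (fun z => RtoC (Re z) ^ n)%C.
Proof.
have O := open_strip R1 R2; elim: n => [|n IH]; first exact: Sm_const.
by apply: (Sm_ext _ _ (fun z => RtoC (Re z) * RtoC (Re z) ^ n)%C) => //; apply: Sm_mult => //; exact: Sm_Re.
Qed.

Let strip_neq_0 z n : strip R1 R2 z -> (RtoC (Re z) ^ n)%C <> RtoC 0.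
Proof. by move=> Hz; apply: Cpow_nz => /RtoC_inj E; move: Hz; rewrite /strip; lra. Qed.

Lemma aN_eq_0 q : aN 0 phi q = RtoC 0.
Proof.
have [phc Hc] : exists pc, forall w, Ann (-1) 1 w -> is_Wd phi w 0 (pc w).
  by move: H => [Pa [pb K]]; exists pb => w /K [_ [_ []]].
have [||M [d [HM [Hd K]]]] := cf_near_0 phi.
- by apply: is_Wd_continuous (Hc _ _); rewrite /Ann Cmod_0; lra.
- by move=> w [h1 h2]; apply: is_Wd_continuous (Hc _ _); split=> //; lra.
apply: (eq_0_of_small _ M d) => //; first lra.
move=> u Hu; have := K u (INR (S q)) Hu.
rewrite (cf_phi_neg r 0 HR0 Phi phi H0); last lra.
have Hp : 0 < u ^ S q by apply: pow_lt; lra.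
have Hle : u ^ S q <= u.
  have : u ^ q <= 1 by rewrite -(pow1 q); apply: pow_incr; lra.
  by rewrite /=; nra.
rewrite Cmod_div; last by apply: Cpow_nz => /RtoC_inj; lra.
rewrite Cmod_pow Cmod_R Rabs_pos_eq; last lra.
move=> /(Rle_div_l _ _ _ Hp) h; apply: (Rle_trans _ _ _ h); exact: Rmult_le_compat_l.
Qed.

Lemma bN_eq_0 q : bN r 0 Phi phi q = RtoC 0.
Proof.
have O := open_strip R1 R2.
apply: (power_not_smooth R1 R2 (r - 1) _ (fun z => cf B (Re z) (IZR (Z.of_nat (S q))) * / (RtoC (Re z) ^ S q))%C) => //.
  move=> k; apply: Sm_mult => //; first by apply: Sm_cf => //; lra.
  by apply: Sm_inv => // z Hz; exact: strip_neq_0.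
move=> u Hu; rewrite re_RtoC (cf_Phi_pos r Hr 0 HR0 Phi phi H0 q u) ?aN_eq_0; last lra.
have Hu0 : RtoC u <> RtoC 0 by move=> /RtoC_inj; lra.
have Hn := Cpow_nz _ q Hu0.
rewrite cf_B // -INR_IZR_INZ (_ : INR (S q) - 1 = INR q); last by rewrite S_INR; ring.
by rewrite Cpow_S; field.
Qed.

Lemma bP_eq_0 m : bP r 0 Phi phi m = RtoC 0.
Proof.
have O := open_strip R1 R2.
apply: (power_not_smooth R1 R2 (r - 1) _ (fun z => cf B (Re z) (IZR (- Z.of_nat m)) * RtoC (Re z) ^ m
  + aP 0 phi m * Qp r m (RtoC (Re z) * RtoC (Re z)))%C) => //.
  move=> k; apply: Sm_plus => //.
    by apply: Sm_mult => //; apply: Sm_cf => //; lra.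
  apply: Sm_mult => //; first exact: Sm_const.
  by apply: (Sm_Qp r m k _ (fun z => RtoC (Re z) * RtoC (Re z))%C) => // j; apply: Sm_mult => //; exact: Sm_Re.
move=> u Hu; rewrite re_RtoC (cf_Phi_neg r Hr 0 HR0 Phi phi H0 m u); last lra.
rewrite cf_B // opp_IZR -INR_IZR_INZ (_ : - INR m - 1 = - INR (S m)); last by rewrite S_INR; ring.
have E := spow_inv u.
transitivity (u * (spow (r - 1) (u * u) * cf Phi u (- INR (S m))) * u ^ m
  + aP 0 phi m * ((spow (r - 1) (u * u) * spow (1 - r) (u * u)) * Qp r m (u * u)))%C.
  by rewrite Cpow_S; ring.
by rewrite E; ring.
Qed.

Lemma aP_eq_0 m : aP 0 phi m = RtoC 0.
Proof.
have HPhi w : Ann (-1) 1 w -> continuous Phi w.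
  by move: H => [Pa [pb K]] /K [D _]; exact: is_Wd_continuous D.
have [||M [d [HM [Hd K]]]] := cf_near_0 Phi.
- by apply: HPhi; rewrite /Ann Cmod_0; lra.
- by move=> w [h1 h2]; apply: HPhi; split=> //; lra.
set L := fun z : C => (spow (1 - r) (z * Cconj z) * Qp r m (z * Cconj z))%C.
have OA := open_Ann (-1) 1.
have CL : continuous L (RtoC 0).
  apply: (Sm_continuous 0 (Ann (-1) 1)); last by rewrite /Ann Cmod_0; lra.
  apply: Sm_mult => //; first by apply: Sm_spow => // w [].
  by apply: (Sm_Qp r m 0 _ (fun z => z * Cconj z)%C) => // j; exact: Sm_mod_sqr.
have EL : L 0 = Bm r m.
  have E1 : (1 - 0)%C = RtoC 1 by ring.
  by rewrite /L Cmult_0_l /spow E1 Cpowc_1_base /Bm Cmult_1_l.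
have HB : 0 < Cmod (Bm r m) by apply Cmod_gt_0; exact: Bm_neq_0.
move/continuous_Cmod: CL => /(_ (Cmod (Bm r m) / 2)) [|d' [Hd' K']]; first lra.
apply: (eq_0_of_small _ (2 * M / Cmod (Bm r m)) (Rmin d d')); first by apply: Rmin_pos; lra.
  by apply: Rdiv_le_0_compat; lra.
move=> u Hu; have := Rmin_l d d'; have := Rmin_r d d' => m1 m2.
have := K u (- INR (S m)) ltac:(lra).
have := cf_Phi_neg r Hr 0 HR0 Phi phi H0 m u ltac:(lra); rewrite bP_eq_0 => E B1.
have Elu : L (RtoC u) = (spow (1 - r) (u * u) * Qp r m (u * u))%C by rewrite /L Cconj_R.
rewrite -Elu in E.
have E2 : (aP 0 phi m * L u = - (cf Phi u (- INR (S m))%R * u ^ S m))%C.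
  transitivity ((cf Phi u (- INR (S m))%R * u ^ S m + aP 0 phi m * L u) - cf Phi u (- INR (S m))%R * u ^ S m)%C; first by ring.
  by rewrite -E; ring.
have := K' (RtoC u); rewrite Cplus_0_l Cmod_R Rabs_pos_eq; last lra.
move=> /(_ ltac:(lra)); rewrite EL => B2.
have B3 : Cmod (Bm r m) / 2 <= Cmod (L u).
  have := Cmod_triangle (L u) (- (L u - Bm r m)); rewrite Cmod_opp.
  by rewrite (_ : (L u + - (L u - Bm r m))%C = Bm r m); [lra | ring].
have Hle : u ^ S m <= u.
  have : u ^ m <= 1 by rewrite -(pow1 m); apply: pow_incr; lra.
  by rewrite /=; nra.
have Hp : 0 < u ^ S m by apply: pow_lt; lra.
have := f_equal Cmod E2; rewrite Cmod_opp (Cmod_mult _ (L u)) (Cmod_mult _ (_ ^ _)) Cmod_pow Cmod_R Rabs_pos_eq; last lra.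
move=> E3; have B4 : Cmod (cf Phi u (- INR (S m))%R) * u ^ S m <= M * u by apply: Rmult_le_compat; try lra; exact: Cmod_ge_0.
have B5 : Cmod (aP 0 phi m) * (Cmod (Bm r m) / 2) <= M * u.
  apply: (Rle_trans _ (Cmod (aP 0 phi m) * Cmod (L u))); last lra.
  by apply: Rmult_le_compat_l => //; exact: Cmod_ge_0.
apply: (Rmult_le_reg_r (Cmod (Bm r m) / 2)); first lra.
by apply: (Rle_trans _ _ _ B5); apply: Req_le; field; lra.
Qed.

Lemma Phi_eq_0 w : 0 < Cmod w < 1 -> Phi w = RtoC 0.
Proof.
move=> Hw; have Hw0 : w <> RtoC 0 by apply Cmod_gt_0; lra.
have [t ->] := polar w Hw0; set rho := Cmod w in Hw *.
have Hrho : RtoC rho <> RtoC 0 by move=> /RtoC_inj; lra.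
have E n : cf Phi rho (IZR n) = RtoC 0.
  case: (Z_le_gt_dec 0 n) => Hn.
    rewrite -(Z2Nat.id n) // -INR_IZR_INZ.
    have := cf_Phi_pos r Hr 0 HR0 Phi phi H0 (Z.to_nat n) rho ltac:(lra).
    rewrite bN_eq_0 aN_eq_0 => E; have Hp := Cpow_nz _ (Z.to_nat n) Hrho.
    transitivity ((cf Phi rho (INR (Z.to_nat n)) / rho ^ Z.to_nat n +
       0 * (spow (1 - r) (rho * rho) * Qn r (Z.to_nat n) (rho * rho))) * rho ^ Z.to_nat n)%C; first by field.
    by rewrite -E; ring.
  have [m ->] : exists m, n = Z.opp (Z.of_nat (S m)) by exists (Z.to_nat (- n - 1)); lia.
  rewrite opp_IZR -INR_IZR_INZ.
  have := cf_Phi_neg r Hr 0 HR0 Phi phi H0 m rho ltac:(lra).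
  rewrite bP_eq_0 aP_eq_0 => E; have Hp := Cpow_nz _ (S m) Hrho.
  transitivity ((cf Phi rho (- INR (S m)) * rho ^ S m +
       0 * (spow (1 - r) (rho * rho) * Qp r m (rho * rho))) / rho ^ S m)%C; first by field.
  by rewrite -E; field.
apply: Cmod_eq_0; apply: Rle_antisym; last exact: Cmod_ge_0.
apply: le_epsilon => eps Heps; rewrite Rplus_0_l.
have [N0 /(_ N0 (le_n _))] := Phi_dirichlet r 0 HR0 Phi phi H0 rho t eps ltac:(lra) Heps.
rewrite (symsum_ext _ (fun _ => RtoC 0)); last by move=> n; rewrite E; ring.
have -> : symsum (fun _ => RtoC 0) N0 = RtoC 0.
  elim: N0 => [|N IH]; last by rewrite symsum_S IH; ring.
  by rewrite /symsum !sum_O; ring.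
by rewrite (_ : (0 - circ Phi rho t)%C = (- circ Phi rho t)%C) ?Cmod_opp //; ring.
Qed.

End UniquenessOnDisk.

Lemma decomposition_unique r G1 G2 K1 K2 : not_pos_int r ->
  rHarm r Hp G1 -> rHarm r Hp G2 -> Wrep r K1 -> Wrep r K2 ->
  germ_eq (fun z => G1 z + K1 z)%C (fun z => G2 z + K2 z)%C -> germ_eq G1 G2 /\ germ_eq K1 K2.
Proof.
move=> Hr HG1 HG2 [U1 [[N1 _] [A1 [HA1 E1]]]] [U2 [[N2 _] [A2 [HA2 E2]]]] [U0 [N0 E0]].
have [e [He KU]] := nbhd_annulus _ (nbhd_inter _ _ N0 (nbhd_inter _ _ N1 N2)).
have Hann w : Ann (1 - e / 2) (1 + e / 4) w -> U0 (Pz w) /\ U1 (Pz w) /\ U2 (Pz w).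
  move=> [h1 h2]; case: (excluded_middle_informative ((1 - w)%C = RtoC 0)) => E.
    move/Cminus_eq: E => <-; rewrite Pz_1.
    by split; [apply N0 | split; [apply N1 | apply N2]].
  rewrite Pz_neq_1 //; apply: KU; first exact: Zw_plus_Ci_neq_0.
  by rewrite Wz_Zw //; apply: Rabs_def1; nra.
set Gd := fun z => (G1 z - G2 z)%C.
have HG : rHarm r Hp Gd by exact: rHarm_minus.
have [phi Hphi] := PhiF_disk_harm r (-1) Hp Gd HG (fun w Hw => Hp_Zw w (proj2 Hw)).
have Z w : 0 < Cmod w < 1 -> PhiF r Gd w = RtoC 0.
  apply: (Phi_eq_0 r Hr (PhiF r Gd) phi Hphi (1 - e / 2) (1 + e / 4) _ _ (fun w => A2 (Pz w) - A1 (Pz w))%C); try lra.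
    move=> k; have OA := open_Ann (1 - e / 2) (1 + e / 4).
    apply: Sm_minus => //.
      by apply: (Sm_Pz U2) => //; [case: N2 | move=> v /Hann []; tauto].
    by apply: (Sm_Pz U1) => //; [case: N1 | move=> v /Hann []; tauto].
  move=> v [v1 v2]; have Hv := disk_neq_1 _ v2; have HZ := Hp_Zw _ v2.
  have [|u0 [u1 u2]] := Hann v; first by split=> //; lra.
  rewrite Pz_neq_1 // in u0 u1 u2 *.
  have Hci : Zw v <> Ci.
    move=> E; have := Wz_Zw v Hv; rewrite E /Wz (_ : (Ci - Ci)%C = RtoC 0); last by ring.
    by rewrite /Cdiv Cmult_0_l => E3; move: v1; rewrite -E3 Cmod_0; lra.
  rewrite E2 // E1 // /PhiF.
  transitivity (Gd (Zw v) / f_r r (Zw v))%C; last by rewrite div_f_r // Wz_Zw.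
  have := E0 (Zw v) (conj HZ u0) => E; rewrite /Gd /Cdiv.
  transitivity ((K2 (Zw v) - K1 (Zw v)) * / f_r r (Zw v))%C; first by ring.
  congr (_ * _)%C; transitivity ((G2 (Zw v) + K2 (Zw v)) - K1 (Zw v) - G2 (Zw v))%C; first by ring.
  by rewrite -E; ring.
have EG z : Hp z -> Wz z <> RtoC 0 -> G1 z = G2 z.
  move=> Hz Hw; have H0 := Hp_plus_Ci _ Hz; have Hd := Wz_disk _ Hz.
  have := Z (Wz z) (conj (proj1 (Cmod_gt_0 _) Hw) Hd).
  rewrite /PhiF Zw_Wz // => E; apply: Cminus_eq.
  transitivity (Cpowc (1 - Wz z) (- r) * Gd z / Cpowc (1 - Wz z) (- r))%C.
    by rewrite /Gd; field; exact: Cpowc_neq_0.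
  by rewrite E /Cdiv Cmult_0_l.
have Ht : nbhdP1R (thin 2) by apply: nbhd_thin; lra.
have Hthin z : thin 2 (Some z) -> Wz z <> RtoC 0 by apply: (thin_neq_0 2 (Some z)); lra.
split; first by exists (thin 2); split=> // z [Hz /Hthin]; exact: EG.
exists (fun p => U0 p /\ thin 2 p); split; first exact: nbhd_inter.
move=> z [Hz [u0 /Hthin Hw]]; have := E0 z (conj Hz u0); rewrite (EG _ Hz Hw) => E.
transitivity (G2 z + K1 z - G2 z)%C; first by ring.
by rewrite E; ring.
Qed.

Theorem theorem8p5 (r : C) (hr : forall n : nat, r <> RtoC (INR (S n))) :
  (* every germ is a sum of (the germ of) an element of H_r(H) and a W^omega germ *)
  (forall (U : P1C -> Prop) (F : C -> C), Brep r U F ->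
     exists G K : C -> C,
       rHarm r Hp G /\ Wrep r K /\ germ_eq F (fun z => (G z + K z)%C)) /\
  (* and the decomposition is unique at the level of germs *)
  (forall G1 G2 K1 K2 : C -> C,
     rHarm r Hp G1 -> rHarm r Hp G2 -> Wrep r K1 -> Wrep r K2 ->
     germ_eq (fun z => (G1 z + K1 z)%C) (fun z => (G2 z + K2 z)%C) ->
     germ_eq G1 G2 /\ germ_eq K1 K2).
Proof.
split; first by move=> U F; exact: decomposition_exists.
by move=> G1 G2 K1 K2; exact: decomposition_unique.
Qed.
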